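(* Let $g \ge 2$ be an integer, $k$ an algebraically closed field, $X$ a $k$-scheme, and $f : \mathcal{A}_1^g \dashrightarrow X$ a rational map of $k$-schemes. Suppose that $f(A_1,\lambda_1) = f(A_2,\lambda_2)$ whenever $(A_1,\lambda_1)$ and $(A_2,\lambda_2)$ are $k$-points in the domain of definition of $f$ with $A_1 \approx A_2$. Then $f$ is constant.
   Context: $\mathcal{A}_1$ is the coarse moduli scheme over $k$ of elliptic curves, and $\mathcal{A}_1^g$ its $g$-fold product. A $k$-point $(E_1,\dots,E_g)$ of $\mathcal{A}_1^g$ is viewed as the principally polarized abelian variety $(A,\lambda)$ where $A = E_1 \times \cdots \times E_g$ and $\lambda$ is the product polarization. $A_1 \approx A_2$ means $A_1$ and $A_2$ are isomorphic as unpolarized abelian varieties. *)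

(* Defs.v *)
From HB Require Import structures.
From mathcomp Require Import all_boot all_order all_algebra.
From mathcomp Require Import boolp classical_sets.
From mathcomp Require Import ring.
Set Implicit Arguments.
Unset Strict Implicit.
Unset Printing Implicit Defensive.
Import GRing.Theory.
Local Open Scope ring_scope.

(** * Schemes over a ring [k], as functors of points

   A [k]-scheme is a Zariski sheaf on affine [k]-schemes that is covered by
   affine open subfunctors (Demazure-Gabriel; Eisenbud-Harris, Ch. VI).
   A morphism of schemes is a natural transformation.  [comAlgType k] contains
   only the nonzero commutative [k]-algebras; nothing is lost, because a
   Zariski sheaf takes the zero ring (covered by the empty family) to a point. *)

Record kfunctor (k : comNzRingType) := KFunctor {
  fobj :> comAlgType k -> Type;
  fmap : forall A B : comAlgType k, {lrmorphism A -> B} -> fobj A -> fobj B;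
  fmap_id : forall (A : comAlgType k) (phi : {lrmorphism A -> A}),
    phi =1 id -> fmap phi =1 id;
  fmap_comp : forall (A B C : comAlgType k) (phi : {lrmorphism A -> B})
    (psi : {lrmorphism B -> C}) (chi : {lrmorphism A -> C}),
    chi =1 psi \o phi -> fmap chi =1 fmap psi \o fmap phi }.
Arguments fmap {k} _ {A B} _ _.

Record nattrans (k : comNzRingType) (X Y : kfunctor k) := NatTrans {
  nt_fun :> forall A : comAlgType k, X A -> Y A;
  nt_nat : forall (A B : comAlgType k) (phi : {lrmorphism A -> B}) (x : X A),
    nt_fun (fmap X phi x) = fmap Y phi (nt_fun x) }.

Definition nat_inverse (k : comNzRingType) (X Y : kfunctor k)
    (phi : nattrans X Y) (psi : nattrans Y X) : Prop :=
  forall A : comAlgType k, cancel (@phi A) (@psi A) /\ cancel (@psi A) (@phi A).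

(* [T] generates the unit ideal *)
Definition unimodular (A : comNzRingType) (T : set A) : Prop :=
  exists n (c a : 'I_n -> A), (forall i, T (a i)) /\ \sum_i c i * a i = 1.

Definition invertible (A : comNzRingType) (a : A) : Prop :=
  exists b, a * b = 1.

Definition is_field (A : comNzRingType) : Prop :=
  forall a : A, a <> 0 -> invertible a.

Definition is_alg_closed (A : comNzRingType) : Prop :=
  is_field A /\
  forall p : {poly A}, p \is monic -> (1 < size p)%N -> exists a, root p a.

(* The sheaf condition for a cover of [Spec A] by the basic opens [D(t)],
   [t \in T], written with the covering sieve it generates: an arrow
   [phi : A -> B] belongs to the sieve when some [phi t] is invertible. *)
Definition in_sieve (k : comNzRingType) (A : comAlgType k) (T : set A)
    (B : comAlgType k) (phi : {lrmorphism A -> B}) : Prop :=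
  exists2 t, T t & invertible (phi t).

Definition is_zariski_sheaf (k : comNzRingType) (X : kfunctor k) : Prop :=
  forall (A : comAlgType k) (T : set A), unimodular T ->
  forall x : (forall (B : comAlgType k) (phi : {lrmorphism A -> B}),
                in_sieve T phi -> X B),
  (forall (B C : comAlgType k) (phi : {lrmorphism A -> B})
      (psi : {lrmorphism B -> C}) (chi : {lrmorphism A -> C})
      (hphi : in_sieve T phi) (hchi : in_sieve T chi),
      chi =1 psi \o phi -> x C chi hchi = fmap X psi (x B phi hphi)) ->
  exists! y : X A, forall (B : comAlgType k) (phi : {lrmorphism A -> B})
      (hphi : in_sieve T phi), fmap X phi y = x B phi hphi.

Record subfunctor (k : comNzRingType) (X : kfunctor k) := SubFunctor {
  sub_mem :> forall A : comAlgType k, set (X A);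
  sub_stable : forall (A B : comAlgType k) (phi : {lrmorphism A -> B}) (x : X A),
    sub_mem x -> sub_mem (fmap X phi x) }.

(* For each [x : Spec A -> X], the preimage of [U] is the open subscheme of
   [Spec A] complementary to the zero locus of some [I]. *)
Definition is_open (k : comNzRingType) (X : kfunctor k) (U : subfunctor X)
    : Prop :=
  forall (A : comAlgType k) (x : X A), exists I : set A,
  forall (B : comAlgType k) (phi : {lrmorphism A -> B}),
    U B (fmap X phi x) <-> unimodular [set phi a | a in I]%classic.

(* [U] is representable, with universal element [u]. *)
Definition is_affine (k : comNzRingType) (X : kfunctor k) (U : subfunctor X)
    : Prop :=
  exists (A : comAlgType k) (u : X A), U A u /\
  forall (B : comAlgType k) (x : X B), U B x ->
    (exists phi : {lrmorphism A -> B}, fmap X phi u = x) /\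
    (forall phi psi : {lrmorphism A -> B},
       fmap X phi u = x -> fmap X psi u = x -> phi =1 psi).

Definition is_scheme (k : comNzRingType) (X : kfunctor k) : Prop :=
  is_zariski_sheaf X /\
  forall K : comAlgType k, is_field K -> forall x : X K,
    exists U : subfunctor X, [/\ is_open U, is_affine U & U K x].

Record scheme (k : comNzRingType) := Scheme {
  sch_functor :> kfunctor k;
  sch_axiom : is_scheme sch_functor }.

Section Constructions.
Variable k : comNzRingType.

(* the structure morphism of a k-algebra, as a morphism of k-algebras *)
Section StructureMap.
Variable A : comAlgType k.
Definition str_map (a : k^o) : A := (a : k)%:A.
Lemma str_map_is_additive : zmod_morphism str_map.
Proof. by move=> a b; rewrite /str_map scalerBl. Qed.
Lemma str_map_is_monoid_morphism : monoid_morphism str_map.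
Proof.
split; first by rewrite /str_map scale1r.
by move=> a b; rewrite /str_map -[in RHS]scalerAl mul1r scalerA.
Qed.
Lemma str_map_is_scalable : scalable str_map.
Proof. by move=> a b; rewrite /str_map scalerA. Qed.
HB.instance Definition _ :=
  GRing.isZmodMorphism.Build k^o A str_map str_map_is_additive.
HB.instance Definition _ :=
  GRing.isMonoidMorphism.Build k^o A str_map str_map_is_monoid_morphism.
HB.instance Definition _ :=
  GRing.isScalable.Build k k^o A *:%R str_map str_map_is_scalable.
Definition structure_map : {lrmorphism k^o -> A} := str_map.
End StructureMap.

Section Subfunctors.
Variables (X : kfunctor k) (U : subfunctor X).

Definition sub_obj (A : comAlgType k) : Type := {x : X A | U A x}.
Definition sub_fmap (A B : comAlgType k) (phi : {lrmorphism A -> B})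
    (x : sub_obj A) : sub_obj B :=
  exist _ (fmap X phi (sval x)) (sub_stable phi (svalP x)).
Lemma sub_fmap_id (A : comAlgType k) (phi : {lrmorphism A -> A}) :
  phi =1 id -> sub_fmap phi =1 id.
Proof.
by move=> phi1 [x Ux]; apply: eq_exist; rewrite /= (fmap_id phi1).
Qed.
Lemma sub_fmap_comp (A B C : comAlgType k) (phi : {lrmorphism A -> B})
    (psi : {lrmorphism B -> C}) (chi : {lrmorphism A -> C}) :
  chi =1 psi \o phi -> sub_fmap chi =1 sub_fmap psi \o sub_fmap phi.
Proof.
by move=> e [x Ux]; apply: eq_exist; rewrite /= (fmap_comp e).
Qed.
Definition functor_of_sub : kfunctor k := KFunctor sub_fmap_id sub_fmap_comp.
End Subfunctors.

Section Product.
Variables (I : Type) (F : I -> kfunctor k).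

Definition prod_fmap (A B : comAlgType k) (phi : {lrmorphism A -> B})
    (x : forall i, F i A) : forall i, F i B := fun i => fmap (F i) phi (x i).
Lemma prod_fmap_id (A : comAlgType k) (phi : {lrmorphism A -> A}) :
  phi =1 id -> prod_fmap phi =1 id.
Proof.
move=> phi1 x; apply: functional_extensionality_dep => i.
by rewrite /prod_fmap (fmap_id phi1).
Qed.
Lemma prod_fmap_comp (A B C : comAlgType k) (phi : {lrmorphism A -> B})
    (psi : {lrmorphism B -> C}) (chi : {lrmorphism A -> C}) :
  chi =1 psi \o phi -> prod_fmap chi =1 prod_fmap psi \o prod_fmap phi.
Proof.
move=> e x; apply: functional_extensionality_dep => i.
by rewrite /prod_fmap (fmap_comp e).
Qed.
Definition prod_functor : kfunctor k :=
  @KFunctor k (fun A => forall i, F i A) _ prod_fmap_id prod_fmap_comp.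
End Product.

Definition power_functor (X : kfunctor k) (g : nat) : kfunctor k :=
  prod_functor (fun _ : 'I_g => X).

End Constructions.

(** * Rational maps *)

Definition nonempty (k : comNzRingType) (X : kfunctor k)
    (P : forall A : comAlgType k, set (X A)) : Prop :=
  exists (A : comAlgType k) (x : X A), P A x.

Definition is_dense (k : comNzRingType) (X : kfunctor k) (U : subfunctor X)
    : Prop :=
  forall V : subfunctor X, is_open V -> nonempty V ->
    nonempty (fun A => U A `&` V A)%classic.

(* A representative of a rational map: a morphism on a dense open.  The
   rational map itself is the class of the representative under [rat_eq]. *)
Record ratmap (k : comNzRingType) (X Y : kfunctor k) := RatMap {
  rdom : subfunctor X;
  rdom_open : is_open rdom;
  rdom_dense : is_dense rdom;
  rfun : nattrans (functor_of_sub rdom) Y }.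
Arguments rdom {k X Y} _.
Arguments rfun {k X Y} _.

Definition rat_eq (k : comNzRingType) (X Y : kfunctor k) (f f' : ratmap X Y)
    : Prop :=
  exists W : subfunctor X, [/\ is_open W, is_dense W &
    forall (A : comAlgType k) (x : X A), W A x ->
      exists (h : rdom f A x) (h' : rdom f' A x),
        rfun f A (exist _ x h) = rfun f' A (exist _ x h')].

(* [x] is a k-point of the domain of definition of the rational map [f] (the
   union of the domains of all representatives), and [f] takes the value [y]
   there. *)
Definition rat_value (k : comNzRingType) (X Y : kfunctor k) (f : ratmap X Y)
    (x : X k^o) (y : Y k^o) : Prop :=
  exists f' : ratmap X Y, rat_eq f f' /\
    exists h : rdom f' k^o x, rfun f' k^o (exist _ x h) = y.

(* Every representative factors through one fixed k-point [Spec k -> Y]. *)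
Definition rat_constant (k : comNzRingType) (X Y : kfunctor k) (f : ratmap X Y)
    : Prop :=
  exists y : Y k^o, forall f' : ratmap X Y, rat_eq f f' ->
    forall (A : comAlgType k) (x : functor_of_sub (rdom f') A),
      rfun f' A x = fmap Y (structure_map A) y.

(** * Elliptic curves *)

(* A Weierstrass equation over [R] with invertible discriminant. *)
Definition discriminant (R : comNzRingType) (a1 a2 a3 a4 a6 : R) : R :=
  let b2 := a1 ^+ 2 + a2 *+ 4 in
  let b4 := a4 *+ 2 + a1 * a3 in
  let b6 := a3 ^+ 2 + a6 *+ 4 in
  let b8 := a1 ^+ 2 * a6 + a2 * a6 *+ 4 - a1 * a3 * a4 + a2 * a3 ^+ 2
            - a4 ^+ 2 in
  - b2 ^+ 2 * b8 - b4 ^+ 3 *+ 8 - b6 ^+ 2 *+ 27 + b2 * b4 * b6 *+ 9.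

Record ellcurve (R : comNzRingType) := EllCurve {
  ec_a1 : R; ec_a2 : R; ec_a3 : R; ec_a4 : R; ec_a6 : R;
  ec_disc : invertible (discriminant ec_a1 ec_a2 ec_a3 ec_a4 ec_a6) }.

Lemma ellcurve_eq (R : comNzRingType) (E E' : ellcurve R) :
  ec_a1 E = ec_a1 E' -> ec_a2 E = ec_a2 E' -> ec_a3 E = ec_a3 E' ->
  ec_a4 E = ec_a4 E' -> ec_a6 E = ec_a6 E' -> E = E'.
Proof.
case: E => a1 a2 a3 a4 a6 d; case: E' => b1 b2 b3 b4 b6 d' /= e1 e2 e3 e4 e6.
by subst; congr EllCurve; apply: Prop_irrelevance.
Qed.

Lemma discriminant_rmorph (R S : comNzRingType) (phi : {rmorphism R -> S})
    (a1 a2 a3 a4 a6 : R) :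
  discriminant (phi a1) (phi a2) (phi a3) (phi a4) (phi a6)
  = phi (discriminant a1 a2 a3 a4 a6).
Proof.
by rewrite /discriminant
  !(rmorphD, rmorphB, rmorphN, rmorphMn, rmorphM, rmorphXn).
Qed.

Lemma ellcurve_map_disc (R S : comNzRingType) (phi : {rmorphism R -> S})
    (E : ellcurve R) :
  invertible (discriminant (phi (ec_a1 E)) (phi (ec_a2 E)) (phi (ec_a3 E))
                           (phi (ec_a4 E)) (phi (ec_a6 E))).
Proof.
have [d hd] := ec_disc E.
by exists (phi d); rewrite discriminant_rmorph -rmorphM hd rmorph1.
Qed.

Definition ellcurve_map (R S : comNzRingType) (phi : {rmorphism R -> S})
    (E : ellcurve R) : ellcurve S := EllCurve (ellcurve_map_disc phi E).

(* the homogeneous Weierstrass equation at [v = (X, Y, Z)] *)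
Definition wcubic (R : comNzRingType) (E : ellcurve R) (v : 'rV[R]_3) : R :=
  let X := v 0 0 in let Y := v 0 1 in let Z := v 0 ord_max in
  Y ^+ 2 * Z + ec_a1 E * X * Y * Z + ec_a3 E * Y * Z ^+ 2
  - (X ^+ 3 + ec_a2 E * X ^+ 2 * Z + ec_a4 E * X * Z ^+ 2 + ec_a6 E * Z ^+ 3).

(* A point of the projective plane over [A] is a rank one direct summand [L]
   of [A^3].  Equivalently: [L] is a submodule whose 2x2 minors vanish and
   whose elements have coordinates generating the unit ideal; where the
   coordinate [l 0 i] is invertible, such an [L] is free on the unimodular
   vector [l]. *)
Definition is_line (A : comNzRingType) (L : set 'rV[A]_3) : Prop :=
  [/\ L 0,
      forall (a : A) u v, L u -> L v -> L (a *: u + v),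
      forall u v, L u -> L v -> forall i j, u 0 i * v 0 j = u 0 j * v 0 i
    & unimodular [set a | exists2 u, L u & exists i, a = u 0 i]%classic].

Definition line_map (A B : comNzRingType) (phi : {rmorphism A -> B})
    (L : set 'rV[A]_3) : set 'rV[B]_3 :=
  [set v | exists n (c : 'I_n -> B) (l : 'I_n -> 'rV[A]_3),
     (forall i, L (l i)) /\ v = \sum_i c i *: map_mx phi (l i)]%classic.

Lemma line_map_in (A B : comNzRingType) (phi : {rmorphism A -> B})
    (L : set 'rV[A]_3) u : L u -> line_map phi L (map_mx phi u).
Proof.
move=> Lu; exists 1%N, (fun=> 1), (fun=> u); split=> //.
by rewrite big_ord1 scale1r.
Qed.

Lemma line_map_submod (A B : comNzRingType) (phi : {rmorphism A -> B})
    (L : set 'rV[A]_3) (a : B) u v :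
  line_map phi L u -> line_map phi L v -> line_map phi L (a *: u + v).
Proof.
move=> [n [c [l [Ll ->]]]] [m [d [h [Lh ->]]]].
exists (n + m)%N,
  (fun i => match split i with inl j => a * c j | inr j => d j end),
  (fun i => match split i with inl j => l j | inr j => h j end).
split; first by move=> i; case: split.
rewrite big_split_ord scaler_sumr; congr (_ + _); apply: eq_bigr => i _.
  by rewrite (unsplitK (inl i)) scalerA.
by rewrite (unsplitK (inr i)).
Qed.

Lemma submod_sum (A : comNzRingType) (L : set 'rV[A]_3) n (c : 'I_n -> A) l :
  L 0 -> (forall (a : A) u v, L u -> L v -> L (a *: u + v)) ->
  (forall i, L (l i)) -> L (\sum_(i < n) c i *: l i).
Proof.
move=> L0 LD Ll; elim/big_rec: _ => // i v _ Lv; exact: LD.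
Qed.

Lemma line_map_line (A B : comNzRingType) (phi : {rmorphism A -> B})
    (L : set 'rV[A]_3) : is_line L -> is_line (line_map phi L).
Proof.
case=> L0 LD Lm [n [c [a [La ca1]]]]; split.
- by exists 0%N, (fun=> 0), (fun=> 0); split=> //; rewrite big_ord0.
- exact: line_map_submod.
- move=> _ _ [p [d [l [Ll ->]]]] [q [e [h [Lh ->]]]] i j.
  rewrite !summxE !mulr_suml; apply: eq_bigr => s _.
  rewrite !mulr_sumr; apply: eq_bigr => t _; rewrite !mxE.
  rewrite mulrACA [RHS]mulrACA -!rmorphM; congr (_ * phi _); exact: Lm.
- exists n, (phi \o c), (phi \o a); split=> [i|].
    have [u Lu [j e]] := La i; exists (map_mx phi u); first exact: line_map_in.
    by exists j; rewrite /= mxE e.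
  rewrite -(rmorph1 phi) -ca1 rmorph_sum; apply: eq_bigr => i _.
  by rewrite /= rmorphM.
Qed.

Lemma line_map_id (A : comNzRingType) (phi : {rmorphism A -> A})
    (L : set 'rV[A]_3) : phi =1 id -> is_line L -> line_map phi L = L.
Proof.
move=> phi1 [L0 LD _ _]; have mp u : map_mx phi u = u :> 'rV_3.
  by apply/matrixP => i j; rewrite mxE phi1.
rewrite predeqE => v; split=> [[n [c [l [Ll ->]]]]|Lv].
  by apply: (submod_sum _ L0 LD) => i; rewrite mp.
by rewrite -(mp v); apply: line_map_in.
Qed.

Lemma line_map_comp (A B C : comNzRingType) (phi : {rmorphism A -> B})
    (psi : {rmorphism B -> C}) (chi : {rmorphism A -> C}) (L : set 'rV[A]_3) :
  chi =1 psi \o phi -> is_line L ->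
  line_map chi L = line_map psi (line_map phi L).
Proof.
move=> e hL; have mp u : map_mx chi u = map_mx psi (map_mx phi u) :> 'rV_3.
  by apply/matrixP => i j; rewrite !mxE e.
have [M0 MD _ _] := line_map_line psi (line_map_line phi hL).
have [N0 ND _ _] := line_map_line chi hL.
rewrite predeqE => v; split=> -[n [c [l [Ll ->]]]].
  by apply: (submod_sum _ M0 MD) => i; rewrite mp; do 2 apply: line_map_in.
apply: (submod_sum _ N0 ND) => i; have [m [d [h [Lh ->]]]] := Ll i.
have -> : map_mx psi (\sum_i d i *: map_mx phi (h i)) =
    \sum_i psi (d i) *: map_mx chi (h i).
  by rewrite raddf_sum; apply: eq_bigr => j _; rewrite mp -map_mxZ.
by apply: (submod_sum _ N0 ND) => j; apply: line_map_in.
Qed.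

Lemma unimodular_kill (A : comNzRingType) (T : set A) (m : nat) (x : A) :
  unimodular T -> (forall t, T t -> t ^+ m * x = 0) -> x = 0.
Proof.
case=> n [c [a [Ta ca1]]] h.
have kill N : forall (e : 'I_n -> nat) (y : A), (\sum_i e i <= N)%N ->
    (forall i, a i ^+ e i * y = 0) -> y = 0.
  elim: N => [|N IH] e y eN hy; rewrite -[y]mul1r -ca1 mulr_suml big1 // => j _.
    have e0 : e j = 0%N.
      by apply/eqP; rewrite -leqn0 (leq_trans _ eN) // (bigD1 j) //= leq_addr.
    by have := hy j; rewrite e0 expr0 mul1r => ->; rewrite mulr0.
  rewrite -mulrA; have [e0|e0] := posnP (e j).
    by have := hy j; rewrite e0 expr0 mul1r => ->; rewrite !mulr0.
  rewrite (IH (fun i => (e i - (i == j))%N) (a j * y)) ?mulr0 //.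
    rewrite -ltnS (leq_trans _ eN) // [X in (_ < X)%N](bigD1 j) //=.
    rewrite (bigD1 j) //= eqxx subn1 -addSn prednK // leq_add2l.
    by apply: leq_sum => i _; rewrite leq_subr.
  move=> i; have [->|_] := eqVneq i j.
    by rewrite mulrA -exprSr subn1 prednK.
  by rewrite subn0 mulrCA hy mulr0.
apply: (kill (\sum_(i < n) m)%N (fun=> m)) => // i; exact: h.
Qed.

Lemma wcubic_line_map (A B : comNzRingType) (phi : {rmorphism A -> B})
    (E : ellcurve A) (L : set 'rV[A]_3) :
  is_line L -> (forall u, L u -> wcubic E u = 0) ->
  forall v, line_map phi L v -> wcubic (ellcurve_map phi E) v = 0.
Proof.
move=> hL EL v Lv; have [_ _ Mm _] := line_map_line phi hL.
case: (hL) => _ _ _ [n [c [a [La ca1]]]].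
apply: (@unimodular_kill _ (phi @` [set a | exists2 u, L u &
    exists i, a = u 0 i])%classic 3).
  exists n, (phi \o c), (phi \o a); split=> [i|].
    by exists (a i).
  rewrite -(rmorph1 phi) -ca1 rmorph_sum; apply: eq_bigr => i _.
  by rewrite /= rmorphM.
move=> _ [_ [u Lu [m ->]] <-].
have wZ (R : comNzRingType) (F : ellcurve R) (r : R) w :
    r ^+ 3 * wcubic F w = wcubic F (r *: w).
  by rewrite /wcubic !mxE; ring.
rewrite wZ; have -> : phi (u 0 m) *: v = v 0 m *: map_mx phi u.
  apply/rowP => j; have := Mm _ _ Lv (line_map_in phi Lu) j m.
  by rewrite !mxE => e; rewrite mulrC e.
rewrite -wZ; suff -> : wcubic (ellcurve_map phi E) (map_mx phi u) = 0.
  by rewrite mulr0.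
rewrite -(rmorph0 phi) -(EL u Lu) /wcubic !mxE /=.
by rewrite !(rmorphD, rmorphN, rmorphM, rmorphXn).
Qed.

Section Curve.
Variables (k : comNzRingType) (E : ellcurve k).

Definition curve_obj (A : comAlgType k) : Type :=
  {L : set 'rV[A]_3 | is_line L /\
     forall v, L v -> wcubic (ellcurve_map (in_alg A) E) v = 0}.

Lemma curve_fmap_subproof (A B : comAlgType k) (phi : {lrmorphism A -> B})
    (x : curve_obj A) : is_line (line_map phi (sval x)) /\
  forall v, line_map phi (sval x) v ->
    wcubic (ellcurve_map (in_alg B) E) v = 0.
Proof.
case: x => L /= [hL EL]; split; first exact: line_map_line.
have -> : ellcurve_map (in_alg B) E =
          ellcurve_map phi (ellcurve_map (in_alg A) E).
  by apply: ellcurve_eq; rewrite /= linearZ /= rmorph1.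
exact: wcubic_line_map.
Qed.

Definition curve_fmap (A B : comAlgType k) (phi : {lrmorphism A -> B})
    (x : curve_obj A) : curve_obj B := exist _ _ (curve_fmap_subproof phi x).

Lemma curve_fmap_id (A : comAlgType k) (phi : {lrmorphism A -> A}) :
  phi =1 id -> curve_fmap phi =1 id.
Proof.
by move=> phi1 [L [hL EL]]; apply: eq_exist; rewrite /= line_map_id.
Qed.

Lemma curve_fmap_comp (A B C : comAlgType k) (phi : {lrmorphism A -> B})
    (psi : {lrmorphism B -> C}) (chi : {lrmorphism A -> C}) :
  chi =1 psi \o phi -> curve_fmap chi =1 curve_fmap psi \o curve_fmap phi.
Proof.
move=> e [L [hL EL]]; apply: eq_exist => /=.
exact: (line_map_comp (phi := phi) (psi := psi) (chi := chi) e hL).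
Qed.

(* The closed subscheme of the projective plane cut out by the equation. *)
Definition curve : kfunctor k := KFunctor curve_fmap_id curve_fmap_comp.

(* The origin [0 : 1 : 0] *)
Definition origin_line (A : comNzRingType) : set 'rV[A]_3 :=
  [set v | v 0 0 = 0 /\ v 0 ord_max = 0]%classic.

Lemma origin_subproof (A : comAlgType k) : is_line (@origin_line A) /\
  forall v, origin_line v -> wcubic (ellcurve_map (in_alg A) E) v = 0.
Proof.
have ord3 (i : 'I_3) : [\/ i = 0, i = 1 | i = ord_max].
  by case: i => -[|[|[|//]]] hi; [apply: Or31|apply: Or32|apply: Or33];
    apply: val_inj.
split; last first.
  by move=> v [v0 v2]; rewrite /wcubic v0 v2; ring.
split.
- by split; rewrite mxE.
- by move=> a u v [u0 u2] [v0 v2]; split; rewrite !mxE ?u0 ?u2 ?v0 ?v2;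
    rewrite mulr0 addr0.
- move=> u v [u0 u2] [v0 v2] i j.
  by case: (ord3 i) => ->; case: (ord3 j) => ->;
    rewrite ?u0 ?u2 ?v0 ?v2 ?mulr0 ?mul0r.
- exists 1%N, (fun=> 1), (fun=> 1); split; last by rewrite big_ord1 mulr1.
  move=> _; exists (\row_i (i == 1)%:R); last by exists 1; rewrite mxE eqxx.
  by split; rewrite mxE.
Qed.

Definition origin (A : comAlgType k) : curve A :=
  exist _ _ (origin_subproof A).

End Curve.

Definition ellcurve_iso (k : comNzRingType) (E E' : ellcurve k) : Prop :=
  exists (phi : nattrans (curve E) (curve E')) (psi : nattrans (curve E') (curve E)),
    nat_inverse phi psi /\
    forall A : comAlgType k, phi A (origin E A) = origin E' A.

(** * The coarse moduli scheme of elliptic curves *)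

Section Moduli.
Variable k : comNzRingType.

Lemma ellcurve_map_id (A : comAlgType k) (phi : {lrmorphism A -> A}) :
  phi =1 id -> ellcurve_map phi =1 id.
Proof. by move=> phi1 E; apply: ellcurve_eq; rewrite /= phi1. Qed.

Lemma ellcurve_map_comp (A B C : comAlgType k) (phi : {lrmorphism A -> B})
    (psi : {lrmorphism B -> C}) (chi : {lrmorphism A -> C}) :
  chi =1 psi \o phi -> ellcurve_map chi =1 ellcurve_map psi \o ellcurve_map phi.
Proof. by move=> e E; apply: ellcurve_eq; rewrite /= e. Qed.

Definition ellcurve_functor : kfunctor k :=
  @KFunctor k (fun A => ellcurve A) (fun A B phi => ellcurve_map phi)
    ellcurve_map_id ellcurve_map_comp.

Definition iso_invariant (X : kfunctor k) (eta : nattrans ellcurve_functor X)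
    : Prop :=
  forall (A : comAlgType k) (E E' : ellcurve A),
    ellcurve_iso E E' -> eta A E = eta A E'.

(* [eta] exhibits [M] as the coarse moduli scheme of elliptic curves: it is a
   bijection from isomorphism classes to points over algebraically closed
   fields, and is universal among maps from the moduli functor to schemes.
   Every elliptic curve over [Spec A] has a Weierstrass equation Zariski-locally
   on [Spec A], so that a map from the moduli functor to a scheme (a Zariski
   sheaf) is the same as an isomorphism-invariant natural transformation from
   Weierstrass curves. *)
Definition is_coarse_moduli (M : scheme k) (eta : nattrans ellcurve_functor M)
    : Prop :=
  [/\ iso_invariant eta,
      forall K : comAlgType k, is_alg_closed K ->
        (forall x : M K, exists E : ellcurve K, eta K E = x) /\
        (forall E E' : ellcurve K, eta K E = eta K E' -> ellcurve_iso E E')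
    & forall (Y : scheme k) (theta : nattrans ellcurve_functor Y),
        iso_invariant theta ->
        exists h : nattrans M Y,
          (forall (A : comAlgType k) (E : ellcurve A),
             h A (eta A E) = theta A E) /\
          forall h' : nattrans M Y,
            (forall (A : comAlgType k) (E : ellcurve A),
               h' A (eta A E) = theta A E) ->
            forall A : comAlgType k, h' A =1 h A].

End Moduli.

(** * Products of elliptic curves as abelian varieties *)

Section AbelianVarieties.
Variable k : closedFieldType.

Definition det2 (t a : 'rV[k]_2) : k := t 0 0 * a 0 1 - t 0 1 * a 0 0.

(* [P + Q + R] is the divisor cut out on [E] by some line: if [M] parametrizes
   the line, the cubic restricts to a product of three linear forms, vanishing
   at the parameters [a], [b], [c] of [P], [Q], [R].  (A nonzero constant factor
   is absorbed by rescaling [a].) *)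
Definition collinear (E : ellcurve k) (P Q R : curve E k^o) : Prop :=
  exists (M : 'M[k]_(2, 3)) (a b c : 'rV[k]_2),
    [/\ row_free M, [/\ a != 0, b != 0 & c != 0],
        [/\ sval P (a *m M), sval Q (b *m M) & sval R (c *m M)]
      & forall t : 'rV[k]_2,
          wcubic E (t *m M) = det2 t a * det2 t b * det2 t c].

(* [P + Q = S] in the group law: the chord through [P] and [Q] and the line
   through [S] and the origin have the same third point of intersection. *)
Definition curve_add (E : ellcurve k) (P Q S : curve E k^o) : Prop :=
  exists R : curve E k^o, collinear P Q R /\ collinear R S (origin E k^o).

Definition curve_prod (g : nat) (E : 'I_g -> ellcurve k) : kfunctor k :=
  prod_functor (fun i => curve (E i)).

(* An isomorphism of abelian varieties: an isomorphism of schemes that is a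
   homomorphism of groups.  As the varieties are reduced and [k] is
   algebraically closed, the latter is a condition on k-points. *)
Definition prod_iso (g : nat) (E E' : 'I_g -> ellcurve k) : Prop :=
  exists (phi : nattrans (curve_prod E) (curve_prod E'))
         (psi : nattrans (curve_prod E') (curve_prod E)),
    nat_inverse phi psi /\
    forall P Q S : curve_prod E k^o,
      (forall i, curve_add (P i) (Q i) (S i)) ->
      forall i, curve_add (phi k^o P i) (phi k^o Q i) (phi k^o S i).

End AbelianVarieties.

(* Main.v *)
(* The coarse moduli scheme is the affine line, through the
   j-invariant: the only delicate points are j = 0 and j = 1728, where a section over a family of curves
   descends because functions on it with values in a fraction field of k[j] have no pole.  So the rational
   map lives on affine g-space, and its composites with regular functions on X are rational functions.

   Let E_0 -> E_1 -> ... -> E_r be a chain of 3-isogenies between curves with compatible 2-isogenies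
   E_i -> E_i'.  As 2 and 3^r are coprime, E_0 x E_r' and E_0' x E_r are isomorphic as abelian varieties,
   by a matrix of isogenies built from Bezout coefficients.  On the family y^2 + (v^3 - 2) x y + v^3 y = x^3
   the 3-isogenies are v_(i+1)^3 (v_i^2 - v_i + 1) = v_i (v_i^2 + 2 v_i + 4), in every characteristic.
   Near the cusp u = 1/v = 0 one has u_0 ~ u_r^(3^r), and j has a pole of order 18 in u on E and of
   order 9 on E'.  A rational function phi(x, y) with
   phi(j(E_0), j(E_r')) = phi(j(E_0'), j(E_r)) therefore has, for r large, numerator and denominator with the
   same lexicographic leading exponent; subtracting a multiple of the denominator shows that phi is constant.
   Hence every such function is constant in each pair of coordinates, hence constant. *)
From HB Require Import structures.
Require Import Defs.
From mathcomp Require Import all_boot all_order all_algebra.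
From mathcomp Require Import boolp classical_sets.
From mathcomp Require Import ring zify.
Set Implicit Arguments.
Unset Strict Implicit.
Unset Printing Implicit Defensive.
Import GRing.Theory.
Local Open Scope ring_scope.

(** * Functors of points of affine schemes *)

(** The obstacle is that morphisms and equalities must be handled over arbitrary algebras, while
    formulas hold only at general points. Two devices bridge this gap. A morphism to a curve is
    given by several homogeneous formulas that are proportional at general k-points and have no
    common zero over a field; the span of their values is then a projective point over any algebra.
    An equality of morphisms is checked at all but finitely many abscissas over k, because the
    coordinate rings are free over polynomial rings and a nonzero element survives at such a point.
    In the relation between phi(j(E_0), j(E_r')) and phi(j(E_0'), j(E_r)) the exchange of roles
    carries the information: with q = 3^r the pole orders in u_r are 18q and 9 on one side, 9q and
    18 on the other, and comparing total orders separates the two degrees once q exceeds the degrees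
    in y. As X is an arbitrary scheme, its regular functions are taken on an affine neighbourhood of
    one value; this shows that f is locally constant, and irreducibility of affine space does the
    rest. *)

Definition alg_of (k Q : comNzRingType) (iota : {rmorphism k -> Q}) : Type := Q.

Section AlgOf.
Variables (k Q : comNzRingType) (iota : {rmorphism k -> Q}).
Local Notation T := (alg_of iota).
HB.instance Definition _ := GRing.ComNzRing.on T.
Definition alg_of_scale (c : k) (x : T) : T := (iota c : T) * x.
Fact alg_of_scaleA a b v :
  alg_of_scale a (alg_of_scale b v) = alg_of_scale (a * b) v.
Proof. by rewrite /alg_of_scale rmorphM mulrA. Qed.
Fact alg_of_scale1 : left_id 1 alg_of_scale.
Proof. by move=> v; rewrite /alg_of_scale rmorph1 mul1r. Qed.
Fact alg_of_scaleDr : right_distributive alg_of_scale +%R.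
Proof. by move=> a u v; rewrite /alg_of_scale mulrDr. Qed.
Fact alg_of_scaleDl v : {morph alg_of_scale^~ v : a b / a + b}.
Proof. by move=> a b; rewrite /alg_of_scale rmorphD mulrDl. Qed.
HB.instance Definition _ := GRing.Zmodule_isLmodule.Build k T
  alg_of_scaleA alg_of_scale1 alg_of_scaleDr alg_of_scaleDl.
Fact alg_of_scaleAl (a : k) (u v : T) : a *: (u * v) = (a *: u) * v.
Proof. exact: mulrA. Qed.
HB.instance Definition _ := GRing.Lmodule_isLalgebra.Build k T alg_of_scaleAl.
Fact alg_of_scaleAr (a : k) (u v : T) : a *: (u * v) = u * (a *: v).
Proof. exact: mulrCA. Qed.
HB.instance Definition _ := GRing.Lalgebra_isAlgebra.Build k T alg_of_scaleAr.
End AlgOf.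

Section Quotients.
Variable k : comNzRingType.
Implicit Types A B C L K Q : comAlgType k.

Section MkLRMorphism.
Variables (A B : comAlgType k) (f : A -> B).
Hypotheses (fB : {morph f : x y / x - y}) (f1 : f 1 = 1)
  (fM : {morph f : x y / x * y}) (fA : forall c : k, f c%:A = c%:A).
Let F (_ : unit) : A -> B := f.
Fact mk_lrmorphism_scalable : scalable f.
Proof. by move=> c u; rewrite -[u in LHS]mul1r scalerAl fM fA -scalerAl mul1r. Qed.
HB.instance Definition _ u := GRing.isZmodMorphism.Build A B (F u) fB.
HB.instance Definition _ u := GRing.isMonoidMorphism.Build A B (F u) (conj f1 fM).
HB.instance Definition _ u :=
  GRing.isScalable.Build k A B *:%R (F u) mk_lrmorphism_scalable.
Lemma mk_lrmorphism : exists phi : {lrmorphism A -> B}, phi =1 f.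
Proof. by exists (F tt : {lrmorphism A -> B}). Qed.
End MkLRMorphism.

Lemma lrmorph_alg A B (phi : {lrmorphism A -> B}) (c : k) : phi c%:A = c%:A.
Proof. by rewrite linearZ /= rmorph1. Qed.

Definition apoly A : comAlgType k := alg_of (polyC \o in_alg A).

Lemma apolyC_ex A : exists phi : {lrmorphism A -> apoly A}, forall a, phi a = a%:P.
Proof.
apply: (@mk_lrmorphism A (apoly A) (fun a => a%:P)).
- exact: polyCB.
- by [].
- exact: polyCM.
- by move=> c; exact: esym (mulr1 _).
Qed.
Definition apolyC A : {lrmorphism A -> apoly A} := projT1 (cid (apolyC_ex A)).
Lemma apolyCE A (a : A) : apolyC A a = a%:P.
Proof. by rewrite /apolyC; case: cid. Qed.

Lemma apoly_eval_ex A B (phi : {lrmorphism A -> B}) (b : B) :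
  exists psi : {lrmorphism apoly A -> B}, forall p, psi p = (map_poly phi p).[b].
Proof.
apply: (@mk_lrmorphism (apoly A) B (fun p => (map_poly phi p).[b])).
- by move=> x y; rewrite rmorphB hornerD hornerN.
- by rewrite rmorph1 hornerC.
- by move=> x y; rewrite rmorphM hornerM.
- move=> c; have -> : (c%:A : apoly A) = (c%:A : A)%:P.
    by rewrite -apolyCE lrmorph_alg.
  by rewrite map_polyC hornerC /= lrmorph_alg.
Qed.
Definition apoly_eval A B (phi : {lrmorphism A -> B}) (b : B) :
  {lrmorphism apoly A -> B} := projT1 (cid (apoly_eval_ex phi b)).
Lemma apoly_evalE A B (phi : {lrmorphism A -> B}) b p :
  apoly_eval phi b p = (map_poly phi p).[b].
Proof. by rewrite /apoly_eval; case: cid. Qed.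
Lemma apoly_evalX A B (phi : {lrmorphism A -> B}) b :
  apoly_eval phi b 'X = b.
Proof. by rewrite apoly_evalE map_polyX hornerX. Qed.
Lemma apoly_evalC A B (phi : {lrmorphism A -> B}) b a :
  apoly_eval phi b (apolyC A a) = phi a.
Proof. by rewrite apoly_evalE apolyCE map_polyC hornerC. Qed.

Definition is_ideal A (I : set A) : Prop :=
  I 0 /\ forall a u v, I u -> I v -> I (a * u + v).

(** Algebras here are nonzero rings, hence the condition that [I] omit 1. *)
Lemma quot_ex A (I : set A) : is_ideal I -> ~ I 1 ->
  exists (Q : comAlgType k) (pi : {lrmorphism A -> Q}),
    (forall q, exists a, pi a = q) /\ (forall a, pi a = 0 <-> I a).
Proof.
move=> [I0 ID] I1; pose S : A -> bool := fun a => `[< I a >].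
have hS : idealr_closed (S : {pred A}).
  split; rewrite ?unfold_in /S.
  - exact/asboolP.
  - exact/asboolP.
  - move=> a u v; rewrite !unfold_in => /asboolP hu /asboolP hv.
    by apply/asboolP; apply: ID.
pose hI := isIdealr.Build A S hS.
pose J : idealr A := HB.pack_for (idealr A) S hI.
pose Q0 : comNzRingType := {ideal_quot J}.
pose pi0 : {rmorphism A -> Q0} := \pi_Q0%qT.
pose Q : comAlgType k := alg_of (pi0 \o in_alg A).
have [pi piE] : exists phi : {lrmorphism A -> Q}, phi =1 pi0.
  apply: mk_lrmorphism.
  - exact: rmorphB.
  - exact: rmorph1.
  - exact: rmorphM.
  - by move=> c; exact: esym (mulr1 _).
exists Q, pi; split.
- move=> q; exists (generic_quotient.repr (q : Q0)).
  by rewrite piE; exact: generic_quotient.reprK.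
- move=> a; rewrite piE.
  have -> : (pi0 a = 0) <-> (pi0 a == pi0 0) by rewrite rmorph0; split=> /eqP.
  have := @Quotient.idealrBE A J a 0; rewrite /pi0 subr0 => <-.
  by rewrite unfold_in; split => /asboolP.
Qed.

Lemma surj_factor A Q B (pi : {lrmorphism A -> Q}) (phi : {lrmorphism A -> B}) :
  (forall q, exists a, pi a = q) -> (forall a, pi a = 0 -> phi a = 0) ->
  exists psi : {lrmorphism Q -> B}, phi =1 psi \o pi.
Proof.
move=> sur ker.
have [r rP] : {r : Q -> A & forall q, pi (r q) = q}.
  by exists (fun q => projT1 (cid (sur q))) => q; case: cid.
have phiE x y : pi x = pi y -> phi x = phi y.
  by move=> e; apply/subr0_eq; rewrite -rmorphB; apply: ker; rewrite rmorphB /= e subrr.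
have [psi psiE] : exists psi : {lrmorphism Q -> B}, psi =1 phi \o r.
  apply: mk_lrmorphism => /=.
  - by move=> x y /=; rewrite -rmorphB; apply: phiE; rewrite rmorphB /= !rP.
  - by rewrite -(rmorph1 phi); apply: phiE; rewrite rP /= rmorph1.
  - by move=> x y /=; rewrite -rmorphM; apply: phiE; rewrite rmorphM /= !rP.
  - by move=> c; rewrite -(lrmorph_alg phi); apply: phiE; rewrite rP /= lrmorph_alg.
by exists psi => a /=; rewrite psiE /=; apply: phiE; rewrite rP.
Qed.

Lemma unimodularS (A : comNzRingType) (S T : set A) :
  (forall a, S a -> T a) -> unimodular S -> unimodular T.
Proof. by move=> ST [n [c [a [Sa e]]]]; exists n, c, a; split=> // i; apply: ST. Qed.

Lemma unimodular_map (A B : comNzRingType) (phi : {rmorphism A -> B}) (T : set A) :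
  unimodular T -> unimodular (phi @` T)%classic.
Proof.
move=> [n [c [a [Ta e]]]]; exists n, (phi \o c), (phi \o a).
split=> [i|]; first by exists (a i).
rewrite -(rmorph1 phi) -e rmorph_sum; apply: eq_bigr => i _.
by rewrite /= rmorphM.
Qed.

Definition gen_ideal (A : comNzRingType) (T : set A) : set A := fun x =>
  exists n (c a : 'I_n -> A), (forall i, T (a i)) /\ \sum_i c i * a i = x.

Lemma gen_ideal_is A (T : set A) : is_ideal (gen_ideal T).
Proof.
split; first by exists 0%N, (fun=> 0), (fun=> 0); split=> [[]//|]; rewrite big_ord0.
move=> r _ _ [n [c [a [Ta <-]]]] [m [d [b [Tb <-]]]].
exists (n + m)%N, (fun i => match split i with inl j => r * c j | inr j => d j end),
 (fun i => match split i with inl j => a j | inr j => b j end).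
split; first by move=> i; case: split.
rewrite big_split_ord mulr_sumr; congr (_ + _); apply: eq_bigr => i _.
  by rewrite (unsplitK (inl i)) mulrA.
by rewrite (unsplitK (inr i)).
Qed.

Lemma gen_ideal_in (A : comNzRingType) (T : set A) a : T a -> gen_ideal T a.
Proof.
by move=> Ta; exists 1%N, (fun=> 1), (fun=> a); split=> //; rewrite big_ord1 mul1r.
Qed.

Lemma ideal_sum A (I : set A) n (c a : 'I_n -> A) :
  is_ideal I -> (forall i, I (a i)) -> I (\sum_i c i * a i).
Proof. by move=> [I0 ID] Ia; elim/big_rec: _ => // i x _; apply: ID. Qed.

Lemma unimodular_gen A (T S : set A) :
  (forall a, S a -> gen_ideal T a) -> unimodular S -> unimodular T.
Proof.
by move=> ST [n [c [a [Sa e]]]]; rewrite /unimodular -/(gen_ideal T 1) -e;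
  apply: ideal_sum => [|i]; [exact: gen_ideal_is | exact: ST].
Qed.

(** Zorn yields a set [S] maximal among those for which [S] and [T] together generate a proper
    ideal; the quotient by that ideal is a field. A failure of unimodularity thus becomes a
    field-valued point where all of [T] vanishes, which takes the place of prime spectra
    throughout. *)
Lemma max_quot A (T : set A) : ~ unimodular T ->
  exists (K : comAlgType k) (pi : {lrmorphism A -> K}),
    is_field K /\ forall t, T t -> pi t = 0.
Proof.
move=> nT.
pose P : set (set A) := fun S => ~ unimodular (S `|` T)%classic.
have [|S [PS Smax]] := @Zorn_bigcup A P.
  move=> F FP tot [n [c [a [Ha e]]]].
  have [[S0 FS0]|nF] := pselect (exists S0, F S0); last first.
    apply: nT; exists n, c, a; split=> // i.
    by have [[S FS _]|] := Ha i => //; case: nF; exists S.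
  (* A unit relation involves finitely many elements, which lie in one member of the chain. *)
  have chain : forall s : seq A, (forall x, x \in s -> ((\bigcup_(X in F) X) `|` T)%classic x) ->
     exists2 S, F S & forall x, x \in s -> (S `|` T)%classic x.
    elim=> [|x s IH] h; first by exists S0.
    have [|S FS hS] := IH; first by move=> y ys; apply: h; rewrite inE ys orbT.
    have [[S' FS' Sx]|Tx] := h x (mem_head _ _); last first.
      by exists S => // y; rewrite inE => /orP[/eqP->|/hS//]; right.
    have [SS|SS] := tot _ _ FS FS'.
      exists S' => // y; rewrite inE => /orP[/eqP->|/hS]; first by left.
      by case=> [/SS|]; [left|right].
    exists S => // y; rewrite inE => /orP[/eqP->|/hS//]; left; exact: SS.
  have [|S FS hS] := chain (codom a).
    by move=> x /codomP[i ->]; exact: Ha.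
  apply: (FP S FS); exists n, c, a; split=> // i; apply: hS; exact: codom_f.
pose I := gen_ideal (S `|` T)%classic.
have [K [pi [sur ker]]] := quot_ex (gen_ideal_is (S `|` T)%classic) PS.
exists K, pi; split; last first.
  by move=> t Tt; apply/ker; apply: gen_ideal_in; right.
move=> q; have [a <-] := sur q => /ker Ia.
have nSa : ~ S a by move=> Sa; apply: Ia; apply: gen_ideal_in; left.
have : unimodular ((S `|` [set a]) `|` T)%classic.
  apply: contrapT; apply: (Smax (S `|` [set a])%classic).
  split; first by move=> x; left.
  by move=> h; apply: nSa; apply: h; right.
move=> [n [c [b [hb e]]]].
suff [x hx] : exists x, I (1 - a * x).
  by exists (pi x); rewrite -rmorphM; apply/esym/subr0_eq; rewrite -(rmorph1 pi) -rmorphB; apply/ker.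
(* The elements congruent modulo [I] to multiples of [a] form an ideal that contains all generators
   in the unit relation. *)
have J : is_ideal (fun y => exists x, I (y - a * x)).
  have [I0 ID] := gen_ideal_is (S `|` T)%classic.
  split; first by exists 0; rewrite mulr0 subr0.
  move=> r u v [x hx] [y hy]; exists (r * x + y).
  by rewrite (_ : _ - _ = r * (u - a * x) + (v - a * y)); [exact: ID | ring].
rewrite -e; apply: (ideal_sum c J) => i.
case: (hb i) => [[Sb|->]|Tb].
- by exists 0; rewrite mulr0 subr0; apply: gen_ideal_in; left.
- by exists 1; rewrite mulr1 subrr; have [] := gen_ideal_is (S `|` T)%classic.
- by exists 0; rewrite mulr0 subr0; apply: gen_ideal_in; right.
Qed.

(** The localization is built as [A[X]/(tX - 1)]. *)
Lemma loc_ex A (t : A) : (forall n, t ^+ n <> 0) ->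
  exists (L : comAlgType k) (iota : {lrmorphism A -> L}),
  [/\ invertible (iota t), forall a, iota a = 0 -> exists n, t ^+ n * a = 0,
      forall l, exists a n, iota t ^+ n * l = iota a
    & forall (B : comAlgType k) (phi : {lrmorphism A -> B}),
        invertible (phi t) -> exists psi : {lrmorphism L -> B}, phi =1 psi \o iota].
Proof.
move=> tn0; pose f : apoly A := t%:P * 'X - 1.
pose I : set (apoly A) := fun p => exists q, p = q * f.
have hI : is_ideal I.
  split; first by exists 0; rewrite mul0r.
  by move=> a _ _ [q ->] [r ->]; exists (a * q + r); ring.
have kerC a : I (a%:P : apoly A) -> exists n, t ^+ n * a = 0.
  (* Comparing coefficients in [a = q (tX - 1)] forces the coefficient of degree n of [q] to be
     [- (t ^+ n * a)], and [q] has finite degree. *)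
  case=> q e; have qi n : (q : {poly A})`_n = - (t ^+ n * a).
    elim: n => [|n IH].
      have := congr1 (fun p : {poly A} => p`_0) e.
      rewrite coefC /= /f mulrBr mulr1 coefB mulrA coefMX /= sub0r => ->.
      by rewrite expr0 mul1r opprK.
    have := congr1 (fun p : {poly A} => p`_n.+1) e.
    rewrite coefC /= /f mulrBr mulr1 coefB mulrA coefMX /= coefMC IH => /esym/subr0_eq <-.
    by rewrite exprSr; ring.
  exists (size (q : {poly A})); have := qi (size (q : {poly A})).
  by rewrite nth_default // => /esym/eqP; rewrite oppr_eq0 => /eqP.
have [|L [pi [sur ker]]] := quot_ex hI.
  by move=> /kerC[n]; rewrite mulr1; apply: tn0.
have pif : pi (apolyC A t) * pi 'X = 1.
  apply/subr0_eq; rewrite -rmorphM -(rmorph1 pi) -rmorphB apolyCE; apply/ker.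
  by exists 1; rewrite mul1r.
have expXn n : pi (apolyC A t) ^+ n * pi 'X ^+ n = 1 by rewrite -exprMn pif expr1n.
exists L, (pi \o apolyC A); split.
- by exists (pi 'X).
- by move=> a /= /ker; rewrite apolyCE => /kerC.
- move=> l; have [p <-] := sur l; elim/poly_ind: p => [|p c [a [n IH]]].
    by exists 0, 0%N; rewrite /= !rmorph0 mulr0.
  exists (a + t ^+ n.+1 * c), n.+1; rewrite /= in IH *.
  have -> : pi (p * 'X + c%:P) = pi p * pi 'X + pi (apolyC A c).
    by rewrite apolyCE -rmorphM -rmorphD.
  rewrite !rmorphD !rmorphM /= -IH !rmorphXn /= exprS.
  transitivity (pi (apolyC A t) ^+ n * pi p * (pi (apolyC A t) * pi 'X) +
    pi (apolyC A t) * pi (apolyC A t) ^+ n * pi (apolyC A c)); first by ring.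
  by rewrite pif mulr1.
- move=> B phi [b hb].
  have [|psi hpsi] := @surj_factor _ _ _ pi (apoly_eval phi b) sur.
    move=> p /ker[q ->]; rewrite rmorphM rmorphB rmorphM rmorph1 /=.
    by rewrite -apolyCE apoly_evalC apoly_evalX hb subrr mulr0.
  by exists psi => a /=; rewrite -(apoly_evalC phi b) hpsi.
Qed.

End Quotients.

(** * Lines and points of plane cubics *)

Lemma map_polyMXC (A B : nzRingType) (f : {rmorphism A -> B}) r c :
  map_poly f (r * 'X + c%:P) = map_poly f r * 'X + (f c)%:P.
Proof. by rewrite rmorphD rmorphM /= map_polyX map_polyC. Qed.

Section MonicQuotient.
Variable k : comNzRingType.
Implicit Types A B : comAlgType k.

Lemma apoly_lrmE A B (f : {lrmorphism apoly A -> B}) (r : apoly A) :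
  f r = (map_poly (f \o apolyC A) r).[f 'X].
Proof.
elim/poly_ind: r => [|r c IH]; first by rewrite rmorph0 map_poly0 horner0.
have -> : f (r * 'X + c%:P) = f r * f 'X + f (apolyC A c).
  by rewrite apolyCE -rmorphM -rmorphD.
have -> : map_poly (f \o apolyC A) (r * 'X + c%:P) =
    map_poly (f \o apolyC A) r * 'X + (f (apolyC A c))%:P.
  exact: map_polyMXC.
by rewrite IH hornerMXaddC.
Qed.

(** The quotient [A[X]/(p)] is free on the powers of [t] below the degree of [p]; the last two
    clauses record this. *)
Lemma monic_quot A (p : {poly A}) : p \is monic -> (1 < size p)%N ->
  exists (R : comAlgType k) (iota : {lrmorphism A -> R}) (t : R),
  [/\ (map_poly iota p).[t] = 0,
      forall B (phi : {lrmorphism A -> B}) (b : B), (map_poly phi p).[b] = 0 ->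
        exists psi : {lrmorphism R -> B}, phi =1 psi \o iota /\ psi t = b,
      forall e : R, exists2 r : {poly A},
        (size r < size p)%N & e = (map_poly iota r).[t]
    & forall r : {poly A}, (size r < size p)%N ->
        (map_poly iota r).[t] = 0 -> r = 0].
Proof.
move=> mp sp; pose I : set (apoly A) := fun q => exists r, q = r * (p : apoly A).
have hI : is_ideal I.
  split; first by exists 0; rewrite mul0r.
  by move=> a _ _ [q ->] [r ->]; exists (a * q + r); rewrite mulrDl mulrA.
have small (r : {poly A}) : (size r < size p)%N -> I r -> r = 0.
  move=> sr [q e]; have [q0|q0] := eqVneq (q : {poly A}) 0.
    by rewrite e q0; exact: mul0r.
  move: sr; rewrite e ltnNge; case/negP.
  have -> : size ((q * (p : apoly A) : apoly A) : {poly A}) = (size (q : {poly A}) + size p).-1.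
    exact: size_Mmonic.
  by rewrite -[size (q : {poly A})]prednK ?size_poly_gt0 // addSn /= leq_addl.
have I1 : ~ I 1.
  by move=> /small; rewrite size_poly1 => /(_ sp)/eqP; rewrite oner_eq0.
have [R [pi [sur ker]]] := quot_ex hI I1.
have ev := apoly_lrmE pi.
exists R, (pi \o apolyC A), (pi 'X); split.
- by rewrite -ev; apply/ker; exists 1; rewrite mul1r.
- move=> B phi b e.
  have [|psi hpsi] := @surj_factor _ _ _ _ pi (apoly_eval phi b) sur.
    by move=> q /ker[r ->]; rewrite rmorphM /= !apoly_evalE e mulr0.
  exists psi; split; last by have /= <- := hpsi 'X; rewrite apoly_evalX.
  by move=> a /=; have /= <- := hpsi (apolyC A a); rewrite apoly_evalC.
- move=> e; have [q <-] := sur e.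
  exists (Pdiv.Ring.rmodp (q : {poly A}) p); first by rewrite Pdiv.Ring.ltn_rmodp monic_neq0.
  have E : q = (Pdiv.Ring.rdivp (q : {poly A}) p : apoly A) * (p : apoly A) +
      (Pdiv.Ring.rmodp (q : {poly A}) p : apoly A).
    exact: (Pdiv.RingMonic.rdivp_eq mp (q : {poly A})).
  have p0 : pi (p : apoly A) = 0 by apply/ker; exists 1; rewrite mul1r.
  by rewrite -ev [in LHS]E rmorphD rmorphM /= p0 mulr0 add0r.
- by move=> r sr; rewrite -ev => /ker; apply: small.
Qed.
End MonicQuotient.

Definition vec3 (A : nzRingType) (x y z : A) : 'rV[A]_3 :=
  \row_i (nth 0 [:: x; y; z] i).

Lemma vec3E (A : nzRingType) (x y z : A) :
  (vec3 x y z 0 0 = x) * (vec3 x y z 0 1 = y) * (vec3 x y z 0 ord_max = z).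
Proof. by rewrite !mxE. Qed.

Lemma ord3P (i : 'I_3) : [\/ i = 0, i = 1 | i = ord_max].
Proof.
by case: i => -[|[|[|//]]] hi; [apply: Or31|apply: Or32|apply: Or33]; apply: val_inj.
Qed.

Lemma row3P (A : nzRingType) (u v : 'rV[A]_3) :
  u 0 0 = v 0 0 -> u 0 1 = v 0 1 -> u 0 ord_max = v 0 ord_max -> u = v.
Proof. by move=> h0 h1 h2; apply/rowP => i; have [->|->|->] := ord3P i. Qed.

Lemma vec3_eta (A : nzRingType) (u : 'rV[A]_3) : u = vec3 (u 0 0) (u 0 1) (u 0 ord_max).
Proof. by apply: row3P; rewrite vec3E. Qed.

Lemma map_vec3 (A B : nzRingType) (f : {rmorphism A -> B}) x y z :
  map_mx f (vec3 x y z) = vec3 (f x) (f y) (f z).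
Proof. by apply: row3P; rewrite mxE !vec3E. Qed.

Lemma scale_vec3 (A : nzRingType) c (x y z : A) :
  c *: vec3 x y z = vec3 (c * x) (c * y) (c * z).
Proof. by apply: row3P; rewrite mxE !vec3E. Qed.

Lemma wcubic_scale (A : comNzRingType) (E : ellcurve A) c u :
  wcubic E (c *: u) = c ^+ 3 * wcubic E u.
Proof. by rewrite /wcubic !mxE; ring. Qed.

Lemma wcubic_map (A B : comNzRingType) (E : ellcurve A) (f : {rmorphism A -> B}) u :
  wcubic (ellcurve_map f E) (map_mx f u) = f (wcubic E u).
Proof. by rewrite /wcubic !mxE /= !(rmorphD, rmorphN, rmorphM, rmorphXn). Qed.

Definition par (A : comNzRingType) (u v : 'rV[A]_3) : Prop :=
  forall i j, u 0 i * v 0 j = u 0 j * v 0 i.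

(** A unit relation among coordinates of vectors [v i] of [M] writes [u] as a sum of terms
    [c i * v i 0 (j i)] times [u], and proportionality turns each into a multiple of [v i]. *)
Lemma line_sub (A : comNzRingType) (L M : set 'rV[A]_3) :
  is_line L -> is_line M -> (forall u v, L u -> M v -> par u v) -> forall u, L u -> M u.
Proof.
move=> [_ _ _ _] [M0 MD _ [n [c [a [Ma e]]]]] LM u Lu.
have [v vP] : {v : 'I_n -> 'rV[A]_3 & forall i, M (v i) /\ exists j, a i = v i 0 j}.
  exists (fun i => projT1 (cid2 (Ma i))) => i.
  by case: cid2 => v /= Mv hj.
have [j jP] : {j : 'I_n -> 'I_3 & forall i, a i = v i 0 (j i)}.
  by exists (fun i => projT1 (cid (vP i).2)) => i; case: cid.
have -> : u = \sum_i (c i * u 0 (j i)) *: v i.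
  rewrite -[LHS]scale1r -e scaler_suml; apply: eq_bigr => i _.
  rewrite -!scalerA; congr (_ *: _); apply/rowP => l; rewrite !mxE jP mulrC.
  by rewrite (LM u (v i) Lu (vP i).1 l (j i)).
by apply: submod_sum => // i; have [] := vP i.
Qed.

Lemma line_eq (A : comNzRingType) (L M : set 'rV[A]_3) :
  is_line L -> is_line M -> (forall u v, L u -> M v -> par u v) -> L = M.
Proof.
move=> hL hM LM; rewrite predeqE => u; split; first exact: line_sub.
apply: line_sub => // x y Mx Ly i j; have := LM y x Ly Mx j i.
by rewrite mulrC [RHS]mulrC => ->.
Qed.

Definition ray (A : comNzRingType) (u : 'rV[A]_3) : set 'rV[A]_3 :=
  fun v => exists c, v = c *: u.

Definition primitive (A : comNzRingType) (u : 'rV[A]_3) : Prop :=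
  unimodular (fun a => exists i, a = u 0 i).

Lemma ray_line (A : comNzRingType) (u : 'rV[A]_3) : primitive u -> is_line (ray u).
Proof.
move=> hu; split.
- by exists 0; rewrite scale0r.
- move=> a _ _ [c ->] [d ->]; exists (a * c + d).
  by rewrite scalerDl scalerA.
- by move=> _ _ [c ->] [d ->] i j; rewrite !mxE; ring.
- apply: unimodularS hu => a [i ->]; exists u; last by exists i.
  by exists 1; rewrite scale1r.
Qed.

Lemma unit_primitive (A : comNzRingType) (u : 'rV[A]_3) i :
  invertible (u 0 i) -> primitive u.
Proof.
move=> [b hb]; exists 1%N, (fun=> b), (fun=> u 0 i); split; first by exists i.
by rewrite big_ord1 mulrC.
Qed.

Lemma line_ray (A : comNzRingType) (L : set 'rV[A]_3) u :
  is_line L -> L u -> primitive u -> L = ray u.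
Proof.
move=> hL Lu hu; apply: line_eq => //; first exact: ray_line.
case: hL => _ _ Lm _ x _ Lx [c ->] i j; rewrite !mxE.
by rewrite mulrCA (Lm x u Lx Lu i j); ring.
Qed.

Section Points.
Variables (k : comNzRingType) (E : ellcurve k).
Implicit Types A B : comAlgType k.

Notation oncone A u := (wcubic (ellcurve_map (in_alg A) E) u = 0).

Lemma ellcurve_map_alg A B (f : {lrmorphism A -> B}) :
  ellcurve_map (in_alg B) E = ellcurve_map f (ellcurve_map (in_alg A) E).
Proof. by apply: ellcurve_eq; rewrite /= linearZ /= rmorph1. Qed.

Lemma oncone_map A B (f : {lrmorphism A -> B}) u :
  oncone A u -> oncone B (map_mx f u).
Proof. by move=> h; rewrite (ellcurve_map_alg f) wcubic_map h rmorph0. Qed.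

Lemma point_ray_subproof A (u : 'rV[A]_3) : primitive u -> oncone A u ->
  is_line (ray u) /\ forall v, ray u v -> oncone A v.
Proof.
move=> hu wu; split; first exact: ray_line.
by move=> _ [c ->]; rewrite wcubic_scale wu mulr0.
Qed.

Definition point_ray A (u : 'rV[A]_3) (hu : primitive u) (wu : oncone A u) : curve E A :=
  exist _ (ray u) (point_ray_subproof hu wu).

Lemma point_eq A (P Q : curve E A) : sval P = sval Q -> P = Q.
Proof. by case: P Q => [L hL] [M hM] /= e; apply: eq_exist. Qed.

Lemma point_par A (P Q : curve E A) :
  (forall u v, sval P u -> sval Q v -> par u v) -> P = Q.
Proof.
by move=> h; apply: point_eq; apply: line_eq h; [case: (svalP P)|case: (svalP Q)].
Qed.

Lemma point_line A (P : curve E A) : is_line (sval P).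
Proof. by case: (svalP P). Qed.
Lemma point_oncone A (P : curve E A) u : sval P u -> oncone A u.
Proof. by case: (svalP P) => _; apply. Qed.
Lemma point_parr A (P : curve E A) u v : sval P u -> sval P v -> par u v.
Proof. by case: (point_line P) => _ _ h _ Pu Pv i j; apply: h. Qed.
Lemma point_scale A (P : curve E A) c u : sval P u -> sval P (c *: u).
Proof.
by case: (point_line P) => P0 PD _ _ Pu; rewrite -[_ *: _]addr0; apply: PD.
Qed.

Lemma point_in A (P : curve E A) u : sval P u -> primitive u ->
  sval P = ray u.
Proof. by move=> Pu; apply: line_ray => //; apply: point_line. Qed.

Lemma fmap_in A B (f : {lrmorphism A -> B}) (P : curve E A) u :
  sval P u -> sval (fmap (curve E) f P) (map_mx f u).
Proof. exact: line_map_in. Qed.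

Lemma point_eq_in A (P Q : curve E A) u : sval P u -> sval Q u -> primitive u -> P = Q.
Proof.
by move=> Pu Qu hu; apply: point_eq; rewrite (point_in Pu hu) (point_in Qu hu).
Qed.

Lemma aff_primitive A (x y : A) : primitive (vec3 x y 1).
Proof. by apply: (@unit_primitive _ _ ord_max); rewrite vec3E; exists 1; rewrite mulr1. Qed.

Definition aff A (x y : A) (h : oncone A (vec3 x y 1)) : curve E A :=
  point_ray (aff_primitive x y) h.

Lemma aff_in A (x y : A) (h : oncone A (vec3 x y 1)) : sval (aff h) (vec3 x y 1).
Proof. by exists 1; rewrite scale1r. Qed.

Lemma point_aff A (P : curve E A) x y (h : oncone A (vec3 x y 1)) :
  sval P (vec3 x y 1) -> P = aff h.
Proof. by move=> Pu; apply: (point_eq_in Pu (aff_in h)); apply: aff_primitive. Qed.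

End Points.

Lemma monic_XnD (R : nzRingType) n (q : {poly R}) : (size q <= n)%N ->
  'X^n + q \is monic /\ size ('X^n + q) = n.+1.
Proof.
move=> sq; have h : (size q < size ('X^n : {poly R}))%N by rewrite size_polyXn ltnS.
by rewrite monicE lead_coefDl // lead_coefXn size_polyDl // size_polyXn.
Qed.

Section Charts.
Variables (k : comNzRingType) (E : ellcurve k).
Implicit Types A B R : comAlgType k.
Notation oncone A u := (wcubic (ellcurve_map (in_alg A) E) u = 0).

(** The universal affine point over [A]. Its ring is free over [A[x]] on 1 and [y], because the
    equation is monic of degree 2 in [y]; this makes specialization to points faithful. *)
Lemma zchart A : exists (R : comAlgType k) (iota : {lrmorphism A -> R}) (x y : R),
  [/\ oncone R (vec3 x y 1),
      forall B (phi : {lrmorphism A -> B}) (x' y' : B), oncone B (vec3 x' y' 1) ->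
        exists psi : {lrmorphism R -> B}, [/\ phi =1 psi \o iota, psi x = x' & psi y = y'],
      forall e : R, exists r0 r1 : {poly A},
        e = (map_poly iota r0).[x] + (map_poly iota r1).[x] * y
    & forall r0 r1 : {poly A},
        (map_poly iota r0).[x] + (map_poly iota r1).[x] * y = 0 -> r0 = 0 /\ r1 = 0].
Proof.
pose X : apoly A := 'X.
have [S SE] : {S : k -> apoly A | forall c, S c = c%:A} by eexists; reflexivity.
pose c1 : apoly A := S (ec_a1 E) * X + S (ec_a3 E).
pose c0 : apoly A := - (X ^+ 3 + S (ec_a2 E) * X ^+ 2 + S (ec_a4 E) * X + S (ec_a6 E)).
pose p : {poly (apoly A)} := 'X^2 + (c1%:P * 'X + c0%:P).
have [mp sp] : p \is monic /\ size p = 3%N.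
  apply: monic_XnD; rewrite size_MXaddC; case: ifP => // _.
  by rewrite ltnS size_polyC leq_b1.
have [R [i [y [y0 yuniv yex yun]]]] : exists (R : comAlgType k) (iota : {lrmorphism apoly A -> R}) (t : R),
  [/\ (map_poly iota p).[t] = 0,
      forall B (phi : {lrmorphism apoly A -> B}) (b : B), (map_poly phi p).[b] = 0 ->
        exists psi : {lrmorphism R -> B}, phi =1 psi \o iota /\ psi t = b,
      forall e : R, exists2 r : {poly (apoly A)},
        (size r < size p)%N & e = (map_poly iota r).[t]
    & forall r : {poly (apoly A)}, (size r < size p)%N ->
        (map_poly iota r).[t] = 0 -> r = 0].
  by apply: monic_quot => //; rewrite sp.
have pE B (phi : {lrmorphism apoly A -> B}) (b : B) : (map_poly phi p).[b] =
    wcubic (ellcurve_map (in_alg B) E) (vec3 (phi X) b 1).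
  have phS c : phi (S c) = c%:A by rewrite SE; exact: lrmorph_alg.
  rewrite rmorphD /= map_polyXn map_polyMXC /= map_polyC /= hornerD hornerXn hornerMXaddC hornerC.
  rewrite /c1 /c0 !(rmorphD, rmorphN, rmorphM, rmorphXn) /= !phS.
  rewrite /wcubic !vec3E /=; ring.
pose iota : {lrmorphism A -> R} := i \o apolyC A.
have iE (r : apoly A) : i r = (map_poly iota r).[i X] by exact: apoly_lrmE.
exists R, iota, (i X), y; split.
- by rewrite -pE.
- move=> B phi x' y' h.
  have [|psi [h1 h2]] := yuniv B (apoly_eval phi x') y'.
    by rewrite pE apoly_evalX.
  exists psi; split=> //.
    by move=> a /=; have /= <- := h1 (apolyC A a); rewrite apoly_evalC.
  by have /= <- := h1 X; rewrite apoly_evalX.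
- move=> e; have [r] := yex e; rewrite sp ltnS => sr ->.
  exists (r`_0), (r`_1); rewrite (horner_coef_wide _ (n := 2)).
    by rewrite !big_ord_recl big_ord0 !coef_map /= (iE r`_0) (iE r`_1) expr0 mulr1 expr1 addr0.
  exact: leq_trans (size_poly _ _) sr.
- move=> r0 r1 h.
  have : \poly_(j < 2) (if j == 0%N then r0 : apoly A else r1 : apoly A) = 0.
    apply: yun; first by rewrite sp ltnS size_poly.
    rewrite (horner_coef_wide _ (n := 2)).
      rewrite !big_ord_recl big_ord0 !coef_map !coef_poly /= (iE r0) (iE r1) expr0 mulr1 expr1 addr0.
      exact: h.
    exact: leq_trans (size_poly _ _) (size_poly _ _).
  move=> e; split.
    by have := congr1 (fun q : {poly (apoly A)} => q`_0) e; rewrite coef_poly coef0.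
  by have := congr1 (fun q : {poly (apoly A)} => q`_1) e; rewrite coef_poly coef0.
Qed.

(** The universal point with [Y = 1], a neighbourhood of the origin. The equation is a cubic in [x]
    with unit leading coefficient over [A[z]], so [z] is not a zero divisor and inverting it loses
    nothing. *)
Lemma ychart A : exists (R : comAlgType k) (iota : {lrmorphism A -> R}) (x z : R),
  [/\ oncone R (vec3 x 1 z),
      forall B (phi : {lrmorphism A -> B}) (x' z' : B), oncone B (vec3 x' 1 z') ->
        exists psi : {lrmorphism R -> B}, [/\ phi =1 psi \o iota, psi x = x' & psi z = z']
    & forall e : R, z * e = 0 -> e = 0].
Proof.
pose Z : apoly A := 'X.
have [S SE] : {S : k -> apoly A | forall c, S c = c%:A} by eexists; reflexivity.
pose c2 : apoly A := S (ec_a2 E) * Z.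
pose c1 : apoly A := S (ec_a4 E) * Z ^+ 2 - S (ec_a1 E) * Z.
pose c0 : apoly A := S (ec_a6 E) * Z ^+ 3 - S (ec_a3 E) * Z ^+ 2 - Z.
pose p : {poly (apoly A)} := 'X^3 + ((c2%:P * 'X + c1%:P) * 'X + c0%:P).
have [mp sp] : p \is monic /\ size p = 4%N.
  apply: monic_XnD; rewrite size_MXaddC; case: ifP => // _; rewrite ltnS.
  rewrite size_MXaddC; case: ifP => // _; rewrite ltnS.
  by rewrite size_polyC leq_b1.
have [R [i [x [x0 xuniv xex xun]]]] : exists (R : comAlgType k) (iota : {lrmorphism apoly A -> R}) (t : R),
  [/\ (map_poly iota p).[t] = 0,
      forall B (phi : {lrmorphism apoly A -> B}) (b : B), (map_poly phi p).[b] = 0 ->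
        exists psi : {lrmorphism R -> B}, phi =1 psi \o iota /\ psi t = b,
      forall e : R, exists2 r : {poly (apoly A)},
        (size r < size p)%N & e = (map_poly iota r).[t]
    & forall r : {poly (apoly A)}, (size r < size p)%N ->
        (map_poly iota r).[t] = 0 -> r = 0].
  by apply: monic_quot => //; rewrite sp.
have pE B (phi : {lrmorphism apoly A -> B}) (b : B) : (map_poly phi p).[b] =
    - wcubic (ellcurve_map (in_alg B) E) (vec3 b 1 (phi Z)).
  have phS c : phi (S c) = c%:A by rewrite SE; exact: lrmorph_alg.
  rewrite rmorphD /= map_polyXn !map_polyMXC /= !map_polyC /= hornerD hornerXn !hornerMXaddC hornerC.
  rewrite /c2 /c1 /c0 !(rmorphD, rmorphN, rmorphM, rmorphXn) /= !phS.
  rewrite /wcubic !vec3E /=; ring.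
pose iota : {lrmorphism A -> R} := i \o apolyC A.
exists R, iota, x, (i Z); split.
- by apply/oppr_inj; rewrite -pE x0 oppr0.
- move=> B phi x' z' h.
  have [|psi [h1 h2]] := xuniv B (apoly_eval phi z') x'.
    by rewrite pE apoly_evalX h oppr0.
  exists psi; split=> //.
    by move=> a /=; have /= <- := h1 (apolyC A a); rewrite apoly_evalC.
  by have /= <- := h1 Z; rewrite apoly_evalX.
- move=> e; have [r sr ->] := xex e.
  have -> : i Z * (map_poly i r).[x] = (map_poly i (Z%:P * r)).[x].
    by rewrite rmorphM /= map_polyC hornerCM.
  move=> /xun h; suff -> : r = 0 by rewrite map_poly0 horner0.
  have Zr : Z%:P * r = 0.
    apply: h; apply: leq_ltn_trans sr.
    by rewrite mul_polyC size_scale_leq.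
  apply/polyP => j; rewrite coef0.
  have := congr1 (fun q : {poly (apoly A)} => q`_j) Zr.
  rewrite coefCM coef0 /Z => h1; apply/polyP => l; rewrite coef0.
  have := congr1 (fun q : {poly A} => q`_l.+1) (h1 : 'X * (r`_j : {poly A}) = 0).
  by rewrite coefXM coef0.
Qed.
End Charts.

Lemma waffE (R : comNzRingType) (E : ellcurve R) (x y : R) :
  wcubic E (vec3 x y 1) = y ^+ 2 + ec_a1 E * x * y + ec_a3 E * y
    - (x ^+ 3 + ec_a2 E * x ^+ 2 + ec_a4 E * x + ec_a6 E).
Proof. by rewrite /wcubic !vec3E; ring. Qed.

Section ClosedField.
Variable k : closedFieldType.

Lemma notin_ex (s : seq k) : exists x, x \notin s.
Proof.
pose p : {poly k} := (\prod_(a <- s) ('X - a%:P)) * 'X + 1%:P.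
have /closed_rootP[x] : size p != 1%N.
  have nz : \prod_(a <- s) ('X - a%:P) != 0 :> {poly k}.
    by rewrite monic_neq0 ?monic_prod_XsubC.
  rewrite size_MXaddC (negPf nz) /=.
  by rewrite eqSS size_poly_eq0.
rewrite rootE hornerMXaddC => px; exists x; apply/negP => xs.
move: px; have /rootP -> : root (\prod_(a <- s) ('X - a%:P)) x by rewrite root_prod_XsubC.
by rewrite mul0r add0r oner_eq0.
Qed.

Lemma nonroot_ex (q : {poly k}) (s : seq k) : q != 0 ->
  exists x, x \notin s /\ q.[x] != 0.
Proof.
move=> q0; have [r rE] := closed_field_poly_normal q.
have [x] := notin_ex (s ++ r); rewrite mem_cat negb_or => /andP[xs xr].
exists x; split=> //; rewrite rE hornerZ mulf_neq0 ?lead_coef_eq0 //.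
by have := root_prod_XsubC r x; rewrite (negPf xr) rootE => /negbT.
Qed.

Lemma scale_inj (A : comAlgType k) (c : k) (a : A) : c != 0 -> c%:A * a = 0 -> a = 0.
Proof.
move=> c0 h; have := congr1 (fun b => c^-1%:A * b) h.
by rewrite mulr0 mulrA -scalerAl mul1r scalerA mulVf // scale1r mul1r.
Qed.

Lemma alg_neq0 (A : comAlgType k) (c : k) : c != 0 -> (c%:A : A) != 0.
Proof.
move=> c0; apply/eqP => h; have := @scale_inj A c 1 c0.
by rewrite mulr1 => /(_ h)/eqP; rewrite oner_eq0.
Qed.

(** [A] may have zero divisors, but differences of distinct scalars are invertible, so linear
    factors can be split off one by one. *)
Lemma poly_many_roots (A : comAlgType k) (p : {poly A}) (s : seq k) :
  uniq s -> (size p <= size s)%N -> (forall x, x \in s -> p.[x%:A] = 0) -> p = 0.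
Proof.
elim: s p => [|a s IH] p; first by move=> _; rewrite leqn0 size_poly_eq0 => /eqP.
move=> /= /andP[ains us] sp h.
have /factor_theorem[q qE] : root p a%:A by apply/rootP; apply: h; rewrite mem_head.
have [q0|q0] := eqVneq q 0; first by rewrite qE q0 mul0r.
suff q00 : q = 0 by rewrite q00 eqxx in q0.
apply: IH => //.
  have : size p = (size q).+1.
    by rewrite qE size_Mmonic ?monicXsubC // size_XsubC addn2.
  by move: sp => /[swap] ->; rewrite ltnS.
move=> x xs; have := h x; rewrite inE xs orbT => /(_ isT).
rewrite qE hornerM hornerXsubC => e.
apply: (@scale_inj _ (x - a)); last by rewrite scalerBl mulrC.
by rewrite subr_eq0; apply: contraNneq ains => <-.
Qed.

Lemma poly_nonroot (A : comAlgType k) (p : {poly A}) (q : {poly k}) (s : seq k) :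
  p != 0 -> q != 0 -> exists x, [/\ x \notin s, q.[x] != 0 & p.[x%:A] != 0].
Proof.
move=> p0 q0; apply: contrapT => nex; move/eqP: p0; apply.
have [t [ut st ht]] : exists t, [/\ uniq t, size t = size p & forall x, x \in t -> p.[x%:A] = 0].
  elim: (size p) => [|n [t [ut st ht]]]; first by exists [::].
  have [x [xt qx]] := nonroot_ex (t ++ s) q0.
  move: xt; rewrite mem_cat negb_or => /andP[xt xs].
  exists (x :: t); split=> /=; [by rewrite xt | by rewrite st|].
  move=> y; rewrite inE => /orP[/eqP->|]; last exact: ht.
  by apply: contrapT => /eqP h; apply: nex; exists x.
by apply: (@poly_many_roots A p t) => //; rewrite st.
Qed.

Lemma quadratic_root (b c : k) : exists y, y ^+ 2 + b * y + c = 0.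
Proof.
have [y] := @solve_monicpoly k 2%N (fun i => if i == 0%N then - c else - b) isT.
rewrite !big_ord_recl big_ord0 /= expr0 expr1 => h; exists y; rewrite h; ring.
Qed.
End ClosedField.

(** * Survival of nonzero elements and the chart principle *)

Section Detection.
Variable k : comNzRingType.
Implicit Types A B C : comAlgType k.

(** If each member of a unit relation had a power killing [e], a common exponent would do, and
    [unimodular_kill] would give [e = 0]. *)
Lemma unimodular_survive A (T : set A) (e : A) : unimodular T -> e <> 0 ->
  exists2 t, T t & forall n, t ^+ n * e <> 0.
Proof.
move=> [n [c [a [Ta ca]]]] e0; apply: contrapT => nex; apply: e0.
have h i : exists m, a i ^+ m * e = 0.
  apply: contrapT => nm; apply: nex; exists (a i) => // m em.
  by apply: nm; exists m.
have [m mP] : {m : 'I_n -> nat | forall i, a i ^+ m i * e = 0}.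
  by exists (fun i => projT1 (cid (h i))) => i; case: cid.
apply: (@unimodular_kill A (fun t => exists i, t = a i) (\max_i m i)%N).
  by exists n, c, a; split=> // i; exists i.
move=> _ [i ->]; rewrite -(subnK (leq_bigmax i : (m i <= _)%N)) exprD -mulrA.
by rewrite mP mulr0.
Qed.

Lemma local_detect A (T : set A) (e : A) : unimodular T -> e <> 0 ->
  exists t (L : comAlgType k) (iota : {lrmorphism A -> L}),
    [/\ T t, invertible (iota t) & iota e <> 0].
Proof.
move=> hT e0; have [t Tt ht] := unimodular_survive hT e0.
have [|L [iota [inv ker _ _]]] := @loc_ex k A t.
  by move=> n h; apply: (ht n); rewrite h mul0r.
by exists t, L, iota; split=> // /ker[n]; apply: ht.
Qed.
End Detection.

Section ChartPrinciple.
Variables (k : closedFieldType) (E : ellcurve k).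
Implicit Types A B C : comAlgType k.
Notation oncone A u := (wcubic (ellcurve_map (in_alg A) E) u = 0).

Definition base A (P : curve E k^o) : curve E A := fmap (curve E) (structure_map A) P.

(* cofinitely many points: all affine points with abscissa outside of a finite set *)
Definition generic (Q : curve E k^o -> Prop) : Prop :=
  exists S : seq k, forall (x y : k^o) (h : oncone k^o (vec3 x y 1)),
    (x : k) \notin S -> Q (aff h).

Lemma generic_and Q R : generic Q -> generic R -> generic (fun P => Q P /\ R P).
Proof.
move=> [S hS] [T hT]; exists (S ++ T) => x y h; rewrite mem_cat negb_or => /andP[xS xT].
by split; [apply: hS | apply: hT].
Qed.

Lemma generic_mono (Q R : curve E k^o -> Prop) : (forall P, Q P -> R P) -> generic Q -> generic R.
Proof. by move=> QR [S hS]; exists S => x y h xS; apply/QR/hS. Qed.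

Lemma ellcurve_ko : ellcurve_map (in_alg k^o) E = E.
Proof. by apply: ellcurve_eq; exact: mulr1. Qed.

Lemma oncone_ko (x y : k) : oncone k^o (vec3 (x : k^o) (y : k^o) 1) <->
  y ^+ 2 + ec_a1 E * x * y + ec_a3 E * y
  - (x ^+ 3 + ec_a2 E * x ^+ 2 + ec_a4 E * x + ec_a6 E) = 0.
Proof.
rewrite -waffE; have -> : wcubic E (vec3 x y 1) =
  wcubic (ellcurve_map (in_alg k^o) E) (vec3 (x : k^o) (y : k^o) 1) by rewrite ellcurve_ko.
by [].
Qed.

Lemma aff_ex (x : k) : exists y : k, oncone k^o (vec3 x y 1).
Proof.
have [y hy] := quadratic_root (ec_a1 E * x + ec_a3 E)
  (- (x ^+ 3 + ec_a2 E * x ^+ 2 + ec_a4 E * x + ec_a6 E)).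
by exists y; apply/oncone_ko; rewrite -[RHS]hy; ring.
Qed.

(** The discriminant of the equation seen as a quadratic in [y]; its roots are the abscissas of the
    points of order two. *)
Definition disc_poly : {poly k} :=
  (ec_a1 E *: 'X + (ec_a3 E)%:P) ^+ 2 +
  4%:R *: ('X^3 + ec_a2 E *: 'X^2 + ec_a4 E *: 'X + (ec_a6 E)%:P).

(** Vanishing of the coefficients means [4 = 0], [b2 = 0], [2 b4 = 0] and [b6 = 0], and then the
    discriminant of the curve is zero. This covers characteristic 2. *)
Lemma disc_poly_neq0 : disc_poly != 0.
Proof.
apply/negP => /eqP e; have [d] := ec_disc E; rewrite /discriminant.
have c i : disc_poly`_i = 0 by rewrite e coef0.
have c3 := c 3%N; have c2 := c 2%N; have c1 := c 1%N; have c0 := c 0%N.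
move: c3 c2 c1 c0; rewrite /disc_poly expr2 mulrDl !mulrDr.
rewrite -!scalerAl -!scalerAr -!polyCM -!mul_polyC !(coefD, coefCM, coefMC, coefXn, coefX, coefC, coefMX) /=.
set a1 := ec_a1 E; set a2 := ec_a2 E; set a3 := ec_a3 E; set a4 := ec_a4 E; set a6 := ec_a6 E.
move=> c3 c2 c1 c0.
have E4 : 4%:R = 0 :> k by rewrite -[RHS]c3; ring.
have b2 : a1 ^+ 2 + a2 *+ 4 = 0 by rewrite -[RHS]c2; ring.
have b4 : 2%:R * (a4 *+ 2 + a1 * a3) = 0 by rewrite -[RHS]c1; ring.
have b6 : a3 ^+ 2 + a6 *+ 4 = 0 by rewrite -[RHS]c0; ring.
rewrite b2 b6 (_ : (a4 *+ 2 + a1 * a3) ^+ 3 *+ 8 = 4%:R * (2%:R * (a4 *+ 2 + a1 * a3)) * (a4 *+ 2 + a1 * a3) ^+ 2); last by ring.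
rewrite E4 => h; suff : 1 = 0 :> k by move/eqP; rewrite oner_eq0.
by rewrite -h; ring.
Qed.

Lemma fmap_aff A B (phi : {lrmorphism A -> B}) x y (h : oncone A (vec3 x y 1)) x' y'
    (h' : oncone B (vec3 x' y' 1)) :
  phi x = x' -> phi y = y' -> fmap (curve E) phi (aff h) = aff h'.
Proof.
move=> ex ey; apply: point_aff; rewrite -ex -ey -(rmorph1 phi) -map_vec3.
by apply: fmap_in; exact: aff_in.
Qed.

Section Principle.
Variables (A : comAlgType k)
  (P : forall B : comAlgType k, {lrmorphism A -> B} -> curve E B -> Prop).
Hypothesis P_stable : forall B C (psi : {lrmorphism A -> B}) (phi : {lrmorphism B -> C})
  (chi : {lrmorphism A -> C}) Q, chi =1 phi \o psi -> P psi Q -> P chi (fmap (curve E) phi Q).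
Hypothesis P_detect : forall B (psi : {lrmorphism A -> B}) Q,
  (forall e : B, e <> 0 -> exists C (phi : {lrmorphism B -> C}) (chi : {lrmorphism A -> C}),
     [/\ chi =1 phi \o psi, phi e <> 0 & P chi (fmap (curve E) phi Q)]) -> P psi Q.
Hypothesis P_generic : forall iota : {lrmorphism A -> A}, iota =1 id ->
  generic (fun Q => P iota (base A Q)).

(** By stability it suffices to treat the universal affine point. A nonzero [e = r0(x) + r1(x) y] of
    its ring survives at a constant k-point: the abscissa avoids the exceptional set and the
    relevant roots, and one of the two ordinates over it then works. *)
Lemma chart_principle_aff B (psi : {lrmorphism A -> B}) x y (h : oncone B (vec3 x y 1)) :
  P psi (aff h).
Proof.
have [R [iota [X [Y [XY univ gen ind]]]]] := zchart E A.
have [f [f1 f2 f3]] := univ B psi x y h.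
rewrite -(fmap_aff XY h f2 f3); apply: P_stable f1 _.
apply: P_detect => e e0; have [r0 [r1 eE]] := gen e.
have idA : {i : {lrmorphism A -> A} | i =1 id} by exists [the {lrmorphism A -> A} of idfun].
case: idA => iA iA1; have [S hS] := P_generic iA1.
have point (x0 y0 : k) (h0 : oncone k^o (vec3 (x0 : k^o) (y0 : k^o) 1)) : x0 \notin S ->
    r0.[x0%:A] + r1.[x0%:A] * y0%:A <> 0 ->
    exists C (phi : {lrmorphism R -> C}) (chi : {lrmorphism A -> C}),
     [/\ chi =1 phi \o iota, phi e <> 0 & P chi (fmap (curve E) phi (aff XY))].
  move=> x0S nz; have hA : oncone A (vec3 x0%:A y0%:A 1).
    have := oncone_map (structure_map A) h0.
    by rewrite map_vec3 rmorph1.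
  have [g [g1 g2 g3]] := univ A iA _ _ hA.
  exists A, g, iA; split=> //.
    rewrite eE rmorphD rmorphM /= -!horner_map -!map_poly_comp /= g2 g3.
    rewrite !map_poly_id //; move=> a _; have /= <- := g1 a; exact: iA1.
  rewrite (fmap_aff XY hA g2 g3) -(fmap_aff (phi := structure_map A) h0) //.
  exact: hS.
have [r10|r10] := eqVneq r1 0; last first.
  have [x0 [x0S dx rx]] := poly_nonroot S r10 disc_poly_neq0.
  have [y0 h0] := aff_ex x0.
  have [z|/eqP nz] := eqVneq (r0.[x0%:A] + r1.[x0%:A] * y0%:A) 0; last exact: (point _ _ h0).
  (* The conjugate ordinate: [e] cannot vanish at both points over [x0], as [r1] and the difference
     of the ordinates are nonzero there. *)
  pose y1 := - y0 - ec_a1 E * x0 - ec_a3 E.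
  have h1 : oncone k^o (vec3 (x0 : k^o) (y1 : k^o) 1).
    by apply/oncone_ko; move/oncone_ko: h0 => h0; rewrite -h0 /y1; ring.
  apply: (point _ _ h1) => // z1.
  move/eqP: rx; apply; apply: (@scale_inj _ _ (y0 - y1)).
    apply: contraNneq dx => y01; rewrite /disc_poly.
    rewrite !(hornerD, hornerZ, hornerXn, hornerX, hornerC, horner_exp).
    have e1 : ec_a1 E * x0 + ec_a3 E = - y0 *+ 2.
      by apply/eqP; rewrite -subr_eq0; apply/eqP; rewrite -[RHS]y01 /y1; ring.
    rewrite e1; apply/eqP; transitivity (4%:R * (y0 ^+ 2 - (y0 *+ 2 + ec_a1 E * x0 + ec_a3 E) * y0 + (x0 ^+ 3 + ec_a2 E * x0 ^+ 2 + ec_a4 E * x0 + ec_a6 E))).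
      by rewrite -[y0 *+ 2 + _ + _]addrA e1; ring.
    apply/eqP; rewrite mulf_eq0; apply/orP; right; rewrite -oppr_eq0; apply/eqP.
    by move/oncone_ko: h0 => h0; rewrite -[RHS]h0; ring.
  by rewrite scalerBl mulrBl [_ * r1.[_]]mulrC [y1%:A * _]mulrC; apply/eqP; rewrite subr_eq0; apply/eqP;
    apply: (addrI r0.[x0%:A]); rewrite z z1.
have r00 : r0 != 0.
  by apply/eqP => r00; apply: e0; rewrite eE r10 r00 !map_poly0 !horner0 mul0r addr0.
have [x0 [x0S dx rx]] := poly_nonroot S r00 disc_poly_neq0.
have [y0 h0] := aff_ex x0; apply: (point _ _ h0) => //.
by rewrite r10 horner0 mul0r addr0; apply/eqP.
Qed.

(** Points with [Y] invertible reduce to affine ones after inverting [z], which is regular in the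
    universal chart. A general [Q] is first localized at its coordinates [Y] and [Z]. *)
Theorem chart_principle B (psi : {lrmorphism A -> B}) Q : P psi Q.
Proof.
have affP C (chi : {lrmorphism A -> C}) (Q' : curve E C) u : sval Q' u ->
    invertible (u 0 ord_max) -> P chi Q'.
  move=> Qu [v uv]; have Qv := point_scale v Qu.
  rewrite [u]vec3_eta scale_vec3 [v * u 0 ord_max]mulrC uv in Qv.
  by rewrite (point_aff (point_oncone Qv) Qv); apply: chart_principle_aff.
have yP C (chi : {lrmorphism A -> C}) (Q' : curve E C) u : sval Q' u ->
    invertible (u 0 1) -> P chi Q'.
  move=> Qu [v uv]; have Qv := point_scale v Qu.
  rewrite [u]vec3_eta scale_vec3 [v * u 0 1]mulrC uv in Qv.
  have [R [iota [X [Z [XZ univ reg]]]]] := ychart E A.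
  have hX : primitive (vec3 X 1 Z).
    by apply: (@unit_primitive _ _ 1); rewrite vec3E; exists 1; rewrite mulr1.
  have [f [f1 f2 f3]] := univ C chi _ _ (point_oncone Qv).
  have -> : Q' = fmap (curve E) f (point_ray hX XZ).
    apply: point_eq_in Qv _ _; last first.
      by apply: (@unit_primitive _ _ 1); rewrite vec3E; exists 1; rewrite mulr1.
    have := @fmap_in _ E _ _ f (point_ray hX XZ) (vec3 X 1 Z).
    rewrite map_vec3 rmorph1 /= f2 f3; apply.
    by exists 1; rewrite scale1r.
  apply: P_stable f1 _; apply: P_detect => e e0.
  have ne n : Z ^+ n * e <> 0.
    by elim: n => [|n IH]; rewrite ?expr0 ?mul1r // exprS -mulrA => /reg.
  have [|L [i [inv ker _ _]]] := @loc_ex k R Z.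
    by move=> n h; apply: (ne n); rewrite h mul0r.
  exists L, i, (i \o iota); split=> //.
    by move=> /ker[n]; apply: ne.
  apply: (affP _ _ _ (map_mx i (vec3 X 1 Z))).
    by apply: fmap_in; exists 1; rewrite scale1r.
  by rewrite map_vec3 vec3E.
apply: P_detect => e e0.
(* Where [Y] and [Z] both vanish, the cubic leaves [X ^+ 3 = 0]; so these two coordinates alone
   generate the unit ideal. *)
have uT : unimodular (fun t : B => exists2 u, sval Q u & t = u 0 1 \/ t = u 0 ord_max).
  have [_ _ _ hu] := point_line Q.
  apply: contrapT => /max_quot[K [pi [fK kill]]].
  have hu' := unimodular_map pi hu.
  suff z : forall t, (pi @` (fun a => exists2 u, sval Q u & exists i, a = u 0 i))%classic t -> t = 0.
    case: hu' => n [c [a [Ta]]]; rewrite big1 => [/esym/eqP|i _]; first by rewrite oner_eq0.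
    by rewrite (z _ (Ta i)) mulr0.
  move=> _ [_ [u Qu [i ->]] <-].
  have u1 : pi (u 0 1) = 0 by apply: kill; exists u => //; left.
  have u2 : pi (u 0 ord_max) = 0 by apply: kill; exists u => //; right.
  have [->|->|->] := ord3P i => //.
  apply: contrapT => /fK[v uv].
  have := oncone_map pi (point_oncone Qu); rewrite /wcubic !mxE u1 u2 => h.
  have h3 : pi (u 0 0) ^+ 3 = 0 by apply/oppr_inj; rewrite oppr0 -[RHS]h; ring.
  have : 1 = 0 :> K by rewrite -(expr1n _ 3) -uv exprMn h3 mul0r.
  by move/eqP; rewrite oner_eq0.
have [t [L [i [[u Qu tu] inv ie]]]] := local_detect uT e0.
exists L, i, (i \o psi); split=> //.
have Qi := fmap_in i Qu.
case: tu => tu; rewrite tu in inv.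
  by apply: (yP _ _ _ _ Qi); rewrite mxE.
by apply: (affP _ _ _ _ Qi); rewrite mxE.
Qed.
End Principle.
End ChartPrinciple.

(** * Bihomogeneous laws and the morphisms they define *)

Section PairFunctor.
Variables (k : comNzRingType) (F G : kfunctor k).
Definition pair_fmap (A B : comAlgType k) (phi : {lrmorphism A -> B})
  (x : F A * G A) : F B * G B := (fmap F phi x.1, fmap G phi x.2).
Lemma pair_fmap_id (A : comAlgType k) (phi : {lrmorphism A -> A}) :
  phi =1 id -> pair_fmap phi =1 id.
Proof. by move=> h [x y]; rewrite /pair_fmap /= !fmap_id. Qed.
Lemma pair_fmap_comp (A B C : comAlgType k) (phi : {lrmorphism A -> B})
    (psi : {lrmorphism B -> C}) (chi : {lrmorphism A -> C}) :
  chi =1 psi \o phi -> pair_fmap chi =1 pair_fmap psi \o pair_fmap phi.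
Proof. by move=> e [x y]; rewrite /pair_fmap /= !(fmap_comp e). Qed.
Definition pairf : kfunctor k := KFunctor pair_fmap_id pair_fmap_comp.
End PairFunctor.

Section Laws.
Variable k : comNzRingType.
Implicit Types A B C : comAlgType k.

(** Bihomogeneity makes vanishing independent of the vectors chosen on two lines, up to powers of
    their coordinates; naturality allows base change. *)
Record slaw2 := SLaw2 {
  sfun :> forall A, 'rV[A]_3 -> 'rV[A]_3 -> A;
  sdeg1 : nat; sdeg2 : nat;
  snat : forall A B (f : {lrmorphism A -> B}) u v,
    f (sfun u v) = sfun (map_mx f u) (map_mx f v);
  shom : forall A (c d : A) u v,
    sfun (c *: u) (d *: v) = c ^+ sdeg1 * d ^+ sdeg2 * sfun u v }.

Record law2 := Law2 {
  lfun :> forall A, 'rV[A]_3 -> 'rV[A]_3 -> 'rV[A]_3;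
  ldeg1 : nat; ldeg2 : nat;
  lnat : forall A B (f : {lrmorphism A -> B}) u v,
    map_mx f (lfun u v) = lfun (map_mx f u) (map_mx f v);
  lhom : forall A (c d : A) u v,
    lfun (c *: u) (d *: v) = (c ^+ ldeg1 * d ^+ ldeg2) *: lfun u v }.

Program Definition lfst : law2 := @Law2 (fun A u v => u) 1 0 _ _.
Next Obligation. by rewrite expr1 expr0 mulr1. Qed.
Program Definition lsnd : law2 := @Law2 (fun A u v => v) 0 1 _ _.
Next Obligation. by rewrite expr1 expr0 mul1r. Qed.
Program Definition lcst (a : 'rV[k]_3) : law2 :=
  @Law2 (fun A u v => map_mx (in_alg A) a) 0 0 _ _.
Next Obligation. by apply/rowP => i; rewrite !mxE /= lrmorph_alg. Qed.
Next Obligation. by rewrite !expr0 mulr1 scale1r. Qed.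
Program Definition lcomp (G f g : law2) : law2 :=
  @Law2 (fun A u v => G A (f A u v) (g A u v))
   (ldeg1 f * ldeg1 G + ldeg1 g * ldeg2 G) (ldeg2 f * ldeg1 G + ldeg2 g * ldeg2 G) _ _.
Next Obligation. by rewrite !lnat. Qed.
Next Obligation. by rewrite !lhom; congr (_ *: _); rewrite !exprD !exprM !exprMn; ring. Qed.
Program Definition lminor (f g : law2) (i j : 'I_3) : slaw2 :=
  @SLaw2 (fun A u v => f A u v 0 i * g A u v 0 j - f A u v 0 j * g A u v 0 i)
   (ldeg1 f + ldeg1 g) (ldeg2 f + ldeg2 g) _ _.
Next Obligation. by rewrite rmorphB !rmorphM /= -!lnat !mxE. Qed.
Next Obligation. by rewrite !lhom !mxE !exprD; ring. Qed.
Program Definition lcubic (E : ellcurve k) (f : law2) : slaw2 :=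
  @SLaw2 (fun A u v => wcubic (ellcurve_map (in_alg A) E) (f A u v))
   (ldeg1 f * 3) (ldeg2 f * 3) _ _.
Next Obligation. by rewrite -wcubic_map -ellcurve_map_alg lnat. Qed.
Next Obligation. by rewrite !lhom wcubic_scale exprMn !exprM. Qed.

Lemma line_kill A (L : set 'rV[A]_3) (m : nat) (x : A) : is_line L ->
  (forall u i, L u -> u 0 i ^+ m * x = 0) -> x = 0.
Proof.
move=> [_ _ _ hu] h; apply: (@unimodular_kill _ _ m x hu) => _ [u Lu [i ->]].
exact: h.
Qed.

Lemma line_scale A (L : set 'rV[A]_3) u l i : is_line L -> L u -> L l ->
  l 0 i *: u = u 0 i *: l.
Proof.
move=> [_ _ Lm _] Lu Ll; apply/rowP => j; rewrite !mxE.
by rewrite (Lm l u Ll Lu i j) mulrC.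
Qed.
End Laws.

Section Vanishing.
Variables (k : closedFieldType) (E1 E2 : ellcurve k).
Implicit Types A B C : comAlgType k.

Definition generic2 (Q : curve E1 k^o -> curve E2 k^o -> Prop) : Prop :=
  generic (fun q => generic (fun p => Q p q)).

Section Principle2.
Variable P : forall A, curve E1 A -> curve E2 A -> Prop.
Hypothesis P_stable : forall A B (f : {lrmorphism A -> B}) p q,
  P p q -> P (fmap (curve E1) f p) (fmap (curve E2) f q).
Hypothesis P_detect : forall A (p : curve E1 A) (q : curve E2 A),
  (forall e : A, e <> 0 -> exists B (f : {lrmorphism A -> B}),
     f e <> 0 /\ P (fmap (curve E1) f p) (fmap (curve E2) f q)) -> P p q.
Hypothesis P_generic : generic2 (fun p q => P p q).

(** The chart principle is applied twice: over [A] with [p] fixed, to make [q] a constant point,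
    then over k with that constant point fixed. *)
Theorem chart_principle2 A (p : curve E1 A) (q : curve E2 A) : P p q.
Proof.
pose idA (B : comAlgType k) : {lrmorphism B -> B} := [the {lrmorphism B -> B} of idfun].
suff h B (psi : {lrmorphism A -> B}) (r : curve E2 B) : P (fmap (curve E1) psi p) r.
  by have := h A (idA A) q; rewrite fmap_id.
apply: (@chart_principle k E2 A (fun B psi r => P (fmap (curve E1) psi p) r)).
- move=> B' C psi' phi chi Q e; rewrite (fmap_comp e) /=; exact: P_stable.
- move=> B' psi' Q h; apply: P_detect => e /h[C [phi [chi [e1 e2 e3]]]].
  by exists C, phi; split=> //; move: e3; rewrite (fmap_comp e1).
move=> iota iota1; apply: generic_mono P_generic => s hs.
rewrite (fmap_id iota1) /base.
suff h' B' (psi' : {lrmorphism k^o -> B'}) (r' : curve E1 B') :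
    P r' (fmap (curve E2) psi' s).
  exact: h'.
apply: (@chart_principle k E1 k^o (fun B psi r => P r (fmap (curve E2) psi s))).
- move=> B1 C psi1 phi chi Q e; rewrite (fmap_comp e) /=; exact: P_stable.
- move=> B1 psi1 Q h1; apply: P_detect => e /h1[C [phi [chi [e1 e2 e3]]]].
  by exists C, phi; split=> //; move: e3; rewrite (fmap_comp e1).
move=> iota' iota1'; apply: generic_mono hs => t ht.
rewrite (fmap_id iota1') /base fmap_id // => a.
by rewrite /= /str_map; exact: mulr1.
Qed.
End Principle2.

(** A vector of the line of [fmap] need not be the image of a vector, but its product with a
    coordinate of such an image is a multiple of that image, and these coordinates generate the unit
    ideal. *)
Lemma slaw2_spread (c : slaw2 k) A B (f : {lrmorphism A -> B})
    (p : curve E1 A) (q : curve E2 A) :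
  (forall u v, sval p u -> sval q v -> c A u v = 0) ->
  forall u v, sval (fmap (curve E1) f p) u -> sval (fmap (curve E2) f q) v -> c B u v = 0.
Proof.
move=> h u v pu qv.
have hl l i : sval p l -> f (l 0 i) *: u = u 0 i *: map_mx f l.
  by move=> pl; have := line_scale i (point_line _) pu (fmap_in f pl); rewrite mxE.
have hm l i : sval q l -> f (l 0 i) *: v = v 0 i *: map_mx f l.
  by move=> ql; have := line_scale i (point_line _) qv (fmap_in f ql); rewrite mxE.
have uM (D : nat) (x : B) (L : set 'rV[A]_3) : is_line L ->
    (forall l i, L l -> f (l 0 i) ^+ D * x = 0) -> x = 0.
  move=> [_ _ _ hu] hx; apply: (@unimodular_kill _ _ D x (unimodular_map f hu)).
  by move=> _ [_ [l Ll [i ->]] <-]; exact: hx.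
apply: (uM (sdeg1 c) _ _ (point_line p)) => l i pl.
apply: (uM (sdeg2 c) _ _ (point_line q)) => m j qm.
rewrite mulrA [X in X * _]mulrC -shom hl // hm // shom -snat h //.
by rewrite rmorph0 mulr0.
Qed.

Theorem slaw2_zero (c : slaw2 k) :
  generic2 (fun p q => forall u v : 'rV[k^o]_3, sval p u -> sval q v -> c k^o u v = 0) ->
  forall A (p : curve E1 A) (q : curve E2 A) u v, sval p u -> sval q v -> c A u v = 0.
Proof.
move=> h A p q.
apply: (@chart_principle2 (fun A p q => forall u v, sval p u -> sval q v -> c A u v = 0)) => //.
- by move=> B C f p' q'; apply: slaw2_spread.
- move=> B p' q' hd u v pu qv; apply: contrapT => /hd[C [f [fe hf]]].
  by apply: fe; rewrite snat; apply: hf; apply: fmap_in.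
Qed.
End Vanishing.

Section Span.
Variables (A : comNzRingType) (V : set 'rV[A]_3).
Definition rspan : set 'rV[A]_3 := fun v =>
  exists n (c : 'I_n -> A) (l : 'I_n -> 'rV[A]_3), (forall i, V (l i)) /\ v = \sum_i c i *: l i.

Lemma rspan_in u : V u -> rspan u.
Proof.
by move=> Vu; exists 1%N, (fun=> 1), (fun=> u); split=> //; rewrite big_ord1 scale1r.
Qed.

Lemma rspan_line : (forall u v, V u -> V v -> par u v) ->
  unimodular (fun a => exists2 u, V u & exists i, a = u 0 i) -> is_line rspan.
Proof.
move=> Vpar hu; split.
- by exists 0%N, (fun=> 0), (fun=> 0); split=> [[]//|]; rewrite big_ord0.
- move=> a u v [n [c [l [Vl ->]]]] [m [d [h [Vh ->]]]].
  exists (n + m)%N,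
    (fun i => match split i with inl j => a * c j | inr j => d j end),
    (fun i => match split i with inl j => l j | inr j => h j end).
  split; first by move=> i; case: split.
  rewrite big_split_ord scaler_sumr; congr (_ + _); apply: eq_bigr => i _.
    by rewrite (unsplitK (inl i)) scalerA.
  by rewrite (unsplitK (inr i)).
- move=> _ _ [n [c [l [Vl ->]]]] [m [d [h [Vh ->]]]] i j.
  rewrite !summxE !mulr_suml; apply: eq_bigr => s _.
  rewrite !mulr_sumr; apply: eq_bigr => t _; rewrite !mxE.
  by rewrite mulrACA [RHS]mulrACA; congr (_ * _); apply: Vpar.
- by apply: unimodularS hu => a [u Vu hi]; exists u => //; apply: rspan_in.
Qed.

Lemma rspan_cubic (E : ellcurve A) : (forall u v, V u -> V v -> par u v) ->
  unimodular (fun a => exists2 u, V u & exists i, a = u 0 i) ->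
  (forall u, V u -> wcubic E u = 0) -> forall u, rspan u -> wcubic E u = 0.
Proof.
move=> Vpar hu Vw u su; have [_ _ hm _] := rspan_line Vpar hu.
apply: (@unimodular_kill _ _ 3 _ hu) => _ [l Vl [i ->]].
rewrite -wcubic_scale; have -> : l 0 i *: u = u 0 i *: l.
  by apply/rowP => j; rewrite !mxE (hm l u (rspan_in Vl) su i j) mulrC.
by rewrite wcubic_scale Vw // mulr0.
Qed.
End Span.

Lemma line_incl (A : comNzRingType) (L M : set 'rV[A]_3) :
  is_line L -> is_line M -> (forall u, L u -> M u) -> L = M.
Proof.
move=> hL hM LM; apply: line_eq => // u v /LM Mu Mv i j.
by case: hM => _ _ h _; apply: h.
Qed.

Lemma field_point_nz (k : comNzRingType) (E : ellcurve k) (A K : comAlgType k)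
   (f : {lrmorphism A -> K}) (P : curve E A) : exists u, sval P u /\ map_mx f u <> 0.
Proof.
apply: contrapT => nex; have [_ _ _ hu] := point_line P.
have /eqP : (1 : K) = 0; last by rewrite oner_eq0.
apply: (@unimodular_kill _ _ 1 1 (unimodular_map f hu)).
move=> _ [_ [u Pu [i ->]] <-]; rewrite mulr1 expr1.
apply: contrapT => fu; apply: nex; exists u; split=> // fu0; apply: fu.
by have := congr1 (fun w : 'rV_3 => w 0 i) fu0; rewrite !mxE.
Qed.

Section System.
Variables (k : closedFieldType) (E1 E2 E' : ellcurve k) (I : Type) (G : I -> law2 k).
Implicit Types A B C K : comAlgType k.
Hypothesis G_par : forall i j, generic2 (fun (p : curve E1 k^o) (q : curve E2 k^o) =>
  forall u v, sval p u -> sval q v -> par (G i k^o u v) (G j k^o u v)).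
Hypothesis G_cubic : forall i, generic2 (fun (p : curve E1 k^o) (q : curve E2 k^o) =>
  forall u v, sval p u -> sval q v ->
    wcubic (ellcurve_map (in_alg k^o) E') (G i k^o u v) = 0).
Hypothesis G_full : forall K, is_field K -> forall (p : curve E1 K) (q : curve E2 K) u v,
  sval p u -> sval q v -> u <> 0 -> v <> 0 -> exists i, G i K u v <> 0.

Let V A (p : curve E1 A) (q : curve E2 A) : set 'rV[A]_3 := fun w =>
  exists i u v, [/\ sval p u, sval q v & w = G i A u v].

Let V_par A (p : curve E1 A) (q : curve E2 A) w w' : V p q w -> V p q w' -> par w w'.
Proof.
move=> [i [u [v [pu qv ->]]]] [j [u' [v' [pu' qv' ->]]]] a b; apply/subr0_eq.
(* Multiplying by suitable powers of coordinates moves all four vectors onto one vector [l] of [p]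
   and one vector [m] of [q], where the minor vanishes. *)
apply: (line_kill (m := ldeg1 (G i) + ldeg1 (G j)) (point_line p)) => l s pl.
apply: (line_kill (m := ldeg2 (G i) + ldeg2 (G j)) (point_line q)) => m t qm.
have z : lminor (G i) (G j) a b A l m = 0.
  apply: (@slaw2_zero k E1 E2 (lminor (G i) (G j) a b) _ A p q) => //.
  apply: generic_mono (G_par i j) => q0; apply: generic_mono => p0 h u0 v0 hu0 hv0 /=.
  by apply/eqP; rewrite subr_eq0; apply/eqP; apply: h.
transitivity (G i A (l 0 s *: u) (m 0 t *: v) 0 a * G j A (l 0 s *: u') (m 0 t *: v') 0 b
   - G i A (l 0 s *: u) (m 0 t *: v) 0 b * G j A (l 0 s *: u') (m 0 t *: v') 0 a).
  by rewrite !lhom !mxE !exprD; ring.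
rewrite !(line_scale s (point_line p) _ pl) // !(line_scale t (point_line q) _ qm) //.
rewrite !lhom !mxE.
transitivity (u 0 s ^+ ldeg1 (G i) * v 0 t ^+ ldeg2 (G i) * (u' 0 s ^+ ldeg1 (G j) * v' 0 t ^+ ldeg2 (G j)) * lminor (G i) (G j) a b A l m).
  by rewrite /=; ring.
by rewrite z mulr0.
Qed.

Let V_cubic A (p : curve E1 A) (q : curve E2 A) w : V p q w ->
  wcubic (ellcurve_map (in_alg A) E') w = 0.
Proof.
move=> [i [u [v [pu qv ->]]]].
apply: (@slaw2_zero k E1 E2 (lcubic E' (G i)) _ A p q) => //.
by apply: generic_mono (G_cubic i) => q0; apply: generic_mono => p0 h u0 v0 hu0 hv0 /=; apply: h.
Qed.

Let V_full A (p : curve E1 A) (q : curve E2 A) :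
  unimodular (fun a => exists2 u, V p q u & exists i, a = u 0 i).
Proof.
apply: contrapT => /max_quot[K [f [fK kill]]].
have [u [pu nu]] := field_point_nz f p; have [v [qv nv]] := field_point_nz f q.
have [i nz] := G_full fK (fmap_in f pu) (fmap_in f qv) nu nv.
apply: nz; rewrite -lnat; apply/rowP => j; rewrite !mxE; apply: kill.
by exists (G i A u v); [exists i, u, v | exists j].
Qed.

Let sys_obj A (x : curve E1 A * curve E2 A) : curve E' A :=
  exist _ (rspan (V x.1 x.2)) (conj
    (rspan_line (@V_par A x.1 x.2) (@V_full A x.1 x.2))
    (rspan_cubic (@V_par A x.1 x.2) (@V_full A x.1 x.2) (@V_cubic A x.1 x.2))).

Let sys_nat A B (f : {lrmorphism A -> B}) (x : pairf (curve E1) (curve E2) A) :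
  sys_obj (fmap (pairf (curve E1) (curve E2)) f x) = fmap (curve E') f (sys_obj x).
Proof.
apply/esym/point_eq; apply: line_incl; [exact: point_line|exact: point_line|].
have [S0 SD _ _] := point_line (sys_obj (fmap (pairf (curve E1) (curve E2)) f x)).
move=> _ [n [c [l [Vl ->]]]]; apply: submod_sum => // i.
have [m [d [h [Vh ->]]]] := Vl i.
rewrite raddf_sum; rewrite (eq_bigr (fun j => f (d j) *: map_mx f (h j))); last first.
  by move=> j _; rewrite -map_mxZ.
apply: submod_sum => // j; apply: rspan_in.
have [a [u [v [pu qv ->]]]] := Vh j; rewrite lnat.
by exists a, (map_mx f u), (map_mx f v); split=> //; apply: fmap_in.
Qed.

(** The image of [(p, q)] is the span of all values [G i A u v]. Generic proportionality and
    membership propagate to all points by [slaw2_zero], applied to minors and to the cubic; the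
    absence of a common zero over fields makes the span a summand of rank one. *)
Theorem law_system : exists Phi : nattrans (pairf (curve E1) (curve E2)) (curve E'),
  forall A (p : curve E1 A) (q : curve E2 A) u v i, sval p u -> sval q v ->
    sval (Phi A (p, q)) (G i A u v).
Proof.
exists (NatTrans sys_nat) => A p q u v i pu qv.
by apply: rspan_in; exists i, u, v.
Qed.
End System.

(** * The group law *)

Section Chord.
Variable R : comNzRingType.
Implicit Types (E : ellcurve R) (u v : 'rV[R]_3).

Definition dwX E u := ec_a1 E * u 0 1 * u 0 ord_max - 3 * u 0 0 ^+ 2
  - 2 * ec_a2 E * u 0 0 * u 0 ord_max - ec_a4 E * u 0 ord_max ^+ 2.
Definition dwY E u := 2 * u 0 1 * u 0 ord_max + ec_a1 E * u 0 0 * u 0 ord_max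
  + ec_a3 E * u 0 ord_max ^+ 2.
Definition dwZ E u := u 0 1 ^+ 2 + ec_a1 E * u 0 0 * u 0 1 + 2 * ec_a3 E * u 0 1 * u 0 ord_max
  - ec_a2 E * u 0 0 ^+ 2 - 2 * ec_a4 E * u 0 0 * u 0 ord_max - 3 * ec_a6 E * u 0 ord_max ^+ 2.
Definition dw E u v := dwX E u * v 0 0 + dwY E u * v 0 1 + dwZ E u * v 0 ord_max.

(* The third intersection point of the cubic with the line through [u] and [v]. *)
Definition chord E u v := dw E v u *: u - dw E u v *: v.

Definition negv E u := vec3 (u 0 0)
  (- u 0 1 - ec_a1 E * u 0 0 - ec_a3 E * u 0 ord_max) (u 0 ord_max).

Lemma wcubic_comb E s t u v : wcubic E (s *: u + t *: v) =
  s ^+ 3 * wcubic E u + s ^+ 2 * t * dw E u v + s * t ^+ 2 * dw E v u + t ^+ 3 * wcubic E v.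
Proof. by rewrite /wcubic /dw /dwX /dwY /dwZ !mxE; ring. Qed.

Lemma dw_comb E s t s' t' u v : dw E (s *: u + t *: v) (s' *: u + t' *: v) =
  s ^+ 2 * s' * (3 * wcubic E u) + (2 * s * t * s' + s ^+ 2 * t') * dw E u v
  + (t ^+ 2 * s' + 2 * s * t * t') * dw E v u + t ^+ 2 * t' * (3 * wcubic E v).
Proof. by rewrite /wcubic /dw /dwX /dwY /dwZ !mxE; ring. Qed.

Lemma dw_scale E s t u v : dw E (s *: u) (t *: v) = s ^+ 2 * t * dw E u v.
Proof. by rewrite /dw /dwX /dwY /dwZ !mxE; ring. Qed.

Lemma dw_diag E u : dw E u u = 3 * wcubic E u.
Proof. by rewrite /wcubic /dw /dwX /dwY /dwZ; ring. Qed.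

Lemma chord_scale E s t u v : chord E (s *: u) (t *: v) = (s ^+ 2 * t ^+ 2) *: chord E u v.
Proof.
rewrite /chord !dw_scale scalerBr !scalerA; congr (_ *: _ - _ *: _); ring.
Qed.

Lemma chordC E u v : chord E u v = - chord E v u.
Proof. by rewrite /chord opprB. Qed.

Lemma wcubic_chord E u v : wcubic E u = 0 -> wcubic E v = 0 -> wcubic E (chord E u v) = 0.
Proof.
move=> hu hv; rewrite /chord -scaleNr wcubic_comb hu hv; ring.
Qed.

(** The line through the third point and [v] meets the curve again in [u]; the cubed factor is zero
    only when the line is tangent at [v]. *)
Lemma chordK E u v : wcubic E u = 0 -> wcubic E v = 0 ->
  chord E (chord E u v) v = dw E v u ^+ 3 *: u.
Proof.
move=> hu hv; rewrite {1}/chord.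
have -> : chord E u v = dw E v u *: u + (- dw E u v) *: v by rewrite scaleNr.
have e1 : dw E v (dw E v u *: u + - dw E u v *: v) = dw E v u ^+ 2.
  have := dw_comb E 0 1 (dw E v u) (- dw E u v) u v.
  by rewrite !scale0r !scale1r !add0r hu hv => ->; ring.
have e2 : dw E (dw E v u *: u + - dw E u v *: v) v = - dw E u v * dw E v u ^+ 2.
  have := dw_comb E (dw E v u) (- dw E u v) 0 1 u v.
  by rewrite !scale0r !scale1r !add0r hu hv => ->; ring.
rewrite e1 e2 scalerDr !scalerA -addrA -scalerBl (_ : _ - _ = 0) ?scale0r ?addr0; last by ring.
by congr (_ *: _); ring.
Qed.

Lemma negv_scale E c u : negv E (c *: u) = c *: negv E u.
Proof. by apply: row3P; rewrite !mxE /=; ring. Qed.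
Lemma negvK E u : negv E (negv E u) = u.
Proof. by apply: row3P; rewrite !mxE /=; ring. Qed.
Lemma wcubic_negv E u : wcubic E (negv E u) = wcubic E u.
Proof. by rewrite /wcubic /negv !vec3E; ring. Qed.
Lemma dw_negv E u v : dw E (negv E u) (negv E v) = dw E u v.
Proof. by rewrite /dw /dwX /dwY /dwZ /negv !vec3E; ring. Qed.
Lemma negvD E u v : negv E (u + v) = negv E u + negv E v.
Proof. by apply: row3P; rewrite !mxE /=; ring. Qed.
Lemma chord_negv E u v : chord E (negv E u) (negv E v) = negv E (chord E u v).
Proof. by rewrite /chord !dw_negv negvD -!scaleNr !negv_scale. Qed.
Lemma negv_par E u v : par u v -> par (negv E u) (negv E v).
Proof.
move=> h; have h01 := h 0 1; have h0m := h 0 ord_max; have h1m := h 1 ord_max.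
have e01 : negv E u 0 0 * negv E v 0 1 = negv E u 0 1 * negv E v 0 0.
  rewrite /negv !vec3E; apply/subr0_eq.
  transitivity (- (u 0 0 * v 0 1 - u 0 1 * v 0 0) - ec_a3 E * (u 0 0 * v 0 ord_max - u 0 ord_max * v 0 0)).
    ring.
  by rewrite h01 h0m; ring.
have e0m : negv E u 0 0 * negv E v 0 ord_max = negv E u 0 ord_max * negv E v 0 0.
  by rewrite /negv !vec3E h0m.
have e1m : negv E u 0 1 * negv E v 0 ord_max = negv E u 0 ord_max * negv E v 0 1.
  rewrite /negv !vec3E; apply/subr0_eq.
  transitivity (- (u 0 1 * v 0 ord_max - u 0 ord_max * v 0 1) - ec_a1 E * (u 0 0 * v 0 ord_max - u 0 ord_max * v 0 0)).
    ring.
  by rewrite h1m h0m; ring.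
by move=> i j; have [->|->|->] := ord3P i; have [->|->|->] := ord3P j => //;
  rewrite ?e01 ?e0m ?e1m.
Qed.

(** The right side belongs to the equation translated so that the point with coordinates [x] and [y]
    becomes the origin. Up to sign its last three coefficients are the two affine partial
    derivatives and the cubic, evaluated at that point. *)
Lemma discriminant_shift (a1 a2 a3 a4 a6 x y : R) :
  discriminant a1 a2 a3 a4 a6 =
  discriminant a1 (a2 + 3 * x) (a3 + a1 * x + 2 * y) (a4 + 2 * x * a2 - y * a1 + 3 * x ^+ 2)
   (- (y ^+ 2 + a1 * x * y + a3 * y - (x ^+ 3 + a2 * x ^+ 2 + a4 * x + a6))).
Proof. by rewrite /discriminant; ring. Qed.

Lemma discriminant_sing (a1 a2 : R) : discriminant a1 a2 0 0 0 = 0.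
Proof. by rewrite /discriminant; ring. Qed.
End Chord.

Lemma map_negv (A B : comNzRingType) (f : {rmorphism A -> B}) (E : ellcurve A) u :
  map_mx f (negv E u) = negv (ellcurve_map f E) (map_mx f u).
Proof.
rewrite /negv map_vec3 !mxE; congr vec3.
by rewrite !(rmorphB, rmorphN, rmorphM).
Qed.

Lemma map_dw (A B : comNzRingType) (f : {rmorphism A -> B}) (E : ellcurve A) u v :
  f (dw E u v) = dw (ellcurve_map f E) (map_mx f u) (map_mx f v).
Proof.
rewrite /dw /dwX /dwY /dwZ !mxE /=.
rewrite !(rmorphD, rmorphB, rmorphN, rmorphM, rmorphXn, rmorph_nat, rmorph1); ring.
Qed.

Lemma map_chord (A B : comNzRingType) (f : {rmorphism A -> B}) (E : ellcurve A) u v :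
  map_mx f (chord E u v) = chord (ellcurve_map f E) (map_mx f u) (map_mx f v).
Proof. by rewrite /chord raddfB /= !map_mxZ !map_dw. Qed.

Section FieldGeometry.
Variables (K : comNzRingType) (fK : is_field K) (E : ellcurve K).
Implicit Types u v a : 'rV[K]_3.

Lemma fmul0 (a b : K) : a * b = 0 -> a = 0 \/ b = 0.
Proof.
move=> h; have [->|a0] := pselect (a = 0); [by left|right].
by have [c ac] := fK a0; rewrite -[b]mul1r -ac mulrAC h mul0r.
Qed.
Lemma fexp0 (a : K) n : a ^+ n = 0 -> a = 0.
Proof.
elim: n => [|n IH]; first by rewrite expr0 => /eqP; rewrite oner_eq0.
by rewrite exprS => /fmul0[|/IH].
Qed.

Lemma npar_ex u v : ~ par u v -> exists i j, u 0 i * v 0 j - u 0 j * v 0 i <> 0.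
Proof.
move=> h; apply: contrapT => nex; apply: h => i j; apply: contrapT => hij.
by apply: nex; exists i, j => /subr0_eq.
Qed.

Lemma npar_comb u v s t : ~ par u v -> s *: u = t *: v -> s = 0 /\ t = 0.
Proof.
move=> /npar_ex[i [j nz]] e.
have ei := congr1 (fun w : 'rV_3 => w 0 i) e; have ej := congr1 (fun w : 'rV_3 => w 0 j) e.
rewrite !mxE in ei ej; split.
  have : s * (u 0 i * v 0 j - u 0 j * v 0 i) = 0 by rewrite mulrBr !mulrA ei ej; ring.
  by case/fmul0.
have : t * (u 0 i * v 0 j - u 0 j * v 0 i) = 0.
  transitivity (u 0 i * (t * v 0 j) - u 0 j * (t * v 0 i)); first by ring.
  by rewrite -ei -ej; ring.
by case/fmul0.
Qed.

Lemma par_multiple u v : u <> 0 -> par u v -> exists c, v = c *: u.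
Proof.
move=> u0 h; have [i ui] : exists i, u 0 i <> 0.
  apply: contrapT => nex; apply: u0; apply/rowP => i; rewrite mxE.
  by apply: contrapT => ui; apply: nex; exists i.
have [b hb] := fK ui; exists (v 0 i * b); apply/rowP => j; rewrite !mxE.
by rewrite mulrAC [v 0 i * _]mulrC -h mulrAC hb mul1r.
Qed.

Lemma infty_vec u : wcubic E u = 0 -> u 0 ord_max = 0 -> u 0 0 = 0.
Proof.
rewrite /wcubic => h z; rewrite z in h; apply: (@fexp0 _ 3); apply/oppr_inj.
by rewrite oppr0 -[RHS]h; ring.
Qed.

(** If the chord vector vanished, so would the cubic on the whole line through [u] and [v]. The
    point [p] of that line at infinity is then zero or a multiple of [[0 : 1 : 0]], whose tangent is
    [Z = 0]; in both cases [u] and [v] lie at infinity, where the curve has one point. *)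
Lemma chord_neq0 u v : wcubic E u = 0 -> wcubic E v = 0 -> ~ par u v -> chord E u v <> 0.
Proof.
move=> hu hv np /subr0_eq /(npar_comb np)[B0 A0].
pose p := v 0 ord_max *: u + - u 0 ord_max *: v.
have pz : p 0 ord_max = 0 by rewrite !mxE; ring.
have px : p 0 0 = 0.
  by apply: infty_vec pz; rewrite wcubic_comb hu hv A0 B0; ring.
have comb s' t' : dw E p (s' *: u + t' *: v) = 0.
  by rewrite dw_comb hu hv A0 B0; ring.
have dwp q : dw E p q = p 0 1 ^+ 2 * q 0 ord_max.
  by rewrite /dw /dwX /dwY /dwZ px pz; ring.
have cu := comb 1 0; have cv := comb 0 1.
rewrite scale1r scale0r addr0 dwp in cu; rewrite scale1r scale0r add0r dwp in cv.
have [p1|p1] := pselect (p 0 1 = 0).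
  have p0 : v 0 ord_max *: u = u 0 ord_max *: v.
    apply/subr0_eq; rewrite -scaleNr; apply: row3P; by rewrite [RHS]mxE.
  have [v2 u2] := npar_comb np p0.
  have u0 := infty_vec hu u2; have v0 := infty_vec hv v2.
  apply: np => i j; have [->|->|->] := ord3P i; have [->|->|->] := ord3P j;
    by rewrite ?u0 ?u2 ?v0 ?v2 ?mulr0 ?mul0r.
have u2 : u 0 ord_max = 0 by case/fmul0: cu => // /fexp0.
have v2 : v 0 ord_max = 0 by case/fmul0: cv => // /fexp0.
have u0 := infty_vec hu u2; have v0 := infty_vec hv v2.
apply: np => i j; have [->|->|->] := ord3P i; have [->|->|->] := ord3P j;
  by rewrite ?u0 ?u2 ?v0 ?v2 ?mulr0 ?mul0r.
Qed.

(** A singular affine point, moved to the origin, would make the last three coefficients vanish and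
    with them the discriminant. At infinity the derivative in [Z] is [Y ^+ 2]. *)
Lemma smooth_vec u : wcubic E u = 0 -> u <> 0 ->
  ~ [/\ dwX E u = 0, dwY E u = 0 & dwZ E u = 0].
Proof.
move=> hu u0 [dX dY dZ]; have [z|z] := pselect (u 0 ord_max = 0).
  have x := infty_vec hu z; move: dZ; rewrite /dwZ x z => h.
  apply: u0; apply: row3P; rewrite ?x ?z mxE //; apply: (@fexp0 _ 2).
  by rewrite -[RHS]h; ring.
have [c hc] := fK z; have [d hd] := ec_disc E.
set x := c * u 0 0; set y := c * u 0 1.
have uE : c *: u = vec3 x y 1.
  by apply: row3P; rewrite !mxE //= mulrC.
have hw : wcubic E (vec3 x y 1) = 0 by rewrite -uE wcubic_scale hu mulr0.
have hX : dwX E (vec3 x y 1) = 0.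
  transitivity (c ^+ 2 * dwX E u); last by rewrite dX mulr0.
  by rewrite -uE /dwX !mxE; ring.
have hY : dwY E (vec3 x y 1) = 0.
  transitivity (c ^+ 2 * dwY E u); last by rewrite dY mulr0.
  by rewrite -uE /dwY !mxE; ring.
rewrite (discriminant_shift _ _ _ _ _ x y) -waffE hw oppr0 in hd.
rewrite (_ : ec_a3 E + _ + _ = dwY E (vec3 x y 1)) in hd; last by rewrite /dwY !vec3E; ring.
rewrite (_ : ec_a4 E + _ - _ + _ = - dwX E (vec3 x y 1)) in hd; last by rewrite /dwX !vec3E; ring.
rewrite hX hY oppr0 discriminant_sing mul0r in hd.
by have /eqP := hd; rewrite eq_sym oner_eq0.
Qed.
End FieldGeometry.

Section AffineSum.
Variables (K : fieldType) (E : ellcurve K).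
Notation on x y := (wcubic E (vec3 x y 1) = 0).

Definition slope (x1 y1 x2 y2 : K) := (y2 - y1) / (x2 - x1).
Definition sumx (l x1 x2 : K) := l ^+ 2 + ec_a1 E * l - ec_a2 E - x1 - x2.
Definition sumy (l x1 y1 x3 : K) := - (l + ec_a1 E) * x3 - (y1 - l * x1) - ec_a3 E.

Lemma chord_slope x1 y1 x2 y2 : on x1 y1 -> on x2 y2 -> x1 != x2 ->
  let l := slope x1 y1 x2 y2 in
  negv E (chord E (vec3 x1 y1 1) (vec3 x2 y2 1)) =
  (x2 - x1) ^+ 3 *: vec3 (sumx l x1 x2) (sumy l x1 y1 (sumx l x1 x2)) 1.
Proof.
rewrite !waffE => h1 h2 n12 l.
have d0 : x2 - x1 != 0 by rewrite subr_eq0 eq_sym.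
have y2E : y2 = y1 + l * (x2 - x1) by rewrite /l /slope divfK // addrC subrK.
move: l y2E => l y2E; rewrite {}y2E in h2 *.
(* The two curve equations are linear in [a6] and [a4]; solving for these leaves an identity without
   side conditions. *)
have e6 : ec_a6 E = y1 ^+ 2 + ec_a1 E * x1 * y1 + ec_a3 E * y1
    - (x1 ^+ 3 + ec_a2 E * x1 ^+ 2 + ec_a4 E * x1).
  by apply/subr0_eq; rewrite -oppr0 -[in RHS]h1; ring.
have e4 : ec_a4 E = l * (y1 *+ 2 + l * (x2 - x1)) + ec_a1 E * (y1 + l * x2) + ec_a3 E * l
    - (x2 ^+ 2 + x1 * x2 + x1 ^+ 2) - ec_a2 E * (x1 + x2).
  apply: (mulIf d0); apply/subr0_eq; rewrite -oppr0 -[in RHS]h2 e6; ring.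
rewrite /sumy /sumx.
rewrite scale_vec3 /negv /chord /dw /dwX /dwY /dwZ !mxE /=.
by congr vec3; rewrite ?e6 ?e4; ring.
Qed.

Lemma sum_on x1 y1 x2 y2 : on x1 y1 -> on x2 y2 -> x1 != x2 ->
  let l := slope x1 y1 x2 y2 in on (sumx l x1 x2) (sumy l x1 y1 (sumx l x1 x2)).
Proof.
move=> h1 h2 n12 l; have := chord_slope h1 h2 n12; rewrite -/l => e.
have := wcubic_chord h1 h2; rewrite -wcubic_negv e wcubic_scale.
by move/eqP; rewrite mulf_eq0 !expf_eq0 /= subr_eq0 eq_sym (negPf n12) => /eqP.
Qed.

Lemma sum_cancel xa ya x y : on xa ya -> on x y -> x != xa ->
  let l := slope x y xa (- ya - ec_a1 E * xa - ec_a3 E) in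
  let xr := sumx l x xa in let yr := sumy l x y xr in xr != xa ->
  let l' := slope xa ya xr yr in
  sumx l' xa xr = x /\ sumy l' xa ya x = y.
Proof.
move=> ha h n l xr yr nr l'.
have d0 : xa - x != 0 by rewrite subr_eq0 eq_sym.
have r0 : xr - xa != 0 by rewrite subr_eq0.
have yaE : ya = - (y + l * (xa - x)) - ec_a1 E * xa - ec_a3 E.
  by rewrite /l /slope divfK //; ring.
have lE : l' = - (l + ec_a1 E).
  apply: (mulIf r0); rewrite /l' /slope divfK // {1}yaE /yr /sumy.
  by move: (l) (xr) => l0 xr0; ring.
split; rewrite /sumx /sumy lE ?yaE /xr /sumx; move: (l) => l0; ring.
Qed.

(** Associativity with the middle point at the origin and outer points [(x1, m x1)] and
    [(x3, n x3)]. The curve equation then gives [a4] twice, and the hypothesis on [a2] equates the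
    two expressions. The translation leaves few enough variables for [field]. *)
Lemma assoc_origin (a1 a2 a3 x1 m x3 n : K) :
  x1 != x3 -> a2 * (x1 - x3) = (m - n) * a3 + m ^+ 2 * x1 - n ^+ 2 * x3
     + a1 * (m * x1 - n * x3) - (x1 ^+ 2 - x3 ^+ 2) ->
  let x4 := m ^+ 2 + a1 * m - a2 - x1 in let y4 := - (m + a1) * x4 - a3 in
  let x5 := n ^+ 2 + a1 * n - a2 - x3 in let y5 := - (n + a1) * x5 - a3 in
  x4 != x3 -> x5 != x1 ->
  let l1 := (n * x3 - y4) / (x3 - x4) in let l2 := (y5 - m * x1) / (x5 - x1) in
  let x6 := l1 ^+ 2 + a1 * l1 - a2 - x4 - x3 in
  l1 ^+ 2 + a1 * l1 - x4 - x3 = l2 ^+ 2 + a1 * l2 - x1 - x5 /\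
  - (l1 + a1) * x6 - (y4 - l1 * x4) = - (l2 + a1) * x6 - (m * x1 - l2 * x1).
Proof.
move=> h13 E0 x4 y4 x5 y5 h4 h5 l1 l2 x6.
have h : x1 - x3 != 0 by rewrite subr_eq0.
have e2 : a2 = ((m - n) * a3 + m ^+ 2 * x1 - n ^+ 2 * x3
     + a1 * (m * x1 - n * x3) - (x1 ^+ 2 - x3 ^+ 2)) / (x1 - x3).
  by rewrite -E0 mulfK.
have h4' : x3 - x4 != 0 by rewrite subr_eq0 eq_sym.
have h5' : x5 - x1 != 0 by rewrite subr_eq0.
have nz c D e : D != 0 -> c != 0 -> e = D * c -> e != 0 :> K.
  by move=> D0 c0 ->; rewrite mulf_neq0.
split; rewrite /x6 /l1 /l2 /y4 /y5 /x4 /x5 e2 in h4' h5' *; field;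
  apply/and3P; split=> //.
all: by first [apply: (nz _ _ _ h5' h); field | apply: (nz _ _ _ h4' h); field].
Qed.

Lemma sum_assoc x1 y1 x2 y2 x3 y3 : on x1 y1 -> on x2 y2 -> on x3 y3 ->
  x1 != x2 -> x2 != x3 -> x1 != x3 ->
  let l := slope x1 y1 x2 y2 in let x4 := sumx l x1 x2 in let y4 := sumy l x1 y1 x4 in
  let m := slope x2 y2 x3 y3 in let x5 := sumx m x2 x3 in let y5 := sumy m x2 y2 x5 in
  x4 != x3 -> x5 != x1 ->
  let l1 := slope x4 y4 x3 y3 in let l2 := slope x1 y1 x5 y5 in
  let x6 := sumx l1 x4 x3 in let x7 := sumx l2 x1 x5 in
  x6 = x7 /\ sumy l1 x4 y4 x6 = sumy l2 x1 y1 x7.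
Proof.
rewrite !waffE => h1 h2 h3 n12 n23 n13 l x4 y4 m x5 y5 n43 n51 l1 l2 x6 x7.
have d1 : x1 - x2 != 0 by rewrite subr_eq0.
have d3 : x3 - x2 != 0 by rewrite subr_eq0 eq_sym.
have lE : l = (y1 - y2) / (x1 - x2) by rewrite /l /slope -opprB -[x2 - x1]opprB invrN mulrNN.
have y1E : y1 = y2 + l * (x1 - x2) by rewrite lE divfK // addrC subrK.
have y3E : y3 = y2 + m * (x3 - x2) by rewrite /m /slope divfK // addrC subrK.
pose A := ec_a2 E + 3 * x2; pose B := 2 * y2 + ec_a1 E * x2 + ec_a3 E.
(* The relation required by [assoc_origin] after moving the second point to the origin; it is the
   combination of the three curve equations that eliminates [a4] and [a6]. *)
have rel : A * ((x1 - x2) - (x3 - x2)) = (l - m) * B + l ^+ 2 * (x1 - x2) - m ^+ 2 * (x3 - x2)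
     + ec_a1 E * (l * (x1 - x2) - m * (x3 - x2)) - ((x1 - x2) ^+ 2 - (x3 - x2) ^+ 2).
  apply: (mulfI d1); apply: (mulfI d3); apply/subr0_eq; rewrite /A /B.
  rewrite y1E in h1; rewrite y3E in h3; move: (l) (m) h1 h3 => l' m' h1 h3.
  transitivity (- (x3 - x2) * ((y2 + l' * (x1 - x2)) ^+ 2 + ec_a1 E * x1 * (y2 + l' * (x1 - x2)) +
     ec_a3 E * (y2 + l' * (x1 - x2)) - (x1 ^+ 3 + ec_a2 E * x1 ^+ 2 + ec_a4 E * x1 + ec_a6 E))
    + (x1 - x2) * ((y2 + m' * (x3 - x2)) ^+ 2 + ec_a1 E * x3 * (y2 + m' * (x3 - x2)) +
     ec_a3 E * (y2 + m' * (x3 - x2)) - (x3 ^+ 3 + ec_a2 E * x3 ^+ 2 + ec_a4 E * x3 + ec_a6 E))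
    + (x3 - x1) * (y2 ^+ 2 + ec_a1 E * x2 * y2 + ec_a3 E * y2 -
     (x2 ^+ 3 + ec_a2 E * x2 ^+ 2 + ec_a4 E * x2 + ec_a6 E))); first by ring.
  by rewrite h1 h2 h3; ring.
have n13' : x1 - x2 != x3 - x2 by rewrite (inj_eq (addIr _)).
have ex4 : l ^+ 2 + ec_a1 E * l - A - (x1 - x2) = x4 - x2 by rewrite /x4 /sumx /A; ring.
have ex5 : m ^+ 2 + ec_a1 E * m - A - (x3 - x2) = x5 - x2 by rewrite /x5 /sumx /A; ring.
have ey4 : - (l + ec_a1 E) * (x4 - x2) - B = y4 - y2.
  by rewrite /y4 /sumy /B y1E; ring.
have ey5 : - (m + ec_a1 E) * (x5 - x2) - B = y5 - y2.
  by rewrite /y5 /sumy /B; ring.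
have := assoc_origin n13' rel; rewrite /= ex4 ex5 ey4 ey5 !(inj_eq (addIr _)) => /(_ n43 n51).
have -> : (m * (x3 - x2) - (y4 - y2)) / (x3 - x2 - (x4 - x2)) = l1.
  by rewrite /l1 /slope y3E; congr (_ / _); ring.
have -> : (y5 - y2 - l * (x1 - x2)) / (x5 - x2 - (x1 - x2)) = l2.
  by rewrite /l2 /slope y1E; congr (_ / _); ring.
case=> e1 e2; have e67 : x6 = x7.
  apply: (addIr (ec_a2 E - 2 * x2)); transitivity (l1 ^+ 2 + ec_a1 E * l1 - (x4 - x2) - (x3 - x2) - 4 * x2).
    by rewrite /x6 /sumx; ring.
  by rewrite e1 /x7 /sumx; ring.
split=> //; rewrite -e67; apply: (addIr (ec_a3 E - y2 - (- (l2 + ec_a1 E) * x2 + y2) + (l2 + ec_a1 E) * x2 + y2 )).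
move: e2.
have -> : l1 ^+ 2 + ec_a1 E * l1 - A - (x4 - x2) - (x3 - x2) = x6 - x2.
  by rewrite /x6 /sumx /A; ring.
move=> e2; apply/subr0_eq.
transitivity (- (l1 + ec_a1 E) * (x6 - x2) - (y4 - y2 - l1 * (x4 - x2)) - (- (l2 + ec_a1 E) * (x6 - x2) - (l * (x1 - x2) - l2 * (x1 - x2)))).
  by rewrite /sumy y1E; ring.
by rewrite e2 subrr.
Qed.
End AffineSum.

Section ClosedFieldCurve.
Variables (k : closedFieldType) (E : ellcurve k).
Notation on x y := (wcubic E (vec3 x y 1) = 0).

Lemma field_closed : is_field k.
Proof. by move=> a /eqP a0; exists a^-1; rewrite divff. Qed.
Let fk := field_closed.

Lemma root_seq (p : {poly k}) : p != 0 -> exists s : seq k, forall x, p.[x] = 0 -> x \in s.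
Proof.
move=> p0; have [r rE] := closed_field_poly_normal p; exists r => x.
rewrite rE hornerZ => /eqP; rewrite mulf_eq0 lead_coef_eq0 (negPf p0) /=.
by rewrite -rootE root_prod_XsubC.
Qed.

Definition agen (Q : k -> k -> Prop) : Prop :=
  exists S : seq k, forall x y, on x y -> x \notin S -> Q x y.

Lemma agen_and (P Q : k -> k -> Prop) : agen P -> agen Q -> agen (fun x y => P x y /\ Q x y).
Proof.
move=> [S hS] [T hT]; exists (S ++ T) => x y h; rewrite mem_cat negb_or => /andP[xS xT].
by split; [apply: hS | apply: hT].
Qed.
Lemma agen_mono (P Q : k -> k -> Prop) : (forall x y, on x y -> P x y -> Q x y) -> agen P -> agen Q.
Proof. by move=> PQ [S hS]; exists S => x y h xS; apply: PQ => //; apply: hS. Qed.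
Lemma agen_notin (s : seq k) : agen (fun x y => x \notin s).
Proof. by exists s. Qed.
Lemma agen_on : agen (fun x y => on x y).
Proof. by exists [::]. Qed.
Lemma on_ex x : exists y, on x y.
Proof.
have [y hy] := quadratic_root (ec_a1 E * x + ec_a3 E)
  (- (x ^+ 3 + ec_a2 E * x ^+ 2 + ec_a4 E * x + ec_a6 E)).
by exists y; rewrite waffE -[RHS]hy; ring.
Qed.
Lemma agen_ex Q : agen Q -> exists x y, on x y /\ Q x y.
Proof.
move=> [S hS]; have [x xS] := notin_ex S; have [y h] := on_ex x.
by exists x, y; split=> //; apply: hS.
Qed.

Lemma on_fiber x y y' : on x y -> on x y' -> y' = y \/ y' = - y - ec_a1 E * x - ec_a3 E.
Proof.
move=> h h'; have e : wcubic E (vec3 x y' 1) - wcubic E (vec3 x y 1) = 0 by rewrite h h' subrr.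
rewrite !waffE in e; have : (y' - y) * (y' - (- y - ec_a1 E * x - ec_a3 E)) = 0.
  by rewrite -[RHS]e; ring.
by move/eqP; rewrite mulf_eq0 !subr_eq0 => /orP[] /eqP; [left|right].
Qed.

(** Substituting a line that is not vertical into the equation gives a polynomial in [x] with
    leading term [- x ^+ 3]. *)
Lemma agen_lin (a b c : k) : ~ [/\ a = 0, b = 0 & c = 0] ->
  agen (fun x y => a * x + b * y + c != 0).
Proof.
move=> nz; have [b0|b0] := eqVneq b 0; last first.
  pose m := - a / b; pose n := - c / b.
  pose p : {poly k} := (m *: 'X + n%:P) ^+ 2 + ec_a1 E *: ('X * (m *: 'X + n%:P))
     + ec_a3 E *: (m *: 'X + n%:P) - ('X^3 + ec_a2 E *: 'X^2 + ec_a4 E *: 'X + (ec_a6 E)%:P).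
  have p0 : p != 0.
    apply/eqP => /(congr1 (fun q : {poly k} => q`_3)).
    have -> : p = - 'X^3 + (m ^+ 2 + ec_a1 E * m - ec_a2 E) *: 'X^2
       + (2 * m * n + ec_a1 E * n + ec_a3 E * m - ec_a4 E) *: 'X + (n ^+ 2 + ec_a3 E * n - ec_a6 E)%:P.
      by rewrite /p -!mul_polyC; ring.
    rewrite !(coefD, coefN, coefZ, coefXn, coefX, coefC) /= !mulr0 !addr0 => /eqP.
    by rewrite oppr_eq0 oner_eq0.
  have [s hs] := root_seq p0; exists s => x y h xs.
  apply: contra xs => /eqP e; apply: hs.
  have yE : y = m * x + n.
    have bm : b * m = - a by rewrite /m mulrC divfK.
    have bn : b * n = - c by rewrite /n mulrC divfK.
    apply: (mulfI b0); rewrite mulrDr mulrA bm bn.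
    by apply/subr0_eq; rewrite -[RHS]e; ring.
  rewrite /p !(hornerD, hornerN, hornerZ, hornerM, hornerXn, hornerX, hornerC, horner_exp) -yE.
  by move: h; rewrite waffE => h; rewrite -[RHS]h; ring.
have [a0|a0] := eqVneq a 0.
  exists [::] => x y _ _; rewrite a0 b0 !mul0r !add0r.
  by apply/eqP => c0; apply: nz.
exists [:: - c / a] => x y _; rewrite inE; apply: contraNneq => e.
apply/eqP; apply: (mulfI a0); rewrite [RHS]mulrC divfK //.
by apply/subr0_eq; rewrite -[RHS]e b0; ring.
Qed.

Lemma vec3_neq0 (x y : k) : vec3 x y 1 <> 0.
Proof. by move=> /(congr1 (fun v : 'rV_3 => v 0 ord_max)) /eqP; rewrite !mxE oner_eq0. Qed.

(* The point [r] with [q + b = r] is recovered as [q = r - b], hence finitely many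
   exceptional [q] unless [q] lies on the tangent at [b]. *)
Lemma agen_translate xb yb (S : seq k) : on xb yb ->
  agen (fun x y => x != xb /\ sumx E (slope x y xb yb) x xb \notin S).
Proof.
move=> hb; set b := vec3 xb yb 1.
have [r hr] : exists r : k -> k, forall s, on s (r s).
  by exists (fun s => projT1 (cid (on_ex s))) => s; case: cid.
pose r' s := - r s - ec_a1 E * s - ec_a3 E.
pose ab (v : 'rV[k]_3) := v 0 0 / v 0 ord_max.
(* Each abscissa of [S] carries at most two points; [T] collects the abscissas of their third
   intersections with the lines through [b]. *)
pose T := [seq ab (chord E (vec3 s (r s) 1) b) | s <- S] ++ [seq ab (chord E (vec3 s (r' s) 1) b) | s <- S].
have lin := agen_lin (smooth_vec fk hb (@vec3_neq0 xb yb)).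
have := agen_and (agen_and (agen_notin (xb :: T)) lin) (agen_on).
apply: agen_mono => x y h [[]]; rewrite inE negb_or => /andP[nx xT] B0 _.
split=> //; apply: contra xT => xS.
set s := sumx _ _ _ _ in xS; pose t := sumy E (slope x y xb yb) x y s.
have hst : on s t by exact: sum_on.
have e : negv E (chord E (vec3 x y 1) b) = (xb - x) ^+ 3 *: vec3 s t 1 by exact: chord_slope.
have d0 : (xb - x) ^+ 3 != 0 by rewrite expf_neq0 // subr_eq0 eq_sym.
pose t' := - t - ec_a1 E * s - ec_a3 E.
have e' : chord E (vec3 x y 1) b = (xb - x) ^+ 3 *: vec3 s t' 1.
  by rewrite -[LHS](negvK E) e negv_scale /negv !vec3E mulr1.
have hst' : on s t' by rewrite -[RHS]hst -[in RHS]wcubic_negv /negv !vec3E mulr1.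
have K := chordK h hb; rewrite -/b e' -[b]scale1r chord_scale in K.
have B : dw E b (vec3 x y 1) != 0.
  by rewrite /dw !vec3E mulr1.
rewrite scale1r in K.
move: (_ ^+ 2 * 1 ^+ 2) K => D K.
have xE : x = ab (chord E (vec3 s t' 1) b).
  have K0 := congr1 (fun v : 'rV_3 => v 0 0) K.
  have K2 := congr1 (fun v : 'rV_3 => v 0 ord_max) K.
  move: K0 K2; rewrite [in RHS]mxE [in LHS]mxE !vec3E => K0.
  rewrite [in RHS]mxE [in LHS]mxE !vec3E mulr1 => K2; rewrite /ab.
  set c := chord _ _ _ in K0 K2 *.
  have B3 : dw E b (vec3 x y 1) ^+ 3 != 0 by rewrite expf_neq0.
  have c2 : c 0 ord_max != 0 by apply: contra_neq B3 => c2; rewrite -K2 c2 mulr0.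
  apply: (mulIf c2); rewrite divfK //.
  have D0 : D != 0 by apply: contra_neq B3 => D0; rewrite -K2 D0 mul0r.
  by apply: (mulfI D0); rewrite K0 -K2; ring.
rewrite /T mem_cat; apply/orP; rewrite xE.
have [->|->] := on_fiber (hr s) hst'; [left|right]; apply/mapP; by exists s.
Qed.
End ClosedFieldCurve.

Section LawConstructions.
Variables (k : comNzRingType) (E : ellcurve k).
Program Definition lchord : law2 k :=
  @Law2 k (fun A u v => chord (ellcurve_map (in_alg A) E) u v) 2 2 _ _.
Next Obligation. by rewrite map_chord -ellcurve_map_alg. Qed.
Next Obligation. by rewrite chord_scale. Qed.
Program Definition lneg (f : law2 k) : law2 k :=
  @Law2 k (fun A u v => negv (ellcurve_map (in_alg A) E) (f A u v)) (ldeg1 f) (ldeg2 f) _ _.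
Next Obligation. by rewrite map_negv -ellcurve_map_alg lnat. Qed.
Next Obligation. by rewrite lhom negv_scale. Qed.
End LawConstructions.

Definition det3 (R : comNzRingType) (u v w : 'rV[R]_3) : R :=
  u 0 0 * (v 0 1 * w 0 ord_max - v 0 ord_max * w 0 1)
  - u 0 1 * (v 0 0 * w 0 ord_max - v 0 ord_max * w 0 0)
  + u 0 ord_max * (v 0 0 * w 0 1 - v 0 1 * w 0 0).

(** Proportional chords have zero cross product; pairing it with [a], [u] and [b] gives the three
    equations. *)
Lemma par_comb3 (R : comNzRingType) (E : ellcurve R) (u a b : 'rV[R]_3) :
  par (chord E u a) (chord E u b) ->
  [/\ dw E a u * dw E u b * det3 u a b = 0, dw E u a * dw E u b * det3 u a b = 0
    & dw E u a * dw E b u * det3 u a b = 0].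
Proof.
rewrite /chord; move: (dw E a u) (dw E u a) (dw E b u) (dw E u b) => B A B2 A2 h.
have h01 := h 0 1; have h02 := h 0 ord_max; have h12 := h 1 ord_max.
rewrite !mxE in h01 h02 h12.
set u0 := u 0 0 in h01 h02 h12 *; set u1 := u 0 1 in h01 h02 h12 *.
set u2 := u 0 ord_max in h01 h02 h12 *.
set a0 := a 0 0 in h01 h02 h12 *; set a1 := a 0 1 in h01 h02 h12 *.
set a2 := a 0 ord_max in h01 h02 h12 *.
set b0 := b 0 0 in h01 h02 h12 *; set b1 := b 0 1 in h01 h02 h12 *.
set b2 := b 0 ord_max in h01 h02 h12 *.
have z (x y z : R) : x * ((B * u1 - A * a1) * (B2 * u2 - A2 * b2) - (B * u2 - A * a2) * (B2 * u1 - A2 * b1))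
   - y * ((B * u0 - A * a0) * (B2 * u2 - A2 * b2) - (B * u2 - A * a2) * (B2 * u0 - A2 * b0))
   + z * ((B * u0 - A * a0) * (B2 * u1 - A2 * b1) - (B * u1 - A * a1) * (B2 * u0 - A2 * b0)) = 0.
  by rewrite h01 h02 h12; ring.
by rewrite /det3 -/u0 -/u1 -/u2 -/a0 -/a1 -/a2 -/b0 -/b1 -/b2; split;
  [rewrite -[RHS](z a0 a1 a2) | rewrite -[RHS](z u0 u1 u2) | rewrite -[RHS](z b0 b1 b2)]; ring.
Qed.

Lemma par_unscale (K : comNzRingType) (fK : is_field K) (c : K) (u v : 'rV[K]_3) :
  c <> 0 -> par u (c *: v) -> par u v.
Proof.
move=> /fK[b cb] h i j; have e := congr1 (fun x => b * x) (h i j); rewrite !mxE in e.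
transitivity (b * (u 0 i * (c * v 0 j))); first by rewrite -[LHS]mul1r -cb; ring.
by rewrite e -[RHS]mul1r -cb; ring.
Qed.

Lemma chord_origin (R : comNzRingType) (E : ellcurve R) x y :
  chord E (vec3 0 1 0) (vec3 x y 1) = - negv E (vec3 x y 1).
Proof.
by apply: row3P; rewrite /chord /negv /dw /dwX /dwY /dwZ !vec3E !mxE /=; ring.
Qed.

(** * The addition morphism and the group of points *)

Section Addition.
Variables (k : closedFieldType) (E : ellcurve k).
Implicit Types A B K : comAlgType k.
Notation on x y := (wcubic E (vec3 x y 1) = 0).
Notation EA A := (ellcurve_map (in_alg A) E).

Lemma generic_agen (Q : k -> k -> Prop) (R : curve E k^o -> Prop) : agen E Q ->
  (forall x y (P : curve E k^o), on x y -> Q x y ->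
     (forall u, sval P u <-> ray (vec3 (x : k^o) (y : k^o) 1) u) -> R P) -> generic R.
Proof.
move=> [S hS] QR; exists S => x y h xS.
have h' : on (x : k) (y : k) by have := h; rewrite ellcurve_ko.
by apply: (QR x y _ h') => //; apply: hS.
Qed.

(* A translation [P + a] on one side and [Q - a] on the other computes [P + Q] away from
   the locus where the chord through [P] and [Q] is undefined. *)
Definition add_index := option {a : k * k | on a.1 a.2 /\ dwY E (vec3 a.1 a.2 1) <> 0}.

Definition addlaw (i : add_index) : law2 k :=
  match i with
  | None => lneg E (lchord E)
  | Some a =>
    let c := vec3 (sval a).1 (sval a).2 1 in
    lneg E (lcomp (lchord E)
      (lneg E (lcomp (lchord E) (lfst k) (lcst c)))
      (lneg E (lcomp (lchord E) (lsnd k) (lneg E (lcst c)))))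
  end.

Lemma cst_on A x y : on x y -> wcubic (EA A) (map_mx (in_alg A) (vec3 x y 1)) = 0.
Proof. by move=> h; rewrite wcubic_map h rmorph0. Qed.

Lemma addlaw_cubic i A u v : wcubic (EA A) u = 0 -> wcubic (EA A) v = 0 ->
  wcubic (EA A) (addlaw i A u v) = 0.
Proof.
move=> hu hv; case: i => [[[x y] /= [h _]]|]; rewrite /= wcubic_negv wcubic_chord //;
  rewrite ?wcubic_negv ?wcubic_chord // ?wcubic_negv cst_on //.
Qed.

Lemma nontorsion_ex (s : seq k) : exists x y, [/\ on x y, dwY E (vec3 x y 1) <> 0 & x \notin s].
Proof.
have [x [xs dx]] := nonroot_ex s (disc_poly_neq0 E).
have [y h] := on_ex E x; exists x, y; split=> // e; move/eqP: dx; apply.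
rewrite /disc_poly !(hornerD, hornerZ, hornerXn, hornerX, hornerC, horner_exp).
move: e h; rewrite /dwY waffE !vec3E => e h.
transitivity ((2 * y * 1 + ec_a1 E * x * 1 + ec_a3 E * 1 ^+ 2) ^+ 2
  - 4 * (y ^+ 2 + ec_a1 E * x * y + ec_a3 E * y - (x ^+ 3 + ec_a2 E * x ^+ 2 + ec_a4 E * x + ec_a6 E))).
  by ring.
by rewrite e h; ring.
Qed.

Lemma alg_is_field_neq0 K (c : k) : c <> 0 -> (c%:A : K) <> 0.
Proof. by move=> /eqP c0; apply/eqP; apply: alg_neq0. Qed.

(** Only [u] proportional to [v] needs care. The law of index [a] then vanishes only if [u + a] and
    [u - a] are proportional. For an affine [u], and an [a] that is not of order two and has another
    abscissa, [par_comb3] would make [u] singular. *)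
Lemma addlaw_full K : is_field K -> forall (p q : curve E K) u v,
  sval p u -> sval q v -> u <> 0 -> v <> 0 -> exists i, addlaw i K u v <> 0.
Proof.
move=> fK p q u v pu qv u0 v0; have hu := point_oncone pu; have hv := point_oncone qv.
have neg0 w : negv (EA K) w = 0 -> w = 0.
  by move=> e; rewrite -(negvK (EA K) w) e; apply: row3P; rewrite !mxE /=; ring.
have [uv|uv] := pselect (par u v); last first.
  by exists None => /= /neg0; apply: chord_neq0.
have [c vE] := par_multiple fK u0 uv.
have c0 : c <> 0 by move=> c0; apply: v0; rewrite vE c0 scale0r.
suff [x [y [h d np]]] : exists x y, [/\ on x y, dwY E (vec3 x y 1) <> 0 &
   let a := map_mx (in_alg K) (vec3 x y 1) in let a' := negv (EA K) a in
   ~ par (negv (EA K) (chord (EA K) u a)) (negv (EA K) (chord (EA K) u a'))].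
  exists (Some (exist _ (x, y) (conj h d))) => /= /neg0.
  apply: chord_neq0 => //; rewrite ?wcubic_negv ?wcubic_chord // ?wcubic_negv ?cst_on //.
  move=> hp; apply: np => /=; move: hp; set a := map_mx _ _ => hp.
  have e w : negv (EA K) (chord (EA K) v w) = c ^+ 2 *: negv (EA K) (chord (EA K) u w).
    by rewrite vE -[w in LHS]scale1r chord_scale negv_scale expr1n mulr1.
  rewrite e in hp; rewrite -/a; apply: (par_unscale fK _ hp).
  by move=> /(fexp0 fK).
have aE (x y : k) : map_mx (in_alg K) (vec3 x y 1) = vec3 x%:A y%:A 1.
  by rewrite map_vec3 /= scale1r.
have dA x y : dwY E (vec3 x y 1) <> 0 -> dwY (EA K) (vec3 x%:A y%:A 1) <> 0.
  move=> d; have -> : dwY (EA K) (vec3 x%:A y%:A 1) = (dwY E (vec3 x y 1))%:A.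
    rewrite /dwY !vec3E /= -!in_algE !(rmorphD, rmorphM, rmorphXn, rmorph_nat, rmorph1); ring.
  exact: alg_is_field_neq0.
(* At the origin, [u + a] is [a] and [u - a] is its opposite, a different point since [a] is not of
   order two. *)
have [uz|uz] := pselect (u 0 ord_max = 0).
  have ux := infty_vec fK hu uz.
  have uy : u 0 1 <> 0 by move=> uy; apply: u0; apply: row3P; rewrite ?ux ?uy ?uz mxE.
  have [x [y [h d _]]] := nontorsion_ex [::]; exists x, y; split=> //= hp.
  have uE : u = u 0 1 *: vec3 0 1 0 by apply: row3P; rewrite !mxE /= ?ux ?uz ?mulr0 ?mulr1.
  have cE Y : negv (EA K) (chord (EA K) u (vec3 x%:A Y 1)) = (- u 0 1 ^+ 2) *: vec3 x%:A Y 1.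
    rewrite {1}uE -[vec3 x%:A Y 1 in LHS]scale1r chord_scale chord_origin -scaleN1r scalerA.
    by rewrite negv_scale negvK; congr (_ *: _); ring.
  have a'E : negv (EA K) (vec3 x%:A y%:A 1) = vec3 x%:A (y%:A - dwY (EA K) (vec3 x%:A y%:A 1)) 1.
    by rewrite /negv /dwY !vec3E; congr vec3; ring.
  move: hp; rewrite aE a'E !cE => /(_ 1 ord_max); rewrite !mxE /= => hp.
  have : u 0 1 ^+ 4 * dwY (EA K) (vec3 x%:A y%:A 1) = 0.
    by move/eqP: hp; rewrite -subr_eq0 => /eqP hp; rewrite -[RHS]hp; ring.
  by case/(fmul0 fK) => [/(fexp0 fK)|]; last exact: dA.
have [w uw] := fK _ uz; pose x0 := u 0 0 * w.
(* At most one scalar maps to the abscissa [x0] in [K], so two candidates suffice. *)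
have [x [xn1 [y [h d _]]]] : exists x, (x%:A : K) <> x0 /\ exists y,
   [/\ on x y, dwY E (vec3 x y 1) <> 0 & True].
  have [x1 [y1 [h1 d1 _]]] := nontorsion_ex [::].
  have [x2 [y2 [h2 d2]]] := nontorsion_ex [:: x1]; rewrite inE => n21.
  have [e1|] := pselect ((x1%:A : K) = x0); last by exists x1; split=> //; exists y1.
  exists x2; split; last by exists y2.
  rewrite -e1 => /eqP; rewrite -subr_eq0 -scalerBl => /eqP.
  by apply: alg_is_field_neq0; apply/eqP; rewrite subr_eq0.
exists x, y; split=> //=; rewrite aE => hp.
have {}hp := negv_par (EA K) hp; rewrite !negvK in hp.
set a := vec3 x%:A y%:A 1 in hp; set a' := negv (EA K) a in hp.
have ha : wcubic (EA K) a = 0 by rewrite /a -aE cst_on.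
have ha' : wcubic (EA K) a' = 0 by rewrite wcubic_negv.
pose D := dwY (EA K) a; have D0 : D <> 0 by apply: dA.
have ux : u 0 0 - x%:A * u 0 ord_max <> 0.
  by move=> /subr0_eq e; apply: xn1; rewrite /x0 e -mulrA uw mulr1.
have a'E : a' = vec3 x%:A (y%:A - D) 1.
  by rewrite /a' /negv /D /dwY !vec3E; congr vec3; ring.
have dt : det3 u a a' <> 0.
  rewrite a'E (_ : det3 _ _ _ = D * (u 0 0 - x%:A * u 0 ord_max)).
    by case/(fmul0 fK).
  by rewrite /det3 !vec3E; ring.
have np1 : ~ par u a.
  by move=> /(_ 0 ord_max); rewrite !vec3E mulr1 => e; apply: ux; rewrite e mulrC subrr.
have np2 : ~ par u a'.
  by move=> /(_ 0 ord_max); rewrite a'E !vec3E mulr1 => e; apply: ux; rewrite e mulrC subrr.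
have r1 := chord_neq0 fK hu ha np1; have r2 := chord_neq0 fK hu ha' np2.
have [q1 q2 q3] := par_comb3 hp.
have {}q1 : dw (EA K) a u * dw (EA K) u a' = 0 by case/(fmul0 fK): q1.
have {}q2 : dw (EA K) u a * dw (EA K) u a' = 0 by case/(fmul0 fK): q2.
have {}q3 : dw (EA K) u a * dw (EA K) a' u = 0 by case/(fmul0 fK): q3.
have A2 : dw (EA K) u a' = 0.
  case/(fmul0 fK): q1 => // B; case/(fmul0 fK): q2 => // A.
  by case: r1; rewrite /chord A B !scale0r subrr.
have A1 : dw (EA K) u a = 0.
  case/(fmul0 fK): q3 => // B.
  by case: r2; rewrite /chord A2 B !scale0r subrr.
(* The derivative of the cubic at [u] vanishes along [u], [a] and [a'], which are three independent
   vectors. *)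
have A0 := dw_diag (EA K) u; rewrite hu mulr0 in A0.
apply: (smooth_vec fK hu u0).
have dY : dwY (EA K) u = 0.
  have : D * dwY (EA K) u = 0.
    transitivity (dw (EA K) u a - dw (EA K) u a'); last by rewrite A1 A2 subrr.
    by rewrite a'E /dw !vec3E; ring.
  by case/(fmul0 fK).
have dX : dwX (EA K) u = 0.
  have : (u 0 0 - x%:A * u 0 ord_max) * dwX (EA K) u = 0.
    transitivity (dw (EA K) u u - u 0 ord_max * dw (EA K) u a); last by rewrite A0 A1 mulr0 subrr.
    by rewrite /dw dY !vec3E; ring.
  by case/(fmul0 fK).
split=> //; move: A1; rewrite /dw dX dY !vec3E => <-; ring.
Qed.
End Addition.

Lemma par_scale2 (R : comNzRingType) c d (u v : 'rV[R]_3) : par u v -> par (c *: u) (d *: v).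
Proof. by move=> h i j; rewrite !mxE mulrACA h mulrACA. Qed.

Lemma par_sym (R : comNzRingType) (u v : 'rV[R]_3) : par u v -> par v u.
Proof. by move=> h i j; rewrite mulrC -h mulrC. Qed.

Lemma par_via (K : comNzRingType) (fK : is_field K) (u v w : 'rV[K]_3) :
  w <> 0 -> par u w -> par v w -> par u v.
Proof.
move=> w0 /par_sym/(par_multiple fK w0)[c ->] /par_sym/(par_multiple fK w0)[d ->].
by apply: par_scale2 => i j; rewrite mulrC.
Qed.

Section AdditionMorphism.
Variables (k : closedFieldType) (E : ellcurve k).
Implicit Types A B K : comAlgType k.
Notation on x y := (wcubic E (vec3 x y 1) = 0).
Notation EA A := (ellcurve_map (in_alg A) E).

Lemma on_neg x y : on x y -> on x (- y - ec_a1 E * x - ec_a3 E).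
Proof. by move=> h; rewrite -[RHS]h -[in RHS]wcubic_negv /negv !vec3E mulr1. Qed.

Lemma addlaw_none x1 y1 x2 y2 : on x1 y1 -> on x2 y2 -> x1 != x2 ->
  let l := slope x1 y1 x2 y2 in
  addlaw (E := E) None k^o (vec3 x1 y1 1) (vec3 x2 y2 1) =
  (x2 - x1) ^+ 3 *: vec3 (sumx E l x1 x2) (sumy E l x1 y1 (sumx E l x1 x2)) 1.
Proof. by move=> h1 h2 n12 l; rewrite /= ellcurve_ko; apply: chord_slope. Qed.

(** This is [(P + a) + (Q - a) = P + Q], obtained from [sum_assoc] and [sum_cancel]. *)
Lemma addlaw_some (a : {a : k * k | on a.1 a.2 /\ dwY E (vec3 a.1 a.2 1) <> 0}) x1 y1 x2 y2 :
  on x1 y1 -> on x2 y2 -> x1 != x2 -> x1 != (sval a).1 -> x2 != (sval a).1 ->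
  let ya' := - (sval a).2 - ec_a1 E * (sval a).1 - ec_a3 E in
  let xr := sumx E (slope x2 y2 (sval a).1 ya') x2 (sval a).1 in
  let xs := sumx E (slope x1 y1 (sval a).1 (sval a).2) x1 (sval a).1 in
  xr != (sval a).1 -> xs != xr -> x1 != xr ->
  par (addlaw (Some a) k^o (vec3 x1 y1 1) (vec3 x2 y2 1))
      (addlaw (E := E) None k^o (vec3 x1 y1 1) (vec3 x2 y2 1)).
Proof.
case: a => [[xa ya] had] h1 h2 n12 n1a n2a ya' xr xs nra nsr n1r.
rewrite /= in n1a n2a ya' xr xs nra nsr n1r *; have [/= ha da] := had.
rewrite ellcurve_ko.
have aE : map_mx (in_alg k^o) (vec3 xa ya 1) = vec3 xa ya 1.
  by rewrite map_vec3; congr vec3; exact: mulr1.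
have ha' := on_neg ha.
have naE : negv E (vec3 xa ya 1) = vec3 xa ya' 1 by rewrite /negv !vec3E mulr1.
rewrite aE naE.
rewrite (chord_slope h1 ha n1a) (chord_slope h2 ha' n2a) -/xr -/xs.
set yr := sumy _ _ x2 y2 xr; set ys := sumy _ _ x1 y1 xs.
have hr : on xr yr by apply: sum_on.
have hs : on xs ys by apply: sum_on.
rewrite chord_scale negv_scale (chord_slope hs hr nsr) (chord_slope h1 h2 n12).
have [e1 e2] := sum_cancel ha h2 n2a nra; rewrite -/ya' -/xr -/yr in e1 e2.
have := sum_assoc h1 ha hr n1a _ n1r; rewrite eq_sym => /(_ nra).
rewrite -/xs -/ys /= e1 e2 => /(_ nsr); rewrite eq_sym => /(_ n12)[-> ->].
by rewrite !scalerA; apply: par_scale2 => i j; rewrite mulrC.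
Qed.

Lemma generic_vec (Q : k -> k -> Prop) : agen E Q ->
  generic (fun P : curve E k^o => exists x y, [/\ on x y, Q x y & sval P = ray (vec3 (x : k^o) (y : k^o) 1)]).
Proof.
move=> h; apply: (generic_agen h) => x y P hxy Qxy PE; exists x, y; split=> //.
by rewrite predeqE.
Qed.

(** It is enough to compare each law with [None]: that one is nonzero at points with distinct
    abscissas, so proportionality to it is transitive there. *)
Lemma addlaw_par_none (i : add_index E) : generic2 (fun (p q : curve E k^o) =>
  forall u v, sval p u -> sval q v -> par (addlaw i k^o u v) (addlaw (E := E) None k^o u v)).
Proof.
case: i => [a|]; last first.
  by exists [::] => x y h _; exists [::] => x' y' h' _ u v hu hv i j; rewrite mulrC.
have [h _] := svalP a.
have := @agen_translate k E _ _ [:: (sval a).1] (on_neg h).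
move=> /generic_vec; apply: generic_mono => q [x2 [y2 [h2 [n2a xra] qE]]].
set xr := sumx _ _ _ _ in xra; rewrite inE in xra.
have := agen_and (@agen_translate k E _ _ [:: xr] h) (agen_notin E [:: x2; xr]).
move=> /generic_vec; apply: generic_mono => p [x1 [y1 [h1 [[n1a xsr] n12] pE]]].
rewrite !inE in xsr; rewrite !inE negb_or in n12; have [n12' n1r] := andP n12.
move=> u v; rewrite pE qE => -[c ->] [d ->]; rewrite !lhom.
by apply: par_scale2; apply: addlaw_some.
Qed.

Theorem addition_ex : exists Phi : nattrans (pairf (curve E) (curve E)) (curve E),
  forall A (p q : curve E A) u v (i : add_index E), sval p u -> sval q v ->
    sval (Phi A (p, q)) (addlaw i A u v).
Proof.
apply: law_system.
- move=> i j; have := generic_and (addlaw_par_none i) (addlaw_par_none j).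
  move=> /generic_and /(_ (generic_vec (agen_on E))).
  apply: generic_mono => q [[hi hj] [x2 [y2 [h2 _ qE]]]].
  have := generic_and (generic_and hi hj) (generic_vec (agen_notin E [:: x2])).
  apply: generic_mono => p [[hpi hpj] [x1 [y1 [h1 n12 pE]]]] u v pu qv.
  rewrite inE in n12; move: pu qv; rewrite pE qE => -[c ->] [d ->].
  rewrite !lhom; apply: par_scale2.
  have pu : sval p (vec3 (x1 : k^o) (y1 : k^o) 1) by rewrite pE; exists 1; rewrite scale1r.
  have qv : sval q (vec3 (x2 : k^o) (y2 : k^o) 1) by rewrite qE; exists 1; rewrite scale1r.
  apply: (@par_via k^o (@field_closed k) _ _ _ _ (hpi _ _ pu qv) (hpj _ _ pu qv)).
  rewrite addlaw_none // => /(congr1 (fun w : 'rV_3 => w 0 ord_max)) /eqP.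
  by rewrite !mxE /= mulr1 expf_eq0 /= subr_eq0 eq_sym (negPf n12).
- move=> i; exists [::] => x y h _; exists [::] => x' y' h' _ u v pu qv.
  by apply: addlaw_cubic; apply: point_oncone; eassumption.
- exact: addlaw_full.
Qed.
End AdditionMorphism.

Section NatTransCombinators.
Variable k : comNzRingType.
Implicit Types F G H : kfunctor k.

Program Definition nt_id F : nattrans F F := @NatTrans k F F (fun A x => x) _.
Program Definition nt_comp F G H (phi : nattrans F G) (psi : nattrans G H) : nattrans F H :=
  @NatTrans k F H (fun A x => psi A (phi A x)) _.
Next Obligation. by move=> *; rewrite !nt_nat. Qed.
Program Definition nt_pair F G H (phi : nattrans F G) (psi : nattrans F H) :
  nattrans F (pairf G H) := @NatTrans k F (pairf G H) (fun A x => (phi A x, psi A x)) _.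
Next Obligation. by move=> *; rewrite !nt_nat. Qed.
Program Definition nt_fst F G : nattrans (pairf F G) F :=
  @NatTrans k (pairf F G) F (fun A x => x.1) _.
Program Definition nt_snd F G : nattrans (pairf F G) G :=
  @NatTrans k (pairf F G) G (fun A x => x.2) _.

Lemma structure_mapE (A B : comAlgType k) (f : {lrmorphism A -> B}) :
  structure_map B =1 f \o structure_map A.
Proof. by move=> a; rewrite /= /str_map lrmorph_alg. Qed.

Lemma fmap_structure F (A B : comAlgType k) (f : {lrmorphism A -> B}) (x : F k^o) :
  fmap F f (fmap F (structure_map A) x) = fmap F (structure_map B) x.
Proof. by rewrite (fmap_comp (structure_mapE f)). Qed.

Program Definition nt_const F G (y : G k^o) : nattrans F G :=
  @NatTrans k F G (fun A x => fmap G (structure_map A) y) _.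
Next Obligation. by move=> *; rewrite fmap_structure. Qed.

Lemma structure_map_ko (f : {lrmorphism k^o -> k^o}) : f =1 id.
Proof.
move=> a; rewrite -[a in LHS]mulr1; have := lrmorph_alg f a.
by rewrite /GRing.scale /=; rewrite mulr1.
Qed.
End NatTransCombinators.

Section Separation.
Variables (k : closedFieldType) (E E' : ellcurve k).
Implicit Types A B : comAlgType k.

Lemma point_detect A (P Q : curve E' A) :
  (forall e : A, e <> 0 -> exists B (f : {lrmorphism A -> B}),
     f e <> 0 /\ fmap (curve E') f P = fmap (curve E') f Q) -> P = Q.
Proof.
move=> h; apply: point_par => u v Pu Qv i j; apply: contrapT => ne.
have [B [f [fe fPQ]]] := h _ (fun e => ne (subr0_eq e)).
apply: fe; have Pf := fmap_in f Pu; have := fmap_in f Qv.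
rewrite -fPQ => Qf; have := point_parr Pf Qf i j; rewrite !mxE => e.
by rewrite rmorphB !rmorphM /= e subrr.
Qed.

(** Equality of points of [E'] is a vanishing of minors, hence can be tested on nonzero elements, so
    the chart principle applies above any base point [x]. *)
Lemma separation_over F (Phi Psi : nattrans (pairf F (curve E)) (curve E')) :
  (forall A (x : F A), generic (fun r => Phi A (x, base A r) = Psi A (x, base A r))) ->
  forall A (x : F A) (r : curve E A), Phi A (x, r) = Psi A (x, r).
Proof.
move=> h A x r.
pose idA (B : comAlgType k) : {lrmorphism B -> B} := [the {lrmorphism B -> B} of idfun].
suff H B (psi : {lrmorphism A -> B}) (s : curve E B) :
    Phi B (fmap F psi x, s) = Psi B (fmap F psi x, s).
  by have := H A (idA A) r; rewrite fmap_id.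
apply: (@chart_principle k E A (fun B psi s => Phi B (fmap F psi x, s) = Psi B (fmap F psi x, s))).
- move=> B' C psi' phi chi Q e; rewrite (fmap_comp e) /=.
  move=> /(congr1 (fmap (curve E') phi)).
  by rewrite -!nt_nat.
- move=> B' psi' Q hd; apply: point_detect => e /hd[C [phi [chi [e1 e2 e3]]]].
  rewrite (fmap_comp e1) /= in e3.
  by exists C, phi; split=> //; rewrite -!nt_nat.
- move=> iota iota1; apply: generic_mono (h A x) => s0 hs.
  by rewrite (fmap_id iota1).
Qed.

Lemma separation (Phi Psi : nattrans (curve E) (curve E')) :
  generic (fun p => Phi k^o p = Psi k^o p) -> forall A p, Phi A p = Psi A p.
Proof.
move=> h A p.
apply: (@separation_over (curve E) (nt_comp (nt_snd _ _) Phi) (nt_comp (nt_snd _ _) Psi) _ A p p).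
move=> B x0; apply: generic_mono h => r e /=.
by rewrite /base !nt_nat e.
Qed.
End Separation.

Lemma separation2 (k : closedFieldType) (E1 E2 E' : ellcurve k)
    (Phi Psi : nattrans (pairf (curve E1) (curve E2)) (curve E')) :
  generic2 (fun p q => Phi k^o (p, q) = Psi k^o (p, q)) ->
  forall A (p : curve E1 A) (q : curve E2 A), Phi A (p, q) = Psi A (p, q).
Proof.
move=> h; apply: separation_over => A p; apply: generic_mono h => q hq.
have := @separation k E1 E' (nt_comp (nt_pair (nt_id _) (nt_const (curve E1) q)) Phi)
   (nt_comp (nt_pair (nt_id _) (nt_const (curve E1) q)) Psi) _ A p.
apply; apply: generic_mono hq => p' hp'.
have eq : fmap (curve E2) (structure_map k^o) q = q.
  by rewrite fmap_id //; exact: structure_map_ko.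
change (Phi k^o (p', fmap (curve E2) (structure_map k^o) q) =
        Psi k^o (p', fmap (curve E2) (structure_map k^o) q)).
by rewrite eq.
Qed.

Section LinearChange.
Variables (k : comNzRingType) (E E' : ellcurve k) (N N' : 'M[k]_3).
Hypothesis NN' : N *m N' = 1%:M.
Hypothesis hN : forall (A : comAlgType k) (u : 'rV[A]_3),
  wcubic (ellcurve_map (in_alg A) E) u = 0 ->
  wcubic (ellcurve_map (in_alg A) E') (u *m map_mx (in_alg A) N) = 0.
Implicit Types A B : comAlgType k.

Definition lin_set A (L : set 'rV[A]_3) : set 'rV[A]_3 := fun v =>
  exists2 u, L u & v = u *m map_mx (in_alg A) N.

Lemma lin_inv A (u : 'rV[A]_3) : u *m map_mx (in_alg A) N *m map_mx (in_alg A) N' = u.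
Proof. by rewrite -mulmxA -map_mxM NN' map_mx1 mulmx1. Qed.

Lemma lin_map A B (f : {lrmorphism A -> B}) (u : 'rV[A]_3) :
  map_mx f (u *m map_mx (in_alg A) N) = map_mx f u *m map_mx (in_alg B) N.
Proof.
rewrite map_mxM; congr (_ *m _); apply/matrixP => i j.
by rewrite !mxE /= lrmorph_alg.
Qed.

Lemma lin_line A (L : set 'rV[A]_3) : is_line L -> is_line (lin_set L).
Proof.
move=> [L0 LD Lm hu]; split.
- by exists 0; rewrite ?mul0mx.
- by move=> a _ _ [u Lu ->] [v Lv ->]; exists (a *: u + v); [exact: LD | rewrite mulmxDl scalemxAl].
- move=> _ _ [u Lu ->] [v Lv ->] i j; rewrite !mxE !mulr_suml.
  under eq_bigr do rewrite mulr_sumr; under [RHS]eq_bigr do rewrite mulr_sumr.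
  rewrite exchange_big /=; apply: eq_bigr => a _; apply: eq_bigr => b _.
  by rewrite mulrACA (Lm _ _ Lu Lv b a); ring.
- apply: unimodular_gen hu => a [u Lu [i ->]].
  exists 3, (fun j => map_mx (in_alg A) N' j i), (fun j => (u *m map_mx (in_alg A) N) 0 j).
  split; first by move=> j; exists (u *m map_mx (in_alg A) N); [exists u | exists j].
  by rewrite -[u in RHS]lin_inv [RHS]mxE; apply: eq_bigr => j _; rewrite mulrC.
Qed.

Lemma lin_subproof A (P : curve E A) : is_line (lin_set (sval P)) /\
  forall v, lin_set (sval P) v -> wcubic (ellcurve_map (in_alg A) E') v = 0.
Proof.
split; first by apply: lin_line; apply: point_line.
by move=> _ [u Pu ->]; apply: hN; apply: point_oncone Pu.
Qed.

Definition lin_obj A (P : curve E A) : curve E' A := exist _ _ (lin_subproof P).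

Lemma lin_nat A B (f : {lrmorphism A -> B}) (P : curve E A) :
  lin_obj (fmap (curve E) f P) = fmap (curve E') f (lin_obj P).
Proof.
apply/esym/point_eq; apply: line_incl; [exact: point_line|exact: point_line|].
have [S0 SD _ _] := point_line (lin_obj (fmap (curve E) f P)).
move=> _ [n [c [l [Vl ->]]]]; apply: submod_sum => // i.
have [u Pu ->] := Vl i; rewrite lin_map; exists (map_mx f u) => //.
exact: fmap_in.
Qed.

Definition lin_trans : nattrans (curve E) (curve E') := NatTrans lin_nat.

Lemma lin_in A (P : curve E A) u : sval P u ->
  sval (lin_trans A P) (u *m map_mx (in_alg A) N).
Proof. by move=> Pu; exists u. Qed.
End LinearChange.

Section KPoints.
Variables (k : closedFieldType) (E : ellcurve k).
Notation on x y := (wcubic E (vec3 x y 1) = 0).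

Lemma on_ko (x y : k) : on x y ->
  wcubic (ellcurve_map (in_alg k^o) E) (vec3 (x : k^o) (y : k^o) 1) = 0.
Proof. by rewrite ellcurve_ko. Qed.

Definition kpt (x y : k) (h : on x y) : curve E k^o := aff (on_ko h).

Lemma kpt_in x y (h : on x y) : sval (kpt h) (vec3 (x : k^o) (y : k^o) 1).
Proof. exact: aff_in. Qed.

Lemma kpt_eq x y x' y' (h : on x y) (h' : on x' y') : x = x' -> y = y' -> kpt h = kpt h'.
Proof. by move=> ex ey; subst; congr kpt; exact: Prop_irrelevance. Qed.

Lemma kpt_inj x y x' y' (h : on x y) (h' : on x' y') : kpt h = kpt h' -> x = x' /\ y = y'.
Proof.
move=> e; have := kpt_in h'; rewrite -e => /(point_parr (kpt_in h)) p.
have := p 0 ord_max; have := p 1 ord_max; rewrite !vec3E !mulr1 !mul1r => -> ->.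
by [].
Qed.

Lemma generic_kpt (Q : curve E k^o -> Prop) (R : k -> k -> Prop) : agen E R ->
  (forall x y (h : on x y), R x y -> Q (kpt h)) -> generic Q.
Proof.
move=> [S hS] RQ; exists S => x y h xS.
have h' : on x y by have := h; rewrite ellcurve_ko.
have -> : aff h = kpt h' by congr aff; exact: Prop_irrelevance.
by apply: RQ; apply: hS.
Qed.

Lemma vec_primitive (u : 'rV[k^o]_3) : u <> 0 -> primitive u.
Proof.
move=> u0; have [i ui] : exists i, u 0 i <> 0.
  apply: contrapT => nex; apply: u0; apply/rowP => i; rewrite mxE.
  by apply: contrapT => ui; apply: nex; exists i.
by apply: (@unit_primitive _ _ i); apply: (@field_closed k).
Qed.

Lemma kpoint_eq (P Q : curve E k^o) u : sval P u -> sval Q u -> u <> 0 -> P = Q.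
Proof. by move=> Pu Qu /vec_primitive; apply: point_eq_in Pu Qu. Qed.

Lemma origin_in (A : comAlgType k) (y : A) : sval (origin E A) (vec3 0 y 0).
Proof. by split; rewrite vec3E. Qed.

Lemma kpoint_cases (P : curve E k^o) : P = origin E k^o \/ exists x y (h : on x y), P = kpt h.
Proof.
have [u [Pu u0]] := field_point_nz [the {lrmorphism k^o -> k^o} of idfun] P.
have {}u0 : u <> 0.
  by move=> e; apply: u0; rewrite e; apply/rowP => i; rewrite !mxE.
have [z|z] := pselect (u 0 ord_max = 0).
  left; have x := @infty_vec k^o (@field_closed k) _ _ (point_oncone Pu) z.
  by apply: (kpoint_eq Pu _ u0); rewrite [u]vec3_eta x z; apply: origin_in.
right; have [w zw] := @field_closed k _ z; have Pw := @point_scale _ E k^o P (w : k^o) u Pu.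
rewrite [u]vec3_eta scale_vec3 [w * u 0 ord_max]mulrC [u 0 ord_max * w]zw in Pw.
have h : on (w * u 0 0 : k) (w * u 0 1) by have := point_oncone Pw; rewrite ellcurve_ko.
by exists (w * u 0 0), (w * u 0 1), h; apply: (kpoint_eq Pw (kpt_in h)); apply: vec3_neq0.
Qed.

Lemma fmap_ko_id (F : kfunctor k) (x : F k^o) : fmap F (structure_map k^o) x = x.
Proof. by rewrite fmap_id //; exact: structure_map_ko. Qed.

Lemma fmap_origin (A B : comAlgType k) (f : {lrmorphism A -> B}) :
  fmap (curve E) f (origin E A) = origin E B.
Proof.
apply: (@point_eq_in _ _ _ _ _ (vec3 0 1 0)).
- have := fmap_in f (@origin_in A 1).
  by rewrite map_vec3 !rmorph0 rmorph1.
- exact: origin_in.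
- by apply: (@unit_primitive _ _ 1); rewrite vec3E; exists 1; rewrite mulr1.
Qed.
End KPoints.

Definition padd_trans (k : closedFieldType) (E : ellcurve k) :
  nattrans (pairf (curve E) (curve E)) (curve E) := projT1 (cid (addition_ex E)).
Definition neg_mx (k : comNzRingType) (E : ellcurve k) : 'M[k]_3 :=
  \matrix_(i < 3, j < 3) (if j == 1 then nth 0 [:: - ec_a1 E; -1; - ec_a3 E] i else (i == j)%:R).

Lemma row3_mul (R : comNzRingType) (u : 'rV[R]_3) (M : 'M[R]_3) j :
  (u *m M) 0 j = u 0 0 * M 0 j + u 0 1 * M 1 j + u 0 ord_max * M ord_max j.
Proof.
rewrite !mxE !big_ord_recl big_ord0 addr0 addrA.
by congr (_ + u 0 _ * M _ j + u 0 _ * M _ j); apply: val_inj.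
Qed.

Lemma mul_neg_mx (k : comNzRingType) (E : ellcurve k) (A : comAlgType k) (u : 'rV[A]_3) :
  u *m map_mx (in_alg A) (neg_mx E) = negv (ellcurve_map (in_alg A) E) u.
Proof.
apply: row3P; rewrite row3_mul /negv !mxE /= ?scaleNr ?scale1r ?scale0r; ring.
Qed.

Lemma neg_mxK (k : comNzRingType) (E : ellcurve k) : neg_mx E *m neg_mx E = 1%:M.
Proof.
apply/matrixP => i j; rewrite !mxE !big_ord_recl big_ord0 !mxE /=.
by have [->|->|->] := ord3P i; have [->|->|->] := ord3P j; rewrite /=; ring.
Qed.

Lemma neg_mx_cubic (k : comNzRingType) (E : ellcurve k) (A : comAlgType k) (u : 'rV[A]_3) :
  wcubic (ellcurve_map (in_alg A) E) u = 0 ->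
  wcubic (ellcurve_map (in_alg A) E) (u *m map_mx (in_alg A) (neg_mx E)) = 0.
Proof. by rewrite mul_neg_mx wcubic_negv. Qed.

Definition pneg_trans (k : comNzRingType) (E : ellcurve k) : nattrans (curve E) (curve E) :=
  lin_trans (neg_mxK E) (@neg_mx_cubic k E).

Section Group.
Variables (k : closedFieldType) (E : ellcurve k).
Implicit Types A B : comAlgType k.
Notation on x y := (wcubic E (vec3 x y 1) = 0).

Definition padd A (p q : curve E A) : curve E A := padd_trans E A (p, q).
Definition pneg A (p : curve E A) : curve E A := pneg_trans E A p.

Lemma padd_in A (p q : curve E A) u v (i : add_index E) : sval p u -> sval q v ->
  sval (padd p q) (addlaw i A u v).
Proof. by rewrite /padd /padd_trans; case: cid => Phi /= h; apply: h. Qed.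

Lemma padd_fmap A B (f : {lrmorphism A -> B}) (p q : curve E A) :
  fmap (curve E) f (padd p q) = padd (fmap (curve E) f p) (fmap (curve E) f q).
Proof. by rewrite /padd -nt_nat. Qed.

Lemma pneg_in A (p : curve E A) u : sval p u ->
  sval (pneg p) (negv (ellcurve_map (in_alg A) E) u).
Proof. by move=> pu; rewrite -mul_neg_mx; apply: lin_in. Qed.

Lemma negv_ko (u : 'rV[k]_3) : negv (ellcurve_map (in_alg k^o) E) u = negv E u.
Proof. by rewrite ellcurve_ko. Qed.

Lemma padd_kpt x1 y1 x2 y2 (h1 : on x1 y1) (h2 : on x2 y2) (n12 : x1 != x2) :
  padd (kpt h1) (kpt h2) = kpt (sum_on h1 h2 n12).
Proof.
have d0 : (x2 - x1) ^+ 3 != 0 by rewrite expf_neq0 // subr_eq0 eq_sym.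
have := padd_in None (kpt_in h1) (kpt_in h2); rewrite addlaw_none // => s.
apply: (kpoint_eq s); first by apply: point_scale; apply: kpt_in.
by move=> /(congr1 (fun w : 'rV_3 => w 0 ord_max)) /eqP; rewrite !mxE /= mulr1 (negPf d0).
Qed.

Lemma pneg_kpt x y (h : on x y) : pneg (kpt h) = kpt (on_neg h).
Proof.
have s := pneg_in (kpt_in h); rewrite negv_ko /negv !vec3E mulr1 in s.
by apply: (kpoint_eq s (kpt_in _)); apply: vec3_neq0.
Qed.

Lemma padd_comm A : commutative (@padd A).
Proof.
move=> p q.
apply: (@separation2 k E E E (padd_trans E) (nt_comp (nt_pair (nt_snd _ _) (nt_fst _ _)) (padd_trans E)) _ A p q).
apply: (generic_kpt (agen_on E)) => x2 y2 h2 _.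
apply: (generic_kpt (agen_notin E [:: x2])) => x1 y1 h1; rewrite inE => n12.
change (padd (kpt h1) (kpt h2) = padd (kpt h2) (kpt h1)).
have n21 : x2 != x1 by rewrite eq_sym.
have s1 := padd_in None (kpt_in h1) (kpt_in h2); have s2 := padd_in None (kpt_in h2) (kpt_in h1).
apply: (@kpoint_eq k E _ _ (addlaw (E := E) None k^o (vec3 x1 y1 1) (vec3 x2 y2 1))) => //.
  have -> : addlaw (E := E) None k^o (vec3 x1 y1 1) (vec3 x2 y2 1) =
     (-1) *: addlaw (E := E) None k^o (vec3 x2 y2 1) (vec3 x1 y1 1).
    by rewrite /= -negv_scale chordC scaleN1r.
  exact: point_scale.
rewrite addlaw_none // => /(congr1 (fun w : 'rV_3 => w 0 ord_max)) /eqP.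
by rewrite !mxE /= mulr1 expf_eq0 /= subr_eq0 eq_sym (negPf n12).
Qed.

Lemma padd_assoc A : associative (@padd A).
Proof.
move=> p q r.
pose L : nattrans (pairf (pairf (curve E) (curve E)) (curve E)) (curve E) :=
  nt_comp (nt_pair (nt_comp (nt_fst _ _) (nt_fst _ _))
    (nt_comp (nt_pair (nt_comp (nt_fst _ _) (nt_snd _ _)) (nt_snd _ _)) (padd_trans E))) (padd_trans E).
pose R : nattrans (pairf (pairf (curve E) (curve E)) (curve E)) (curve E) :=
  nt_comp (nt_pair (nt_comp (nt_fst _ _) (padd_trans E)) (nt_snd _ _)) (padd_trans E).
apply: (@separation_over k E E _ L R _ A (p, q) r) => {p q r}.
move=> {}A [p q].
apply: (generic_kpt (agen_on E)) => x3 y3 h3 _.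
pose c := nt_const (pairf (curve E) (curve E)) (kpt h3).
apply: (@separation2 k E E E (nt_comp (nt_pair (nt_id _) c) L) (nt_comp (nt_pair (nt_id _) c) R) _ A p q).
have := agen_and (agen_translate [:: x3] h3) (agen_notin E [:: x3]).
move=> a2; apply: (generic_kpt a2) => x2 y2 h2 [[n23 _] _] {a2}.
have nx : x3 \notin [::] by [].
have a1 := agen_and (agen_translate [:: x3] h2) (agen_notin E [:: x3; sumx E (slope x2 y2 x3 y3) x2 x3]).
apply: (generic_kpt a1) => x1 y1 h1 [[n12 n43] n1] {a1}.
rewrite inE in n43; rewrite !inE negb_or in n1; have [n13 n15] := andP n1.
change (padd (kpt h1) (padd (kpt h2) (fmap (curve E) (structure_map k^o) (kpt h3))) =
        padd (padd (kpt h1) (kpt h2)) (fmap (curve E) (structure_map k^o) (kpt h3))).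
rewrite fmap_ko_id (padd_kpt h2 h3 n23) (padd_kpt h1 h2 n12).
rewrite (padd_kpt h1 (sum_on h2 h3 n23) n15) (padd_kpt (sum_on h1 h2 n12) h3 n43).
have n51 := n15; rewrite eq_sym in n51.
have [e1 e2] := sum_assoc h1 h2 h3 n12 n23 n13 n43 n51.
by apply: kpt_eq; [exact: esym e1 | exact: esym e2].
Qed.

Lemma padd_origin A : right_id (origin E A) (@padd A).
Proof.
move=> p.
rewrite -(fmap_origin E (structure_map A)).
apply: (@separation k E E (nt_comp (nt_pair (nt_id _) (nt_const _ (origin E k^o))) (padd_trans E))
  (nt_id _) _ A p).
apply: (generic_kpt (agen_on E)) => x y h _.
change (padd (kpt h) (fmap (curve E) (structure_map k^o) (origin E k^o)) = kpt h).
rewrite fmap_ko_id; have s := padd_in None (kpt_in h) (@origin_in k E k^o 1).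
rewrite /= chordC chord_origin opprK negvK in s.
by apply: (kpoint_eq s (kpt_in h)); apply: vec3_neq0.
Qed.

Lemma padd_neg A (p : curve E A) : padd p (pneg p) = origin E A.
Proof.
rewrite -(fmap_origin E (structure_map A)).
apply: (@separation k E E (nt_comp (nt_pair (nt_id _) (pneg_trans E)) (padd_trans E))
  (nt_const _ (origin E k^o)) _ A p).
have [S hS] := root_seq (disc_poly_neq0 E).
apply: (generic_kpt (agen_notin E S)) => x y h xS.
change (padd (kpt h) (pneg (kpt h)) = fmap (curve E) (structure_map k^o) (origin E k^o)).
rewrite fmap_ko_id; have s := padd_in None (kpt_in h) (pneg_in (kpt_in h)).
(* [D] is the difference of the ordinates of the point and of its opposite, zero only at points of
   order two. *)
set D := 2 * y + ec_a1 E * x + ec_a3 E.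
have D0 : D != 0.
  apply: contraNneq xS => D0; apply: hS.
  rewrite /disc_poly !(hornerD, hornerZ, hornerXn, hornerX, hornerC, horner_exp).
  transitivity (D ^+ 2 - 4 * wcubic E (vec3 x y 1)); first by rewrite waffE /D; ring.
  by rewrite D0 h; ring.
have e2 : addlaw (E := E) None k^o (vec3 x y 1) (negv E (vec3 x y 1)) = D ^+ 3 *: vec3 0 1 0.
  rewrite /= ellcurve_ko -[X in chord E X _](negvK E) chord_negv negvK.
  have -> : negv E (vec3 x y 1) = vec3 x (y - D) 1.
    by rewrite /negv !vec3E /D; congr vec3; ring.
  have hD : ec_a3 E = D - 2 * y - ec_a1 E * x by rewrite /D; ring.
  have h0 := h; rewrite waffE in h0.
  have h6 : ec_a6 E = y ^+ 2 + ec_a1 E * x * y + ec_a3 E * y - (x ^+ 3 + ec_a2 E * x ^+ 2 + ec_a4 E * x).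
    by apply/subr0_eq; rewrite -oppr0 -[in RHS]h0; ring.
  move: (D) hD => D' hD.
  by apply: row3P; rewrite /chord /dw /dwX /dwY /dwZ !mxE /= h6 hD; ring.
rewrite negv_ko e2 in s.
apply: (kpoint_eq s (point_scale _ (@origin_in k E k^o 1))).
move=> /(congr1 (fun w : 'rV_3 => w 0 1)) /eqP; rewrite !mxE /= mulr1 expf_eq0 /=.
by rewrite (negPf D0).
Qed.
End Group.

HB.instance Definition _ (k : comNzRingType) (E : ellcurve k) (A : comAlgType k) :=
  gen_eqMixin (curve_obj E A).
HB.instance Definition _ (k : comNzRingType) (E : ellcurve k) (A : comAlgType k) :=
  gen_choiceMixin (curve_obj E A).

(** An alias that carries the abelian group structure, so that [+], [-] and [*+] denote the group
    law. *)
Definition pts (k : closedFieldType) (E : ellcurve k) (A : comAlgType k) : Type := curve_obj E A.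
HB.instance Definition _ (k : closedFieldType) (E : ellcurve k) (A : comAlgType k) :=
  Choice.on (pts E A).

Section Zmod.
Variables (k : closedFieldType) (E : ellcurve k) (A : comAlgType k).
Let add0 : left_id (origin E A) (@padd k E A).
Proof. by move=> p; rewrite padd_comm padd_origin. Qed.
Let addN : left_inverse (origin E A) (@pneg k E A) (@padd k E A).
Proof. by move=> p; rewrite padd_comm padd_neg. Qed.
HB.instance Definition _ := GRing.isZmodule.Build (pts E A)
  (@padd_assoc k E A) (@padd_comm k E A) add0 addN.
End Zmod.

(** * Extending generic formulas to homomorphisms *)

Record law1 (k : comNzRingType) := Law1 {
  vfun :> forall A : comAlgType k, 'rV[A]_3 -> 'rV[A]_3;
  vdeg : nat;
  vnat : forall (A B : comAlgType k) (f : {lrmorphism A -> B}) u,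
    map_mx f (vfun u) = vfun (map_mx f u);
  vhom : forall (A : comAlgType k) (c : A) u, vfun (c *: u) = c ^+ vdeg *: vfun u }.

Program Definition lcomp1 (k : comNzRingType) (F : law1 k) (g : law2 k) : law2 k :=
  @Law2 k (fun A u v => F A (g A u v)) (ldeg1 g * vdeg F) (ldeg2 g * vdeg F) _ _.
Next Obligation. by move=> *; rewrite vnat lnat. Qed.
Next Obligation. by move=> *; rewrite lhom vhom exprMn !exprM. Qed.

Definition is_hom (k : closedFieldType) (E E' : ellcurve k)
    (phi : nattrans (curve E) (curve E')) : Prop :=
  forall (A : comAlgType k) (p q : curve E A), phi A (padd p q) = padd (phi A p) (phi A q).

Section HomExtension.
Variables (k : closedFieldType) (E E' : ellcurve k) (F : law1 k) (S : seq k).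
Implicit Types A B K : comAlgType k.
Notation on x y := (wcubic E (vec3 x y 1) = 0).
Notation Fk x y := (F k^o (vec3 (x : k^o) (y : k^o) 1)).

Hypothesis F_nz : forall K, is_field K -> forall x y : K,
  wcubic (ellcurve_map (in_alg K) E) (vec3 x y 1) = 0 ->
  (forall s, s \in S -> x <> s%:A) -> F K (vec3 x y 1) <> 0.
Hypothesis F_cubic : forall x y : k, on x y -> x \notin S -> wcubic E' (Fk x y) = 0.
Hypothesis F_add : forall x1 y1 x2 y2 (h1 : on x1 y1) (h2 : on x2 y2) (n12 : x1 != x2),
  let l := slope x1 y1 x2 y2 in let x3 := sumx E l x1 x2 in let y3 := sumy E l x1 y1 x3 in
  x1 \notin S -> x2 \notin S -> x3 \notin S ->
  forall P Q R : curve E' k^o, sval P (Fk x1 y1) -> sval Q (Fk x2 y2) -> sval R (Fk x3 y3) ->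
  padd P Q = R.

Lemma F_nzk x y : on x y -> x \notin S -> Fk x y <> 0.
Proof.
move=> h xS; apply: F_nz.
- exact: (@field_closed k).
- exact: on_ko.
- move=> s sS e; move/negP: xS; apply.
  by rewrite (_ : x = s) // e; exact: mulr1.
Qed.

Lemma F_pt x y : on x y -> x \notin S -> exists P : curve E' k^o, sval P (Fk x y).
Proof.
move=> h xS; have w : wcubic (ellcurve_map (in_alg k^o) E') (Fk x y) = 0.
  by rewrite ellcurve_ko; exact: F_cubic.
exists (point_ray (vec_primitive (F_nzk h xS)) w).
by exists 1; rewrite scale1r.
Qed.

(** Besides [F] itself there are the laws that compute [F (u + a) - F (a)], one for each choice of
    addition laws on the two curves; they take over at the zeros of [F]. All depend on the first
    argument, so the morphism obtained from [law_system] is restricted to the diagonal. *)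
Let idx := option (add_index E * add_index E' * {a : k * k | on a.1 a.2 /\ a.1 \notin S}).
Let H (i : idx) : law2 k :=
  match i with
  | None => lcomp1 F (lfst k)
  | Some (t, s, a) =>
    lcomp (addlaw s) (lcomp1 F (lcomp (addlaw t) (lfst k) (lcst (vec3 (sval a).1 (sval a).2 1))))
      (lcst (negv E' (Fk (sval a).1 (sval a).2)))
  end.

Lemma map_ko (u : 'rV[k]_3) : map_mx (in_alg k^o) u = u.
Proof. by apply/rowP => i; rewrite mxE; exact: mulr1. Qed.

(** At a general point all laws give one and the same point [P]; for the translated laws this is the
    identity [(P + Q) - Q = P]. *)
Lemma H_in i : generic (fun p : curve E k^o => exists P : curve E' k^o,
  exists2 u0, sval p u0 /\ u0 <> 0 & [/\ sval P (F k^o u0), F k^o u0 <> 0 &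
   forall u v, sval p u -> sval P (H i k^o u v)]).
Proof.
case: i => [[[t s] [[xa ya] [/= ha aS]]]|].
  have := agen_and (agen_translate S ha) (agen_notin E S).
  move=> ag; apply: (generic_kpt ag) => x y h [[na n3] xS] {ag}.
  have [P PF] := F_pt h xS; have [Q QF] := F_pt ha aS.
  have h3 := sum_on h ha na; have [R RF] := F_pt h3 n3.
  exists P; exists (vec3 (x : k^o) (y : k^o) 1).
    by split; [exact: kpt_in | exact: vec3_neq0].
  split=> //; first exact: F_nzk.
  move=> u v pu /=; rewrite !map_ko.
  have eP : P = padd R (pneg Q).
    have <- := F_add h ha na xS aS n3 PF QF RF.
    by rewrite -padd_assoc padd_neg padd_origin.
  rewrite eP; apply: padd_in; last by have := pneg_in QF; rewrite negv_ko.
  have ain : sval (kpt ha) (vec3 (xa : k^o) (ya : k^o) 1) by exact: kpt_in.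
  have := padd_in t pu ain; rewrite (padd_kpt h ha na) => -[c ->].
  by rewrite vhom; apply: point_scale.
apply: (generic_kpt (agen_notin E S)) => x y h xS.
have [P PF] := F_pt h xS; exists P; exists (vec3 (x : k^o) (y : k^o) 1).
  by split; [exact: kpt_in | exact: vec3_neq0].
split=> //; first exact: F_nzk.
by move=> u v [c ->] /=; rewrite vhom; apply: point_scale.
Qed.

(** Zeros of [F] lie at infinity or over an abscissa of [S], and the ordinate is then a root of a
    quadratic that splits over k. So they are constant points even for large [K], and can be
    translated by k-points. *)
Lemma F_vanish K (p : curve E K) u : is_field K -> sval p u -> u <> 0 -> F K u = 0 ->
  exists p0 : curve E k^o, p = base K p0.
Proof.
move=> fK pu u0 Fu; have [z|z] := pselect (u 0 ord_max = 0).
  exists (origin E k^o); have x := infty_vec fK (point_oncone pu) z.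
  have y : u 0 1 <> 0 by move=> y; apply: u0; apply: row3P; rewrite ?x ?y ?z mxE.
  rewrite /base fmap_origin; apply: (point_eq_in pu).
    by rewrite [u]vec3_eta x z; exact: origin_in.
  by apply: (@unit_primitive _ _ 1); exact: fK.
have [w zw] := fK _ z; have pw := point_scale w pu.
pose x := w * u 0 0; pose y := w * u 0 1.
have wE : w *: u = vec3 x y 1.
  by apply: row3P; rewrite !mxE // mulrC.
rewrite wE in pw; have h := point_oncone pw.
have [s sS xs] : exists2 s, s \in S & x = s%:A.
  apply: contrapT => nex; apply: (F_nz fK h).
    by move=> s sS xs; apply: nex; exists s.
  by rewrite -wE vhom Fu scaler0.
have [t ht] := on_ex E s.
pose t' := - t - ec_a1 E * s - ec_a3 E.
have ht' := on_neg ht; rewrite -/t' in ht'.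
suff [r [hr yr]] : exists r, exists hr : on s r, y = r%:A.
  exists (kpt hr); rewrite (point_aff h pw) /base.
  by apply/esym/fmap_aff; rewrite /= /str_map ?xs ?yr.
have fib (a1 a3 C s0 y0 t0 : K) : y0 ^+ 2 + a1 * s0 * y0 + a3 * y0 - C = 0 ->
    t0 ^+ 2 + a1 * s0 * t0 + a3 * t0 - C = 0 -> (y0 - t0) * (y0 - (- t0 - a1 * s0 - a3)) = 0.
  move=> h1 h2; transitivity ((y0 ^+ 2 + a1 * s0 * y0 + a3 * y0 - C) -
    (t0 ^+ 2 + a1 * s0 * t0 + a3 * t0 - C)); first by ring.
  by rewrite h1 h2 subrr.
have q : (y - t%:A) * (y - t'%:A) = 0.
  have -> : t'%:A = - t%:A - (ec_a1 E)%:A * s%:A - (ec_a3 E)%:A :> K.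
    by rewrite /t' !scalerBl scaleNr -!in_algE rmorphM.
  have hA : wcubic (ellcurve_map (in_alg K) E) (vec3 s%:A t%:A 1) = 0.
    by have := cst_on K ht; rewrite map_vec3 /= scale1r.
  by move: h hA; rewrite !waffE xs; apply: fib.
by case/(fmul0 fK): q => /subr0_eq e; [exists t, ht | exists t', ht'].
Qed.

Lemma translate_generic (p0 : curve E k^o) (T : seq k) :
  agen E (fun x y => forall h : on x y, exists x' y' (h' : on x' y'),
    padd p0 (kpt h) = kpt h' /\ x' \notin T).
Proof.
have [->|[x0 [y0 [h0 ->]]]] := kpoint_cases p0.
  exists T => x y h xT h1; exists x, y, h1.
  by rewrite padd_comm padd_origin.
apply: agen_mono (agen_translate T h0) => x y h [n xT] h1.
by exists _, _, (sum_on h1 h0 n); rewrite padd_comm (padd_kpt h1 h0 n).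
Qed.

(** At a zero [p0] of [F] one takes a k-point [a] such that both [a] and [p0 + a] avoid [S].
    Additivity, assumed for general points, then holds everywhere by separation. *)
Theorem hom_extension : exists phi : nattrans (curve E) (curve E'),
  is_hom phi /\ forall A (p : curve E A) u, sval p u -> sval (phi A p) (F A u).
Proof.
have [Phi hPhi] : exists Phi : nattrans (pairf (curve E) (curve E)) (curve E'),
  forall A (p q : curve E A) u v i, sval p u -> sval q v ->
    sval (Phi A (p, q)) (H i A u v).
  apply: law_system.
  - move=> i j; exists [::] => x2 y2 h2 _.
    apply: generic_mono (generic_and (H_in i) (H_in j)).
    move=> p [[P [u0 [pu0 n0] [P0 nF hP]]] [Q [v0 [pv0 m0] [Q0 _ hQ]]]] u v pu qv.
    have ePQ : P = Q.
      have [c e] := @par_multiple k^o (@field_closed k) _ _ n0 (point_parr pu0 pv0).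
      have c0 : c <> 0 by move=> c0; apply: m0; rewrite e c0 scale0r.
      apply: (kpoint_eq _ Q0); rewrite e vhom; first exact: point_scale.
      move=> z; apply: nF; apply: (@scalerI _ _ (c ^+ vdeg F : k)).
        by rewrite expf_neq0 //; apply/eqP.
      by rewrite scaler0; exact: z.
    rewrite -ePQ in hQ; exact: (point_parr (hP u v pu) (hQ u v pu)).
  - move=> i; exists [::] => x2 y2 h2 _.
    apply: generic_mono (H_in i) => p [P [u0 _ [_ _ hP]]] u v pu qv.
    exact: point_oncone (hP u v pu).
  - move=> K fK p q u v pu qv u0 v0.
    have [Fu|Fu] := pselect (F K u = 0); last by exists None.
    have [p0 pE] := F_vanish fK pu u0 Fu.
    have := agen_and (translate_generic p0 S) (agen_notin E S).
    move=> /agen_ex[xa [ya [ha [/(_ ha)[x3 [y3 [h3 [e3 n3]]]] aS]]]].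
    have aK : sval (base K (kpt ha)) (map_mx (in_alg K) (vec3 xa ya 1)).
      have := fmap_in (structure_map K) (kpt_in ha).
      by rewrite (_ : map_mx (structure_map K) _ = map_mx (in_alg K) (vec3 xa ya 1)) //;
        apply/rowP => i; rewrite !mxE.
    have nzmap (w : 'rV[k^o]_3) : w <> 0 -> map_mx (in_alg K) (w : 'rV[k]_3) <> 0.
      move=> w0 mw; apply: w0; apply/rowP => i; rewrite mxE; apply: contrapT => wi.
      have := congr1 (fun z : 'rV_3 => z 0 i) mw; rewrite !mxE /=.
      exact: alg_is_field_neq0.
    have [t nt] := addlaw_full fK pu aK u0 (nzmap _ (@vec3_neq0 _ _ _)).
    have s := padd_in t pu aK.
    have eb : padd p (base K (kpt ha)) = base K (kpt h3).
      by rewrite pE /base -padd_fmap e3.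
    have s3 : sval (base K (kpt h3)) (map_mx (in_alg K) (vec3 x3 y3 1)).
      have := fmap_in (structure_map K) (kpt_in h3).
      by rewrite (_ : map_mx (structure_map K) _ = map_mx (in_alg K) (vec3 x3 y3 1)) //;
        apply/rowP => i; rewrite !mxE.
    rewrite eb in s; set w := addlaw t K u _ in nt s.
    have [R RF] := F_pt h3 n3; have [Q QF] := F_pt ha aS.
    have [c wE] := par_multiple fK (nzmap _ (@vec3_neq0 _ _ _)) (point_parr s3 s).
    have c0 : c <> 0 by move=> c0; apply: nt; rewrite wE c0 scale0r.
    have strE (z : 'rV[k^o]_3) : map_mx (structure_map K) z = map_mx (in_alg K) (z : 'rV[k]_3).
      by apply/rowP => i; rewrite !mxE.
    have FwE : F K w = c ^+ vdeg F *: map_mx (in_alg K) (Fk x3 y3).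
      by rewrite wE vhom -!strE vnat.
    have RK := fmap_in (structure_map K) RF; rewrite strE in RK.
    have QK := fmap_in (structure_map K) (pneg_in QF); rewrite strE negv_ko in QK.
    have nRF : F K w <> 0.
      rewrite FwE => z; have {}z : map_mx (in_alg K) (Fk x3 y3) = 0.
        have cd0 : c ^+ vdeg F <> 0 by move=> /(fexp0 fK).
        have [d cd] := fK _ cd0.
        by have := congr1 (fun y => d *: y) z; rewrite scaler0 scalerA mulrC cd scale1r.
      by apply: (nzmap _ _ z); exact: F_nzk.
    have nQF : map_mx (in_alg K) (negv E' (Fk xa ya)) <> 0.
      apply: nzmap => z; apply: (F_nzk ha aS).
      by rewrite -[LHS](negvK E') z; apply: row3P; rewrite !mxE /=; ring.
    have RKw : sval (fmap (curve E') (structure_map K) R) (F K w) by rewrite FwE; apply: point_scale.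
    have [s' ns'] := addlaw_full fK RKw QK nRF nQF.
    by exists (Some (t, s', exist _ (xa, ya) (conj ha aS))).
pose phi : nattrans (curve E) (curve E') := nt_comp (nt_pair (nt_id _) (nt_id _)) Phi.
have phiF A (p : curve E A) u : sval p u -> sval (phi A p) (F A u).
  by move=> pu; exact: (hPhi A p p u u None pu pu).
exists phi; split=> // A p q.
apply: (@separation2 k E E E' (nt_comp (padd_trans E) phi)
  (nt_comp (nt_pair (nt_comp (nt_fst _ _) phi) (nt_comp (nt_snd _ _) phi)) (padd_trans E')) _ A p q).
apply: (generic_kpt (agen_notin E S)) => x2 y2 h2 n2.
have ag := agen_and (agen_translate S h2) (agen_notin E S).
apply: (generic_kpt ag) => x1 y1 h1 [[n12 n3] n1] {ag}.
change (phi k^o (padd (kpt h1) (kpt h2)) = padd (phi k^o (kpt h1)) (phi k^o (kpt h2))).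
rewrite (padd_kpt h1 h2 n12); apply/esym.
by apply: (F_add h1 h2 n12) => //; apply: phiF; apply: kpt_in.
Qed.
End HomExtension.

(** * Isogenies and their duals *)

Section HomTheory.
Variables (k : closedFieldType) (E E' : ellcurve k).
Variables (phi : nattrans (curve E) (curve E')).

Lemma hom_ext (psi : nattrans (curve E) (curve E')) :
  (forall p, phi k^o p = psi k^o p) -> forall A p, phi A p = psi A p.
Proof. by move=> e; apply: separation; apply: (generic_kpt (agen_notin E [::])). Qed.

Hypothesis hphi : is_hom phi.
Variable A : comAlgType k.
Implicit Types p q : pts E A.
Let f (p : pts E A) : pts E' A := phi A p.

Lemma homD p q : phi A (p + q : pts E A) = f p + f q.
Proof. exact: hphi. Qed.
Lemma hom0 : f 0 = 0.
Proof. by apply: (addrI (f 0)); rewrite addr0 -[LHS]homD addr0. Qed.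
Lemma homN p : f (- p) = - f p.
Proof. by apply/eqP; rewrite -addr_eq0 -[_ + _]homD addNr [phi A _]hom0. Qed.
Lemma homB p q : f (p - q) = f p - f q.
Proof. by rewrite -homN; exact: homD. Qed.
Lemma homMn p n : f (p *+ n) = f p *+ n.
Proof. by elim: n => [|n IH]; rewrite ?mulr0n ?hom0 // !mulrSr -IH; exact: homD. Qed.
End HomTheory.

Section Homs.
Variables (k : closedFieldType) (E E' : ellcurve k).

Definition p_add (phi psi : nattrans (curve E) (curve E')) : nattrans (curve E) (curve E') :=
  nt_comp (nt_pair phi psi) (padd_trans E').

Definition p_opp (phi : nattrans (curve E) (curve E')) : nattrans (curve E) (curve E') :=
  nt_comp phi (pneg_trans E').

Definition p_muln n (phi : nattrans (curve E) (curve E')) : nattrans (curve E) (curve E') :=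
  iter n (p_add phi) (nt_const _ (origin E' k^o)).

Lemma p_mulnE n phi A (p : curve E A) : p_muln n phi A p = (phi A p : pts E' A) *+ n.
Proof.
elim: n => [|n IH]; last by rewrite mulrS -IH.
exact: (fmap_origin E' (structure_map A)).
Qed.

Lemma p_muln_hom n phi : is_hom phi -> is_hom (p_muln n phi).
Proof.
by move=> h A p q; rewrite !p_mulnE h; exact: (@mulrnDl (pts E' A)).
Qed.

End Homs.

Lemma nt_comp_hom (k : closedFieldType) (E E' E2 : ellcurve k)
  (phi : nattrans (curve E) (curve E')) (psi : nattrans (curve E') (curve E2)) :
  is_hom phi -> is_hom psi -> is_hom (nt_comp phi psi).
Proof. by move=> h h' A p q; rewrite /= h h'. Qed.

Section Surjective.
Variables (k : closedFieldType) (E E' : ellcurve k).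
Notation on E x y := (wcubic E (vec3 x y 1) = 0).

Definition surj (phi : nattrans (curve E) (curve E')) := forall q, exists p, phi k^o p = q.

(** Every point is the difference of two general points, and both of these lie in the image. *)
Lemma surj_generic phi : is_hom phi ->
  agen E' (fun x y => forall h : on E' x y, exists p, phi k^o p = kpt h) -> surj phi.
Proof.
move=> hphi ag q; have [T hT] := ag.
have := agen_and (translate_generic q T) ag.
move=> /agen_ex[x [y [h [/(_ h)[x' [y' [h' [e n]]]] /(_ h)[p ep]]]]].
have [r er] := hT x' y' h' n h'.
exists ((r : pts E k^o) - (p : pts E k^o)); rewrite [LHS](homB hphi) er ep -e.
exact: (@addrK (pts E' k^o)).
Qed.
End Surjective.

(** The normal form of a curve with a point of order three, placed at [(0, 0)] with tangent
    [y = 0]. *)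
Definition isC (k : comNzRingType) (E : ellcurve k) (a b : k) : Prop :=
  [/\ ec_a1 E = a, ec_a2 E = 0, ec_a3 E = b, ec_a4 E = 0 & ec_a6 E = 0].

Lemma onC (k : comNzRingType) (E : ellcurve k) a b x y : isC E a b ->
  (wcubic E (vec3 x y 1) = 0) <-> y ^+ 2 + a * x * y + b * y = x ^+ 3.
Proof.
move=> [e1 e2 e3 e4 e6]; rewrite waffE e1 e2 e3 e4 e6 !mul0r !addr0.
by split=> [/subr0_eq //|->]; rewrite subrr.
Qed.

Section Isogeny.
Variables (k : closedFieldType) (E E' : ellcurve k) (a b a' b' : k) (F : law1 k) (S : seq k).
Variables (fx : k -> k) (fy : k -> k -> k).
Implicit Types A B K : comAlgType k.
Notation on E x y := (wcubic E (vec3 x y 1) = 0).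
Notation Fk x y := (F k^o (vec3 (x : k^o) (y : k^o) 1)).
Hypotheses (hE : isC E a b) (hE' : isC E' a' b').
Hypothesis F_nz : forall K, is_field K -> forall x y : K,
  wcubic (ellcurve_map (in_alg K) E) (vec3 x y 1) = 0 ->
  (forall s, s \in S -> x <> s%:A) -> F K (vec3 x y 1) <> 0.
Hypothesis F_form : forall x y, x \notin S ->
  exists2 d : k, d != 0 & Fk x y = d *: (vec3 (fx x) (fy x y) 1 : 'rV[k]_3).
Hypothesis f_on : forall x y, on E x y -> x \notin S -> on E' (fx x) (fy x y).
Hypothesis f_fib : forall c, exists T : seq k, forall x, x \notin S -> x \notin T -> fx x != c.
Hypothesis f_neg : forall x y, x \notin S ->
  fy x (- y - a * x - b) = - fy x y - a' * fx x - b'.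
Hypothesis f_line : forall x1 x2 x3 l m, x1 \notin S -> x2 \notin S -> x3 \notin S ->
  x1 + x2 + x3 = l ^+ 2 + a * l ->
  x1 * x2 + x1 * x3 + x2 * x3 = - (2 * l * m + a * m + b * l) ->
  x1 * x2 * x3 = m ^+ 2 + b * m ->
  exists l' m', fx x1 + fx x2 + fx x3 = l' ^+ 2 + a' * l' /\
    forall x, x \in [:: x1; x2; x3] -> fy x (l * x + m) = l' * fx x + m'.

Lemma vieta x1 y1 x2 y2 : on E x1 y1 -> on E x2 y2 -> x1 != x2 ->
  let l := slope x1 y1 x2 y2 in let x3 := sumx E l x1 x2 in let m := y1 - l * x1 in
  [/\ y2 = l * x2 + m, x1 + x2 + x3 = l ^+ 2 + a * l,
      x1 * x2 + x1 * x3 + x2 * x3 = - (2 * l * m + a * m + b * l)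
    & x1 * x2 * x3 = m ^+ 2 + b * m].
Proof.
move=> /(onC _ _ hE) h1 /(onC _ _ hE) h2 n l x3 m.
have d0 : x2 - x1 != 0 by rewrite subr_eq0 eq_sym.
have y1E : y1 = l * x1 + m by rewrite /m addrC subrK.
have y2E : y2 = l * x2 + m.
  have : l * (x2 - x1) = y2 - y1 by rewrite /l /slope divfK.
  by rewrite /m mulrBr => e; transitivity (l * x2 - l * x1 + (y1 - l * x1) + l * x1);
    [rewrite e; ring | ring].
have x3E : x3 = l ^+ 2 + a * l - x1 - x2.
  by rewrite /x3 /sumx; case: hE => -> -> _ _ _; rewrite subr0.
rewrite y1E y2E {y1E} in h1 h2 *; clearbody x3; subst x3; clearbody m; move: (l) h1 h2 => l0 h1 h2.
split=> //; first by ring.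
  apply: (mulfI d0); apply/subr0_eq.
  transitivity (((l0 * x2 + m) ^+ 2 + a * x2 * (l0 * x2 + m) + b * (l0 * x2 + m) - x2 ^+ 3) -
    ((l0 * x1 + m) ^+ 2 + a * x1 * (l0 * x1 + m) + b * (l0 * x1 + m) - x1 ^+ 3)); first by ring.
  by rewrite h1 h2; ring.
apply: (mulfI d0); apply/subr0_eq.
transitivity (x1 * ((l0 * x2 + m) ^+ 2 + a * x2 * (l0 * x2 + m) + b * (l0 * x2 + m) - x2 ^+ 3) -
    x2 * ((l0 * x1 + m) ^+ 2 + a * x1 * (l0 * x1 + m) + b * (l0 * x1 + m) - x1 ^+ 3)); first by ring.
by rewrite h1 h2; ring.
Qed.

(** By [f_line] a line goes to a line, so images of a collinear triple are collinear, and the chord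
    formula applies when two of the image abscissas differ. *)
Lemma f_add_weak x1 y1 x2 y2 (h1 : on E x1 y1) (h2 : on E x2 y2) (n12 : x1 != x2) :
  let l := slope x1 y1 x2 y2 in let x3 := sumx E l x1 x2 in let y3 := sumy E l x1 y1 x3 in
  x1 \notin S -> x2 \notin S -> x3 \notin S -> fx x1 != fx x2 ->
  forall (g1 : on E' (fx x1) (fy x1 y1)) (g2 : on E' (fx x2) (fy x2 y2))
    (g3 : on E' (fx x3) (fy x3 y3)), padd (kpt g1) (kpt g2) = kpt g3.
Proof.
move=> l x3 y3 s1 s2 s3 nf g1 g2 g3; rewrite (padd_kpt g1 g2 nf).
have [y2E e1 e2 e3] := vieta h1 h2 n12; rewrite -/l -/x3 in y2E e1 e2 e3.
set m := y1 - l * x1 in y2E e1 e2 e3.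
have y1E : y1 = l * x1 + m by rewrite /m addrC subrK.
have [l' [m' [e hl]]] := f_line s1 s2 s3 e1 e2 e3.
have f1 : fy x1 y1 = l' * fx x1 + m' by rewrite [in LHS]y1E hl // inE eqxx.
have f2 : fy x2 y2 = l' * fx x2 + m' by rewrite [in LHS]y2E hl // !inE eqxx orbT.
have f3 : fy x3 (l * x3 + m) = l' * fx x3 + m' by rewrite hl // !inE eqxx !orbT.
have d0 : fx x2 - fx x1 != 0 by rewrite subr_eq0 eq_sym.
have lE : slope (fx x1) (fy x1 y1) (fx x2) (fy x2 y2) = l'.
  rewrite /slope f1 f2; apply: (mulIf d0); rewrite divfK //; ring.
case: (hE') => a1' a2' a3' _ _; case: (hE) => a1 a2 a3 _ _.
have xE : sumx E' l' (fx x1) (fx x2) = fx x3.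
  by rewrite /sumx a1' a2' -e; ring.
apply: kpt_eq; rewrite lE xE //.
have -> : y3 = - (l * x3 + m) - a * x3 - b.
  by rewrite /y3 /sumy a1 a3 -/m; move: (l) (x3) (m) => *; ring.
by rewrite f_neg // f3 /sumy f1 a1' a3'; ring.
Qed.

(** The condition [fx x1 != fx x2] is removed by a general auxiliary point [a]: the identities for
    [a + P2], [a + P3] and [(a + P2) + P1] are of the weak kind, and the image of [a] cancels. *)
Lemma f_add x1 y1 x2 y2 (h1 : on E x1 y1) (h2 : on E x2 y2) (n12 : x1 != x2) :
  let l := slope x1 y1 x2 y2 in let x3 := sumx E l x1 x2 in let y3 := sumy E l x1 y1 x3 in
  x1 \notin S -> x2 \notin S -> x3 \notin S ->
  forall (g1 : on E' (fx x1) (fy x1 y1)) (g2 : on E' (fx x2) (fy x2 y2))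
    (g3 : on E' (fx x3) (fy x3 y3)), padd (kpt g1) (kpt g2) = kpt g3.
Proof.
move=> l x3 y3 s1 s2 s3 g1 g2 g3; have h3 : on E x3 y3 := sum_on h1 h2 n12.
have [T1 hT1] := f_fib (fx x1); have [T2 hT2] := f_fib (fx x2); have [T3 hT3] := f_fib (fx x3).
have := agen_and (agen_and (agen_translate (S ++ x1 :: T1) h2) (agen_translate S h3))
  (agen_notin E (S ++ T2 ++ T3)).
move=> /agen_ex[xa [ya [ha [[[na2 n4] [na3 n5]]]]]].
rewrite !mem_cat !negb_or => /and3P[sa ta2 ta3].
move: n4; rewrite mem_cat inE !negb_or => /and3P[s4 n41 t4].
set x4 := sumx E _ xa x2 in n41 t4 s4; set x5 := sumx E _ xa x3 in n5.
have h4 := sum_on ha h2 na2; have h5 := sum_on ha h3 na3.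
have e4 := padd_kpt ha h2 na2; have e5 := padd_kpt ha h3 na3.
have e6 := padd_kpt h4 h1 n41.
have e56 : kpt (sum_on h4 h1 n41) = kpt h5.
  have -> : kpt h5 = padd (kpt ha) (kpt h3) by rewrite e5; exact: kpt_eq.
  have -> : kpt h3 = padd (kpt h1) (kpt h2) by rewrite (padd_kpt h1 h2 n12); exact: kpt_eq.
  rewrite -e6 [padd (kpt h1) _]padd_comm padd_assoc e4.
  by congr (padd _ _); exact: kpt_eq.
have [ex ey] := kpt_inj e56.
have ga := f_on ha sa; have g4 := f_on h4 s4; have g5 := f_on h5 n5.
have s6 : sumx E (slope x4 (sumy E (slope xa ya x2 y2) xa ya x4) x1 y1) x4 x1 \notin S by rewrite ex.
have g6 := f_on (sum_on h4 h1 n41) s6.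
have w1 := @f_add_weak _ _ _ _ ha h2 na2 sa s2 s4 (hT2 _ sa ta2) ga g2 g4.
have w2 := @f_add_weak _ _ _ _ ha h3 na3 sa s3 n5 (hT3 _ sa ta3) ga g3 g5.
have w3 := @f_add_weak _ _ _ _ h4 h1 n41 s4 s1 s6 (hT1 _ s4 t4) g4 g1 g6.
have e : kpt g6 = kpt g5 by apply: kpt_eq; rewrite ?ey ?ex.
rewrite e -w2 -w1 in w3.
apply: (@addrI (pts E' k^o) (kpt ga)).
rewrite [X in _ + X](padd_comm (kpt g1)) addrA; exact: w3.
Qed.

Lemma Fk_pt x y (h : on E' (fx x) (fy x y)) (P : curve E' k^o) : x \notin S ->
  sval P (Fk x y) -> P = kpt h.
Proof.
move=> xS; have [d d0 ->] := F_form y xS => PF.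
apply: (kpoint_eq PF); first by apply: point_scale; exact: kpt_in.
move/eqP; rewrite scaler_eq0 (negPf d0) => /eqP; exact: vec3_neq0.
Qed.

Theorem isogeny_ex : exists phi : nattrans (curve E) (curve E'), is_hom phi /\
  forall x y (h : on E x y) (h' : on E' (fx x) (fy x y)), x \notin S -> phi k^o (kpt h) = kpt h'.
Proof.
have [|x1 y1 x2 y2 h1 h2 n12 /= s1 s2 s3 P Q R hP hQ hR|phi [hphi phiF]] :=
  @hom_extension k E E' F S F_nz.
- move=> x y h xS; have [d d0 ->] := F_form y xS.
  by have := point_oncone (point_scale (d : k^o) (kpt_in (f_on h xS))); rewrite ellcurve_ko.
- have h3 := sum_on h1 h2 n12.
  rewrite (Fk_pt (f_on h1 s1) s1 hP) (Fk_pt (f_on h2 s2) s2 hQ) (Fk_pt (f_on h3 s3) s3 hR).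
  exact: f_add.
exists phi; split=> // x y h h' xS; apply: Fk_pt => //.
by apply: phiF; exact: kpt_in.
Qed.
End Isogeny.

Section Dual.
Variables (k : closedFieldType) (E E' : ellcurve k) (a b a' b' : k) (S : seq k).
Variables (fx : k -> k) (fy : k -> k -> k) (phi : nattrans (curve E) (curve E')).
Implicit Types A B K : comAlgType k.
Notation on E x y := (wcubic E (vec3 x y 1) = 0).
Hypotheses (hE : isC E a b) (hE' : isC E' a' b').
Hypothesis hphi : is_hom phi.
Hypothesis f_on : forall x y, on E x y -> x \notin S -> on E' (fx x) (fy x y).
Hypothesis f_neg : forall x y, x \notin S ->
  fy x (- y - a * x - b) = - fy x y - a' * fx x - b'.
Hypothesis phiE : forall x y (h : on E x y) (h' : on E' (fx x) (fy x y)),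
  x \notin S -> phi k^o (kpt h) = kpt h'.
Hypothesis f_solve : forall X, exists2 x, x \notin S & fx x = X.

(** A preimage of the abscissa lifts to a point up to sign, and [f_neg] corrects the sign. *)
Lemma solve_point (T : seq k) X Y : on E' X Y -> X \notin map fx T ->
  exists x y, [/\ on E x y, x \notin S, x \notin T, X = fx x & Y = fy x y].
Proof.
move=> hXY XT; have [x xS fE] := f_solve X; rewrite -{X}fE in hXY XT *.
have xT : x \notin T by apply: contra XT; exact: map_f.
have [y h] := on_ex E x; have := on_fiber (f_on h xS) hXY.
case: (hE) => a1 _ a3 _ _; case: (hE') => a1' _ a3' _ _.
rewrite a1' a3' => -[->|->]; first by exists x, y.
by exists x, (- y - a * x - b); rewrite f_neg //; split=> //; have := on_neg h; rewrite a1 a3.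
Qed.

Lemma isogeny_surj : surj phi.
Proof.
apply: (surj_generic hphi); apply: (agen_mono _ (agen_notin E' [::])) => X Y h _ h'.
have [x [y [hxy xS _ eX eY]]] := @solve_point [::] X Y h isT.
by subst X Y; exists (kpt hxy); exact: phiE.
Qed.

Variables (G : law1 k) (S' Bad : seq k) (gx : k -> k) (gy : k -> k -> k) (n : nat).
Notation Gk x y := (G k^o (vec3 (x : k^o) (y : k^o) 1)).
Hypothesis G_nz : forall K, is_field K -> forall x y : K,
  wcubic (ellcurve_map (in_alg K) E') (vec3 x y 1) = 0 ->
  (forall s, s \in S' -> x <> s%:A) -> G K (vec3 x y 1) <> 0.
Hypothesis G_form : forall x y, x \notin S' ->
  exists2 d : k, d != 0 & Gk x y = d *: (vec3 (gx x) (gy x y) 1 : 'rV[k]_3).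
Hypothesis G_mul : forall x y (h : on E x y), x \notin Bad -> x \notin S -> fx x \notin S' ->
  exists h' : on E (gx (fx x)) (gy (fx x) (fy x y)), (kpt h : pts E k^o) *+ n = kpt h'.

Lemma G_pt x y (h : on E x y) (P : curve E k^o) : x \notin Bad -> x \notin S -> fx x \notin S' ->
  sval P (Gk (fx x) (fy x y)) -> P = (kpt h : pts E k^o) *+ n.
Proof.
move=> xB xS xS'; have [h' ->] := G_mul h xB xS xS'; have [d d0 ->] := G_form (fy x y) xS'.
move=> hP; apply: (kpoint_eq hP); first by apply: point_scale; exact: kpt_in.
move/eqP; rewrite scaler_eq0 (negPf d0) => /eqP; exact: vec3_neq0.
Qed.

Hypothesis f_fib : forall c, exists T : seq k, forall x, x \notin S -> x \notin T -> fx x != c.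

Lemma f_fibs (cs : seq k) : exists T : seq k, forall x, x \notin S -> x \notin T -> fx x \notin cs.
Proof.
elim: cs => [|c cs [T hT]]; first by exists [::].
have [U hU] := f_fib c; exists (U ++ T) => x xS; rewrite mem_cat negb_or inE negb_or => /andP[xU xT].
by rewrite hU // hT.
Qed.

(** Adding one general point to [p] and [q] brings both into the range of the formula, where n times
    a point is a function of its image. *)
Lemma kernel_mul (p q : pts E k^o) : phi k^o p = phi k^o q -> p *+ n = q *+ n.
Proof.
move=> epq; have [T hT] := f_fibs S'.
have ag (r : curve E k^o) := translate_generic r (Bad ++ S ++ T).
have := agen_and (ag p) (ag q).
move=> /agen_ex[x [y [h [/(_ h)[x1 [y1 [h1 [e1 n1]]]] /(_ h)[x2 [y2 [h2 [e2 n2]]]]]]]].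
rewrite !mem_cat !negb_or in n1 n2; case/and3P: n1 => b1 s1 t1; case/and3P: n2 => b2 s2 t2.
have {}t1 := hT _ s1 t1; have {}t2 := hT _ s2 t2.
have : phi k^o (kpt h1) = phi k^o (kpt h2).
  by rewrite -e1 -e2 !hphi epq.
rewrite (phiE h1 (f_on h1 s1) s1) (phiE h2 (f_on h2 s2) s2) => /kpt_inj[ex ey].
have [h1' m1] := G_mul h1 b1 s1 t1; have [h2' m2] := G_mul h2 b2 s2 t2.
have m12 : (kpt h1 : pts E k^o) *+ n = (kpt h2 : pts E k^o) *+ n.
  by rewrite m1 m2; apply: kpt_eq; rewrite ?ey ?ex.
have s r x' y' (h' : on E x' y') : padd r (kpt h) = kpt h' ->
    (r : pts E k^o) *+ n = (kpt h' : pts E k^o) *+ n - (kpt h : pts E k^o) *+ n.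
  by move=> <-; rewrite -mulrnBl; congr (_ *+ n); apply/esym; exact: (@addrK (pts E k^o)).
by rewrite (s _ _ _ _ e1) (s _ _ _ _ e2) m12.
Qed.

(** General points of [E'] lift to [E], where [G] computes multiplication by n. A lift of a sum
    differs from the sum of the lifts by an element of the kernel, which n kills; so [G] is additive
    and extends to a homomorphism. *)
Theorem dual_ex : exists psi : nattrans (curve E') (curve E), is_hom psi /\
  forall A (p : pts E A), psi A (phi A p) = p *+ n.
Proof.
pose T' := S' ++ map fx Bad.
have prep X Y : on E' X Y -> X \notin T' -> exists x y (h : on E x y) (h' : on E' X Y),
    [/\ x \notin Bad, x \notin S, fx x \notin S', X = fx x /\ Y = fy x y & phi k^o (kpt h) = kpt h'].
  move=> hXY; rewrite mem_cat negb_or => /andP[XS' XB].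
  have [x [y [h xS xB eX eY]]] := solve_point hXY XB; subst X Y.
  by exists x, y, h, hXY; split=> //; exact: phiE.
have [| |x1 y1 x2 y2 h1 h2 n12 /= s1 s2 s3 P Q R hP hQ hR|psi [hpsi psiG]] :=
  @hom_extension k E' E G T'.
- move=> K fK x y h xs; apply: G_nz => // s sS; apply: xs.
  by rewrite mem_cat sS.
- move=> X Y hXY XT; have [x [y [h [h' [xB xS xS' [eX eY] _]]]]] := prep X Y hXY XT.
  rewrite eX eY; have [g _] := G_mul h xB xS xS'; have [d d0 ->] := G_form (fy x y) xS'.
  by have := point_oncone (point_scale (d : k^o) (kpt_in g)); rewrite ellcurve_ko.
- have h3 := sum_on h1 h2 n12; have e12 := padd_kpt h1 h2 n12.
  have [u1 [v1 [g1 [g1' [B1 S1 S1' [ex1 ey1] p1]]]]] := prep _ _ h1 s1.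
  have [u2 [v2 [g2 [g2' [B2 S2 S2' [ex2 ey2] p2]]]]] := prep _ _ h2 s2.
  have [u3 [v3 [g3 [g3' [B3 S3 S3' [ex3 ey3] p3]]]]] := prep _ _ h3 s3.
  rewrite ex1 ey1 in hP; rewrite ex2 ey2 in hQ; rewrite ey3 ex3 in hR.
  rewrite (G_pt g1 B1 S1 S1' hP) (G_pt g2 B2 S2 S2' hQ) (G_pt g3 B3 S3 S3' hR).
  have <- : ((kpt g1 : pts E k^o) + (kpt g2 : pts E k^o)) *+ n = (kpt g3 : pts E k^o) *+ n.
    apply: kernel_mul; rewrite [LHS](homD hphi) p1 p2 p3.
    transitivity (padd (kpt h1) (kpt h2)); last by rewrite e12; exact: kpt_eq.
    by congr (padd _ _); exact: kpt_eq.
  by rewrite mulrnDl.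
exists psi; split=> // A p.
rewrite -(p_mulnE n (nt_id _)) -[LHS]/(nt_comp phi psi A p).
have [T hT] := f_fibs S'.
apply: (@separation k E E (nt_comp phi psi)).
apply: (generic_kpt (agen_notin E (S ++ Bad ++ T))) => x y h.
rewrite !mem_cat !negb_or => /and3P[xS xB xT]; have xS' := hT _ xS xT.
rewrite p_mulnE; apply: (G_pt h xB xS xS').
by rewrite /= (phiE h (f_on h xS) xS); apply: psiG; exact: kpt_in.
Qed.
End Dual.

(** * Explicit isogenies of degrees 2 and 3 *)

Section IsogenyFormulas.
Variable k : fieldType.
Section Phi.
Variables (a z : k).
(** With [b = z ^+ 2 * (a + 2 * z)] the point [(- z ^+ 2, - z ^+ 3)] has order two. This is Velu's
    map [x + t / (x + z ^+ 2)] with [t = z ^+ 3 * (a + 3 * z)], shifted by [- z * (a + 3 * z)] so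
    that the target again has the form [isC]. *)
Definition phx (x : k) := x * (x - z * (a + 2 * z)) / (x + z ^+ 2).
Definition phy (x y : k) := y - z ^+ 3 * (a + 3 * z) * (a * (x + z ^+ 2) + y + z ^+ 3) / (x + z ^+ 2) ^+ 2
  - 3 * z * phx x - z ^+ 3.
(** Abscissa of the dual isogeny: composed with [phx] it is duplication. The formula serves in every
    characteristic; in characteristic 2 its denominator is the constant [a ^+ 2]. *)
Definition dphx (x : k) := ((x + z * (a + 4 * z)) ^+ 2 - 4 * z ^+ 3 * (a + 3 * z)) / (4 * x + (a + 2 * z) ^+ 2) - z ^+ 2.
Definition dphy (x y : k) :=
  let X := x + z * (a + 4 * z) in let Y := y + 3 * z * x + 2 * z ^+ 3 in
  let t := z ^+ 3 * (a + 3 * z) in let b2 := a ^+ 2 - 12 * z ^+ 2 in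
  ((X ^+ 2 + 4 * t) * (2 * Y + a * X) + b2 * X * Y - 2 * a * X ^+ 3 + 8 * a * t * X + 2 * a * t * b2) /
    (4 * x + (a + 2 * z) ^+ 2) ^+ 2 - z ^+ 3.

Lemma ph_on x y : x + z ^+ 2 != 0 -> y ^+ 2 + a * x * y + z ^+ 2 * (a + 2 * z) * y = x ^+ 3 ->
  phy x y ^+ 2 + (a + 6 * z) * phx x * phy x y + z * (a + 2 * z) ^+ 2 * phy x y = phx x ^+ 3.
Proof.
move=> u0 h; apply/subr0_eq.
transitivity ((1 - z ^+ 3 * (a + 3 * z) / (x + z ^+ 2) ^+ 2) ^+ 2 *
  ((y ^+ 2 + a * x * y + z ^+ 2 * (a + 2 * z) * y) - x ^+ 3)); last by rewrite h subrr mulr0.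
by rewrite /phy /phx; field.
Qed.
Lemma ph_neg x y : x + z ^+ 2 != 0 ->
  phy x (- y - a * x - z ^+ 2 * (a + 2 * z)) =
  - phy x y - (a + 6 * z) * phx x - z * (a + 2 * z) ^+ 2.
Proof. by move=> u0; rewrite /phy /phx; field. Qed.

Lemma ph_line b x1 x2 x3 l m : b = z ^+ 2 * (a + 2 * z) ->
  x1 + z ^+ 2 != 0 -> x2 + z ^+ 2 != 0 -> x3 + z ^+ 2 != 0 ->
  x1 + x2 + x3 = l ^+ 2 + a * l ->
  x1 * x2 + x1 * x3 + x2 * x3 = - (2 * l * m + a * m + b * l) ->
  x1 * x2 * x3 = m ^+ 2 + b * m ->
  exists l' m', phx x1 + phx x2 + phx x3 = l' ^+ 2 + (a + 6 * z) * l' /\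
    forall x, x \in [:: x1; x2; x3] -> phy x (l * x + m) = l' * phx x + m'.
Proof.
move=> bE u1 u2 u3 e1 e2 e3; set n := m + z ^+ 3 - l * z ^+ 2.
have v1 : (x1 + z ^+ 2) + (x2 + z ^+ 2) + (x3 + z ^+ 2) = l ^+ 2 + a * l + 3 * z ^+ 2.
  by rewrite -e1; ring.
have v2 : (x1 + z ^+ 2) * (x2 + z ^+ 2) + (x1 + z ^+ 2) * (x3 + z ^+ 2) + (x2 + z ^+ 2) * (x3 + z ^+ 2) =
    - (2 * l * m + a * m + b * l) + 2 * z ^+ 2 * (l ^+ 2 + a * l) + 3 * z ^+ 4.
  by rewrite -e2 -e1; ring.
(* [n] measures how far the line passes from the kernel point [(- z ^+ 2, - z ^+ 3)]; its square is
   the product of the three denominators, so it is nonzero. *)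
have v3 : (x1 + z ^+ 2) * (x2 + z ^+ 2) * (x3 + z ^+ 2) = n ^+ 2.
  transitivity (x1 * x2 * x3 + z ^+ 2 * (x1 * x2 + x1 * x3 + x2 * x3) + z ^+ 4 * (x1 + x2 + x3) + z ^+ 6); first by ring.
  by rewrite e1 e2 e3 /n bE; ring.
have n0 : n != 0.
  by have : n ^+ 2 != 0; [rewrite -v3 !mulf_neq0 | rewrite expf_eq0].
pose t := z ^+ 3 * (a + 3 * z).
exists (l - t / n - 3 * z),
  ((l - t / n) * (z * (a + 4 * z)) + n + t * (l ^+ 2 + a * l + 3 * z ^+ 2) / n - 2 * z ^+ 3); split.
  transitivity (((x1 + z ^+ 2) + (x2 + z ^+ 2) + (x3 + z ^+ 2)) +
    t * ((x1 + z ^+ 2) * (x2 + z ^+ 2) + (x1 + z ^+ 2) * (x3 + z ^+ 2) + (x2 + z ^+ 2) * (x3 + z ^+ 2))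
      / ((x1 + z ^+ 2) * (x2 + z ^+ 2) * (x3 + z ^+ 2)) - 3 * (z * (a + 4 * z))).
    by rewrite /phx /t; field; rewrite u1 u2 u3.
  by rewrite v1 v2 v3 /t bE /n; field.
move=> x xin; have ux : x + z ^+ 2 != 0.
  by move: xin; rewrite !inE => /or3P[] /eqP ->.
(* The deviation of the image from the line is a multiple of the polynomial with roots [x1], [x2],
   [x3]. *)
apply/subr0_eq; transitivity (t / (n * (x + z ^+ 2) ^+ 2) * ((x - x1) * (x - x2) * (x - x3))); last first.
  by move: xin; rewrite !inE => /or3P[] /eqP ->; rewrite subrr ?mul0r ?mulr0 ?mul0r ?mulr0.
have -> : (x - x1) * (x - x2) * (x - x3) =
    x ^+ 3 - (l ^+ 2 + a * l) * x ^+ 2 + (- (2 * l * m + a * m + b * l)) * x - (m ^+ 2 + b * m).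
  by rewrite -e1 -e2 -e3; ring.
by rewrite /phy /phx /t bE /n; field; rewrite -/n n0 ux.
Qed.

Lemma ph_D x : x + z ^+ 2 != 0 -> 4 * phx x + (a + 2 * z) ^+ 2 =
  (4 * x ^+ 3 + (a * x) ^+ 2 + 2 * a * (z ^+ 2 * (a + 2 * z)) * x + (z ^+ 2 * (a + 2 * z)) ^+ 2) / (x + z ^+ 2) ^+ 2.
Proof. by move=> u0; rewrite /phx; field. Qed.
(** The right sides are the tangent formula for doubling, with [l] the slope of the tangent. *)
Lemma dph_ph x y b : b = z ^+ 2 * (a + 2 * z) -> x + z ^+ 2 != 0 -> y ^+ 2 + a * x * y + b * y = x ^+ 3 ->
  2 * y + a * x + b != 0 ->
  let l := (3 * x ^+ 2 - a * y) / (2 * y + a * x + b) in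
  let x2 := l ^+ 2 + a * l - x - x in
  dphx (phx x) = x2 /\ dphy (phx x) (phy x y) = - (l + a) * x2 - (y - l * x) - b.
Proof.
move=> bE u0 h psi0 l x2.
set P := 4 * x ^+ 3 + (a * x) ^+ 2 + 2 * a * b * x + b ^+ 2.
have PE : (2 * y + a * x + b) ^+ 2 = P.
  transitivity (4 * (y ^+ 2 + a * x * y + b * y) + (a * x + b) ^+ 2); first by ring.
  by rewrite h /P; ring.
have P0 : P != 0 by rewrite -PE expf_neq0.
have lE : l = (3 * x ^+ 2 - a * y) * (2 * y + a * x + b) / P.
  by rewrite /l -PE; field.
have x2E : x2 = (x ^+ 4 - a * b * x ^+ 2 - 2 * b ^+ 2 * x) / P.
  apply: (mulIf P0); rewrite divfK //.
  have lp : l * (2 * y + a * x + b) = 3 * x ^+ 2 - a * y by rewrite /l divfK.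
  rewrite -PE; transitivity ((l * (2 * y + a * x + b)) ^+ 2 + a * (l * (2 * y + a * x + b)) * (2 * y + a * x + b) - 2 * x * (2 * y + a * x + b) ^+ 2).
    by rewrite /x2; move: (l) => l0; ring.
  rewrite lp; apply/subr0_eq.
  transitivity (- (a ^+ 2 + 8 * x) * ((y ^+ 2 + a * x * y + b * y) - x ^+ 3)); last by rewrite h subrr mulr0.
  ring.
have Q0 : 4 * phx x + (a + 2 * z) ^+ 2 = P / (x + z ^+ 2) ^+ 2.
  by rewrite ph_D // /P bE.
have P0' : 4 * x ^+ 3 + (a * x) ^+ 2 + 2 * a * (z ^+ 2 * (a + 2 * z)) * x + (z ^+ 2 * (a + 2 * z)) ^+ 2 != 0.
  by rewrite -bE.
have lE' : l = (3 * x ^+ 2 - a * y) * (2 * y + a * x + b) / P.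
  by rewrite /l -PE; field.
split.
  by rewrite x2E /dphx Q0 /phx /P bE; field; rewrite P0'.
apply/subr0_eq.
transitivity (- 2 * a * (x2 - x) / P * (y ^+ 2 + a * x * y + b * y - x ^+ 3)).
  by rewrite lE x2E /dphy Q0 /phy /phx /P bE; field; rewrite P0'.
by rewrite h subrr mulr0.
Qed.
End Phi.

Section Alpha.
Variables (a w : k).
(** Velu's map [x + a b / x + b ^+ 2 / x ^+ 2] with [b = w ^+ 3], whose kernel is generated by
    [(0, 0)], shifted so that the target has the form [isC]. The cube root [w] provides a point of
    order three on the target, so that the step can be repeated. *)
Definition alx (x : k) := x + a * w ^+ 3 / x + w ^+ 6 / x ^+ 2 - a * w - 3 * w ^+ 2.
Definition aly (x y : k) := y - w ^+ 6 * (2 * y + a * x + w ^+ 3) / x ^+ 3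
  - a * w ^+ 3 * (a * x + y) / x ^+ 2 - a * w ^+ 6 / x ^+ 2 - 3 * w * alx x - 4 * w ^+ 3.
Let X (x : k) := x + a * w + 3 * w ^+ 2.
Definition dal_den (x : k) := 3 * X x + a ^+ 2.
Definition dalx (x : k) := (X x ^+ 3 - 9 * a * w ^+ 3 * X x - a ^+ 3 * w ^+ 3 - 27 * w ^+ 6) / dal_den x ^+ 2.
Definition daly (x y : k) := let b := w ^+ 3 in let Y := y + 3 * w * x + 4 * w ^+ 3 in
  ((X x ^+ 3 + a ^+ 2 * X x ^+ 2 + 9 * a * b * X x - a ^+ 3 * b + 54 * b ^+ 2) * Y
   - a * X x ^+ 4 - 13 * b * X x ^+ 3 + 5 * a ^+ 2 * b * X x ^+ 2 + (a ^+ 4 * b + 72 * a * b ^+ 2) * X x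
   + 13 * a ^+ 3 * b ^+ 2 + 27 * b ^+ 3) / dal_den x ^+ 3.

Lemma al_on x y : x != 0 -> y ^+ 2 + a * x * y + w ^+ 3 * y = x ^+ 3 ->
  aly x y ^+ 2 + (a + 6 * w) * alx x * aly x y + w * (a ^+ 2 + 3 * a * w + 9 * w ^+ 2) * aly x y = alx x ^+ 3.
Proof.
move=> x0 h; apply/subr0_eq.
transitivity ((1 - 2 * w ^+ 6 / x ^+ 3 - a * w ^+ 3 / x ^+ 2) ^+ 2 *
  ((y ^+ 2 + a * x * y + w ^+ 3 * y) - x ^+ 3)); last by rewrite h subrr mulr0.
by rewrite /aly /alx; field.
Qed.

Lemma al_neg x y : x != 0 ->
  aly x (- y - a * x - w ^+ 3) = - aly x y - (a + 6 * w) * alx x - w * (a ^+ 2 + 3 * a * w + 9 * w ^+ 2).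
Proof. by move=> x0; rewrite /aly /alx; field. Qed.

Lemma al_line b x1 x2 x3 l m : b = w ^+ 3 ->
  x1 != 0 -> x2 != 0 -> x3 != 0 ->
  x1 + x2 + x3 = l ^+ 2 + a * l ->
  x1 * x2 + x1 * x3 + x2 * x3 = - (2 * l * m + a * m + b * l) ->
  x1 * x2 * x3 = m ^+ 2 + b * m ->
  exists l' m', alx x1 + alx x2 + alx x3 = l' ^+ 2 + (a + 6 * w) * l' /\
    forall x, x \in [:: x1; x2; x3] -> aly x (l * x + m) = l' * alx x + m'.
Proof.
move=> bE u1 u2 u3 e1 e2 e3.
have : m * (m + b) != 0 by rewrite mulrDr -expr2 [m * b]mulrC -e3 !mulf_neq0.
rewrite mulf_eq0 negb_or => /andP[m0]; rewrite bE => n0.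
pose l0 := l + b * l / m - b * (l + a) / (m + b).
pose k0 := b ^+ 2 * (2 * m + b) / (m * (m + b)).
exists (l0 - 3 * w), (m - k0 + (l - l0) * (l ^+ 2 + a * l) + l0 * (a * w + 3 * w ^+ 2) - 4 * w ^+ 3); split.
  transitivity ((x1 + x2 + x3) + a * b * (x1 * x2 + x1 * x3 + x2 * x3) / (x1 * x2 * x3)
    + b ^+ 2 * ((x1 * x2 + x1 * x3 + x2 * x3) ^+ 2 - 2 * (x1 + x2 + x3) * (x1 * x2 * x3)) / (x1 * x2 * x3) ^+ 2
    - 3 * (a * w + 3 * w ^+ 2)).
    by rewrite /alx bE; field; rewrite u1 u2 u3.
  by rewrite e1 e2 e3 /l0 bE (_ : m ^+ 2 + _ = m * (m + w ^+ 3)); [field; rewrite n0 m0 | ring].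
move=> x xin; have x0 : x != 0.
  by move: xin; rewrite !inE => /or3P[] /eqP ->.
apply/subr0_eq; transitivity (((l - l0) * x + k0) / x ^+ 3 * ((x - x1) * (x - x2) * (x - x3))); last first.
  by move: xin; rewrite !inE => /or3P[] /eqP ->; rewrite subrr ?mul0r ?mulr0 ?mul0r ?mulr0.
have -> : (x - x1) * (x - x2) * (x - x3) =
    x ^+ 3 - (l ^+ 2 + a * l) * x ^+ 2 + (- (2 * l * m + a * m + b * l)) * x - (m ^+ 2 + b * m).
  by rewrite -e1 -e2 -e3; ring.
by rewrite /aly /alx /l0 /k0 bE; field; rewrite x0 n0 m0.
Qed.

Lemma al_D x : x != 0 -> dal_den (alx x) =
  (3 * x ^+ 3 + (a * x) ^+ 2 + 3 * a * w ^+ 3 * x + 3 * w ^+ 6) / x ^+ 2.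
Proof. by move=> x0; rewrite /dal_den /X /alx; field. Qed.

(** Tripling is computed as [2 P + P], with [x2] and [y2] the coordinates of the double; the
    condition on [dal_den] is what makes [x2] differ from [x]. *)
Lemma dal_al x y b : b = w ^+ 3 -> x != 0 -> y ^+ 2 + a * x * y + b * y = x ^+ 3 ->
  2 * y + a * x + b != 0 -> dal_den (alx x) != 0 ->
  let l := (3 * x ^+ 2 - a * y) / (2 * y + a * x + b) in
  let x2 := l ^+ 2 + a * l - x - x in let y2 := - (l + a) * x2 - (y - l * x) - b in
  x2 != x /\
  let n := (y - y2) / (x - x2) in let x3 := n ^+ 2 + a * n - x2 - x in
  dalx (alx x) = x3 /\ daly (alx x) (aly x y) = - (n + a) * x3 - (y2 - n * x2) - b.
Proof.
move=> bE u0 h psi0 D0 l x2 y2.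
set P := 4 * x ^+ 3 + (a * x) ^+ 2 + 2 * a * b * x + b ^+ 2.
set T := 3 * x ^+ 3 + (a * x) ^+ 2 + 3 * a * b * x + 3 * b ^+ 2.
have T0 : T != 0.
  by apply: contraNneq D0; rewrite /T bE => T0; rewrite al_D // -exprM in T0 *; rewrite T0 mul0r.
have PE : (2 * y + a * x + b) ^+ 2 = P.
  transitivity (4 * (y ^+ 2 + a * x * y + b * y) + (a * x + b) ^+ 2); first by ring.
  by rewrite h /P; ring.
have P0 : P != 0 by rewrite -PE expf_neq0.
have lE : l = (3 * x ^+ 2 - a * y) * (2 * y + a * x + b) / P.
  by rewrite /l -PE; field.
have lp : l * (2 * y + a * x + b) = 3 * x ^+ 2 - a * y by rewrite /l divfK.
have x2E : x2 = x - x * T / P.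
  apply: (mulIf P0); rewrite [RHS]mulrBl divfK //.
  rewrite -{1}PE; transitivity ((l * (2 * y + a * x + b)) ^+ 2 + a * (l * (2 * y + a * x + b)) * (2 * y + a * x + b) - 2 * x * (2 * y + a * x + b) ^+ 2).
    by rewrite /x2; move: (l) => l0; ring.
  rewrite lp; apply/subr0_eq.
  transitivity (- (a ^+ 2 + 8 * x) * ((y ^+ 2 + a * x * y + b * y) - x ^+ 3)); last by rewrite h subrr mulr0.
  by rewrite /P /T; ring.
have n2 : x2 != x.
  by rewrite -subr_eq0 x2E addrAC subrr sub0r oppr_eq0 !mulf_neq0 // invr_eq0.
split=> // n x3.
pose d := (2 * y + a * x + b) * P / (x * T).
have nE : n = - l - a + d.
  have xd : x - x2 = x * T / P by rewrite x2E; ring.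
  rewrite /n; have -> : y - y2 = - (l + a) * (x - x2) + (2 * y + a * x + b).
    by rewrite /y2; move: (l) (x2) => *; ring.
  by rewrite xd /d; move: (l) (P) (T) P0 T0 => *; field; apply/and3P.
have x3E : x3 = x + P ^+ 3 / (x * T) ^+ 2 - (6 * x ^+ 2 + a ^+ 2 * x + a * b) * P / (x * T).
  transitivity (x + d ^+ 2 - (2 * (l * (2 * y + a * x + b)) + a * (2 * y + a * x + b)) * P / (x * T)).
    rewrite /x3 nE /x2 /d; move: (l) (P) (T) T0 => *; field; exact/andP.
  rewrite lp /d; have -> : ((2 * y + a * x + b) * P / (x * T)) ^+ 2 = P ^+ 3 / (x * T) ^+ 2.
    by rewrite !exprMn PE exprVn exprMn exprS.
  by congr (_ - _ / _); ring.
have T0' : 3 * x ^+ 3 + (a * x) ^+ 2 + 3 * a * w ^+ 3 * x + 3 * w ^+ 6 != 0.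
  by move: T0; rewrite /T bE -exprM.
have P0' : 4 * x ^+ 3 + (a * x) ^+ 2 + 2 * a * w ^+ 3 * x + w ^+ 6 != 0.
  by move: P0; rewrite /P bE -exprM.
split.
  by rewrite x3E /dalx al_D // /X /alx /P /T bE; field; rewrite ?T0' ?P0'.
apply/subr0_eq.
have -> : - (n + a) * x3 - (y2 - n * x2) - b = - n * (x3 - x) - a * x3 - y - b.
  suff : y2 - n * x2 = y - n * x by move=> ->; move: (n) (x3) => *; ring.
  apply/subr0_eq; transitivity (n * (x - x2) - (y - y2)); first by move: (n) (x2) (y2) => *; ring.
  by rewrite /n divfK ?subrr // subr_eq0 eq_sym.
transitivity (2 * a * (x3 - x) / P * (y ^+ 2 + a * x * y + b * y - x ^+ 3)).
  rewrite nE lE /d x3E /daly al_D // /X /aly /alx /P /T bE; field.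
  by rewrite -exprM P0' T0'.
by rewrite h subrr mulr0.
Qed.
End Alpha.
End IsogenyFormulas.

Section Laws.
Variables (k : comNzRingType).

Definition ph_vec (R : comNzRingType) (a z : R) (u : 'rV[R]_3) : 'rV[R]_3 :=
  let X := u 0 0 in let Y := u 0 1 in let Z := u 0 ord_max in
  let U := X + z ^+ 2 * Z in let G := X * (X - z * (a + 2 * z) * Z) * U in
  vec3 G (Y * U ^+ 2 - z ^+ 3 * (a + 3 * z) * Z ^+ 2 * (a * U + Y + z ^+ 3 * Z) - 3 * z * G - z ^+ 3 * U ^+ 2 * Z)
    (U ^+ 2 * Z).

Definition dph_vec (R : comNzRingType) (a z : R) (u : 'rV[R]_3) : 'rV[R]_3 :=
  let Z := u 0 ord_max in
  let D := 4 * u 0 0 + (a + 2 * z) ^+ 2 * Z in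
  let X := u 0 0 + z * (a + 4 * z) * Z in let Y := u 0 1 + 3 * z * u 0 0 + 2 * z ^+ 3 * Z in
  let t := z ^+ 3 * (a + 3 * z) in let b2 := a ^+ 2 - 12 * z ^+ 2 in
  vec3 ((X ^+ 2 - 4 * t * Z ^+ 2) * D - z ^+ 2 * D ^+ 2 * Z)
    ((X ^+ 2 + 4 * t * Z ^+ 2) * (2 * Y + a * X) + b2 * X * Y * Z - 2 * a * X ^+ 3 + 8 * a * t * X * Z ^+ 2
     + 2 * a * t * b2 * Z ^+ 3 - z ^+ 3 * D ^+ 2 * Z)
    (D ^+ 2 * Z).

Definition al_vec (R : comNzRingType) (a w : R) (u : 'rV[R]_3) : 'rV[R]_3 :=
  let X := u 0 0 in let Y := u 0 1 in let Z := u 0 ord_max in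
  let G := X ^+ 4 + a * w ^+ 3 * X ^+ 2 * Z ^+ 2 + w ^+ 6 * X * Z ^+ 3 - (a * w + 3 * w ^+ 2) * X ^+ 3 * Z in
  vec3 G (Y * X ^+ 3 - w ^+ 6 * (2 * Y + a * X + w ^+ 3 * Z) * Z ^+ 3 - a * w ^+ 3 * (a * X + Y) * X * Z ^+ 2
          - a * w ^+ 6 * X * Z ^+ 3 - 3 * w * G - 4 * w ^+ 3 * X ^+ 3 * Z)
    (X ^+ 3 * Z).

Definition dal_vec (R : comNzRingType) (a w : R) (u : 'rV[R]_3) : 'rV[R]_3 :=
  let Z := u 0 ord_max in
  let X := u 0 0 + (a * w + 3 * w ^+ 2) * Z in let Y := u 0 1 + 3 * w * u 0 0 + 4 * w ^+ 3 * Z in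
  let b := w ^+ 3 in let D := 3 * X + a ^+ 2 * Z in
  vec3 ((X ^+ 3 - 9 * a * b * X * Z ^+ 2 - (a ^+ 3 * b + 27 * w ^+ 6) * Z ^+ 3) * D)
    ((X ^+ 3 + a ^+ 2 * X ^+ 2 * Z + 9 * a * b * X * Z ^+ 2 + (- a ^+ 3 * b + 54 * b ^+ 2) * Z ^+ 3) * Y
     - a * X ^+ 4 - 13 * b * X ^+ 3 * Z + 5 * a ^+ 2 * b * X ^+ 2 * Z ^+ 2
     + (a ^+ 4 * b + 72 * a * b ^+ 2) * X * Z ^+ 3
     + (13 * a ^+ 3 * b ^+ 2 + 27 * b ^+ 3) * Z ^+ 4)
    (D ^+ 3 * Z).

Let mapE (R S : comNzRingType) (f : {rmorphism R -> S}) (u : 'rV[R]_3) i : map_mx f u 0 i = f (u 0 i).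
Proof. by rewrite mxE. Qed.

Lemma map_ph_vec (R S : comNzRingType) (f : {rmorphism R -> S}) a z a' z' u :
  f a = a' -> f z = z' -> map_mx f (ph_vec a z u) = ph_vec a' z' (map_mx f u).
Proof.
by move=> <- <-; rewrite /ph_vec map_vec3 !mapE; congr (vec3 _ _ _); ring.
Qed.
Lemma map_dph_vec (R S : comNzRingType) (f : {rmorphism R -> S}) a z a' z' u :
  f a = a' -> f z = z' -> map_mx f (dph_vec a z u) = dph_vec a' z' (map_mx f u).
Proof.
by move=> <- <-; rewrite /dph_vec map_vec3 !mapE; congr (vec3 _ _ _); ring.
Qed.
Lemma map_al_vec (R S : comNzRingType) (f : {rmorphism R -> S}) a z a' z' u :
  f a = a' -> f z = z' -> map_mx f (al_vec a z u) = al_vec a' z' (map_mx f u).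
Proof.
by move=> <- <-; rewrite /al_vec map_vec3 !mapE; congr (vec3 _ _ _); ring.
Qed.
Lemma map_dal_vec (R S : comNzRingType) (f : {rmorphism R -> S}) a z a' z' u :
  f a = a' -> f z = z' -> map_mx f (dal_vec a z u) = dal_vec a' z' (map_mx f u).
Proof.
by move=> <- <-; rewrite /dal_vec map_vec3 !mapE; congr (vec3 _ _ _); ring.
Qed.

Variables a z : k.
Program Definition ph_law := @Law1 k (fun A u => ph_vec (a%:A : A) z%:A u) 3 _ _.
Next Obligation. apply: map_ph_vec; exact: lrmorph_alg. Qed.
Next Obligation. by move=> *; rewrite /ph_vec scale_vec3 !mxE; congr (vec3 _ _ _); ring. Qed.
Program Definition dph_law := @Law1 k (fun A u => dph_vec (a%:A : A) z%:A u) 3 _ _.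
Next Obligation. apply: map_dph_vec; exact: lrmorph_alg. Qed.
Next Obligation. by move=> *; rewrite /dph_vec scale_vec3 !mxE; congr (vec3 _ _ _); ring. Qed.
Program Definition al_law := @Law1 k (fun A u => al_vec (a%:A : A) z%:A u) 4 _ _.
Next Obligation. apply: map_al_vec; exact: lrmorph_alg. Qed.
Next Obligation. by move=> *; rewrite /al_vec scale_vec3 !mxE; congr (vec3 _ _ _); ring. Qed.
Program Definition dal_law := @Law1 k (fun A u => dal_vec (a%:A : A) z%:A u) 4 _ _.
Next Obligation. apply: map_dal_vec; exact: lrmorph_alg. Qed.
Next Obligation. by move=> *; rewrite /dal_vec scale_vec3 !mxE; congr (vec3 _ _ _); ring. Qed.
End Laws.

(** Doubling through [(P + a) + (P - a)], with [P] at the origin: [d] is the abscissa of [a], [m]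
    the slope from [P] to [a], and [N / D] the slope of the tangent at [P]. *)
Lemma double_origin (K : fieldType) (a1 A D d m : K) : D != 0 -> d != 0 ->
  let N := m * D - d * (A + d - m ^+ 2 - a1 * m) in
  let xs := m ^+ 2 + a1 * m - A - d in let ys := - (m + a1) * xs - D in
  let m' := - m - a1 - D / d in
  let xr := m' ^+ 2 + a1 * m' - A - d in let yr := - (m' + a1) * xr - D in
  xs != xr ->
  let l := (yr - ys) / (xr - xs) in let n := N / D in
  let x := n ^+ 2 + a1 * n - A in
  l ^+ 2 + a1 * l - A - xs - xr = x /\
  - (l + a1) * x - (ys - l * xs) - D = - (n + a1) * x - D.
Proof.
move=> D0 d0 N xs ys m' xr yr nsr l n x.
have e : xr - xs = D * (D + 2 * m * d + a1 * d) / d ^+ 2.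
  by rewrite /xr /xs /m'; field.
have z : D + 2 * m * d + a1 * d != 0.
  apply: contraNneq nsr => z; rewrite eq_sym -subr_eq0 e z mulr0 mul0r //.
have lE : l = (- (m' + a1) * xr + (m + a1) * xs) * d ^+ 2 / (D * (D + 2 * m * d + a1 * d)).
  by rewrite /l e /yr /ys; field; rewrite z D0 d0.
split; rewrite /x /n /N lE /yr /ys /xr /xs /m'; field; by rewrite ?z ?D0 ?d0.
Qed.

(** * Collinear triples and the group law *)

Section Collinear.
Variables (k : closedFieldType) (E : ellcurve k).
Notation on x y := (wcubic E (vec3 x y 1) = 0).
Let fk := @field_closed k.

Definition dblm (x y : k) := (3 * x ^+ 2 + 2 * ec_a2 E * x + ec_a4 E - ec_a1 E * y) /
  (2 * y + ec_a1 E * x + ec_a3 E).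

(** The formula for the sum is available for distinct abscissas, so [P + P] is rewritten as
    [(P + a) + (P - a)] for a suitable [a]. *)
Lemma padd_double x y (h : on x y) : 2 * y + ec_a1 E * x + ec_a3 E != 0 ->
  let l := dblm x y in
  exists h' : on (sumx E l x x) (sumy E l x y (sumx E l x x)), padd (kpt h) (kpt h) = kpt h'.
Proof.
set D := 2 * y + _ + _ => D0 l.
have [xa [ya [ha da]]] := nontorsion_ex E [:: x]; rewrite inE => na.
have nxa : x != xa by rewrite eq_sym.
have d0 : xa - x != 0 by rewrite subr_eq0.
have ha' := on_neg ha; set ya' := - ya - _ - _ in ha'.
pose s := padd (kpt h) (kpt ha); pose r := padd (kpt h) (kpt ha').
have e : padd (kpt h) (kpt h) = padd s r.
  rewrite /s /r -padd_assoc [padd (kpt ha) _]padd_comm -[padd (padd _ _) _]padd_assoc.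
  have -> : kpt ha' = pneg (kpt ha) by rewrite pneg_kpt; apply: kpt_eq.
  by rewrite [padd (pneg _) _]padd_comm padd_neg padd_origin.
rewrite e /s /r (padd_kpt h ha nxa) (padd_kpt h ha' nxa).
set m := slope x y xa ya; set m' := slope x y xa ya'.
pose A := ec_a2 E + 3 * x; pose d := xa - x.
have yaE : ya = y + m * d by rewrite /m /slope divfK // addrC subrK.
have m'E : m' = - m - ec_a1 E - D / d.
  apply: (mulIf d0); rewrite /m' /slope divfK //.
  have -> : (- m - ec_a1 E - D / d) * (xa - x) = - m * d - ec_a1 E * d - D.
    by rewrite -/d mulrBl mulrBl divfK.
  by rewrite /ya' yaE /D /d; move: (m) => m0; ring.
have lE : l = (m * D - d * (A + d - m ^+ 2 - ec_a1 E * m)) / D.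
  apply: (mulIf D0); rewrite /l /dblm -/D !divfK //.
  have hw := h; have haw := ha; rewrite !waffE yaE in hw haw.
  have xaE : xa = x + d by rewrite /d addrC subrK.
  apply: (mulfI d0); rewrite -/d /A; apply/subr0_eq; rewrite xaE in haw.
  move: (m) (d) haw => m0 d1 haw.
  transitivity (- ((y + m0 * d1) ^+ 2 + ec_a1 E * (x + d1) * (y + m0 * d1) + ec_a3 E * (y + m0 * d1) -
       ((x + d1) ^+ 3 + ec_a2 E * (x + d1) ^+ 2 + ec_a4 E * (x + d1) + ec_a6 E)) +
    (y ^+ 2 + ec_a1 E * x * y + ec_a3 E * y - (x ^+ 3 + ec_a2 E * x ^+ 2 + ec_a4 E * x + ec_a6 E))).
    by rewrite /D; ring.
  by rewrite haw hw; ring.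
have nsr : sumx E m x xa != sumx E m' x xa.
  rewrite -subr_eq0 (_ : _ - _ = - D * (D + 2 * m * d + ec_a1 E * d) / d ^+ 2).
    rewrite !mulf_neq0 ?oppr_eq0 ?invr_eq0 ?expf_neq0 //.
    apply/eqP => z; apply: da; rewrite /dwY !vec3E -[RHS]z yaE /D /d; ring.
  by rewrite /sumx m'E; field.
rewrite (padd_kpt (sum_on h ha nxa) (sum_on h ha' nxa) nsr).
have := @double_origin _ (ec_a1 E) A D d m D0 d0; rewrite /= -m'E -lE.
have xsE : m ^+ 2 + ec_a1 E * m - A - d = sumx E m x xa - x by rewrite /sumx /A /d; ring.
have xrE : m' ^+ 2 + ec_a1 E * m' - A - d = sumx E m' x xa - x by rewrite /sumx /A /d; ring.
have ysE : - (m + ec_a1 E) * (sumx E m x xa - x) - D = sumy E m x y (sumx E m x xa) - y.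
  by rewrite /sumy /D; ring.
have yrE : - (m' + ec_a1 E) * (sumx E m' x xa - x) - D = sumy E m' x y (sumx E m' x xa) - y.
  by rewrite /sumy /D; ring.
rewrite xsE xrE ysE yrE (inj_eq (addIr _)) => /(_ nsr).
rewrite -/m -/m'; set xs := sumx E m x xa; set xr := sumx E m' x xa.
set ys := sumy E m x y xs; set yr := sumy E m' x y xr.
have -> : (yr - y - (ys - y)) / (xr - x - (xs - x)) = slope xs ys xr yr.
  by rewrite /slope; congr (_ / _); ring.
set l3 := slope xs ys xr yr => -[e1 e2].
have E1 : sumx E l3 xs xr = sumx E l x x.
  apply: (addIr (- x)); transitivity (l3 ^+ 2 + ec_a1 E * l3 - A - (xs - x) - (xr - x)).
    by rewrite /sumx /A; ring.
  by rewrite e1 /sumx /A; ring.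
have E2 : sumy E l3 xs ys (sumx E l3 xs xr) = sumy E l x y (sumx E l x x).
  rewrite E1; apply: (addIr (- y)).
  transitivity (- (l3 + ec_a1 E) * (l ^+ 2 + ec_a1 E * l - A) - (ys - y - l3 * (xs - x)) - D).
    by rewrite /sumy /sumx /A /D; ring.
  by rewrite e2 /sumy /sumx /A /D; ring.
have h' : on (sumx E l x x) (sumy E l x y (sumx E l x x)).
  by rewrite -E2 -E1; apply: sum_on => //; apply: sum_on.
by exists h'; apply: kpt_eq.
Qed.

Lemma row2_mul (t : 'rV[k]_2) (u v : 'rV[k]_3) :
  t *m col_mx u v = t 0 0 *: u + t 0 1 *: v.
Proof.
have tE : t = row_mx (t 0 0)%:M (t 0 1)%:M.
  apply/rowP => i; rewrite mxE; case: splitP => j ej; rewrite !mxE !ord1 eqxx /= mulr1n;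
    congr (t 0 _); apply: val_inj; by rewrite /= ej ord1.
transitivity (row_mx (t 0 0)%:M (t 0 1)%:M *m col_mx u v).
  by congr (_ *m _).
by rewrite mul_row_col !mul_scalar_mx.
Qed.

Definition vec2 (a b : k) : 'rV[k]_2 := \row_i (nth 0 [:: a; b] i).
Lemma vec2E a b : (vec2 a b 0 0 = a) * (vec2 a b 0 1 = b).
Proof. by rewrite !mxE. Qed.

Lemma vec2_neq0 a b : (a != 0) || (b != 0) -> vec2 a b != 0.
Proof.
apply: contraTneq => e; have := congr1 (fun w : 'rV_2 => w 0 0) e.
have := congr1 (fun w : 'rV_2 => w 0 1) e; rewrite !mxE /= => -> ->.
by rewrite eqxx.
Qed.

Lemma collinearI (P Q R : curve E k^o) (u v : 'rV[k]_3) (a0 a1 b0 b1 c0 c1 : k) :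
  ~ par u v ->
  (a0 != 0) || (a1 != 0) -> (b0 != 0) || (b1 != 0) -> (c0 != 0) || (c1 != 0) ->
  sval P (a0 *: u + a1 *: v : 'rV[k]_3) -> sval Q (b0 *: u + b1 *: v : 'rV[k]_3) ->
  sval R (c0 *: u + c1 *: v : 'rV[k]_3) ->
  (forall s t : k, wcubic E (s *: u + t *: v) =
    (s * a1 - t * a0) * (s * b1 - t * b0) * (s * c1 - t * c0)) ->
  collinear P Q R.
Proof.
move=> np na nb nc hP hQ hR hw.
exists (col_mx u v), (vec2 a0 a1), (vec2 b0 b1), (vec2 c0 c1); split.
- apply: inj_row_free => t; rewrite row2_mul => e.
  have e' : t 0 0 *: u = (- t 0 1) *: v by apply/subr0_eq; rewrite -scaleNr opprK.
  have [t0 t1] := npar_comb fk np e'.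
  apply/rowP => i; rewrite mxE; case: i => -[|[|//]] hi.
    by rewrite -[RHS]t0; congr (t 0 _); apply: val_inj.
  by apply/eqP; rewrite -oppr_eq0 -t1; apply/eqP; congr (- t 0 _); apply: val_inj.
- by split; apply: vec2_neq0.
- by split; rewrite row2_mul !vec2E.
- by move=> t; rewrite row2_mul hw /det2 !vec2E.
Qed.

Lemma kvec (P : curve E k^o) : exists u : 'rV[k]_3, [/\ sval P u, u <> 0 & wcubic E u = 0].
Proof.
have [u [Pu u0]] := field_point_nz [the {lrmorphism k^o -> k^o} of idfun] P.
exists u; split=> //; first by move=> e; apply: u0; rewrite e; apply/rowP => i; rewrite !mxE.
by have := point_oncone Pu; rewrite ellcurve_ko.
Qed.

Lemma third_in (P Q : curve E k^o) (u v : 'rV[k]_3) : sval P u -> sval Q v ->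
  sval (pneg (padd P Q)) (chord E u v).
Proof.
move=> Pu Qv; have <- : negv (ellcurve_map (in_alg k^o) E) (addlaw (E := E) None k^o u v) = chord E u v.
  by rewrite negv_ko /= ellcurve_ko negvK.
exact: pneg_in (padd_in None Pu Qv).
Qed.

(** Four kinds of lines occur: the chord of distinct points, the line at infinity for the flex at
    the origin, the vertical line at a point of order two, and otherwise the tangent of slope
    [dblm]. *)
Lemma collinear_ex (P Q : curve E k^o) : collinear P Q (pneg (padd P Q)).
Proof.
have [ePQ|nPQ] := pselect (P = Q); last first.
  have [u [Pu u0 wu]] := kvec P; have [v [Qv v0 wv]] := kvec Q.
  have np : ~ par u v.
    by move=> /(par_multiple fk u0)[c vc]; apply: nPQ; apply: (kpoint_eq _ Qv v0);
      rewrite vc; apply: (@point_scale _ E k^o P (c : k^o)).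
  have nz := chord_neq0 fk wu wv np.
  apply: (@collinearI P Q _ u v 1 0 0 1 (dw E v u) (- dw E u v)) => //.
  - by rewrite oner_eq0.
  - by rewrite oner_eq0 orbT.
  - apply: contraPT nz; rewrite negb_or !negbK oppr_eq0 => /andP[/eqP B /eqP A].
    by rewrite /chord A B !scale0r subrr => /(_ erefl).
  - by rewrite scale1r scale0r addr0.
  - by rewrite scale1r scale0r add0r.
  - by have := third_in Pu Qv; rewrite /chord scaleNr.
  - by move=> s t; rewrite wcubic_comb wu wv; ring.
rewrite -{}ePQ {Q}; have [->|[x [y [h ->]]]] := kpoint_cases P.
  have eO : pneg (padd (origin E k^o) (origin E k^o)) = origin E k^o.
    rewrite padd_origin -[LHS]padd_origin padd_comm; exact: padd_neg.
  apply: (@collinearI _ _ _ (vec3 1 0 0) (vec3 0 1 0) 0 1 0 1 0 (-1)).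
  - by move=> /(_ 0 1); rewrite !vec3E mulr1 mulr0 => /eqP; rewrite oner_eq0.
  - by rewrite oner_eq0 orbT.
  - by rewrite oner_eq0 orbT.
  - by rewrite oppr_eq0 oner_eq0 orbT.
  - by rewrite scale0r scale1r add0r; exact: (@origin_in k E k^o).
  - by rewrite scale0r scale1r add0r; exact: (@origin_in k E k^o).
  - rewrite eO scale0r add0r scale_vec3 !mulr0; exact: (@origin_in k E k^o).
  - by move=> s t; rewrite /wcubic !mxE /=; ring.
have [D0|D0] := eqVneq (2 * y + ec_a1 E * x + ec_a3 E) 0.
  have eP : pneg (kpt h) = kpt h.
    rewrite pneg_kpt; apply: kpt_eq => //; apply/subr0_eq.
    by rewrite -oppr0 -[in RHS]D0; ring.
  have -> : pneg (padd (kpt h) (kpt h)) = origin E k^o.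
    by rewrite -{2}eP padd_neg -[LHS]padd_origin padd_comm padd_neg.
  apply: (@collinearI _ _ _ (vec3 x y 1) (vec3 0 1 0) 1 0 1 0 0 1).
  - by move=> /(_ 1 ord_max); rewrite !vec3E mulr0 mul1r => /esym/eqP; rewrite oner_eq0.
  - by rewrite oner_eq0.
  - by rewrite oner_eq0.
  - by rewrite oner_eq0 orbT.
  - by rewrite scale0r scale1r addr0; exact: kpt_in.
  - by rewrite scale0r scale1r addr0; exact: kpt_in.
  - by rewrite scale0r scale1r add0r; exact: (@origin_in k E k^o).
  - move=> s t; rewrite wcubic_comb h.
    transitivity (s ^+ 2 * t * (2 * y + ec_a1 E * x + ec_a3 E) + s * t ^+ 2).
      by rewrite /dw /dwX /dwY /dwZ /wcubic !vec3E; ring.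
    by rewrite D0; ring.
have [h' e] := padd_double h D0; set l := dblm x y in h' e; set x3 := sumx E l x x in h' e.
rewrite e pneg_kpt.
apply: (@collinearI _ _ _ (vec3 x y 1) (vec3 1 l 0) 1 0 1 0 1 (x3 - x)).
- by move=> /(_ 0 ord_max); rewrite !vec3E mulr0 mul1r => /esym/eqP; rewrite oner_eq0.
- by rewrite oner_eq0.
- by rewrite oner_eq0.
- by rewrite oner_eq0.
- by rewrite scale0r scale1r addr0; exact: kpt_in.
- by rewrite scale0r scale1r addr0; exact: kpt_in.
- have -> : 1 *: vec3 x y 1 + (x3 - x) *: vec3 1 l 0 =
    vec3 x3 (- sumy E l x y x3 - ec_a1 E * x3 - ec_a3 E) 1.
    by apply: row3P; rewrite !mxE /= /sumy; ring.
  exact: kpt_in.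
- move=> s t; rewrite wcubic_comb h.
  have lD : l * (2 * y + ec_a1 E * x + ec_a3 E) =
     3 * x ^+ 2 + 2 * ec_a2 E * x + ec_a4 E - ec_a1 E * y by rewrite /l /dblm divfK.
  transitivity (s ^+ 2 * t * (l * (2 * y + ec_a1 E * x + ec_a3 E) -
     (3 * x ^+ 2 + 2 * ec_a2 E * x + ec_a4 E - ec_a1 E * y)) + s * t ^+ 2 * (l ^+ 2 + ec_a1 E * l - ec_a2 E - 3 * x) - t ^+ 3).
    by move: (l) => l0; rewrite /dw /dwX /dwY /dwZ /wcubic !vec3E; ring.
  by rewrite lD /x3 /sumx; move: (l) => l0; ring.
Qed.

Lemma collinear_perm (P Q R : curve E k^o) : collinear P Q R -> collinear P R Q /\ collinear Q P R.
Proof.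
move=> [M [a [b [c [fM [a0 b0 c0] [hP hQ hR] hw]]]]]; split.
  by exists M, a, c, b; split=> // t; rewrite hw; ring.
by exists M, b, a, c; split=> // t; rewrite hw; ring.
Qed.

Lemma rowM_neq0 (M : 'M[k]_(2, 3)) (s : 'rV[k]_2) : row_free M -> s != 0 -> s *m M <> 0.
Proof.
by move=> fM s0 e; move/eqP: s0; apply; apply: (row_free_inj fM); rewrite mul0mx.
Qed.

Lemma det2_0 (a b : 'rV[k]_2) : det2 a b = 0 -> a != 0 -> exists c, b = c *: a.
Proof.
move=> D0 a0.
have E0 (hi : (0 < 2)%N) : Ordinal hi = 0 :> 'I_2 by apply: val_inj.
have E1 (hi : (1 < 2)%N) : Ordinal hi = 1 :> 'I_2 by apply: val_inj.
have [z|z] := eqVneq (a 0 0) 0.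
  have a1 : a 0 1 != 0.
    apply: contraNneq a0 => a1; apply/eqP/rowP => i; rewrite mxE.
    by case: i => -[|[|//]] hi; rewrite ?E0 ?E1.
  exists (b 0 1 / a 0 1); apply/rowP => i; rewrite !mxE.
  have b00 : b 0 0 = 0.
    by move: D0; rewrite /det2 z mul0r sub0r => /eqP; rewrite oppr_eq0 mulf_eq0 (negPf a1) => /eqP.
  by case: i => -[|[|//]] hi; rewrite ?E0 ?E1 ?b00 ?z ?mulr0 // divfK.
exists (b 0 0 / a 0 0); apply/rowP => i; rewrite !mxE.
case: i => -[|[|//]] hi; rewrite ?E0 ?E1 ?divfK //.
apply: (mulfI z); move/eqP: D0; rewrite /det2 subr_eq0 => /eqP ->.
by rewrite mulrCA [a 0 1 * _]mulrC !mulrA divfK // mulrC.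
Qed.

Lemma collinear_neq (P Q R : curve E k^o) : collinear P Q R -> P <> Q -> R = pneg (padd P Q).
Proof.
move=> [M [a [b [c [fM [a0 b0 c0] [hP hQ hR] hw]]]]] nPQ.
have inj (s : 'rV[k]_2) : s != 0 -> s *m M <> 0 by exact: rowM_neq0.
set D := det2 a b.
have D0 : D != 0.
  apply/eqP => D0; apply: nPQ; apply: (kpoint_eq _ hQ (inj b b0)).
  have [r ->] := det2_0 D0 a0; rewrite -scalemxAl; exact: (@point_scale _ E k^o P).
have wu : wcubic E (a *m M) = 0 by rewrite hw /det2; ring.
have wv : wcubic E (b *m M) = 0 by rewrite hw /det2; ring.
have comb s t : wcubic E (s *: (a *m M) + t *: (b *m M)) =
   - (s * t * D ^+ 2 * (s * det2 a c + t * det2 b c)).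
  by rewrite !scalemxAl -mulmxDl hw /D /det2 !mxE; ring.
have comb2 s t := etrans (esym (wcubic_comb E s t (a *m M) (b *m M))) (comb s t).
set A := dw E (a *m M) (b *m M) in comb2; set B := dw E (b *m M) (a *m M) in comb2.
have sAB s t : s ^+ 2 * t * A + s * t ^+ 2 * B = - (s * t * D ^+ 2 * (s * det2 a c + t * det2 b c)).
  by rewrite -(comb2 s t) wu wv; move: (A) (B) => A0 B0; ring.
(* A scalar other than 0 and 1 separates the coefficients of [s ^+ 2 * t] and [s * t ^+ 2]. *)
have [x] := notin_ex [:: 0; 1 : k]; rewrite !inE negb_or => /andP[x0 x1].
have f1 := sAB 1 1; have f2 := sAB x 1.
have AE : A = - (D ^+ 2 * det2 a c).
  apply: (mulfI (_ : x * (x - 1) != 0)); first by rewrite mulf_neq0 // subr_eq0.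
  transitivity ((x ^+ 2 * 1 * A + x * 1 ^+ 2 * B) - x * (1 ^+ 2 * 1 * A + 1 * 1 ^+ 2 * B)).
    by move: (A) (B) => A0 B0; ring.
  by rewrite f1 f2; move: (D) => D1; ring.
have BE : B = - (D ^+ 2 * det2 b c).
  by apply: (addrI A); rewrite {2}AE -[LHS]mul1r; transitivity (1 ^+ 2 * 1 * A + 1 * 1 ^+ 2 * B);
    [move: (A) (B) => A0 B0; ring | rewrite f1; move: (D) => D1; ring].
have chE : chord E (a *m M) (b *m M) = D ^+ 3 *: (c *m M).
  rewrite /chord -/A -/B AE BE !scalemxAl -mulmxBl; congr (_ *m M).
  apply/rowP => i; rewrite !mxE /D /det2; case: i => -[|[|//]] hi.
    by rewrite (_ : Ordinal hi = 0); [ring | exact: val_inj].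
  by rewrite (_ : Ordinal hi = 1); [ring | exact: val_inj].
have s := third_in hP hQ; rewrite chE in s.
apply: (kpoint_eq _ s); first exact: (@point_scale _ E k^o R).
by move/eqP; rewrite scaler_eq0 expf_eq0 /= (negPf D0) => /eqP; apply: inj.
Qed.

(** On the line the cubic has a double zero at [a]; evaluation along [s a + b] at three values of
    [s] isolates the coefficient of [s ^+ 2]. *)
Lemma collinear_tangent (M : 'M[k]_(2, 3)) (a b c : 'rV[k]_2) :
  (forall t, wcubic E (t *m M) = det2 t a * det2 t a * det2 t c) ->
  dw E (a *m M) (b *m M) = 0.
Proof.
move=> hw; set A := dw E _ _.
have comb s : s ^+ 2 * A + s * dw E (b *m M) (a *m M) + wcubic E (b *m M) =
   det2 b a ^+ 2 * (s * det2 a c + det2 b c).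
  have wu : wcubic E (a *m M) = 0 by rewrite hw /det2; ring.
  have e := wcubic_comb E s 1 (a *m M) (b *m M).
  rewrite wu !scalemxAl -mulmxDl (hw (s *: a + 1 *: b)) -/A in e.
  transitivity (s ^+ 3 * 0 + s ^+ 2 * 1 * A + s * 1 ^+ 2 * dw E (b *m M) (a *m M) + 1 ^+ 3 * wcubic E (b *m M)).
    move: (A) (dw E _ _) (wcubic E _) => A0 B0 W0; ring.
  by rewrite -e /det2 !mxE; ring.
have [x] := notin_ex [:: 0; 1 : k]; rewrite !inE negb_or => /andP[x0 x1].
apply: (mulfI (_ : x * (x - 1) != 0)); first by rewrite mulf_neq0 // subr_eq0.
have f0 := comb 0; have f1 := comb 1; have f2 := comb x.
rewrite mulr0; move: f0 f1 f2; set B := dw E _ _; set W := wcubic E _; move: (A) (B) (W) => A0 B0 W0 f0 f1 f2.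
transitivity ((x ^+ 2 * A0 + x * B0 + W0) - x * (1 ^+ 2 * A0 + 1 * B0 + W0) + (x - 1) * (0 ^+ 2 * A0 + 0 * B0 + W0)).
  by ring.
by rewrite f0 f1 f2; ring.
Qed.

(** The gradient at [u] is nonzero and vanishes on the rows of [M] and on [v], so these three
    vectors are dependent. *)
Lemma tangent_line (M : 'M[k]_(2, 3)) (u v : 'rV[k]_3) :
  row_free M -> wcubic E u = 0 -> u <> 0 -> (forall b : 'rV_2, dw E u (b *m M) = 0) ->
  dw E u v = 0 -> exists s, v = s *m M.
Proof.
move=> fM wu u0 hM hv; pose g : 'cV[k]_3 := (vec3 (dwX E u) (dwY E u) (dwZ E u))^T.
have gE (w : 'rV[k]_3) : (w *m g) 0 0 = dw E u w.
  by rewrite mxE !big_ord_recl big_ord0 !mxE /= /dw !(mulrC (w 0 _)) addr0 addrA;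
    congr (_ * w 0 _ + _ * w 0 _ + _ * w 0 _); apply: val_inj.
have g0 : g != 0.
  apply/eqP => /(congr1 trmx); rewrite trmxK trmx0 => e; apply: (smooth_vec fk wu u0).
  have := congr1 (fun w : 'rV_3 => w 0 0) e; have := congr1 (fun w : 'rV_3 => w 0 1) e.
  by have := congr1 (fun w : 'rV_3 => w 0 ord_max) e; rewrite !vec3E !mxE.
pose N : 'M[k]_(2 + 1, 3) := col_mx M v.
have Ng : N *m g = 0.
  rewrite mul_col_mx; have -> : M *m g = 0.
    apply/row_matrixP => l; rewrite row_mul row0 rowE; apply/rowP => i.
    by rewrite !ord1 [RHS]mxE gE hM.
  have -> : v *m g = 0 by apply/rowP => i; rewrite !ord1 [RHS]mxE gE.
  exact: col_mx0.
have : row_free N = false.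
  apply/negP => /row_freeP [N' NN']; move/eqP: g0; apply.
  have N'N : N' *m N = 1%:M by apply: mulmx1C.
  by rewrite -[g]mul1mx -N'N -mulmxA Ng mulmx0.
move/negbT; rewrite -kermx_eq0 => /rowV0Pn[t /sub_kermxP tN t0].
have := tN; rewrite -[t]hsubmxK mul_row_col; set s := lsubmx t; set r := rsubmx t => e.
have r0 : r 0 0 != 0.
  apply: contraNneq t0 => r0; have rE : r = 0 by apply/rowP => i; rewrite !ord1 r0 mxE.
  rewrite rE mul0mx addr0 in e.
  have sE : s = 0 by apply: (row_free_inj fM); rewrite mul0mx.
  by rewrite -[t]hsubmxK -/s -/r rE sE row_mx0.
exists (- (r 0 0)^-1 *: s); rewrite -scalemxAl.
have -> : s *m M = - (r 0 0 *: v).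
  apply/eqP; rewrite -addr_eq0 -mul_scalar_mx -e; apply/eqP; congr (_ + _ *m _).
  by apply/matrixP => i j; rewrite !ord1 mxE.
by rewrite scalerN scaleNr opprK scalerA mulVf // scale1r.
Qed.

Lemma eq_pts_third A (P Q R : curve E A) : Q = pneg (padd P R) -> R = pneg (padd P Q).
Proof.
move=> e; have {}e : (Q : pts E A) = - ((P : pts E A) + (R : pts E A)) by [].
suff : (R : pts E A) = - ((P : pts E A) + (Q : pts E A)) by [].
by rewrite e !opprD !opprK addKr.
Qed.

(** If exactly two points coincide, a permutation reduces to distinct ones. If all three do, the
    given line is tangent at [P], as is the line of [collinear_ex]; so they are equal, and the third
    point of the latter is a zero of the cubic on the former, that is [P]. *)
Theorem collinear_third (P Q R : curve E k^o) : collinear P Q R -> R = pneg (padd P Q).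
Proof.
move=> h; have [ePQ|nPQ] := pselect (P = Q); last exact: collinear_neq h nPQ.
rewrite -{Q}ePQ in h *; have [h' _] := collinear_perm h.
have [ePR|nPR] := pselect (P = R); last first.
  have := collinear_neq h' nPR => e.
  exact: eq_pts_third e.
rewrite -{R h'}ePR in h *.
move: h => [M [a [b [c [fM [a0 b0 c0] [ha hb hc] hw]]]]].
have u0 := rowM_neq0 fM a0.
have hP : forall M' (a' : 'rV[k]_2), row_free M' -> a' != 0 -> sval P (a' *m M') ->
    exists2 r, r != 0 & a *m M = r *: (a' *m M').
  move=> M' a' fM' a0' ha'.
  have [r e] := par_multiple fk (rowM_neq0 fM' a0') (point_parr ha' ha).
  by exists r => //; apply: contra_notN u0 => /eqP r0; rewrite e r0 scale0r.
have wu : wcubic E (a *m M) = 0 by rewrite hw /det2; ring.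
have par_a (s : 'rV[k]_2) : sval P (s *m M) -> s != 0 -> exists2 r, r != 0 & a *m M = r *: (s *m M).
  by move=> hs s0; apply: hP.
have [rb rb0 eb] := par_a _ hb b0; have [rc rc0 ec] := par_a _ hc c0.
have aE (s : 'rV[k]_2) r : a *m M = r *: (s *m M) -> a = r *: s.
  by rewrite scalemxAl => /(row_free_inj fM).
have hM (d : 'rV_2) : dw E (a *m M) (d *m M) = 0.
  have -> : dw E (a *m M) (d *m M) = rb ^+ 2 * dw E (b *m M) (d *m M).
    by rewrite eb -[d *m M in LHS]scale1r dw_scale mulr1.
  rewrite (@collinear_tangent M b d (rb *: c)) ?mulr0 // => t.
  by rewrite hw (aE _ _ eb) /det2 !mxE; ring.
have [M' [a' [b' [c' [fM' [a0' b0' c0'] [ha' hb' hc'] hw']]]]] := collinear_ex P P.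
have [r r0 er] := hP _ _ fM' a0' ha'.
have [r2 r20 er2] := hP _ _ fM' b0' hb'.
have hM' (d : 'rV_2) : dw E (a *m M) (d *m M') = 0.
  have -> : dw E (a *m M) (d *m M') = r ^+ 2 * dw E (a' *m M') (d *m M').
    by rewrite er -[d *m M' in LHS]scale1r dw_scale mulr1.
  rewrite (@collinear_tangent M' a' d ((r / r2) *: c')) ?mulr0 // => t.
  have -> : det2 t a' * det2 t a' * det2 t ((r / r2) *: c') = det2 t a' * det2 t ((r / r2) *: a') * det2 t c'.
    by rewrite /det2 !mxE; ring.
  rewrite hw'; congr (_ * det2 _ _ * _).
  apply: (row_free_inj fM'); rewrite -scalemxAl mulrC -scalerA -er er2 scalerA mulVf // scale1r //.
have [s vE] := tangent_line fM wu u0 hM (hM' c').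
have v0 := rowM_neq0 fM' c0'.
have wv : wcubic E (c' *m M') = 0 by have := point_oncone hc'; rewrite ellcurve_ko.
have s0 : s != 0 by apply: contra_notN v0 => /eqP s0; rewrite vE s0 mul0mx.
have : det2 s a * det2 s b * det2 s c = 0 by rewrite -hw -vE.
move/eqP; rewrite !mulf_eq0 => hs.
have {}hs : det2 a s = 0.
  have ab : det2 s a = rb * det2 s b by rewrite (aE _ _ eb) /det2 !mxE; ring.
  have ac : det2 s a = rc * det2 s c by rewrite (aE _ _ ec) /det2 !mxE; ring.
  have -> : det2 a s = - det2 s a by rewrite /det2; ring.
  case/orP: hs => [/orP[]|] /eqP hs; first by rewrite hs oppr0.
    by rewrite ab hs mulr0 oppr0.
  by rewrite ac hs mulr0 oppr0.
have [q sE] := det2_0 hs a0.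
apply: (kpoint_eq _ hc' v0); rewrite vE sE -scalemxAl; exact: (@point_scale _ E k^o P).
Qed.

Theorem curve_addP (P Q S : curve E k^o) : curve_add P Q S <-> S = padd P Q.
Proof.
split=> [[R [/collinear_third eR /collinear_third eO]]|->].
  have {}eR : (R : pts E k^o) = - ((P : pts E k^o) + (Q : pts E k^o)) by [].
  have {}eO : 0 = - ((R : pts E k^o) + (S : pts E k^o)) by [].
  have /eqP : (R : pts E k^o) + (S : pts E k^o) = 0 by rewrite -[LHS]opprK -eO oppr0.
  by rewrite eR addrC subr_eq0 => /eqP.
exists (pneg (padd P Q)); split; first exact: collinear_ex.
have := collinear_ex (pneg (padd P Q)) (padd P Q).
have -> : padd (pneg (padd P Q)) (padd P Q) = origin E k^o by rewrite padd_comm padd_neg.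
have -> // : pneg (origin E k^o) = origin E k^o.
rewrite -[LHS]padd_origin padd_comm; exact: padd_neg.
Qed.
End Collinear.

(** * Chains of 3-isogenies and isomorphic products *)

Section TwoIsogeny.
Variables (k : closedFieldType) (E E' : ellcurve k) (a z : k).
Notation on E x y := (wcubic E (vec3 x y 1) = 0).
Let b := z ^+ 2 * (a + 2 * z).
Hypotheses (hE : isC E a b) (hE' : isC E' (a + 6 * z) (z * (a + 2 * z) ^+ 2)).

Lemma isC_disc (E1 : ellcurve k) a1 b1 : isC E1 a1 b1 -> b1 != 0 /\ a1 ^+ 3 - 27 * b1 != 0.
Proof.
move=> [e1 e2 e3 e4 e6]; have [d] := ec_disc E1; rewrite e1 e2 e3 e4 e6 => hd.
have : b1 ^+ 3 * (a1 ^+ 3 - 27 * b1) != 0.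
  apply/eqP => h; have : 1 != 0 :> k := oner_neq0 k; rewrite -hd.
  rewrite (_ : discriminant _ _ _ _ _ = b1 ^+ 3 * (a1 ^+ 3 - 27 * b1)).
    by rewrite h mul0r eqxx.
  by rewrite /discriminant; ring.
by rewrite mulf_eq0 expf_eq0 negb_or /= => /andP[].
Qed.

Let b0 : b != 0. Proof. by case: (isC_disc hE). Qed.
Let z0 : z != 0. Proof. by apply: contraNneq b0 => z0; rewrite /b z0 expr0n mul0r. Qed.
Let c0 : a + 2 * z != 0. Proof. by apply: contraNneq b0 => c0; rewrite /b c0 mulr0. Qed.
Let e0 : a + 3 * z != 0.
Proof.
have [_] := isC_disc hE; apply: contraNneq => e0.
rewrite (_ : _ - _ = (a - 6 * z) * (a + 3 * z) ^+ 2); first by rewrite e0 expr0n mulr0.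
by rewrite /b; ring.
Qed.

Let S := [:: - z ^+ 2].
Lemma ph_S x : x \notin S -> x + z ^+ 2 != 0.
Proof. by rewrite inE; apply: contra => /eqP e; rewrite -addr_eq0 e. Qed.

Lemma algk (c : k) : (c%:A : k^o) = c.
Proof. exact: mulr1. Qed.

Lemma lin_roots (p q : k) : (p != 0) || (q != 0) -> exists s : seq k, forall x, (p * x + q == 0) = (x \in s).
Proof.
have [->|p0] := eqVneq p 0 => /= [q0|_].
  by exists [::] => x; rewrite mul0r add0r (negPf q0).
exists [:: - q / p] => x; rewrite inE.
apply/eqP/eqP => [e|->]; last by field.
by apply: (mulfI p0); rewrite mulrCA divff // mulr1; apply/eqP; rewrite -addr_eq0 e.
Qed.

Lemma poly_root_seq (p : {poly k}) : p != 0 -> exists s : seq k, forall x, x \notin s -> p.[x] != 0.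
Proof.
move=> /root_seq[s hs]; exists s => x; apply: contra => /eqP; exact: hs.
Qed.

(* abscissas of the points of order two *)
Lemma two_torsion (E1 : ellcurve k) a1 b1 : isC E1 a1 b1 -> exists s : seq k, forall x y, on E1 x y ->
  x \notin s -> 2 * y + a1 * x + b1 != 0.
Proof.
move=> h1; have [b10 _] := isC_disc h1.
pose p : {poly k} := 4 *: 'X^3 + (a1 *: 'X + b1%:P) ^+ 2.
have pE x : p.[x] = 4 * x ^+ 3 + (a1 * x + b1) ^+ 2 by rewrite /p !hornerE.
have p0 : p != 0.
  apply/eqP => e; have := pE 0; rewrite e horner0 => /esym/eqP.
  by rewrite expr0n mulr0 mulr0 !add0r expf_eq0 (negPf b10).
have [s hs] := poly_root_seq p0; exists s => x y /(onC _ _ h1) h xs.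
have := hs x xs; rewrite pE; apply: contra_neq => e.
transitivity ((2 * y + a1 * x + b1) ^+ 2); last by rewrite e expr0n.
by rewrite -h; ring.
Qed.

Lemma infty_neq0 (K : comAlgType k) (P : 'rV[K]_3) (t d : K) : is_field K -> t <> 0 -> d <> 0 ->
  P 0 ord_max = t * d -> P <> 0.
Proof.
move=> fK t0 d0 e P0; move: e; rewrite P0 mxE => /esym /(fmul0 fK)[]; contradiction.
Qed.

Lemma lin_root_alg (K : comAlgType k) (p q : k) (s : seq k) :
  (forall x, (p * x + q == 0) = (x \in s)) -> p != 0 \/ q != 0 -> forall x : K, is_field K ->
  (forall t, t \in s -> x <> t%:A) -> p%:A * x + q%:A <> 0.
Proof.
move=> hs pq x fK xs; have [p0|p0] := eqVneq p 0.
  case: pq => [|q0]; first by rewrite p0 eqxx.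
  by rewrite p0 scale0r mul0r add0r; apply: alg_is_field_neq0; exact/eqP.
move=> e; apply: (xs (- q / p)); first by rewrite -hs; apply/eqP; field.
have -> : x = p^-1 *: (p%:A * x) by rewrite scalerAl scalerA mulVf // scale1r mul1r.
have -> : p%:A * x = - q%:A by apply/eqP; rewrite -addr_eq0 e.
by rewrite -scaleNr scalerA mulrC.
Qed.

Theorem two_isogeny : exists (phi : nattrans (curve E) (curve E')) (psi : nattrans (curve E') (curve E)),
  [/\ is_hom phi, is_hom psi, surj phi,
    forall A (p : pts E A), psi A (phi A p) = p *+ 2
  & forall x y (h : on E x y) (h' : on E' (phx a z x) (phy a z x y)), x != - z ^+ 2 ->
    phi k^o (kpt h) = kpt h'].
Proof.
have f_on x y : on E x y -> x \notin S -> on E' (phx a z x) (phy a z x y).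
  by move=> /(onC _ _ hE) h /ph_S u0; apply/(onC _ _ hE'); apply: ph_on.
have f_fib c : exists T : seq k, forall x, x \notin S -> x \notin T -> phx a z x != c.
  pose p : {poly k} := 'X^2 - (z * (a + 2 * z) + c) *: 'X - (c * z ^+ 2)%:P.
  have pE x : p.[x] = x * (x - z * (a + 2 * z)) - c * (x + z ^+ 2) by rewrite /p !(hornerD, hornerN, hornerZ, hornerC, hornerXn, hornerX); ring.
  have p0 : p != 0.
    apply/eqP => /(congr1 (fun q : {poly k} => q`_2)).
    rewrite !coefE /= => /eqP; by rewrite mulr0 !subr0 oner_eq0.
  have [s hs] := poly_root_seq p0; exists s => x /ph_S u0 xs.
  have := hs x xs; rewrite pE; apply: contra_neq => <-; rewrite /phx; by field.
have f_neg x y : x \notin S -> phy a z x (- y - a * x - b) =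
    - phy a z x y - (a + 6 * z) * phx a z x - z * (a + 2 * z) ^+ 2.
  by move=> /ph_S; exact: ph_neg.
have f_solve X : exists2 x, x \notin S & phx a z x = X.
  have [x hx] := quadratic_root (- (z * (a + 2 * z) + X)) (- X * z ^+ 2).
  have e : x * (x - z * (a + 2 * z)) = X * (x + z ^+ 2).
    by apply/subr0_eq; rewrite -[RHS]hx; ring.
  have u0 : x + z ^+ 2 != 0.
    apply: contra_neq (_ : z ^+ 3 * (a + 3 * z) != 0); last by rewrite mulf_neq0 ?expf_neq0.
    move=> u0; have xE : x = - z ^+ 2 by apply/eqP; rewrite -addr_eq0 u0.
    by move: e; rewrite u0 mulr0 xE => e; rewrite -[RHS]e; ring.
  exists x; first by rewrite inE -addr_eq0.
  by rewrite /phx e mulfK.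
have [|x y xS|x1 x2 x3 l m s1 s2 s3|phi [hphi phiE]] :=
    @isogeny_ex k E E' a b (a + 6 * z) (z * (a + 2 * z) ^+ 2) (ph_law a z) S (phx a z) (phy a z) hE hE' _ _ f_on f_fib f_neg.
- move=> K fK x y _ xs; set U := x + z%:A ^+ 2.
  have U0 : U <> 0.
    move=> e; apply: (xs (- z ^+ 2)); first by rewrite inE.
    by rewrite scaleNr -(in_algE _ (z ^+ 2)) rmorphXn; apply/eqP; rewrite -addr_eq0; apply/eqP.
  apply: (infty_neq0 fK U0 U0); rewrite /= /ph_vec !vec3E /U; ring.
- have u0 := ph_S xS; exists ((x + z ^+ 2) ^+ 2); first by rewrite expf_neq0.
  transitivity (@ph_vec k a z (vec3 x y 1)); first by rewrite /= !algk.
  rewrite /ph_vec !vec3E scale_vec3; congr (vec3 _ _ _); rewrite /phy /phx; by field.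
- by apply: (@ph_line _ a z b x1 x2 x3 l m (erefl _)); apply: ph_S.
have [S' hS'] : exists S' : seq k, forall x, (4 * x + (a + 2 * z) ^+ 2 == 0) = (x \in S').
  by apply: lin_roots; rewrite expf_neq0 ?orbT.
have [B hB] := two_torsion hE.
have hsurj := isogeny_surj hE hE' hphi f_on f_neg phiE f_solve.
have [|X Y XS|x y h xB /ph_S u0 xS'|psi [hpsi psiE]] := @dual_ex k E E' a b (a + 6 * z) (z * (a + 2 * z) ^+ 2) S (phx a z) (phy a z)
   phi hE hE' hphi f_on f_neg phiE f_solve (dph_law a z) S' B (dphx a z) (dphy a z) 2 _ _ _ f_fib.
- move=> K fK x y _ xs; set D := 4 * x + (a%:A + 2 * z%:A) ^+ 2.
  have cE : (a%:A + 2 * z%:A) ^+ 2 = ((a + 2 * z) ^+ 2)%:A :> K by rewrite -!in_algE; ring.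
  have D0 : D <> 0.
    have := @lin_root_alg K 4 ((a + 2 * z) ^+ 2) S' hS' (or_intror (expf_neq0 2 c0)) x fK xs.
    by rewrite -cE scaler_nat.
  apply: (infty_neq0 fK D0 D0); rewrite /= /dph_vec !vec3E /D; ring.
- have D0 : 4 * X + (a + 2 * z) ^+ 2 != 0 by rewrite hS'.
  exists ((4 * X + (a + 2 * z) ^+ 2) ^+ 2); first by rewrite expf_neq0.
  transitivity (@dph_vec k a z (vec3 X Y 1)); first by rewrite /= !algk.
  rewrite /dph_vec !vec3E scale_vec3; congr (vec3 _ _ _); rewrite /dphx /dphy /=; by field.
- have psi0 := hB x y h xB.
  have [a1 a2 a3 a4 _] := hE.
  have psi0' : 2 * y + ec_a1 E * x + ec_a3 E != 0 by rewrite a1 a3.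
  have [h' e] := padd_double h psi0'.
  have [ex ey] := @dph_ph k a z x y b (erefl _) u0 (proj1 (onC _ _ hE) h) psi0.
  have lE : dblm E x y = (3 * x ^+ 2 - a * y) / (2 * y + a * x + b).
    by rewrite /dblm a1 a2 a3 a4; congr (_ / _); ring.
  have xE : sumx E (dblm E x y) x x = dphx a z (phx a z x).
    by rewrite ex lE /sumx a1 a2 subr0.
  have yE : sumy E (dblm E x y) x y (sumx E (dblm E x y) x x) = dphy a z (phx a z x) (phy a z x y).
    by rewrite xE ey ex lE /sumy a1 a3.
  have h2 : on E (dphx a z (phx a z x)) (dphy a z (phx a z x) (phy a z x y)) by rewrite -yE -xE.
  exists h2; rewrite mulr2n; transitivity (kpt h'); first exact: e.
  exact: kpt_eq.
exists phi, psi; split=> // x y h h' xS; apply: phiE; by rewrite inE.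
Qed.
End TwoIsogeny.

Section ThreeIsogeny.
Variables (k : closedFieldType) (E E' : ellcurve k) (a w : k).
Notation on E x y := (wcubic E (vec3 x y 1) = 0).
Let c := a ^+ 2 + 3 * a * w + 9 * w ^+ 2.
Hypotheses (hE : isC E a (w ^+ 3)) (hE' : isC E' (a + 6 * w) (w * c)).

Let w0 : w != 0.
Proof. by have [b0 _] := isC_disc hE; apply: contraNneq b0 => ->; rewrite expr0n. Qed.
Let c0 : c != 0.
Proof. by have [b0 _] := isC_disc hE'; apply: contraNneq b0 => ->; rewrite mulr0. Qed.

Let S := [:: 0 : k].
Let inS x : x \notin S -> x != 0. Proof. by rewrite inE. Qed.

Theorem three_isogeny : exists (phi : nattrans (curve E) (curve E')) (psi : nattrans (curve E') (curve E)),
  [/\ is_hom phi, is_hom psi, surj phi,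
    forall A (p : pts E A), psi A (phi A p) = p *+ 3
  & forall x y (h : on E x y) (h' : on E' (alx a w x) (aly a w x y)), x != 0 ->
    phi k^o (kpt h) = kpt h'].
Proof.
have f_on x y : on E x y -> x \notin S -> on E' (alx a w x) (aly a w x y).
  by move=> /(onC _ _ hE) h /inS u0; apply/(onC _ _ hE'); apply: al_on.
have f_fib X : exists T : seq k, forall x, x \notin S -> x \notin T -> alx a w x != X.
  pose p : {poly k} := 'X^3 - (X + a * w + 3 * w ^+ 2) *: 'X^2 + (a * w ^+ 3) *: 'X + (w ^+ 6)%:P.
  have pE x : p.[x] = x ^+ 3 + a * w ^+ 3 * x + w ^+ 6 - (X + a * w + 3 * w ^+ 2) * x ^+ 2.
    by rewrite /p !(hornerD, hornerN, hornerZ, hornerC, hornerXn, hornerX); ring.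
  have p0 : p != 0.
    apply/eqP => e; have := pE 0; rewrite e horner0 => /esym/eqP.
    by rewrite !expr0n !mulr0 subr0 !add0r expf_eq0 (negPf w0).
  have [s hs] := poly_root_seq p0; exists s => x /inS x0 xs.
  by have := hs x xs; rewrite pE; apply: contra_neq => <-; rewrite /alx; field.
have f_neg x y : x \notin S -> aly a w x (- y - a * x - w ^+ 3) =
    - aly a w x y - (a + 6 * w) * alx a w x - w * c.
  by move=> /inS; exact: al_neg.
have f_solve X : exists2 x, x \notin S & alx a w x = X.
  have [x hx] := @solve_monicpoly k 3 (nth 0 [:: - w ^+ 6; - a * w ^+ 3; X + a * w + 3 * w ^+ 2]) isT.
  rewrite !big_ord_recl big_ord0 /= /bump /= in hx.
  have x0 : x != 0.
    apply: contra_neq (expf_neq0 6 w0) => x0; rewrite x0 in hx.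
    have e : 0 ^+ 3 = - w ^+ 6 by rewrite hx; ring.
    by apply/eqP; rewrite -oppr_eq0 -e expr0n.
  exists x; first by rewrite inE.
  apply: (mulIf (expf_neq0 2 x0)); apply/subr0_eq.
  transitivity ((x ^+ 3 - (- w ^+ 6 * x ^+ 0 + (- a * w ^+ 3 * x ^+ 1 + ((X + a * w + 3 * w ^+ 2) * x ^+ 2 + 0))))).
    by rewrite /alx; field.
  by rewrite hx; ring.
have [|x y xS|x1 x2 x3 l m s1 s2 s3|phi [hphi phiE]] :=
    @isogeny_ex k E E' a (w ^+ 3) (a + 6 * w) (w * c) (al_law a w) S (alx a w) (aly a w) hE hE' _ _ f_on f_fib f_neg.
- move=> K fK x y _ xs.
  have x0 : x <> 0 by move=> e; apply: (xs 0); rewrite ?inE // scale0r.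
  have t0 : x ^+ 2 <> 0 by move=> /(fexp0 fK).
  apply: (@infty_neq0 k K _ (x ^+ 2) x fK t0 x0); rewrite /= /al_vec !vec3E; ring.
- have x0 := inS xS; exists (x ^+ 3); first by rewrite expf_neq0.
  transitivity (@al_vec k a w (vec3 x y 1)); first by rewrite /= !algk.
  rewrite /al_vec !vec3E scale_vec3; congr (vec3 _ _ _); rewrite /aly /alx; by field.
- by apply: (@al_line _ a w _ x1 x2 x3 l m (erefl _)); apply: inS.
have DE x : 3 * x + c = dal_den a w x by rewrite /dal_den /c; ring.
have [S' hS'] : exists S' : seq k, forall x, (3 * x + c == 0) = (x \in S').
  by apply: lin_roots; rewrite c0 orbT.
have [B hB] := two_torsion hE.
have hsurj := isogeny_surj hE hE' hphi f_on f_neg phiE f_solve.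
have [|X Y XS|x y h xB /inS u0 xS'|psi [hpsi psiE]] := @dual_ex k E E' a (w ^+ 3) (a + 6 * w) (w * c) S (alx a w) (aly a w)
   phi hE hE' hphi f_on f_neg phiE f_solve (dal_law a w) S' B (dalx a w) (daly a w) 3 _ _ _ f_fib.
- move=> K fK x y _ xs; set D := 3 * (x + (a%:A * w%:A + 3 * w%:A ^+ 2) * 1) + a%:A ^+ 2 * 1.
  have D0 : D <> 0.
    have := @lin_root_alg k K 3 c S' hS' (or_intror c0) x fK xs.
    have -> : c%:A = a%:A ^+ 2 + 3 * a%:A * w%:A + 9 * w%:A ^+ 2 :> K by rewrite -!in_algE /c; ring.
    by rewrite scaler_nat; apply: contra_not => e; rewrite -[RHS]e /D; ring.
  have t0 : D ^+ 2 <> 0 by move=> /(fexp0 fK).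
  apply: (@infty_neq0 k K _ (D ^+ 2) D fK t0 D0); rewrite /= /dal_vec !vec3E -/D; ring.
- have D0 : dal_den a w X != 0 by rewrite -DE hS'.
  exists (dal_den a w X ^+ 3); first by rewrite expf_neq0.
  transitivity (@dal_vec k a w (vec3 X Y 1)); first by rewrite /= !algk.
  rewrite /dal_vec !vec3E scale_vec3; rewrite /dalx /daly; rewrite /dal_den /= in D0 *.
  by congr (vec3 _ _ _); field.
- have psi0 := hB x y h xB.
  have [a1 a2 a3 a4 _] := hE.
  have psi0' : 2 * y + ec_a1 E * x + ec_a3 E != 0 by rewrite a1 a3.
  have [h' e] := padd_double h psi0'.
  have D0 : dal_den a w (alx a w x) != 0 by rewrite -DE hS'.
  have := @dal_al k a w x y (w ^+ 3) (erefl _) u0 (proj1 (onC _ _ hE) h) psi0 D0.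
  have lE : (3 * x ^+ 2 - a * y) / (2 * y + a * x + w ^+ 3) = dblm E x y.
    by rewrite /dblm a1 a2 a3 a4; congr (_ / _); ring.
  rewrite lE /=; set l := dblm E x y in h' e *.
  have -> : l ^+ 2 + a * l - x - x = sumx E l x x by rewrite /sumx a1 a2 subr0.
  set x2 := sumx E l x x in h' e *.
  have -> : - (l + a) * x2 - (y - l * x) - w ^+ 3 = sumy E l x y x2 by rewrite /sumy a1 a3.
  set y2 := sumy E l x y x2 in h' e *; move=> [n2 [ex ey]].
  have e3 := padd_kpt h' h n2; set n := slope x2 y2 x y in e3.
  have xE : sumx E n x2 x = dalx a w (alx a w x).
    by rewrite ex /sumx a1 a2 subr0.
  have yE : sumy E n x2 y2 (sumx E n x2 x) = daly a w (alx a w x) (aly a w x y).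
    by rewrite xE ey ex /sumy a1 a3.
  have h2 : on E (dalx a w (alx a w x)) (daly a w (alx a w x) (aly a w x y)).
    by rewrite -yE -xE; exact: sum_on.
  exists h2; rewrite mulrSr mulr2n; transitivity (padd (kpt h') (kpt h)); first by rewrite -e.
  by rewrite e3; exact: kpt_eq.
exists phi, psi; split=> // x y h h' xS; apply: phiE; by rewrite inE.
Qed.
End ThreeIsogeny.

(** * Commutation of the 2- and 3-isogenies along a chain *)

Section StepFormulas.
Variables (k : fieldType) (a w z : k).
Hypotheses (z0 : z != 0) (h : w ^+ 3 = z ^+ 2 * (a + 2 * z)).
Let a1 := a + 6 * w.
Let z1 := (w ^+ 2 - w * z + z ^+ 2) / z.
Let a' := a + 6 * z.
Let w' := w ^+ 2 / z.
Let aE : a = (w ^+ 3 - 2 * z ^+ 3) / z ^+ 2.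
Proof. by rewrite h; field. Qed.

(** The left side vanishes where the image is the kernel point of the next 2-isogeny. Its zeros are
    the point of order two and its two translates by the kernel of [alx]; these are opposite and
    share the abscissa [w ^+ 3 / z]. *)
Lemma step_kernel x : x != 0 -> alx a w x + z1 ^+ 2 = (x + z ^+ 2) * (x - w ^+ 3 / z) ^+ 2 / x ^+ 2.
Proof. by move=> x0; rewrite /alx /z1 aE; field; rewrite x0 z0. Qed.

Lemma step_phx x : x + z ^+ 2 != 0 -> phx a z x = x * (x - w ^+ 3 / z) / (x + z ^+ 2).
Proof. by move=> x0; rewrite /phx aE; field; rewrite x0 z0. Qed.

Lemma step_x (x : k) : x != 0 -> x + z ^+ 2 != 0 -> x - w ^+ 3 / z != 0 ->
  phx a1 z1 (alx a w x) = alx a' w' (phx a z x).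
Proof.
move=> x0 u0 v0; rewrite {1}/phx step_kernel // step_phx // /alx /a1 /z1 /a' /w' aE.
have v0' : x * z - w ^+ 3 != 0 by move: v0; apply: contra_neq => e; apply: (mulIf z0); rewrite mulrBl divfK // e mul0r.
by field; exact/and4P.
Qed.

Lemma step_y (x y : k) : x != 0 -> x + z ^+ 2 != 0 -> x - w ^+ 3 / z != 0 ->
  phy a1 z1 (alx a w x) (aly a w x y) = aly a' w' (phx a z x) (phy a z x y).
Proof.
move=> x0 u0 v0; rewrite /phy step_x // step_kernel // /aly step_phx // /alx /a1 /z1 /a' /w' aE.
have v0' : x * z - w ^+ 3 != 0 by move: v0; apply: contra_neq => e; apply: (mulIf z0); rewrite mulrBl divfK // e mul0r.
by field; exact/and4P.
Qed.
End StepFormulas.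

Section DualPairs.
Variable k : closedFieldType.
Implicit Types E : ellcurve k.

Definition dualpair n E E' (phi : nattrans (curve E) (curve E')) (psi : nattrans (curve E') (curve E)) :=
  [/\ is_hom phi, is_hom psi, surj phi & forall A (p : pts E A), psi A (phi A p) = p *+ n].

(** Since [phi] is surjective on k-points, it can be cancelled on the right. *)
Lemma dualpairC n E E' (phi : nattrans (curve E) (curve E')) psi : dualpair n phi psi ->
  forall A (q : pts E' A), phi A (psi A q) = q *+ n.
Proof.
move=> [h1 h2 h3 h4] A q.
transitivity (p_muln n (nt_id (curve E')) A q); last exact: (p_mulnE n (nt_id (curve E'))).
apply: (@hom_ext k E' E' (nt_comp psi phi)) => {A}q; have [p <-] := h3 q.
by rewrite p_mulnE /= h4 [LHS](homMn h1).
Qed.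

Lemma dualpair_comp m n E0 E1 E2 (phi : nattrans (curve E0) (curve E1)) psi
    (phi' : nattrans (curve E1) (curve E2)) psi' :
  dualpair m phi psi -> dualpair n phi' psi' -> dualpair (n * m) (nt_comp phi phi') (nt_comp psi' psi).
Proof.
move=> [h1 h2 h3 h4] [g1 g2 g3 g4]; split; try exact: nt_comp_hom.
  by move=> q; have [r <-] := g3 q; have [p <-] := h3 r; exists p.
by move=> A p; rewrite /= g4 [LHS](homMn h2) /= h4 -mulrnA mulnC.
Qed.

Lemma dualpair_id E : dualpair 1 (nt_id (curve E)) (nt_id (curve E)).
Proof. by split=> // q; exists q. Qed.

Section Square.
Variables (E E' E1 E1' : ellcurve k) (a w z : k).
Notation on E x y := (wcubic E (vec3 x y 1) = 0).
Hypotheses (z0 : z != 0) (hwz : w ^+ 3 = z ^+ 2 * (a + 2 * z)).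
Let a1 := a + 6 * w.
Let z1 := (w ^+ 2 - w * z + z ^+ 2) / z.
Let a' := a + 6 * z.
Let w' := w ^+ 2 / z.
Hypotheses (hE : isC E a (w ^+ 3)) (hE' : isC E' a' (w' ^+ 3))
  (hE1 : isC E1 a1 (w * (a ^+ 2 + 3 * a * w + 9 * w ^+ 2)))
  (hE1' : isC E1' (a' + 6 * w') (w' * (a' ^+ 2 + 3 * a' * w' + 9 * w' ^+ 2))).
Variables (phi : nattrans (curve E) (curve E')) (phi1 : nattrans (curve E1) (curve E1'))
  (alpha : nattrans (curve E) (curve E1)) (alpha' : nattrans (curve E') (curve E1')).
Hypothesis phiE : forall x y (h : on E x y) (h' : on E' (phx a z x) (phy a z x y)), x != - z ^+ 2 ->
  phi k^o (kpt h) = kpt h'.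
Hypothesis phi1E : forall x y (h : on E1 x y) (h' : on E1' (phx a1 z1 x) (phy a1 z1 x y)), x != - z1 ^+ 2 ->
  phi1 k^o (kpt h) = kpt h'.
Hypothesis alphaE : forall x y (h : on E x y) (h' : on E1 (alx a w x) (aly a w x y)), x != 0 ->
  alpha k^o (kpt h) = kpt h'.
Hypothesis alpha'E : forall x y (h : on E' x y) (h' : on E1' (alx a' w' x) (aly a' w' x y)), x != 0 ->
  alpha' k^o (kpt h) = kpt h'.

(** Both composites are given by the same rational functions away from three abscissas, those of the
    two kernels and of the preimage found in [step_kernel]. *)
Lemma square_commutes A (p : curve E A) : phi1 A (alpha A p) = alpha' A (phi A p).
Proof.
apply: (@separation k E E1' (nt_comp alpha phi1) (nt_comp phi alpha')).
apply: (generic_kpt (agen_notin E [:: 0; - z ^+ 2; w ^+ 3 / z])) => x y h.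
rewrite !inE !negb_or -addr_eq0 -[x == w ^+ 3 / z]subr_eq0 => /and3P[x0 u0 v0].
have on1 := proj1 (onC _ _ hE) h.
have g1 : on E1 (alx a w x) (aly a w x y) by apply/(onC _ _ hE1)/al_on.
have b'E : w' ^+ 3 = z * (a + 2 * z) ^+ 2.
  have -> : w' ^+ 3 = (w ^+ 3) ^+ 2 / z ^+ 3 by rewrite /w'; field.
  by rewrite hwz; field.
have g2 : on E' (phx a z x) (phy a z x y).
  by apply/(onC _ _ hE'); rewrite b'E; apply: ph_on => //; rewrite -hwz.
have n2 : phx a z x != 0 by rewrite (step_phx z0 hwz) // !mulf_neq0 // invr_eq0.
have g3 : on E1' (alx a' w' (phx a z x)) (aly a' w' (phx a z x) (phy a z x y)).
  by apply/(onC _ _ hE1')/al_on => //; apply/(onC _ _ hE').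
have g4 : on E1' (phx a1 z1 (alx a w x)) (phy a1 z1 (alx a w x) (aly a w x y)).
  by rewrite /a1 /z1 step_x // step_y.
change (phi1 k^o (alpha k^o (kpt h)) = alpha' k^o (phi k^o (kpt h))).
rewrite (alphaE h g1 x0) (phiE h g2) -?addr_eq0 // (alpha'E g2 g3 n2).
rewrite (phi1E g1 g4); last first.
  rewrite -addr_eq0 /z1 step_kernel //; apply: mulf_neq0; last by rewrite invr_eq0 expf_neq0.
  by rewrite mulf_neq0 ?expf_neq0.
by apply: kpt_eq; [exact: step_x | exact: step_y].
Qed.
End Square.

Section Chain.
Variables (r : nat) (v z : nat -> k) (E E' : nat -> ellcurve k).
Hypothesis hv : forall i, (i < r)%N ->
  v i.+1 ^+ 3 * (v i ^+ 2 - v i + 1) = v i * (v i ^+ 2 + 2 * v i + 4).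
Hypothesis hz : forall i, (i < r)%N -> z i.+1 = z i * (v i ^+ 2 - v i + 1).
Hypothesis z0 : forall i, (i <= r)%N -> z i != 0.
(** With [w = v z] and [a + 2 z = v ^+ 3 z] each curve has its marked points of orders two and
    three. The recursions say that the next curve is the target of [alx]: the one for [z] comes from
    [step_kernel], and [hv] is the equation for the next [w ^+ 3], divided by [z ^+ 3] and by the
    square of [v ^+ 2 - v + 1]. *)
Let a i := (v i ^+ 3 - 2) * z i.
Let w i := v i * z i.
Hypothesis hE : forall i, (i <= r)%N -> isC (E i) (a i) (w i ^+ 3).
Hypothesis hE' : forall i, (i <= r)%N -> isC (E' i) (a i + 6 * z i) (z i * (a i + 2 * z i) ^+ 2).

Lemma chain_two i : (i <= r)%N -> exists (phi : nattrans (curve (E i)) (curve (E' i))) psi,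
  dualpair 2 phi psi /\ forall x y (h : wcubic (E i) (vec3 x y 1) = 0)
    (h' : wcubic (E' i) (vec3 (phx (a i) (z i) x) (phy (a i) (z i) x y) 1) = 0), x != - z i ^+ 2 ->
    phi k^o (kpt h) = kpt h'.
Proof.
move=> ir; have hEi := hE ir.
have e : w i ^+ 3 = z i ^+ 2 * (a i + 2 * z i) by rewrite /w /a; ring.
rewrite e in hEi.
have [phi [psi [h1 h2 h3 h4 h5]]] := two_isogeny hEi (hE' ir).
by exists phi, psi; split.
Qed.

(** The 2-isogeny at the start is fixed in advance, and the explicit form of the one at step [i] is
    carried through the induction, as the next commuting square depends on it. *)
Lemma chain_ex i (phi0 : nattrans (curve (E 0)) (curve (E' 0))) : (i <= r)%N ->
  (forall x y (h : wcubic (E 0) (vec3 x y 1) = 0)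
    (h' : wcubic (E' 0) (vec3 (phx (a 0) (z 0) x) (phy (a 0) (z 0) x y) 1) = 0), x != - z 0 ^+ 2 ->
    phi0 k^o (kpt h) = kpt h') ->
  exists (phi : nattrans (curve (E i)) (curve (E' i))) psi
    (alpha : nattrans (curve (E 0)) (curve (E i))) beta
    (alpha' : nattrans (curve (E' 0)) (curve (E' i))) beta',
  [/\ dualpair 2 phi psi, dualpair (3 ^ i) alpha beta, dualpair (3 ^ i) alpha' beta',
     forall A p, phi A (alpha A p) = alpha' A (phi0 A p)
   & forall x y (h : wcubic (E i) (vec3 x y 1) = 0)
    (h' : wcubic (E' i) (vec3 (phx (a i) (z i) x) (phy (a i) (z i) x y) 1) = 0), x != - z i ^+ 2 ->
    phi k^o (kpt h) = kpt h'].
Proof.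
move=> ir hphi0; elim: i ir => [|i IH] ir.
  have [phi [psi [hd hk]]] := chain_two (leq0n r).
  exists phi, psi, (nt_id _), (nt_id _), (nt_id _), (nt_id _); split=> //; try exact: dualpair_id.
  move=> A p /=; apply: separation; apply: (generic_kpt (agen_notin _ [:: - z 0 ^+ 2])) => x y h.
  rewrite inE => xz; have z00 := z0 (leq0n r).
  have h' : wcubic (E' 0) (vec3 (phx (a 0) (z 0) x) (phy (a 0) (z 0) x y) 1) = 0.
    apply/(onC _ _ (hE' (leq0n r))); apply: ph_on; first by rewrite addr_eq0.
    rewrite -(proj1 (onC _ _ (hE (leq0n r))) h); congr (_ + _ * _); rewrite /w /a; ring.
  by rewrite (hk _ _ h h' xz) (hphi0 _ _ h h' xz).
have [phi [psi [al [be [al' [be' [h1 h2 h3 h4 h5]]]]]]] := IH (ltnW ir).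
have [phi1 [psi1 [hd hk]]] := chain_two ir.
have zi := z0 (ltnW ir); have e := hv ir; have ez := hz ir.
have zi1 := z0 ir; have q0 : v i ^+ 2 - v i + 1 != 0.
  by move: zi1; rewrite ez mulf_eq0 negb_or => /andP[].
have hwz : w i ^+ 3 = z i ^+ 2 * (a i + 2 * z i) by rewrite /w /a; ring.
have eE' : isC (E' i) (a i + 6 * z i) ((w i ^+ 2 / z i) ^+ 3).
  have -> : (w i ^+ 2 / z i) ^+ 3 = z i * (a i + 2 * z i) ^+ 2 by rewrite /w /a; field.
  exact: hE' (ltnW ir).
have a1E : a i.+1 = a i + 6 * w i.
  rewrite /a /w ez; transitivity (z i * (v i.+1 ^+ 3 * (v i ^+ 2 - v i + 1) - 2 * (v i ^+ 2 - v i + 1))); first by ring.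
  by rewrite e; ring.
have eE1 : isC (E i.+1) (a i + 6 * w i) (w i * (a i ^+ 2 + 3 * a i * w i + 9 * w i ^+ 2)).
  rewrite -a1E; have -> : w i * (a i ^+ 2 + 3 * a i * w i + 9 * w i ^+ 2) = w i.+1 ^+ 3; last exact: hE.
  rewrite /w ez; transitivity (z i ^+ 3 * (v i ^+ 2 - v i + 1) ^+ 2 * (v i.+1 ^+ 3 * (v i ^+ 2 - v i + 1))).
    by rewrite e /a; ring.
  by ring.
have eE1' : isC (E' i.+1) (a i + 6 * z i + 6 * (w i ^+ 2 / z i)) ((w i ^+ 2 / z i) *
    ((a i + 6 * z i) ^+ 2 + 3 * (a i + 6 * z i) * (w i ^+ 2 / z i) + 9 * (w i ^+ 2 / z i) ^+ 2)).
  have -> : a i + 6 * z i + 6 * (w i ^+ 2 / z i) = a i.+1 + 6 * z i.+1.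
    by rewrite a1E ez /w; field.
  have -> : (w i ^+ 2 / z i) * ((a i + 6 * z i) ^+ 2 + 3 * (a i + 6 * z i) * (w i ^+ 2 / z i) + 9 * (w i ^+ 2 / z i) ^+ 2)
     = z i.+1 * (a i.+1 + 2 * z i.+1) ^+ 2; last exact: hE'.
  transitivity (z i ^+ 3 * (v i ^+ 2 - v i + 1) * (v i.+1 ^+ 3 * (v i ^+ 2 - v i + 1)) ^+ 2).
    by rewrite e /w /a; field.
  by rewrite /a ez; ring.
have [A1 [B1 [g1 g2 g3 g4 g5]]] := three_isogeny (hE (ltnW ir)) eE1.
have [A1' [B1' [g1' g2' g3' g4' g5']]] := three_isogeny eE' eE1'.
have z1E : z i.+1 = (w i ^+ 2 - w i * z i + z i ^+ 2) / z i by rewrite ez /w; field.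
exists phi1, psi1, (nt_comp al A1), (nt_comp B1 be), (nt_comp al' A1'), (nt_comp B1' be'); split=> //.
- by rewrite expnS; apply: dualpair_comp.
- by rewrite expnS; apply: dualpair_comp.
- move=> A p /=; rewrite -h4; rewrite a1E z1E in hk.
  exact: (square_commutes zi hwz (hE (ltnW ir)) eE' eE1 eE1' h5 hk g5 g5').
Qed.
End Chain.
End DualPairs.

Definition nt_proj (k : comNzRingType) (I : Type) (F : I -> kfunctor k) (i : I) :
  nattrans (prod_functor F) (F i) :=
  @NatTrans k (prod_functor F) (F i) (fun A x => x i) (fun A B phi x => erefl).

Definition nt_prod (k : comNzRingType) (I : Type) (G : kfunctor k) (F : I -> kfunctor k)
    (f : forall i, nattrans G (F i)) : nattrans G (prod_functor F) :=
  @NatTrans k G (prod_functor F) (fun A x i => f i A x)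
    (fun A B phi x => functional_extensionality_dep (fun i => nt_nat (f i) phi x)).

Lemma const_hom (k : closedFieldType) (E E' : ellcurve k) :
  is_hom (nt_const (curve E) (origin E' k^o : curve E' k^o)).
Proof.
move=> A p q; have e : fmap (curve E') (structure_map A) (origin E' k^o) = origin E' A by exact: fmap_origin.
change (fmap (curve E') (structure_map A) (origin E' k^o) =
  padd (fmap (curve E') (structure_map A) (origin E' k^o)) (fmap (curve E') (structure_map A) (origin E' k^o))).
by rewrite e padd_origin.
Qed.

Lemma hom_sum (k : closedFieldType) (E E' : ellcurve k) (phi : nattrans (curve E) (curve E')) :
  is_hom phi -> forall A,
  [/\ forall p q : pts E A, phi A (p + q) = (phi A p : pts E' A) + phi A q :> pts E' A,
      forall p : pts E A, phi A (- p) = - (phi A p : pts E' A) :> pts E' A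
    & forall (p : pts E A) n, phi A (p *+ n) = (phi A p : pts E' A) *+ n :> pts E' A].
Proof.
by move=> h A; split=> *; [exact: homD | exact: homN | exact: homMn].
Qed.

(** * Products made isomorphic by isogenies of coprime degrees *)

Section ProductIso.
Variables (k : closedFieldType) (g : nat) (E E' : 'I_g -> ellcurve k) (i0 i1 : 'I_g) (n : nat).
Hypotheses (n01 : i0 != i1) (n_odd : odd n).
Variables (phi0 : nattrans (curve (E i0)) (curve (E' i0))) (psi0 : nattrans (curve (E' i0)) (curve (E i0)))
  (phi1 : nattrans (curve (E' i1)) (curve (E i1))) (psi1 : nattrans (curve (E i1)) (curve (E' i1)))
  (al : nattrans (curve (E i0)) (curve (E' i1))) (be : nattrans (curve (E' i1)) (curve (E i0)))
  (al' : nattrans (curve (E' i0)) (curve (E i1))) (be' : nattrans (curve (E i1)) (curve (E' i0))).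
Hypotheses (h0 : dualpair 2 phi0 psi0) (h1 : dualpair 2 phi1 psi1)
  (ha : dualpair n al be) (ha' : dualpair n al' be').
Hypothesis sq : forall A p, phi1 A (al A p) = al' A (phi0 A p).
Hypothesis others : forall i, i != i0 -> i != i1 -> E i = E' i.

(** The Bezout relation between 2 and the odd degree n is [2 b - n = 1]. *)
Let b := n.+1./2.
Let bE : (b * 2 = n + 1)%N.
Proof. by rewrite /b addn1 muln2 -[RHS]odd_double_half /= n_odd. Qed.

Let hom_phi0 : is_hom phi0. Proof. by case: h0. Qed.
Let hom_psi0 : is_hom psi0. Proof. by case: h0. Qed.
Let hom_phi1 : is_hom phi1. Proof. by case: h1. Qed.
Let hom_psi1 : is_hom psi1. Proof. by case: h1. Qed.
Let hom_al : is_hom al. Proof. by case: ha. Qed.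
Let hom_be : is_hom be. Proof. by case: ha. Qed.
Let hom_al' : is_hom al'. Proof. by case: ha'. Qed.
Let hom_be' : is_hom be'. Proof. by case: ha'. Qed.

(** The squares with dual isogenies follow from [sq] by composing with surjective isogenies, which
    are then cancelled. *)
Let comm1 A (q : pts (E i1) A) : psi0 A (be' A q) = be A (psi1 A q).
Proof.
apply: (@hom_ext k _ _ (nt_comp be' psi0) (nt_comp psi1 be)) => {A}q /=.
have [_ _ sal' be'K] := ha'; have [_ _ s0 psi0K] := h0.
have [_ _ _ psi1K] := h1; have [_ _ _ beK] := ha.
have [p' <-] := sal' q; have [p <-] := s0 p'.
rewrite be'K -sq psi1K [LHS](homMn hom_psi0) /= psi0K [RHS](homMn hom_be) /= beK.
by rewrite -!mulrnA mulnC.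
Qed.
Let comm2 A (q : pts (E' i1) A) : phi0 A (be A q) = be' A (phi1 A q).
Proof.
apply: (@hom_ext k _ _ (nt_comp be phi0) (nt_comp phi1 be')) => {A}q /=.
have [_ _ sal beK] := ha; have [_ _ _ be'K] := ha'.
have [p <-] := sal q; rewrite beK sq be'K; exact: (homMn hom_phi0).
Qed.
Let comm3 A (q : pts (E' i0) A) : al A (psi0 A q) = psi1 A (al' A q).
Proof.
apply: (@hom_ext k _ _ (nt_comp psi0 al) (nt_comp al' psi1)) => {A}q /=.
have [_ _ s0 psi0K] := h0; have [_ _ _ psi1K] := h1.
have [p <-] := s0 q; rewrite psi0K -sq psi1K; exact: (homMn hom_al).
Qed.

Definition nt_plus F (E2 : ellcurve k) (u v : nattrans F (curve E2)) : nattrans F (curve E2) :=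
  nt_comp (nt_pair u v) (padd_trans E2).

Let T i := nattrans (curve_prod E) (curve (E' i)).
Let T' i := nattrans (curve_prod E') (curve (E i)).

(** The matrix has rows [phi0, be'] and [al, b psi1], its inverse [b psi0, - be] and [- al', phi1].
    The diagonal entries of the products are [2 b - n], and the other entries cancel by the
    commuting squares. *)
Let M0 : T i0 := nt_plus (nt_comp (nt_proj _ i0) phi0) (nt_comp (nt_proj _ i1) be').
Let M1 : T i1 := nt_plus (nt_comp (nt_proj _ i0) al) (nt_comp (nt_proj _ i1) (p_muln b psi1)).
Let N0 : T' i0 := nt_plus (nt_comp (nt_proj _ i0) (p_muln b psi0)) (nt_comp (nt_proj _ i1) (p_opp be)).
Let N1 : T' i1 := nt_plus (nt_comp (nt_proj _ i0) (p_opp al')) (nt_comp (nt_proj _ i1) phi1).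

(** [E i = E' i] holds for the remaining indices; asking only for the existence of mutually inverse
    morphisms avoids transport along this equality. Zero maps fill the two exceptional places. *)
Let others_iso i : exists (c : nattrans (curve (E i)) (curve (E' i))) (d : nattrans (curve (E' i)) (curve (E i))),
  is_hom c /\ (i != i0 -> i != i1 -> forall A, cancel (c A) (d A) /\ cancel (d A) (c A)).
Proof.
have [/andP[n0 n1]|n01'] := boolP ((i != i0) && (i != i1)).
  by rewrite -others //; exists (nt_id _), (nt_id _); split=> // _ _ A; split.
exists (nt_const _ (origin _ _)), (nt_const _ (origin _ _)); split; first exact: const_hom.
by move=> n0 n1; rewrite n0 n1 in n01'.
Qed.

Theorem product_iso : prod_iso E E'.
Proof.
pose c i := projT1 (cid (others_iso i)).
pose d i := projT1 (cid (projT2 (cid (others_iso i)))).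
have hc i : is_hom (c i) by case: (projT2 (cid (projT2 (cid (others_iso i))))).
have cd i (j0 : i != i0) (j1 : i != i1) A : cancel (c i A) (d i A) /\ cancel (d i A) (c i A).
  by case: (projT2 (cid (projT2 (cid (others_iso i))))) => _; exact.
pose M : forall i, T i := dfwith (dfwith (fun i => nt_comp (nt_proj _ i) (c i)) M1) M0.
pose N : forall i, T' i := dfwith (dfwith (fun i => nt_comp (nt_proj _ i) (d i)) N1) N0.
have ME0 : M i0 = M0 by rewrite /M dfwith_in.
have NE0 : N i0 = N0 by rewrite /N dfwith_in.
have ME1 : M i1 = M1 by rewrite /M dfwith_out // dfwith_in.
have NE1 : N i1 = N1 by rewrite /N dfwith_out // dfwith_in.
have ME i : i != i0 -> i != i1 -> M i = nt_comp (nt_proj _ i) (c i).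
  by move=> j0 j1; rewrite /M !dfwith_out // eq_sym.
have NE i : i != i0 -> i != i1 -> N i = nt_comp (nt_proj _ i) (d i).
  by move=> j0 j1; rewrite /N !dfwith_out // eq_sym.
have bn (G : ellcurve k) A (x : pts G A) : x *+ 2 *+ b - x *+ n = x.
  by rewrite -mulrnA mulnC bE mulrnDr mulr1n addrC addKr.
exists (nt_prod M), (nt_prod N); split.
  move=> A.
  have [psi0D _ _] := hom_sum hom_psi0 A; have [beD _ beM] := hom_sum hom_be A.
  have [al'D _ _] := hom_sum hom_al' A; have [phi1D _ phi1M] := hom_sum hom_phi1 A.
  have [phi0D phi0N phi0M] := hom_sum hom_phi0 A; have [be'D be'N _] := hom_sum hom_be' A.
  have [alD alN alM] := hom_sum hom_al A; have [psi1D psi1N _] := hom_sum hom_psi1 A.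
  have [_ _ _ psi0K] := h0; have [_ _ _ psi1K] := h1; have [_ _ _ beK] := ha; have [_ _ _ be'K] := ha'.
  split=> P; apply: functional_extensionality_dep => i.
    have [ei|j0] := eqVneq i i0; last have [ei|j1] := eqVneq i i1.
    - subst i; change (N i0 A (fun i => M i A P) = P i0); rewrite NE0.
      change ((p_muln b psi0 A (M i0 A P) : pts (E i0) A) + - (be A (M i1 A P) : pts (E i0) A) = P i0).
      have -> : M i0 A P = (phi0 A (P i0) : pts _ A) + be' A (P i1) by rewrite ME0.
      have -> : M i1 A P = (al A (P i0) : pts _ A) + (psi1 A (P i1) : pts _ A) *+ b by rewrite ME1 -p_mulnE.
      rewrite p_mulnE psi0D psi0K comm1 beD beK beM.
      by rewrite mulrnDl opprD addrACA subrr addr0 bn.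
    - subst i; change (N i1 A (fun i => M i A P) = P i1); rewrite NE1.
      change (- (al' A (M i0 A P) : pts (E i1) A) + (phi1 A (M i1 A P) : pts (E i1) A) = P i1).
      have -> : M i0 A P = (phi0 A (P i0) : pts _ A) + be' A (P i1) by rewrite ME0.
      have -> : M i1 A P = (al A (P i0) : pts _ A) + (psi1 A (P i1) : pts _ A) *+ b by rewrite ME1 -p_mulnE.
      rewrite al'D phi1D phi1M sq (dualpairC h1) (dualpairC ha').
      by rewrite opprD addrACA addNr add0r addrC bn.
    - by change (N i A (fun i => M i A P) = P i); rewrite NE //= ME //=; have [-> _] := cd i j0 j1 A.
  have [ei|j0] := eqVneq i i0; last have [ei|j1] := eqVneq i i1.
  - subst i; change (M i0 A (fun i => N i A P) = P i0); rewrite ME0.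
    change ((phi0 A (N i0 A P) : pts (E' i0) A) + (be' A (N i1 A P) : pts (E' i0) A) = P i0).
    have -> : N i0 A P = (psi0 A (P i0) : pts _ A) *+ b - (be A (P i1) : pts _ A) by rewrite NE0 -p_mulnE.
    have -> : N i1 A P = - (al' A (P i0) : pts _ A) + (phi1 A (P i1) : pts _ A) by rewrite NE1.
    rewrite phi0D phi0N phi0M be'D be'N comm2 (dualpairC h0) be'K.
    by rewrite [- _ + _]addrC addrA subrK bn.
  - subst i; change (M i1 A (fun i => N i A P) = P i1); rewrite ME1.
    change ((al A (N i0 A P) : pts (E' i1) A) + (p_muln b psi1 A (N i1 A P) : pts (E' i1) A) = P i1).
    have -> : N i0 A P = (psi0 A (P i0) : pts _ A) *+ b - (be A (P i1) : pts _ A) by rewrite NE0 -p_mulnE.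
    have -> : N i1 A P = - (al' A (P i0) : pts _ A) + (phi1 A (P i1) : pts _ A) by rewrite NE1.
    rewrite p_mulnE alD alN alM comm3 psi1D psi1N (dualpairC ha) psi1K.
    by rewrite mulrnDl mulNrn addrACA subrr add0r addrC bn.
  - by change (M i A (fun i => N i A P) = P i); rewrite ME //= NE //=; have [_ ->] := cd i j0 j1 A.
move=> P Q S hS i; apply/curve_addP.
have {}hS j : S j = padd (P j) (Q j) by apply/curve_addP.
have AC (G : ellcurve k) (x y z t : pts G k^o) : x + y + (z + t) = (x + z) + (y + t).
  by rewrite addrACA.
have [ei|j0] := eqVneq i i0; last have [ei|j1] := eqVneq i i1.
- subst i; change (M i0 k^o S = padd (M i0 k^o P) (M i0 k^o Q)); rewrite ME0 /= !hS hom_phi0 hom_be'.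
  exact: AC.
- subst i; change (M i1 k^o S = padd (M i1 k^o P) (M i1 k^o Q)); rewrite ME1 /= !hS hom_al.
  rewrite (p_muln_hom b hom_psi1); exact: AC.
- by change (M i k^o S = padd (M i k^o P) (M i k^o Q)); rewrite ME //= hS hc.
Qed.
End ProductIso.

Lemma isC_ex (k : fieldType) (a b : k) : b != 0 -> a ^+ 3 - 27 * b != 0 -> exists E : ellcurve k, isC E a b.
Proof.
move=> b0 d0; have h : invertible (discriminant a 0 b 0 0).
  have -> : discriminant a 0 b 0 0 = b ^+ 3 * (a ^+ 3 - 27 * b) by rewrite /discriminant; ring.
  by exists (b ^+ 3 * (a ^+ 3 - 27 * b))^-1; rewrite divff // mulf_neq0 ?expf_neq0.
by exists (EllCurve h).
Qed.

Section ChainIso.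
Variables (k : closedFieldType) (r : nat) (v : nat -> k).
Hypothesis hv : forall i, (i < r)%N ->
  v i.+1 ^+ 3 * (v i ^+ 2 - v i + 1) = v i * (v i ^+ 2 + 2 * v i + 4).
Hypothesis nv : forall i, (i <= r)%N -> v i * (v i ^+ 3 - 8) * (v i ^+ 3 + 1) != 0.

(** The product [z i] is the scale accumulated along the chain, starting at 1; its last value [s]
    does not affect j-invariants. The hypothesis [nv] amounts to nonzero discriminants for both
    curves of every step. *)
Theorem chain_iso g (i0 i1 : 'I_g) (G : 'I_g -> ellcurve k) : i0 != i1 ->
  exists (F F' : 'I_g -> ellcurve k) (s : k), prod_iso F F' /\ s != 0 /\
  [/\ isC (F i0) (v 0 ^+ 3 - 2) (v 0 ^+ 3), isC (F' i0) (v 0 ^+ 3 + 4) (v 0 ^+ 6),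
      isC (F i1) ((v r ^+ 3 + 4) * s) (v r ^+ 6 * s ^+ 3), isC (F' i1) ((v r ^+ 3 - 2) * s) (v r ^+ 3 * s ^+ 3)
    & forall i, i != i0 -> i != i1 -> F i = G i /\ F' i = G i].
Proof.
move=> n01; pose z i := \prod_(j < i) (v j ^+ 2 - v j + 1).
have z0 i : (i <= r)%N -> z i != 0.
  move=> ir; apply/prodf_neq0 => j _.
  have := nv (leq_trans (ltnW (ltn_ord j)) ir); apply: contra_neq => e.
  transitivity (v j * (v j ^+ 3 - 8) * ((v j + 1) * (v j ^+ 2 - v j + 1))); first by ring.
  by rewrite e !mulr0.
have fact i : (i <= r)%N -> [/\ v i != 0, v i ^+ 3 - 8 != 0 & v i ^+ 3 + 1 != 0].
  by move=> /nv; rewrite !mulf_eq0 !negb_or => /andP[/andP[]].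
have exE i : exists E : ellcurve k * ellcurve k, (i <= r)%N ->
  isC E.1 ((v i ^+ 3 - 2) * z i) ((v i * z i) ^+ 3) /\
  isC E.2 ((v i ^+ 3 - 2) * z i + 6 * z i) (z i * ((v i ^+ 3 - 2) * z i + 2 * z i) ^+ 2).
  wlog ir : i / (i <= r)%N.
    move=> H; have [ir|ir] := pselect (i <= r)%N; first exact: H.
    by have [E _] := H 0%N isT; exists E.
  have [v0 v8 v1] := fact i ir; have zi := z0 i ir.
  have [||E hE] := @isC_ex k ((v i ^+ 3 - 2) * z i) ((v i * z i) ^+ 3).
  - by rewrite expf_neq0 ?mulf_neq0.
  - rewrite (_ : _ - _ = z i ^+ 3 * (v i ^+ 3 - 8) * (v i ^+ 3 + 1) ^+ 2); last by ring.
    by rewrite !mulf_neq0 ?expf_neq0.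
  have [||E' hE'] := @isC_ex k ((v i ^+ 3 - 2) * z i + 6 * z i) (z i * ((v i ^+ 3 - 2) * z i + 2 * z i) ^+ 2).
  - rewrite (_ : _ * _ ^+ 2 = z i ^+ 3 * v i ^+ 6); last by ring.
    by rewrite mulf_neq0 ?expf_neq0.
  - rewrite (_ : _ - _ = z i ^+ 3 * (v i ^+ 3 - 8) ^+ 2 * (v i ^+ 3 + 1)); last by ring.
    by rewrite !mulf_neq0 ?expf_neq0.
  by exists (E, E').
pose E i := (projT1 (cid (exE i))).1; pose E' i := (projT1 (cid (exE i))).2.
have hE i : (i <= r)%N -> isC (E i) ((v i ^+ 3 - 2) * z i) ((v i * z i) ^+ 3).
  by move=> ir; case: (projT2 (cid (exE i)) ir).
have hE' i : (i <= r)%N -> isC (E' i) ((v i ^+ 3 - 2) * z i + 6 * z i) (z i * ((v i ^+ 3 - 2) * z i + 2 * z i) ^+ 2).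
  by move=> ir; case: (projT2 (cid (exE i)) ir).
have hz i : (i < r)%N -> z i.+1 = z i * (v i ^+ 2 - v i + 1) by rewrite /z big_ord_recr.
pose F i := if i == i0 then E 0 else if i == i1 then E' r else G i.
pose F' i := if i == i0 then E' 0 else if i == i1 then E r else G i.
have F0 : F i0 = E 0 by rewrite /F eqxx.
have F1 : F i1 = E' r by rewrite /F eq_sym (negPf n01) eqxx.
have F'0 : F' i0 = E' 0 by rewrite /F' eqxx.
have F'1 : F' i1 = E r by rewrite /F' eq_sym (negPf n01) eqxx.
have z00 : z 0%N = 1 by rewrite /z big_ord0.
exists F, F', (z r); split; last first.
  split; first exact: z0.
  rewrite F0 F1 F'0 F'1; split.
  - by have := hE 0%N (leq0n r); rewrite z00 !mulr1.
  - have := hE' 0%N (leq0n r); rewrite z00 !mulr1; congr (isC _ _ _); ring.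
  - have := hE' r (leqnn r); congr (isC _ _ _); ring.
  - have := hE r (leqnn r); congr (isC _ _ _); ring.
  by move=> i j0 j1; rewrite /F /F' (negPf j0) (negPf j1).
have [phi0 [psi0 [hd hk]]] := chain_two hE hE' (leq0n r).
have [phi [psi [al [be [al' [be' [h1 h2 h3 h4 _]]]]]]] := chain_ex hv hz z0 hE hE' (leqnn r) hk.
move: phi0 psi0 hd phi psi al be al' be' h1 h2 h3 h4 {hk}.
rewrite -F0 -F1 -F'0 -F'1 => phi0 psi0 hd phi psi al be al' be' h1 h2 h3 h4.
apply: (@product_iso k g F F' i0 i1 (3 ^ r) n01 _ phi0 psi0 phi psi al be al' be' hd h1 h2 h3 h4).
  by rewrite oddX orbT.
by move=> i j0 j1; rewrite /F /F' (negPf j0) (negPf j1).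
Qed.
End ChainIso.

(** * The j-invariant *)

Notation delta E := (discriminant (ec_a1 E) (ec_a2 E) (ec_a3 E) (ec_a4 E) (ec_a6 E)).

Section JInvariant.
Variable R : comNzRingType.
Implicit Types E : ellcurve R.

Definition c4 (a1 a2 a3 a4 : R) : R := (a1 ^+ 2 + 4 * a2) ^+ 2 - 24 * (2 * a4 + a1 * a3).
Definition jinv E : R :=
  c4 (ec_a1 E) (ec_a2 E) (ec_a3 E) (ec_a4 E) ^+ 3 * projT1 (cid (ec_disc E)).

Lemma mulI_inv (a x y : R) : invertible a -> a * x = a * y -> x = y.
Proof.
by move=> [b ab] e; rewrite -[x]mul1r -[y]mul1r -ab [a * b]mulrC -!mulrA e.
Qed.

Lemma jinvE E : delta E * jinv E = c4 (ec_a1 E) (ec_a2 E) (ec_a3 E) (ec_a4 E) ^+ 3.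
Proof. by rewrite /jinv mulrCA; case: cid => d /= ->; rewrite mulr1. Qed.

Lemma jinv_uniq E x : delta E * x = c4 (ec_a1 E) (ec_a2 E) (ec_a3 E) (ec_a4 E) ^+ 3 -> jinv E = x.
Proof. by rewrite -jinvE => e; apply: (mulI_inv (ec_disc E)). Qed.

(* [E'] becomes [E] under [x' = u^2 x + r], [y' = u^3 y + u^2 s x + t] *)
Definition coord_change (u r s t : R) E E' : Prop :=
  [/\ u * ec_a1 E = ec_a1 E' + 2 * s,
      u ^+ 2 * ec_a2 E = ec_a2 E' - s * ec_a1 E' + 3 * r - s ^+ 2,
      u ^+ 3 * ec_a3 E = ec_a3 E' + r * ec_a1 E' + 2 * t,
      u ^+ 4 * ec_a4 E = ec_a4 E' - s * ec_a3 E' + 2 * r * ec_a2 E' - (t + r * s) * ec_a1 E'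
        + 3 * r ^+ 2 - 2 * s * t
    & u ^+ 6 * ec_a6 E = ec_a6 E' + r * ec_a4 E' + r ^+ 2 * ec_a2 E' + r ^+ 3 - t * ec_a3 E'
        - t ^+ 2 - r * t * ec_a1 E'].

Lemma coord_change_disc (b1 b2 b3 b4 b6 r s t : R) :
  discriminant (b1 + 2 * s) (b2 - s * b1 + 3 * r - s ^+ 2) (b3 + r * b1 + 2 * t)
    (b4 - s * b3 + 2 * r * b2 - (t + r * s) * b1 + 3 * r ^+ 2 - 2 * s * t)
    (b6 + r * b4 + r ^+ 2 * b2 + r ^+ 3 - t * b3 - t ^+ 2 - r * t * b1) = discriminant b1 b2 b3 b4 b6.
Proof. rewrite /discriminant; ring. Qed.

Lemma discriminant_scale (u a1 a2 a3 a4 a6 : R) :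
  discriminant (u * a1) (u ^+ 2 * a2) (u ^+ 3 * a3) (u ^+ 4 * a4) (u ^+ 6 * a6) =
  u ^+ 12 * discriminant a1 a2 a3 a4 a6.
Proof. rewrite /discriminant; ring. Qed.

Lemma coord_change_j u r s t E E' : coord_change u r s t E E' -> jinv E = jinv E'.
Proof.
move=> [e1 e2 e3 e4 e6].
have eD : u ^+ 12 * delta E = delta E'.
  by rewrite -discriminant_scale e1 e2 e3 e4 e6 coord_change_disc.
have eC : u ^+ 4 * c4 (ec_a1 E) (ec_a2 E) (ec_a3 E) (ec_a4 E) = c4 (ec_a1 E') (ec_a2 E') (ec_a3 E') (ec_a4 E').
  transitivity (c4 (u * ec_a1 E) (u ^+ 2 * ec_a2 E) (u ^+ 3 * ec_a3 E) (u ^+ 4 * ec_a4 E)).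
    by rewrite /c4; ring.
  by rewrite e1 e2 e3 e4 /c4; ring.
apply/esym/jinv_uniq; rewrite -eD -eC -mulrA jinvE; ring.
Qed.
End JInvariant.

Lemma jinv_map (R S : comNzRingType) (f : {rmorphism R -> S}) (E : ellcurve R) :
  jinv (ellcurve_map f E) = f (jinv E).
Proof.
apply: jinv_uniq; rewrite /= discriminant_rmorph -rmorphM jinvE rmorphXn /c4; congr (_ ^+ 3); ring.
Qed.

Lemma coord_change_map (R S : comNzRingType) (f : {rmorphism R -> S}) (E E' : ellcurve R) u r s t :
  coord_change u r s t E E' ->
  coord_change (f u) (f r) (f s) (f t) (ellcurve_map f E) (ellcurve_map f E').
Proof.
move=> [e1 e2 e3 e4 e6]; split => /=.
- by transitivity (f (u * ec_a1 E)); [ring | rewrite e1; ring].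
- by transitivity (f (u ^+ 2 * ec_a2 E)); [ring | rewrite e2; ring].
- by transitivity (f (u ^+ 3 * ec_a3 E)); [ring | rewrite e3; ring].
- by transitivity (f (u ^+ 4 * ec_a4 E)); [ring | rewrite e4; ring].
- by transitivity (f (u ^+ 6 * ec_a6 E)); [ring | rewrite e6; ring].
Qed.

Definition mx3 (R : nzRingType) (a b c : 'rV[R]_3) : 'M[R]_3 := \matrix_(i, j) nth 0 [:: a; b; c] i 0 j.

Lemma mx3_mul (R : comNzRingType) (a b c : 'rV[R]_3) (w : 'rV[R]_3) :
  w *m mx3 a b c = w 0 0 *: a + w 0 1 *: b + w 0 ord_max *: c.
Proof. by apply/rowP => j; rewrite row3_mul !mxE /=. Qed.

Lemma mx3_eq (R : comNzRingType) (N : 'M[R]_3) : (forall w : 'rV[R]_3, w *m N = w) -> N = 1%:M.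
Proof. by move=> h; apply/row_matrixP => i; rewrite !rowE h mulmx1. Qed.

Lemma map_mx3 (R S : nzRingType) (f : {rmorphism R -> S}) (a b c : 'rV[R]_3) :
  map_mx f (mx3 a b c) = mx3 (map_mx f a) (map_mx f b) (map_mx f c).
Proof. by apply/matrixP => -[[|[|[|//]]] hi] j; rewrite !mxE /= ?mxE. Qed.

Definition cc_mx (R : comNzRingType) (u r s t : R) : 'M[R]_3 :=
  mx3 (vec3 (u ^+ 2) (u ^+ 2 * s) 0) (vec3 0 (u ^+ 3) 0) (vec3 r t 1).

Lemma cc_mx_map (R S : comNzRingType) (f : {rmorphism R -> S}) (u r s t : R) :
  map_mx f (cc_mx u r s t) = cc_mx (f u) (f r) (f s) (f t).
Proof. by rewrite /cc_mx map_mx3 !map_vec3 !(rmorphXn, rmorphM, rmorph0, rmorph1). Qed.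

Lemma cc_cubic (R : comNzRingType) (E E' : ellcurve R) u r s t w : coord_change u r s t E E' ->
  wcubic E' (w *m cc_mx u r s t) = u ^+ 6 * wcubic E w.
Proof.
move=> [e1 e2 e3 e4 e6]; rewrite mx3_mul.
transitivity (let X := w 0 0 in let Y := w 0 1 in let Z := w 0 ord_max in
  u ^+ 6 * Y ^+ 2 * Z + u ^+ 5 * (u * ec_a1 E) * X * Y * Z + u ^+ 3 * (u ^+ 3 * ec_a3 E) * Y * Z ^+ 2
  - (u ^+ 6 * X ^+ 3 + u ^+ 4 * (u ^+ 2 * ec_a2 E) * X ^+ 2 * Z + u ^+ 2 * (u ^+ 4 * ec_a4 E) * X * Z ^+ 2
     + (u ^+ 6 * ec_a6 E) * Z ^+ 3)); last by rewrite /wcubic /=; ring.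
by rewrite e1 e2 e3 e4 e6 /wcubic !mxE /=; ring.
Qed.

Section CoordIso.
Variables (k : comNzRingType) (E E' : ellcurve k) (u v r s t : k).
Hypotheses (uv : u * v = 1) (hc : coord_change u r s t E E').
Let M := cc_mx u r s t.
Let M' : 'M[k]_3 := mx3 (vec3 (v ^+ 2) (- v ^+ 3 * s) 0) (vec3 0 (v ^+ 3) 0)
  (vec3 (- v ^+ 2 * r) (v ^+ 3 * (r * s - t)) 1).
Let e2 : u ^+ 2 * v ^+ 2 = 1. Proof. by rewrite -exprMn uv expr1n. Qed.
Let e3 : u ^+ 3 * v ^+ 3 = 1. Proof. by rewrite -exprMn uv expr1n. Qed.

Let MM' : M *m M' = 1%:M.
Proof.
apply: mx3_eq => w; rewrite mulmxA !mx3_mul; apply: row3P; rewrite !mxE /=.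
- by transitivity (w 0 0 * (u ^+ 2 * v ^+ 2)); [ring | rewrite e2 mulr1].
- by transitivity (w 0 1 * (u ^+ 3 * v ^+ 3)); [ring | rewrite e3 mulr1].
- by ring.
Qed.
Let M'M : M' *m M = 1%:M. Proof. exact: mulmx1C. Qed.

Let hM (A : comAlgType k) (w : 'rV[A]_3) : wcubic (ellcurve_map (in_alg A) E) w = 0 ->
  wcubic (ellcurve_map (in_alg A) E') (w *m map_mx (in_alg A) M) = 0.
Proof.
by move=> h; rewrite cc_mx_map (cc_cubic _ (coord_change_map (in_alg A) hc)) h mulr0.
Qed.
Let hM' (A : comAlgType k) (w : 'rV[A]_3) : wcubic (ellcurve_map (in_alg A) E') w = 0 ->
  wcubic (ellcurve_map (in_alg A) E) (w *m map_mx (in_alg A) M') = 0.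
Proof.
have {1}-> : w = w *m map_mx (in_alg A) M' *m map_mx (in_alg A) M.
  by rewrite -mulmxA -map_mxM M'M map_mx1 mulmx1.
set w' := w *m _; rewrite cc_mx_map (cc_cubic _ (coord_change_map (in_alg A) hc)) => h.
have uvA : in_alg A u * in_alg A v = 1 by rewrite -rmorphM uv rmorph1.
by rewrite -[LHS]mul1r -(expr1n _ 6) -uvA exprMn [in_alg A u ^+ 6 * _]mulrC -mulrA h mulr0.
Qed.

Lemma lin_trans_inv (E1 E2 : ellcurve k) (N N' : 'M[k]_3) (h : N *m N' = 1%:M) (h' : N' *m N = 1%:M) hN hN' :
  forall A, cancel (@lin_trans k E1 E2 N N' h hN A) (@lin_trans k E2 E1 N' N h' hN' A).
Proof.
move=> A P; apply: point_par => w w' [w1 [w2 Pw ->] ->] Pw'; rewrite -mulmxA -map_mxM h map_mx1 mulmx1.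
exact: point_parr Pw Pw'.
Qed.

Theorem coord_change_iso : ellcurve_iso E E'.
Proof.
exists (lin_trans MM' hM), (lin_trans M'M hM'); split.
  by move=> A; split; apply: lin_trans_inv.
move=> A; apply: point_par => w w' [w1 [x z] ->] [x' z'] i j.
rewrite cc_mx_map mx3_mul x z !scale0r add0r addr0.
by case: (ord3P i) => ->; case: (ord3P j) => ->; rewrite !mxE /= ?x' ?z' ?mulr0 ?mul0r // mulrC.
Qed.
End CoordIso.

(** * Isomorphisms of curves are coordinate changes *)

Lemma ko_alg (k : comNzRingType) (C : comAlgType k) (f : {lrmorphism k^o -> C}) (c : k^o) :
  f c = (c : k)%:A.
Proof. by rewrite -[c in LHS]mulr1 -[LHS]/(f ((c : k) *: (1 : k^o))) linearZ /= rmorph1. Qed.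

(** The algebra [k[t]/(t^N)], over which germs of curves at the origin are studied. The last clause
    says that scalars are still visible in the top power of [t]. *)
Lemma trunc_ex (k : comNzRingType) N : (0 < N)%N -> exists (B : comAlgType k) (t : B),
  [/\ t ^+ N = 0,
      forall (C : comAlgType k) (b : C), b ^+ N = 0 -> exists f : {lrmorphism B -> C}, f t = b,
      forall e : B, exists (c : k) e', e = c%:A + t * e'
    & forall c : k, t ^+ N.-1 * c%:A = 0 -> c = 0].
Proof.
move=> N0; have sX : (1 < size ('X^N : {poly k^o}))%N by rewrite size_polyXn ltnS.
have [B [iota [t [h1 h2 h3 h4]]]] := monic_quot (monicXn _ N) sX.
exists B, t; split.
- by rewrite map_polyXn hornerXn in h1.
- move=> C b bN; have [|f [_ ft]] := h2 C (structure_map C) b; first by rewrite map_polyXn hornerXn.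
  by exists f.
- move=> e; have [r _ ->] := h3 e; exists (r`_0 : k), (map_poly iota (\poly_(i < size r) r`_i.+1)).[t].
  rewrite -(ko_alg iota); have {1}-> : r = (r`_0)%:P + (\poly_(i < size r) r`_i.+1) * 'X.
    apply/polyP => -[|i]; rewrite coefD coefC coefMX /= ?addr0 // add0r coef_poly.
    by case: ltnP => // sr; rewrite nth_default // (leq_trans sr).
  rewrite (rmorphD (map_poly iota)) (rmorphM (map_poly iota)) /= map_polyC map_polyX !hornerE /=.
  by rewrite mulrC.
move=> c tc; pose p : {poly k^o} := (c : k^o) *: 'X^(N.-1).
have s : (size p < size ('X^N : {poly k^o}))%N.
  by rewrite size_polyXn (leq_ltn_trans (size_scale_leq _ _)) // size_polyXn prednK.
have := h4 p s; rewrite map_polyZ map_polyXn hornerZ hornerXn /= ko_alg mulrC => /(_ tc).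
by move=> /(congr1 (fun q : {poly k^o} => q`_N.-1)); rewrite coefZ coefXn eqxx coef0 mulr1.
Qed.

Section Truncated.
Variables (k : comNzRingType) (N : nat) (B : comAlgType k) (t : B).
Hypotheses (N1 : (1 < N)%N) (tN : t ^+ N = 0).
Hypothesis B_univ : forall (C : comAlgType k) (b : C), b ^+ N = 0 -> exists f : {lrmorphism B -> C}, f t = b.
Hypothesis B_dec : forall e : B, exists (c : k) e', e = c%:A + t * e'.
Hypothesis B_inj : forall c : k, t ^+ N.-1 * c%:A = 0 -> c = 0.

Lemma tpow0 n e : (N <= n)%N -> t ^+ n * e = 0.
Proof. by move=> /subnK <-; rewrite exprD tN mulr0 mul0r. Qed.

Lemma ttop e : t ^+ N.-1 * (1 + t * e) = t ^+ N.-1.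
Proof. by rewrite mulrDr mulr1 mulrA -exprSr prednK ?(ltnW N1) // tN mul0r addr0. Qed.

Lemma ttopM e f : t ^+ N.-1 * (e + t * f) = t ^+ N.-1 * e.
Proof. by rewrite mulrDr mulrA -exprSr prednK ?(ltnW N1) // tN mul0r addr0. Qed.

Lemma tinv e : exists f, (1 + t * e) * (1 + t * f) = 1.
Proof.
exists (- e * \sum_(i < N) (- (t * e)) ^+ i).
set s := \sum_(i < N) _.
have h : (1 + t * e) * s = 1.
  have := subrX1 (- (t * e)) N; rewrite exprNn exprMn tN mul0r mulr0 -/s => h.
  by apply: oppr_inj; rewrite -[RHS]add0r h; ring.
have -> : 1 + t * (- e * s) = s; last exact: h.
by rewrite -{1}h; ring.
Qed.

(** The germ [[t x : 1 : t z]], which passes through the origin at [t = 0]. *)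
Definition onB (E : ellcurve k) (x z : B) : Prop :=
  wcubic (ellcurve_map (in_alg B) E) (vec3 (t * x) 1 (t * z)) = 0.

Lemma onBE (E : ellcurve k) x z : let EB := ellcurve_map (in_alg B) E in let X := t * x in let Z := t * z in
  onB E x z <-> Z = X ^+ 3 + ec_a2 EB * X ^+ 2 * Z + ec_a4 EB * X * Z ^+ 2 + ec_a6 EB * Z ^+ 3
    - ec_a1 EB * X * Z - ec_a3 EB * Z ^+ 2.
Proof.
move=> EB X Z; rewrite /onB /wcubic !vec3E -/EB -/X -/Z; split=> h; last first.
  by rewrite {1}h; ring.
by apply/subr0_eq; rewrite -[RHS]h; ring.
Qed.

(** The difference satisfies [D = t e D], and [t] is nilpotent. *)
Lemma formal_uniq (E : ellcurve k) x z z' : onB E x z -> onB E x z' -> t * z = t * z'.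
Proof.
move=> /onBE h /onBE h'; apply/subr0_eq; set EB := ellcurve_map _ _ in h h'.
set D := _ - _; pose Z := t * z; pose Z' := t * z'; pose X := t * x.
pose e := ec_a2 EB * X * x + ec_a4 EB * x * (Z + Z') + ec_a6 EB * (Z * z + z * Z' + z' * Z')
    - ec_a1 EB * x - ec_a3 EB * (z + z').
have DE : D = t * e * D.
  rewrite {1}/D h h' /D /e /X /Z /Z'; ring.
suff H n : D = t ^+ n * (e ^+ n * D) by rewrite (H N) tpow0.
elim: n => [|n IH]; first by rewrite !expr0 !mul1r.
rewrite {1}IH {1}DE !exprS; ring.
Qed.

(** [z] is a fixed point of a map [g] that contracts by the factor [t]; N iterations reach it. *)
Lemma formal_ex (E : ellcurve k) x : exists z, onB E x z.
Proof.
set EB := ellcurve_map (in_alg B) E; pose X := t * x.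
pose g (z : B) := t ^+ 2 * x ^+ 3 + ec_a2 EB * X ^+ 2 * z + ec_a4 EB * X * (t * z) * z + ec_a6 EB * (t * z) ^+ 2 * z
    - ec_a1 EB * X * z - ec_a3 EB * (t * z) * z.
suff H n : exists z e, g z - z = t ^+ n * e.
  have [z [e ze]] := H N; exists z; apply/onBE; rewrite -/EB.
  have gz : g z = z by apply/subr0_eq; rewrite ze tpow0.
  by rewrite -{1}gz /g /X; ring.
elim: n => [|n [z [e ze]]]; first by exists 0, (g 0); rewrite subr0 expr0 mul1r.
pose D y := ec_a2 EB * X * x + ec_a4 EB * X * (y + z) + ec_a6 EB * t * (y ^+ 2 + y * z + z ^+ 2)
    - ec_a1 EB * x - ec_a3 EB * (y + z).
have gD y : g y - g z = (y - z) * t * D y by rewrite /g /D /X; ring.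
by exists (g z), (e * D (g z)); rewrite gD ze exprS; ring.
Qed.

Lemma formal_shape (E : ellcurve k) x z : onB E x z -> exists w, t * z = (t * x) ^+ 3 * (1 + t * w).
Proof.
move=> /onBE; set EB := ellcurve_map _ _ => h.
pose e := ec_a2 EB * t * x ^+ 2 + ec_a4 EB * x * t * z + ec_a6 EB * t * z ^+ 2 - ec_a1 EB * x - ec_a3 EB * z.
have [w hw] := tinv (- e); exists w.
have h' : t * z * (1 + t * - e) = (t * x) ^+ 3.
  apply/subr0_eq; transitivity (t * z - ((t * x) ^+ 3 + ec_a2 EB * (t * x) ^+ 2 * (t * z) + ec_a4 EB * (t * x) * (t * z) ^+ 2
     + ec_a6 EB * (t * z) ^+ 3 - ec_a1 EB * (t * x) * (t * z) - ec_a3 EB * (t * z) ^+ 2)); first by rewrite /e; ring.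
  by rewrite -h subrr.
by rewrite -h' -mulrA hw mulr1.
Qed.

Lemma ev0_ex : exists pi : {lrmorphism B -> k^o}, forall c e, pi (c%:A + t * e) = c.
Proof.
have [|pi pit] := B_univ (b := 0 : k^o); first by rewrite expr0n; case: (N) N1.
exists pi => c e; rewrite rmorphD rmorphM /= pit mul0r addr0 lrmorph_alg; exact: mulr1.
Qed.

Section Iso.
Variables (E E' : ellcurve k) (phi : nattrans (curve E) (curve E')).
Hypothesis phiO : forall A, phi A (origin E A) = origin E' A.

(** At [t = 0] the germ is the origin, which [phi] preserves. So some vector of the image has as
    middle coordinate 1 plus a multiple of [t], and can be normalized. *)
Lemma phi_formal (P : curve E B) x z : sval P (vec3 (t * x) 1 (t * z)) ->
  exists x' z', onB E' x' z' /\ sval (phi B P) (vec3 (t * x') 1 (t * z')).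
Proof.
move=> hP; have [pi hpi] := ev0_ex.
have pi_t e : pi (t * e) = 0 by have := hpi 0 e; rewrite scale0r add0r.
have pi1 : pi 1 = 1 by rewrite rmorph1.
have pv : map_mx pi (vec3 (t * x) 1 (t * z)) = vec3 0 1 0.
  by rewrite map_vec3; congr (vec3 _ _ _); [exact: pi_t | exact: pi1 | exact: pi_t].
have fO : fmap (curve E) pi P = origin E k^o.
  have h := fmap_in pi hP; rewrite pv in h.
  apply: (point_eq_in h); first by split; rewrite vec3E.
  by apply: (@unit_primitive _ _ 1); rewrite vec3E; exists 1; rewrite mulr1.
have : sval (fmap (curve E') pi (phi B P)) (vec3 0 1 0).
  by rewrite -(nt_nat phi pi P) fO phiO; split; rewrite vec3E.
move=> [n [c [l [hl e]]]]; pose v := \sum_i (c i : k)%:A *: l i.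
have [L0 LD _ _] := point_line (phi B P).
have hv : sval (phi B P) v by apply: submod_sum.
have pv' j : pi (v 0 j) = vec3 0 1 0 0 j.
  rewrite e /v !summxE rmorph_sum; apply: eq_bigr => i _; rewrite !mxE rmorphM /= lrmorph_alg.
  by congr (_ * _); exact: mulr1.
have dec (y : B) : exists f, y = (pi y)%:A + t * f.
  by have [c' [f ->]] := B_dec y; exists f; rewrite hpi.
have [e0 E0] := dec (v 0 0); have [e1 E1] := dec (v 0 1); have [e2 E2] := dec (v 0 ord_max).
rewrite !pv' !vec3E in E0 E1 E2; rewrite ?scale0r ?add0r in E0 E2; rewrite scale1r in E1.
have [f hf] := tinv e1; have hw := point_scale (1 + t * f) hv.
have wE : (1 + t * f) *: v = vec3 (t * (e0 * (1 + t * f))) 1 (t * (e2 * (1 + t * f))).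
  by apply: row3P; rewrite !mxE /= ?E0 ?E1 ?E2; [ring | rewrite mulrC hf | ring].
rewrite wE in hw; exists (e0 * (1 + t * f)), (e2 * (1 + t * f)); split=> //.
exact: point_oncone hw.
Qed.

Definition fpt (E1 : ellcurve k) x z (h : onB E1 x z) : curve E1 B :=
  point_ray (@unit_primitive _ (vec3 (t * x) 1 (t * z)) 1 (ex_intro _ 1 (etrans (mulr1 _) (vec3E _ _ _).1.2))) h.

Lemma fpt_in (E1 : ellcurve k) x z (h : onB E1 x z) : sval (fpt h) (vec3 (t * x) 1 (t * z)).
Proof. by exists 1; rewrite scale1r. Qed.


Lemma fpt_subst (E1 : ellcurve k) x z x0 z0 (h : onB E1 x z) (h0 : onB E1 x0 z0) (s : {lrmorphism B -> B}) :
  s t = t * (x : B) -> s (t * x0) = t * x -> fmap (curve E1) s (fpt h0) = fpt h.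
Proof.
move=> st sx; have hs := fmap_in s (fpt_in h0).
have e : map_mx s (vec3 (t * x0) 1 (t * z0)) = vec3 (t * x) 1 (t * (x * s z0)).
  by rewrite map_vec3; congr (vec3 _ _ _); [exact: sx | exact: rmorph1 | rewrite rmorphM /= st mulrA].
rewrite e in hs; have h1 : onB E1 x (x * s z0) by exact: point_oncone hs.
rewrite -(formal_uniq h h1) in hs; apply: (point_eq_in hs (fpt_in h)).
by apply: (@unit_primitive _ _ 1); rewrite vec3E; exists 1; rewrite mulr1.
Qed.
End Iso.

(** The scalar [c] is the derivative of [phi] at the origin. Substituting [t x'] for [t] in the
    standard germ of [E'] gives the image germ; applying [psi] to it shows that the derivative [d]
    of [psi] is inverse to [c], by comparison in the top power of [t]. *)
Lemma formal_deriv (E E' : ellcurve k) (phi : nattrans (curve E) (curve E')) (psi : nattrans (curve E') (curve E))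
    z0 (h0 : onB E 1 z0) :
  (forall A, phi A (origin E A) = origin E' A) -> (forall A, psi A (origin E' A) = origin E A) ->
  (forall A, cancel (phi A) (psi A)) ->
  exists (c d : k) x' z' e, [/\ c * d = 1, x' = c%:A + t * e, onB E' x' z'
    & sval (phi B (fpt h0)) (vec3 (t * x') 1 (t * z'))].
Proof.
move=> phiO psiO psiK; have [x' [z' [h' hP]]] := phi_formal phiO (fpt_in h0).
have [c [e x'E]] := B_dec x'.
have [z1 h1] := formal_ex E' 1.
have [x2 [z2 [h2 hQ]]] := phi_formal psiO (fpt_in h1).
have [|s st] := B_univ (b := t * x'); first by rewrite exprMn tN mul0r.
have eP : phi B (fpt h0) = fmap (curve E') s (fpt h1).
  rewrite (fpt_subst h' h1 st); last by rewrite mulr1.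
  apply: (point_eq_in hP (fpt_in h')).
  by apply: (@unit_primitive _ _ 1); rewrite vec3E; exists 1; rewrite mulr1.
have e0 : fpt h0 = fmap (curve E) s (psi B (fpt h1)).
  transitivity (psi B (phi B (fpt h0))); first exact/esym/psiK.
  by rewrite eP; exact: nt_nat.
have hs : sval (fpt h0) (map_mx s (vec3 (t * x2) 1 (t * z2))) by rewrite e0; exact: fmap_in hQ.
have e1 : map_mx s (vec3 (t * x2) 1 (t * z2)) = vec3 (t * x' * s x2) 1 (s (t * z2)).
  by rewrite map_vec3; congr (vec3 _ _ _); [rewrite rmorphM /= st | exact: rmorph1].
rewrite e1 in hs; have := point_parr (fpt_in h0) hs 0 1; rewrite !vec3E !mulr1 mul1r => et.
have [d [f fE]] := B_dec (s x2).
exists c, d, x', z', e; split=> //; apply/eqP; rewrite eq_sym -subr_eq0; apply/eqP/B_inj.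
have N2 : t ^+ N.-1 = t ^+ N.-2 * t by rewrite -exprSr; case: (N) N1 => [|[]].
have cd : (c * d)%:A = c%:A * d%:A :> B by rewrite mulr_algl scalerA.
have top : t ^+ N.-1 = t ^+ N.-1 * (c%:A * d%:A).
  rewrite {1}N2; transitivity (t ^+ N.-2 * (t * x' * s x2)); first by congr (_ * _).
  rewrite fE x'E; transitivity ((t ^+ N.-2 * t) * (c%:A * d%:A + t * (e * d%:A + c%:A * f + t * e * f))); first by ring.
  by rewrite -N2 ttopM.
by rewrite scalerBl cd scale1r mulrBr mulr1 -top subrr.
Qed.
End Truncated.

Section IsoCoord.
Variables (k : comNzRingType) (E E' : ellcurve k).
Variables (phi : nattrans (curve E) (curve E')) (psi : nattrans (curve E') (curve E)).
Hypothesis phiO : forall A, phi A (origin E A) = origin E' A.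
Hypothesis psiO : forall A, psi A (origin E' A) = origin E A.
Hypothesis psiK : forall A, cancel (phi A) (psi A).
Implicit Types A B C R : comAlgType k.

(** Otherwise the image would be the origin over some field, and applying [psi] would place an
    affine point at the origin. *)
Lemma affine_image R (x y : R) (h : wcubic (ellcurve_map (in_alg R) E) (vec3 x y 1) = 0) :
  exists X Y, sval (phi R (aff h)) (vec3 X Y 1).
Proof.
pose T : set R := fun a => exists2 v, sval (phi R (aff h)) v & a = v 0 ord_max.
have [L0 LD _ _] := point_line (phi R (aff h)).
have [[n [c [a [Ta ca1]]]]|nT] := pselect (unimodular T).
  have /all_sig2[l hl lE] : forall i, {v | sval (phi R (aff h)) v & a i = v 0 ord_max}.
    by move=> i; have [v hv e] := cid2 (Ta i); exists v.
  pose v := \sum_i c i *: l i; have hv : sval (phi R (aff h)) v by apply: submod_sum.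
  exists (v 0 0), (v 0 1); have <- : v 0 ord_max = 1; last by rewrite -vec3_eta.
  by rewrite summxE -ca1; apply: eq_bigr => i _; rewrite mxE lE.
have [K [pi [fK hpi]]] := max_quot nT.
have hO : phi K (fmap (curve E) pi (aff h)) = origin E' K.
  rewrite nt_nat; apply: point_par => w w' [n [c [l [hl ->]]]] [x' z'].
  have z : (\sum_(i < n) c i *: map_mx pi (l i)) 0 ord_max = 0.
    rewrite summxE big1 // => i _; rewrite !mxE; have -> : pi (l i 0 ord_max) = 0 by apply: hpi; exists (l i).
    by rewrite mulr0.
  have wL : sval (fmap (curve E') pi (phi R (aff h))) (\sum_(i < n) c i *: map_mx pi (l i)).
    by exists n, c, l.
  have xx := infty_vec fK (point_oncone wL) z; move: (\sum_(i < n) _) z xx {wL} => w2 z xx i j.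
  by case: (ord3P i) => ->; case: (ord3P j) => ->; rewrite ?x' ?z' ?xx ?z ?mulr0 ?mul0r // mulrC.
have e : fmap (curve E) pi (aff h) = origin E K.
  transitivity (psi K (phi K (fmap (curve E) pi (aff h)))); first exact/esym/psiK.
  by rewrite hO; exact: psiO.
have : sval (origin E K) (map_mx pi (vec3 x y 1)) by rewrite -e; exact: fmap_in (aff_in h).
case=> _; rewrite mxE vec3E rmorph1 => /eqP.
by rewrite oner_eq0.
Qed.

(** In the chart [Y = 1] the affine coordinates are [x / z] and [1 / z]; this is [r0 + r1 y] with
    denominators cleared by [z ^+ m]. *)
Definition pole_sum A (r0 r1 : {poly k^o}) m (x z : A) : A :=
  \sum_(j < m) ((r0`_j : k)%:A * (x ^+ j * z ^+ (m - j)) + (r1`_j : k)%:A * (x ^+ j * z ^+ (m.-1 - j))).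

Lemma pole_sum_map A B (f : {lrmorphism A -> B}) r0 r1 m x z :
  f (pole_sum r0 r1 m x z) = pole_sum r0 r1 m (f x) (f z).
Proof.
rewrite rmorph_sum; apply: eq_bigr => j _.
by rewrite rmorphD !rmorphM /= !lrmorph_alg !rmorphXn.
Qed.

(** The affine expression of a coordinate of [phi] is carried to the chart at the origin: both sides
    agree once [z] is inverted, and [z] is regular in the universal chart. *)
Lemma pole_relation R (iota : {lrmorphism k^o -> R}) (x y F : R)
    (h : wcubic (ellcurve_map (in_alg R) E) (vec3 x y 1) = 0) (i : 'I_3) r0 r1 m u :
  (forall B (f : {lrmorphism k^o -> B}) (x' y' : B), wcubic (ellcurve_map (in_alg B) E) (vec3 x' y' 1) = 0 ->
     exists g : {lrmorphism R -> B}, [/\ f =1 g \o iota, g x = x' & g y = y']) ->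
  sval (phi R (aff h)) u -> u 0 ord_max = 1 -> F = u 0 i ->
  F = (map_poly iota r0).[x] + (map_poly iota r1).[x] * y -> (size r0 <= m)%N -> (size r1 <= m)%N ->
  forall C (xc zc : C) (P : curve E C) l, sval P (vec3 xc 1 zc) -> sval (phi C P) l ->
    zc ^+ m * l 0 i = pole_sum r0 r1 m xc zc * l 0 ord_max.
Proof.
move=> R_univ hu u2 Fu FE s0 s1 C xc zc P l hP hl.
have [Ry [iy [xy [zy [hy y_univ y_reg]]]]] := ychart E k^o.
pose q := point_ray (@unit_primitive _ (vec3 xy 1 zy) 1 (ex_intro _ 1 (etrans (mulr1 _) (vec3E _ _ _).1.2))) hy.
have hq : sval q (vec3 xy 1 zy) by exists 1; rewrite scale1r.
suff {hl} main l' : sval (phi Ry q) l' -> zy ^+ m * l' 0 i = pole_sum r0 r1 m xy zy * l' 0 ord_max.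
  have [f [_ fx fz]] := y_univ C (structure_map C) xc zc (point_oncone hP).
  have eP : P = fmap (curve E) f q.
    have hf := fmap_in f hq; have e1 : map_mx f (vec3 xy 1 zy) = vec3 xc 1 zc.
      by rewrite map_vec3; congr (vec3 _ _ _); [exact: fx | exact: rmorph1 | exact: fz].
    rewrite e1 in hf; apply: (point_eq_in hP hf).
    by apply: (@unit_primitive _ _ 1); rewrite vec3E; exists 1; rewrite mulr1.
  have : sval (fmap (curve E') f (phi Ry q)) l by rewrite -(nt_nat phi f q) -eP.
  move=> [n [c [v [hv ->]]]]; rewrite !summxE !mulr_sumr; apply: eq_bigr => j _; rewrite !mxE.
  have := congr1 f (main _ (hv j)); rewrite !rmorphM rmorphXn /= pole_sum_map fx fz => e.
  by rewrite mulrCA e mulrCA.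
move=> hl'; have znz n : zy ^+ n <> 0.
  by elim: n => [|n IH]; [rewrite expr0; apply/eqP; rewrite oner_eq0 | rewrite exprS => /y_reg].
have [L [io [[zi hzi] io_ker _ _]]] := loc_ex znz.
have reg n e : zy ^+ n * e = 0 -> e = 0.
  by elim: n => [|n IH]; rewrite ?expr0 ?mul1r // exprS -mulrA => /y_reg.
have hL : wcubic (ellcurve_map (in_alg L) E) (vec3 (io xy * zi) zi 1) = 0.
  have := oncone_map io hy; rewrite map_vec3 rmorph1 => e.
  have := congr1 (fun a => zi ^+ 3 * a) e; rewrite mulr0 -wcubic_scale scale_vec3 mulr1.
  by rewrite [zi * io zy]mulrC hzi [zi * _]mulrC.
have [g [_ gx gy]] := R_univ L (structure_map L) _ _ hL.
have e : fmap (curve E') g (phi R (aff h)) = fmap (curve E') io (phi Ry q).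
  rewrite -(nt_nat phi g) -(nt_nat phi io); congr (phi _ _).
  have a1 := fmap_in g (aff_in h); have a2 := point_scale zi (fmap_in io hq).
  have b1 : map_mx g (vec3 x y 1) = vec3 (io xy * zi) zi 1.
    by rewrite map_vec3; congr (vec3 _ _ _); [exact: gx | exact: gy | exact: rmorph1].
  have b2 : zi *: map_mx io (vec3 xy 1 zy) = vec3 (io xy * zi) zi 1.
    by rewrite map_vec3 scale_vec3 rmorph1 mulr1 [zi * io zy]mulrC hzi [zi * _]mulrC.
  rewrite b1 in a1; rewrite b2 in a2; exact: (point_eq_in a1 a2 (aff_primitive _ _)).
have p1 := fmap_in g hu; rewrite e in p1.
have := point_parr p1 (fmap_in io hl') ord_max i; rewrite !mxE u2 rmorph1 mul1r -Fu => e1.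
suff e2 : io (zy ^+ m) * g F = io (pole_sum r0 r1 m xy zy).
  apply/subr0_eq; have [|n hn] := io_ker (zy ^+ m * l' 0 i - pole_sum r0 r1 m xy zy * l' 0 ord_max).
    by rewrite rmorphB !rmorphM /= -e2 e1 mulrA subrr.
  exact: reg hn.
have ev (r : {poly k^o}) : (size r <= m)%N -> g (map_poly iota r).[x] = \sum_(j < m) (r`_j : k)%:A * (io xy * zi) ^+ j.
  move=> sr; rewrite (@horner_coef_wide _ m) ?(leq_trans (size_poly _ _)) // rmorph_sum; apply: eq_bigr => j _.
  rewrite rmorphM rmorphXn /= gx; congr (_ * _).
  by rewrite coef_map /= (ko_alg iota) lrmorph_alg.
rewrite FE rmorphD rmorphM /= gy !ev // pole_sum_map /pole_sum mulr_suml -big_split mulr_sumr.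
apply: eq_bigr => j _ /=; rewrite mulrDr; have jm := ltn_ord j.
have zz a b : (b <= a)%N -> io zy ^+ a * zi ^+ b = io zy ^+ (a - b).
  by move=> ba; rewrite -{1}(subnK ba) exprD -mulrA -exprMn hzi expr1n mulr1.
rewrite rmorphXn exprMn; congr (_ + _).
  by rewrite -(zz m j (ltnW jm)); ring.
have -> : (m.-1 - j = m - j.+1)%N by lia.
by rewrite -(zz m j.+1 jm) exprS; ring.
Qed.
End IsoCoord.

Section PoleOrder.
Variables (k : comNzRingType) (m : nat) (B : comAlgType k) (t w : B) (r0 r1 : {poly k^o}).
(** [z] has order 3 in [t], so clearing denominators costs the exponent [3 * m.+2]; four further
    powers keep poles of order up to 3 visible in the top coefficient. *)
Let N := (3 * m.+2 + 4)%N.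
Hypotheses (tN : t ^+ N = 0) (s0 : (size r0 <= m.+2)%N) (s1 : (size r1 <= m.+2)%N).
Let N1 : (1 < N)%N. Proof. by rewrite /N; lia. Qed.
Hypothesis B_inj : forall c : k, t ^+ N.-1 * c%:A = 0 -> c = 0.

(** [x ^+ j] has a pole of order [2 * j] at the origin and [x ^+ j * y] one of order [2 * j + 3].
    The parities differ, so at most one coefficient contributes to each order. *)
Definition pcoef d : k := \sum_(j < m.+2) ((2 * j == d)%N%:R * (r0`_j : k) + (2 * j + 3 == d)%N%:R * (r1`_j : k)).
Definition pvanish d := forall j, ((d <= 2 * j)%N -> r0`_j = 0) /\ ((d <= 2 * j + 3)%N -> r1`_j = 0).

Lemma one_pow a : exists f, (1 + t * w) ^+ a = 1 + t * f.
Proof.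
elim: a => [|a [f e]]; first by exists 0; rewrite expr0 mulr0 addr0.
by exists (w + f + t * w * f); rewrite exprS e; ring.
Qed.

Lemma pole_mono K d s a (c : k) (f : B) : (K + 3 * a + s = N.-1 + d)%N -> ((d < s)%N -> c = 0) ->
  t ^+ K * (c%:A * (t ^+ (3 * a) * (1 + t * f))) = t ^+ N.-1 * ((s == d)%N%:R * c)%:A.
Proof.
move=> e hs; case: (ltngtP s d) => [sd|sd|sd] /=.
- rewrite mulr0n mul0r scale0r mulr0.
  transitivity (t ^+ (K + 3 * a) * (c%:A * (1 + t * f))); first by rewrite exprD; ring.
  by apply: (tpow0 tN); lia.
- by rewrite hs // mulr0 scale0r !mul0r !mulr0.
- rewrite mulr1n mul1r; transitivity (t ^+ (K + 3 * a) * (1 + t * f) * c%:A); first by rewrite exprD; ring.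
  have -> : (K + 3 * a = N.-1)%N by lia.
  by rewrite (ttop N1 tN).
Qed.

(** Multiplication by [t ^+ K] pushes the terms of pole order below [d] beyond the truncation and
    puts the term of order [d] in the top power of [t]. *)
Lemma trunc_pole K d : (K + 3 * m.+2 = N.-1 + d)%N -> pvanish d.+1 ->
  t ^+ K * pole_sum r0 r1 m.+2 (t * 1) (t ^+ 3 * (1 + t * w)) = t ^+ N.-1 * (pcoef d)%:A.
Proof.
move=> e hv; rewrite /pole_sum /pcoef scaler_suml !mulr_sumr; apply: eq_bigr => j _.
have jm := ltn_ord j; have [h0 h1] := hv j.
have Z a : (t ^+ 3 * (1 + t * w)) ^+ a = t ^+ (3 * a) * (1 + t * w) ^+ a by rewrite exprMn exprM.
have [f1 e1] := one_pow (m.+2 - j); have [f2 e2] := one_pow (m.+2.-1 - j).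
rewrite mulr1 !Z e1 e2 scalerDl [LHS]mulrDr [RHS]mulrDr; congr (_ + _).
  rewrite -(@pole_mono (K + j) d _ (m.+2 - j) _ f1) //; last by lia.
  by rewrite exprD; ring.
rewrite -(@pole_mono (K + j) d _ (m.+2.-1 - j) _ f2) //; last by lia.
by rewrite exprD; ring.
Qed.

Lemma pvanish_step d : pvanish d.+1 -> pcoef d = 0 -> pvanish d.
Proof.
move=> hv hc j; have [h0 h1] := hv j.
have pick i : (i < m.+2)%N -> (2 * i = d)%N -> pcoef d = r0`_i.
  move=> im di; rewrite /pcoef (bigD1 (Ordinal im)) //= big1 => [|l nl].
    have -> : (2 * i == d)%N by lia.
    have -> : (2 * i + 3 == d)%N = false by lia.
    by rewrite mul0r !addr0 mul1r.
  have li : (l : nat) != i by apply: contra nl => /eqP li; apply/eqP/val_inj.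
  have -> : (2 * l == d)%N = false by lia.
  have -> : (2 * l + 3 == d)%N = false by lia.
  by rewrite !mul0r addr0.
have pick1 i : (i < m.+2)%N -> (2 * i + 3 = d)%N -> pcoef d = r1`_i.
  move=> im di; rewrite /pcoef (bigD1 (Ordinal im)) //= big1 => [|l nl].
    have -> : (2 * i + 3 == d)%N by lia.
    have -> : (2 * i == d)%N = false by lia.
    by rewrite mul0r add0r addr0 mul1r.
  have li : (l : nat) != i by apply: contra nl => /eqP li; apply/eqP/val_inj.
  have -> : (2 * l == d)%N = false by lia.
  have -> : (2 * l + 3 == d)%N = false by lia.
  by rewrite !mul0r addr0.
split; rewrite leq_eqVlt => /orP[/eqP dj|]; [|exact: h0| |exact: h1].
  have [jm|mj] := ltnP j m.+2; last by rewrite nth_default // (leq_trans s0).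
  by rewrite -(pick j jm (esym dj)).
have [jm|mj] := ltnP j m.+2; last by rewrite nth_default // (leq_trans s1).
by rewrite -(pick1 j jm (esym dj)).
Qed.

(** Descending induction on the pole order, started beyond the sizes of [r0] and [r1]. *)
Lemma pvanish_down d0 : (forall d, (d0 < d)%N -> pvanish d.+1 -> pcoef d = 0) -> pvanish d0.+1.
Proof.
move=> H; suff D g n : (n + g = d0 + 2 * m.+2 + 4)%N -> (d0 < n)%N -> pvanish n.
  by apply: (D (2 * m.+2 + 3)%N); lia.
elim: g n => [|g IH] n e dn.
  by move=> j; split=> h; rewrite nth_default //; [apply: (leq_trans s0) | apply: (leq_trans s1)]; lia.
have hn : pvanish n.+1 by apply: IH; lia.
exact: pvanish_step hn (H n dn hn).
Qed.

Lemma pcoef3 : pcoef 3 = r1`_0.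
Proof.
rewrite /pcoef big_ord_recl big1 => [|j _]; first by rewrite /= mul0r add0r mul1r addr0.
have -> : (2 * lift ord0 j == 3)%N = false by rewrite lift0; lia.
have -> : (2 * lift ord0 j + 3 == 3)%N = false by rewrite lift0; lia.
by rewrite !mul0r addr0.
Qed.

Lemma pcoef2 : pcoef 2 = r0`_1.
Proof.
rewrite /pcoef !big_ord_recl big1 => [|j _].
  by rewrite /= /bump /= !mul0r !addr0 add0r mul1r.
have -> : (2 * lift ord0 (lift ord0 j) == 2)%N = false by rewrite !lift0; lia.
have -> : (2 * lift ord0 (lift ord0 j) + 3 == 2)%N = false by rewrite !lift0; lia.
by rewrite !mul0r addr0.
Qed.

Lemma shape0 d : pvanish d.+1 -> (d <= 3)%N -> r0 = (r0`_0)%:P + r0`_1 *: 'X.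
Proof.
move=> hv d3; apply/polyP => i; rewrite coefD coefC coefZ coefX.
case: i => [|[|i]] /=; rewrite ?mulr0 ?mulr1 ?addr0 ?add0r //.
by have [h _] := hv i.+2; apply: h; lia.
Qed.

Lemma shape1 d : pvanish d.+1 -> (d <= 3)%N -> r1 = (r1`_0)%:P.
Proof.
move=> hv d3; apply/polyP => i; rewrite coefC.
by case: i => [|i] //=; have [_ h] := hv i.+1; apply: h; lia.
Qed.

Variables (c ci : k) (g x' tz' : B).
Hypotheses (cci : c * ci = 1) (tz'E : tz' = t ^+ 3 * ((c ^+ 3)%:A + t * g)).
Let Z := t ^+ 3 * (1 + t * w).
Let S := pole_sum r0 r1 m.+2 (t * 1) Z.

Lemma key_relation d : pvanish d.+1 -> t ^+ d * (S * tz') = t ^+ N.-1 * (pcoef d * c ^+ 3)%:A.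
Proof.
move=> hv; have := @trunc_pole (d + 3) d _ hv; rewrite -/Z -/S => h.
rewrite tz'E; transitivity ((t ^+ (d + 3) * S) * ((c ^+ 3)%:A + t * g)); first by rewrite exprD; ring.
rewrite h; last by rewrite /N; lia.
rewrite mulrAC (ttopM N1 tN) -mulrA; congr (_ * _).
by rewrite mulr_algl scalerA mulrC.
Qed.

Lemma cI (a b : k) n : a * c ^+ n = b -> a = b * ci ^+ n.
Proof. by move=> <-; rewrite -mulrA -exprMn cci expr1n mulr1. Qed.

Lemma topI (a b : k) : t ^+ N.-1 * a%:A = t ^+ N.-1 * b%:A -> a = b.
Proof. by move=> e; apply/subr0_eq/B_inj; rewrite scalerBl mulrBr e subrr. Qed.

(** The left side has order [3 * m.+2] in [t], so its product with a power of [t] above the third is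
    zero; this excludes poles of order above 3, and the third power reads off the coefficient of
    order 3. *)
Lemma pole_three : Z ^+ m.+2 = S * tz' -> pvanish 4 /\ r1`_0 = ci ^+ 3.
Proof.
move=> e; have top d f : (3 < d)%N -> t ^+ d * (Z ^+ m.+2 * f) = 0.
  move=> d3; rewrite /Z exprMn -exprM.
  by rewrite (_ : _ * _ = t ^+ (d + 3 * m.+2) * ((1 + t * w) ^+ m.+2 * f));
    [apply: (tpow0 tN); rewrite /N; lia | rewrite exprD; ring].
have V : pvanish 4.
  apply: pvanish_down => d d3 hv; have := key_relation hv; rewrite -e -[Z ^+ _]mulr1 top //.
  by move=> /esym /B_inj /cI ->; rewrite mul0r.
split=> //; have := key_relation V; rewrite pcoef3 -e /Z exprMn -exprM.
have [f ->] := one_pow m.+2.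
rewrite mulrA -exprD (_ : (3 + 3 * m.+2 = N.-1)%N) ?(ttop N1 tN) //; last by rewrite /N; lia.
move=> h; have h1 : t ^+ N.-1 * 1%:A = t ^+ N.-1 * (r1`_0 * c ^+ 3)%:A by rewrite scale1r mulr1.
by rewrite (cI (esym (topI h1))) mul1r.
Qed.

Lemma pole_two e' : x' = c%:A + t * e' -> Z ^+ m.+2 * (t * x') = S * tz' ->
  pvanish 3 /\ r0`_1 = ci ^+ 2.
Proof.
move=> x'E e.
have V : pvanish 3.
  apply: pvanish_down => d d3 hv; have := key_relation hv; rewrite -e.
  rewrite /Z exprMn -exprM (_ : _ * _ = t ^+ (d + 3 * m.+2 + 1) * ((1 + t * w) ^+ m.+2 * x')).
    rewrite (tpow0 tN) //; last by rewrite /N; lia.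
    by move=> /esym /B_inj /cI ->; rewrite mul0r.
  by rewrite !exprD; ring.
split=> //; have := key_relation V; rewrite pcoef2 -e /Z exprMn -exprM.
have [f ->] := one_pow m.+2.
rewrite (_ : _ * _ = t ^+ (2 + 3 * m.+2 + 1) * (c%:A + t * (e' + f * x'))); last by rewrite !exprD x'E; ring.
rewrite (_ : (2 + 3 * m.+2 + 1 = N.-1)%N) ?(ttopM N1 tN) //; last by rewrite /N; lia.
by move=> h1; rewrite (cI (esym (topI h1))) !exprS expr0 mulr1 mulrA cci mul1r.
Qed.
End PoleOrder.

(** [A0], [A1] and [B0], [B1], [B2] are the coefficients of the images of [x] and [y], and the
    equations compare coefficients in the equation of [E']. The scale is the quotient of [B2] by
    [A1], written [B2 * c ^+ 2]. *)
Lemma coord_change_of_coef (k : comNzRingType) (E E' : ellcurve k) (c A0 A1 B0 B1 B2 : k) :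
  A1 * c ^+ 2 = 1 -> B2 * c ^+ 3 = 1 -> B2 ^+ 2 = A1 ^+ 3 ->
  2 * B1 * B2 + ec_a1 E' * A1 * B2 - B2 ^+ 2 * ec_a1 E = 0 ->
  2 * B0 * B2 + ec_a1 E' * A0 * B2 + ec_a3 E' * B2 - B2 ^+ 2 * ec_a3 E = 0 ->
  B1 ^+ 2 + ec_a1 E' * A1 * B1 - 3 * A1 ^+ 2 * A0 - ec_a2 E' * A1 ^+ 2 + B2 ^+ 2 * ec_a2 E = 0 ->
  2 * B0 * B1 + ec_a1 E' * (A0 * B1 + A1 * B0) + ec_a3 E' * B1 - 3 * A1 * A0 ^+ 2 - 2 * ec_a2 E' * A1 * A0
     - ec_a4 E' * A1 + B2 ^+ 2 * ec_a4 E = 0 ->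
  B0 ^+ 2 + ec_a1 E' * A0 * B0 + ec_a3 E' * B0 - A0 ^+ 3 - ec_a2 E' * A0 ^+ 2 - ec_a4 E' * A0 - ec_a6 E'
     + B2 ^+ 2 * ec_a6 E = 0 ->
  exists u s, u * c = 1 /\ coord_change u A0 s B0 E E'.
Proof.
move=> hA hB hAB c1 c3 c2 c4 c6; pose u := B2 * c ^+ 2; pose s := B1 * c ^+ 2.
have uc : u * c = 1 by rewrite -hB /u; ring.
have A1E : A1 = u ^+ 2 by rewrite -[A1]mulr1 -(expr1n _ 2) -uc exprMn mulrCA hA mulr1.
have B2E : B2 = u ^+ 3 by rewrite -[B2]mulr1 -(expr1n _ 3) -uc exprMn mulrCA hB mulr1.
have B1E : B1 = u ^+ 2 * s.
  by rewrite /s -[LHS]mulr1 -(expr1n _ 2) -uc exprMn; ring.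
clearbody u s; subst A1 B2 B1.
have inv n : invertible (u ^+ n) by exists (c ^+ n); rewrite -exprMn uc expr1n.
exists u, s; split=> //; split.
- by apply: (mulI_inv (inv 5%N)); apply/esym/subr0_eq; rewrite -[RHS]c1; ring.
- by apply: (mulI_inv (inv 4%N)); apply/subr0_eq; rewrite -[RHS]c2; ring.
- by apply: (mulI_inv (inv 3%N)); apply/esym/subr0_eq; rewrite -[RHS]c3; ring.
- by apply: (mulI_inv (inv 2%N)); apply/subr0_eq; rewrite -[RHS]c4; ring.
- by apply/subr0_eq; rewrite -[RHS]c6; ring.
Qed.

(** On the universal affine point the coordinates of [phi] have the form [r0(x) + r1(x) y]. Their
    pole orders at the origin are at most 2 and 3, which leaves an affine change of coordinates as
    in Riemann-Roch; truncated germs make this work over any base ring. *)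
Theorem iso_coord_change (k : comNzRingType) (E E' : ellcurve k) : ellcurve_iso E E' ->
  exists u c r s t, u * c = 1 /\ coord_change u r s t E E'.
Proof.
move=> [phi [psi [inv phiO]]].
have psiK A : cancel (phi A) (psi A) by case: (inv A).
have psiO A : psi A (origin E' A) = origin E A.
  by transitivity (psi A (phi A (origin E A))); [rewrite phiO | exact: psiK].
have [R [iota [x [y [h R_univ span uniq]]]]] := zchart E k^o.
have [X [Y hXY]] := affine_image psiO psiK h.
have [rX0 [rX1 eX]] := span X; have [rY0 [rY1 eY]] := span Y.
pose m := (size rX0 + size rX1 + size rY0 + size rY1)%N.
pose N := (3 * m.+2 + 4)%N; have N0 : (0 < N)%N by rewrite /N; lia.
have N1 : (1 < N)%N by rewrite /N; lia.
have [B [t [tN B_univ B_dec B_inj]]] := trunc_ex k N0.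
have [z0 h0] := formal_ex tN E 1.
have [w zE] := formal_shape tN h0.
have [c [d [x' [z' [e [cd x'E h' hP]]]]]] := formal_deriv N1 tN B_univ B_dec B_inj h0 phiO psiO psiK.
have [w' z'E] := formal_shape tN h'.
have relX := pole_relation (i := 0) R_univ hXY (vec3E _ _ _).2 (esym (vec3E _ _ _).1.1) eX
   (m := m.+2) _ _ (fpt_in h0) hP.
have relY := pole_relation (i := 1) R_univ hXY (vec3E _ _ _).2 (esym (vec3E _ _ _).1.2) eY
   (m := m.+2) _ _ (fpt_in h0) hP.
have [sX0 sX1 sY0 sY1] : [/\ (size rX0 <= m.+2)%N, (size rX1 <= m.+2)%N, (size rY0 <= m.+2)%N & (size rY1 <= m.+2)%N].
  by rewrite /m; split; lia.
have {}relX := relX sX0 sX1; have {}relY := relY sY0 sY1.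
rewrite !vec3E zE mulr1 in relX; rewrite !vec3E zE !mulr1 in relY.
have [g tz'E] : exists g, t * z' = t ^+ 3 * ((c ^+ 3)%:A + t * g).
  rewrite z'E x'E; exists (3 * c%:A ^+ 2 * e + 3 * c%:A * t * e ^+ 2 + t ^+ 2 * e ^+ 3 + (c%:A + t * e) ^+ 3 * w').
  by rewrite -(in_algE B (c ^+ 3)) rmorphXn /=; ring.
rewrite -[X in pole_sum _ _ _ X _](mulr1 t) in relX.
rewrite -[X in pole_sum _ _ _ X _](mulr1 t) in relY.
have [VX eX1] := @pole_two k m B t w rX0 rX1 tN sX0 sX1 B_inj c d g x' (t * z') cd tz'E e x'E relX.
have [VY eY1] := @pole_three k m B t w rY0 rY1 tN sY0 sY1 B_inj c d g (t * z') cd tz'E relY.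
have X_eq : X = (rX0`_0 : k)%:A + (rX0`_1 : k)%:A * x.
  have z1 : rX1 = 0 by apply/polyP => j; have [_ hj] := VX j; rewrite coef0 hj //; lia.
  rewrite eX z1 rmorph0 horner0 mul0r addr0 {1}(shape0 sX0 sX1 VX) // rmorphD /= map_polyC map_polyZ map_polyX /=.
  by rewrite hornerD hornerC hornerZ hornerX /= !(ko_alg iota).
have Y_eq : Y = (rY0`_0 : k)%:A + (rY0`_1 : k)%:A * x + (rY1`_0 : k)%:A * y.
  rewrite eY {1}(shape0 sY0 sY1 VY) // {1}(shape1 sY0 sY1 VY) // rmorphD /= !map_polyC map_polyZ map_polyX /=.
  by rewrite hornerD !hornerC hornerZ hornerX /= !(ko_alg iota).
set A0 : k := rX0`_0 in X_eq; set A1 : k := rX0`_1 in X_eq eX1.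
set B0 : k := rY0`_0 in Y_eq; set B1 : k := rY0`_1 in Y_eq; set B2 : k := rY1`_0 in Y_eq eY1.
have wXY := point_oncone hXY.
pose q0 : {poly k^o} := (B0 ^+ 2 + ec_a1 E' * A0 * B0 + ec_a3 E' * B0 - A0 ^+ 3 - ec_a2 E' * A0 ^+ 2 - ec_a4 E' * A0 - ec_a6 E'
     + B2 ^+ 2 * ec_a6 E : k^o)%:P
  + (2 * B0 * B1 + ec_a1 E' * (A0 * B1 + A1 * B0) + ec_a3 E' * B1 - 3 * A1 * A0 ^+ 2 - 2 * ec_a2 E' * A1 * A0
     - ec_a4 E' * A1 + B2 ^+ 2 * ec_a4 E : k^o) *: 'X
  + (B1 ^+ 2 + ec_a1 E' * A1 * B1 - 3 * A1 ^+ 2 * A0 - ec_a2 E' * A1 ^+ 2 + B2 ^+ 2 * ec_a2 E : k^o) *: 'X^2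
  + (B2 ^+ 2 - A1 ^+ 3 : k^o) *: 'X^3.
pose q1 : {poly k^o} := (2 * B0 * B2 + ec_a1 E' * A0 * B2 + ec_a3 E' * B2 - B2 ^+ 2 * ec_a3 E : k^o)%:P
  + (2 * B1 * B2 + ec_a1 E' * A1 * B2 - B2 ^+ 2 * ec_a1 E : k^o) *: 'X.
have q01 : (map_poly iota q0).[x] + (map_poly iota q1).[x] * y = 0.
  transitivity (wcubic (ellcurve_map (in_alg R) E') (vec3 X Y 1) - in_alg R B2 ^+ 2 * wcubic (ellcurve_map (in_alg R) E) (vec3 x y 1)).
    rewrite /q0 /q1 !rmorphD /= !map_polyZ !map_polyC /= !map_polyX !map_polyXn.
    rewrite !hornerD !hornerZ !hornerC !hornerXn !hornerX /= !(ko_alg iota) !waffE /= X_eq Y_eq.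
    rewrite -!in_algE; ring.
  by rewrite wXY h mulr0 subrr.
have [z0' z1'] := uniq _ _ q01.
have cf0 j : q0`_j = 0 by rewrite z0' coef0.
have cf1 j : q1`_j = 0 by rewrite z1' coef0.
have dc n : d ^+ n * c ^+ n = 1 by rewrite -exprMn mulrC cd expr1n.
have [||||||u [s [uc hcc]]] := @coord_change_of_coef k E E' c A0 A1 B0 B1 B2
  (etrans (congr1 ( *%R^~ _) eX1) (dc 2%N)) (etrans (congr1 ( *%R^~ _) eY1) (dc 3%N)).
- by apply/subr0_eq; have := cf0 3%N; rewrite /q0 !coefD coefC !coefZ coefX !coefXn /= !mulr0 !add0r mulr1.
- by have := cf1 1%N; rewrite /q1 !coefD coefC !coefZ coefX /= add0r mulr1.
- by have := cf1 0%N; rewrite /q1 !coefD coefC !coefZ coefX /= mulr0 addr0.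
- by have := cf0 2%N; rewrite /q0 !coefD coefC !coefZ coefX !coefXn /= !mulr0 !add0r mulr1 addr0.
- by have := cf0 1%N; rewrite /q0 !coefD coefC !coefZ coefX !coefXn /= !mulr0 !add0r mulr1 !addr0.
- by have := cf0 0%N; rewrite /q0 !coefD coefC !coefZ coefX !coefXn /= !mulr0 !addr0.
by exists u, c, A0, s, B0.
Qed.

Corollary iso_jinv (k : comNzRingType) (E E' : ellcurve k) : ellcurve_iso E E' -> jinv E = jinv E'.
Proof. by move=> /iso_coord_change[u [c [r [s [t [_ h]]]]]]; exact: coord_change_j h. Qed.

(** * The affine line and the Nullstellensatz *)

Section AffineLine.
Variable k : comNzRingType.
Implicit Types A B C L : comAlgType k.

Lemma apoly_lrm_ext B (f g : {lrmorphism apoly k^o -> B}) : f 'X = g 'X -> f =1 g.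
Proof.
move=> e p; rewrite (apoly_lrmE f p) (apoly_lrmE g p) e; congr (_.[_]); apply: eq_map_poly => a /=.
have c : apolyC k^o a = (a : k)%:A by exact: ko_alg.
by rewrite c; transitivity ((a : k)%:A : B); [exact: lrmorph_alg | exact/esym/lrmorph_alg].
Qed.

Definition affine_line : kfunctor k :=
  @KFunctor k (fun A => A : Type) (fun A B (phi : {lrmorphism A -> B}) => phi : A -> B)
    (fun A phi e => e) (fun A B C phi psi chi e => e).

(** The elements [a] whose product with the given family is globally defined form an ideal [I]. Each
    [t] of [T] has a power in [I], so [I] is the unit ideal. *)
Lemma affine_line_sheaf : is_zariski_sheaf affine_line.
Proof.
move=> A T uT x xE.
have xE' B C (phi : {lrmorphism A -> B}) (psi : {lrmorphism B -> C}) (chi : {lrmorphism A -> C})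
    hphi hchi (e : chi =1 psi \o phi) : x C chi hchi = psi (x B phi hphi).
  exact: (xE B C phi psi chi hphi hchi e).
pose I : set A := fun a => exists y : A, forall B (phi : {lrmorphism A -> B}) (h : in_sieve T phi),
  phi a * x B phi h = phi y.
have II : is_ideal I.
  split; first by exists 0 => B phi h; rewrite rmorph0 mul0r.
  move=> a u v [yu hu] [yv hv]; exists (a * yu + yv) => B phi h.
  by rewrite !rmorphD !rmorphM mulrDl -mulrA hu hv.
have uniq (y y' : A) : (forall B (phi : {lrmorphism A -> B}), in_sieve T phi -> phi y = phi y') -> y = y'.
  move=> e; apply/subr0_eq; apply: contrapT => ne.
  have [t [L [iota [Tt it]]]] := local_detect uT ne; apply.
  by rewrite rmorphB; apply/eqP; rewrite subr_eq0; apply/eqP/e; exists t.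
suff [y hy] : I 1.
  exists y; split=> [B phi h | y' hy'].
    by rewrite /= -hy rmorph1 mul1r.
  by apply: uniq => B phi h; rewrite -(hy B phi h) rmorph1 mul1r; exact: esym (hy' B phi h).
have power t : T t -> exists n, I (t ^+ n).
  move=> Tt; have [[n tn]|nt] := pselect (exists n, t ^+ n = 0).
    by exists n; rewrite tn; case: II.
  have {}nt n : t ^+ n <> 0 by move=> e; apply: nt; exists n.
  have [L [io [hio io_ker io_surj io_univ]]] := loc_ex nt.
  have sL : in_sieve T io by exists t.
  have [y0 [m hm]] := io_surj (x L io sL).
  have [n [c [a [Ta ca1]]]] := uT.
  (* Over [D(t)] the family is the fraction [y0 / t ^+ m]. On each [D(a i)] the cleared equation
     holds after multiplication by a further power of [t]; there are finitely many [a i], so one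
     exponent will serve. *)
  have /all_sig[N hN] : forall i, {N | forall B (phi : {lrmorphism A -> B}) (h : in_sieve T phi),
      invertible (phi (a i)) -> phi t ^+ N * (phi (t ^+ m) * x B phi h - phi y0) = 0}.
    move=> i; apply: cid; have [[q aq]|na] := pselect (exists q, a i ^+ q = 0).
      exists 0%N => B phi h [b hb]; have := congr1 phi aq; rewrite rmorph0 rmorphXn => e.
      have /eqP : (1 : B) ^+ q = 0 by rewrite -hb exprMn e mul0r.
      by rewrite expr1n oner_eq0.
    have {}na q : a i ^+ q <> 0 by move=> e; apply: na; exists q.
    have [L1 [i1 [h1 k1 s1 u1]]] := loc_ex na.
    have sL1 : in_sieve T i1 by exists (a i).
    set e1 := i1 (t ^+ m) * x L1 i1 sL1 - i1 y0.
    suff [N eN] : exists N, i1 t ^+ N * e1 = 0.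
      exists N => B phi h hi; have [f hf] := u1 B phi hi.
      rewrite (xE' _ _ _ _ _ sL1 h hf) !hf /= -rmorphXn -rmorphM -rmorphB -rmorphM.
      by rewrite -/e1 eN rmorph0.
    have [[N eN]|n2] := pselect (exists N, i1 t ^+ N = 0); first by exists N; rewrite eN mul0r.
    have {}n2 q : i1 t ^+ q <> 0 by move=> e; apply: n2; exists q.
    have [L2 [i2 [h2 k2 _ _]]] := loc_ex n2; apply: k2.
    have [chi hchi] : exists chi : {lrmorphism A -> L2}, chi =1 i2 \o i1 by exists (i2 \o i1).
    have ht : invertible (chi t) by rewrite hchi.
    have [f hf] := io_univ _ _ ht; have sc : in_sieve T chi by exists t.
    have a1 := xE' _ _ _ _ _ sL1 sc hchi; have a2 := xE' _ _ _ _ _ sL sc hf.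
    have cc z : i2 (i1 z) = f (io z) by transitivity (chi z); [exact/esym/hchi | exact: hf].
    transitivity (f (io (t ^+ m) * x L io sL - io y0)).
      rewrite /e1 !rmorphB !rmorphM; congr (_ * _ - _); [exact: cc | exact: etrans (esym a1) a2 | exact: cc].
    by rewrite rmorphXn hm subrr rmorph0.
  pose M := (\max_i N i)%N; exists (M + m)%N; exists (t ^+ M * y0) => B phi h.
  apply/subr0_eq; apply: contrapT => ne.
  have ub : unimodular [set phi b | b in [set b | exists i, b = a i]]%classic.
    apply: unimodular_map; exists n, c, a; split=> // i; by exists i.
  have [_ [L2 [i2 [[_ [i ->] <-] hi nz]]]] := local_detect ub ne; apply: nz.
  have [chi hchi] : exists chi : {lrmorphism A -> L2}, chi =1 i2 \o phi by exists (i2 \o phi).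
  have hi' : invertible (chi (a i)) by rewrite hchi.
  have sc : in_sieve T chi by exists (a i).
  have e := hN i _ chi sc hi'; have ax := xE' _ _ _ _ _ h sc hchi.
  have NM : (N i <= M)%N by apply: leq_bigmax.
  transitivity (chi t ^+ (M - N i) * (chi t ^+ N i * (chi (t ^+ m) * x L2 chi sc - chi y0))); last by rewrite e mulr0.
  have cz z : i2 (phi z) = chi z by exact/esym/hchi.
  rewrite mulrA -exprD subnK // mulrBr mulrA -!rmorphXn -!rmorphM -exprD rmorphB.
  congr (_ - _); last by exact: cz.
  by rewrite rmorphM ax; congr (_ * _); exact: cz.
have [[n [c [a [Ia ca]]]]|nu] := pselect (unimodular I); first by rewrite -ca; apply: ideal_sum.
have [K [pi [fK hpi]]] := max_quot nu; have [n [c [a [Ta ca1]]]] := uT.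
have : pi 1 = 0.
  rewrite -ca1 rmorph_sum big1 // => i _; rewrite rmorphM.
  have [q hq] := power _ (Ta i); have := hpi _ hq; rewrite rmorphXn => e.
  suff pa : pi (a i) = 0 by transitivity (pi (c i) * 0); [congr (_ * _) | rewrite mulr0].
  apply: contrapT => ne; have [b hb] := fK _ ne.
  have /eqP : (1 : K) ^+ q = 0 by rewrite -hb exprMn e mul0r.
  by rewrite expr1n oner_eq0.
by rewrite rmorph1 => /eqP; rewrite oner_eq0.
Qed.

Lemma affine_line_scheme : is_scheme affine_line.
Proof.
split; first exact: affine_line_sheaf.
move=> K fK x; exists (@SubFunctor k affine_line (fun A => (fun _ => True)) (fun A B phi y h => I)); split=> //.
  move=> A y; exists (fun a : A => a = 1) => B phi; split=> // _.
  exists 1%N, (fun=> 1), (fun=> 1); split; last by rewrite big_ord1 mulr1.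
  by move=> _; exists 1; rewrite ?rmorph1.
exists (apoly k^o), ('X : {poly k^o}); split=> // B y _; split.
  by exists (apoly_eval (structure_map B) y); exact: apoly_evalX.
by move=> f g ef eg; apply: apoly_lrm_ext; exact: etrans ef (esym eg).
Qed.

Definition affine_line_sch : scheme k := Scheme affine_line_scheme.
End AffineLine.

Section Nullstellensatz.
Variable k : closedFieldType.
Implicit Types A B C D L K : comAlgType k.

(** A form of the Nullstellensatz that is inherited by polynomial rings and localizations: [f]
    stands for the prime ideal that is its kernel, and some k-point of the corresponding closed set
    avoids the zeros of [a]. *)
Definition nullst A := forall K (f : {lrmorphism A -> K}) (a : A), is_field K -> f a <> 0 ->
  exists ev : {lrmorphism A -> k^o}, (forall x, f x = 0 -> ev x = 0) /\ ev a <> 0.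

Definition domain A := forall x y : A, x * y = 0 -> x = 0 \/ y = 0.
Definition nice A := domain A /\ nullst A.

Lemma nullst_ko : nullst k^o.
Proof.
move=> K f a fK fa; exists [the {lrmorphism k^o -> k^o} of idfun]; split=> [x|/= a0].
  rewrite ko_alg => /eqP h; apply/eqP; apply: contraTT h => x0; exact: (alg_neq0 K x0).
by apply: fa; rewrite a0 rmorph0.
Qed.

Lemma domain_ko : domain k^o.
Proof. by move=> x y /eqP; rewrite mulf_eq0 => /orP[] /eqP; [left | right]. Qed.

Lemma domain_apoly A : domain A -> domain (apoly A).
Proof.
move=> dA p q; rewrite -[p * q]/((p : {poly A}) * (q : {poly A})) => pq.
have [->|p0] := eqVneq (p : {poly A}) 0; first by left.
have [->|q0] := eqVneq (q : {poly A}) 0; first by right.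
have := mul_lead_coef (p : {poly A}) (q : {poly A}); rewrite [(p : {poly A}) * _]pq coef0 => /dA[] /eqP.
  by rewrite lead_coef_eq0 (negPf p0).
by rewrite lead_coef_eq0 (negPf q0).
Qed.

Section Extend.
Variables (A K : comAlgType k) (f : {lrmorphism apoly A -> K}) (a : {poly A}).
Hypotheses (nA : nullst A) (fK : is_field K) (fa : f a <> 0).
Let P (c : A) := f (apolyC A c) = 0.

Let fcoef (p : {poly A}) : (forall i, P p`_i) -> f p = 0.
Proof.
move=> hp; rewrite (apoly_lrmE f p).
have -> : map_poly (f \o apolyC A) p = 0; last by rewrite horner0.
by apply/polyP => i; rewrite coef_map coef0; exact: hp.
Qed.
Let f_C c : f (c%:P : {poly A}) = f (apolyC A c). Proof. by rewrite apolyCE. Qed.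
Let f_D (p q : {poly A}) : f (p + q : {poly A}) = f p + f q. Proof. exact: (rmorphD f). Qed.
Let f_B (p q : {poly A}) : f (p - q : {poly A}) = f p - f q. Proof. exact: (rmorphB f). Qed.
Let f_M (p q : {poly A}) : f (p * q : {poly A}) = f p * f q. Proof. exact: (rmorphM f). Qed.
Let f_Z c (p : {poly A}) : f (c *: p : {poly A}) = f (apolyC A c) * f p.
Proof. by rewrite -mul_polyC f_M f_C. Qed.
Let F := [the {lrmorphism A -> K} of f \o apolyC A].
Let P0 : P 0. Proof. exact: (rmorph0 F). Qed.
Let PD c d : P c -> P d -> P (c + d).
Proof. by move=> hc hd; transitivity (F c + F d); [exact: (rmorphD F) | rewrite [F c]hc [F d]hd addr0]. Qed.
Let PN c : P (- c) -> P c.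
Proof. by move=> hc; transitivity (- F (- c)); [rewrite (rmorphN F) opprK | rewrite [F _]hc oppr0]. Qed.
Let PMl c d : P d -> P (c * d).
Proof. by move=> hd; transitivity (F c * F d); [exact: (rmorphM F) | rewrite [F d]hd mulr0]. Qed.
Let Pprime c d : P (c * d) -> P c \/ P d.
Proof. by move=> h; apply: (fmul0 fK); exact: etrans (esym (rmorphM F c d)) h. Qed.
Let PX c n : ~ P c -> ~ P (c ^+ n).
Proof.
by move=> hc h; apply: hc; apply: (@fexp0 K fK _ n); exact: etrans (esym (rmorphXn F n c)) h.
Qed.
Let Psum n (G : 'I_n -> A) : (forall i, P (G i)) -> P (\sum_i G i).
Proof. by move=> h; elim/big_rec: _ => // i x _; exact: PD. Qed.

(** Leading coefficients killed by [f] are discarded one at a time; this replaces reduction modulo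
    the prime [P]. *)
Let strip (p : {poly A}) : exists p' : {poly A}, [/\ (size p' <= size p)%N, forall i, P (p - p')`_i
  & p' = 0 \/ ~ P (lead_coef p')].
Proof.
have [n] := ubnP (size p); elim: n p => // n IH p sp.
have [hl|hl] := pselect (P (lead_coef p)); last first.
  by exists p; split=> //; [move=> i; rewrite subrr coef0 | right].
have [p0|p0] := eqVneq p 0.
  by exists 0; split; [rewrite size_poly0 | move=> i; rewrite p0 subrr coef0 | left].
pose m := (size p).-1; pose q := p - lead_coef p *: 'X^m.
have sm : size p = m.+1 by rewrite /m prednK // size_poly_gt0.
have sq : (size q < size p)%N.
  rewrite sm ltnS; apply/leq_sizeP => j mj; rewrite /q coefB coefZ coefXn.
  move: mj; rewrite leq_eqVlt => /orP[/eqP <-|mj]; first by rewrite eqxx mulr1 /lead_coef subrr.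
  by rewrite nth_default ?sm // (gtn_eqF mj) mulr0 subr0.
have [|q' [s1 s2 s3]] := IH q; first by rewrite (leq_trans sq).
exists q'; split=> //; first exact: leq_trans s1 (ltnW sq).
move=> i; have -> : p - q' = (q - q') + lead_coef p *: 'X^m by rewrite /q addrAC subrK.
rewrite coefD; apply: PD => //; rewrite coefZ mulrC; exact: PMl.
Qed.

Let strip_f (p p' : {poly A}) : (forall i, P (p - p')`_i) -> f p' = f p.
Proof. by move=> h; apply/eqP; rewrite eq_sym -subr_eq0 -f_B fcoef. Qed.

Let lead_n0 (p : {poly A}) : ~ P (lead_coef p) -> p != 0.
Proof. by apply: contra_notN => /eqP ->; rewrite lead_coef0. Qed.

Let min_size (Q : {poly A} -> Prop) p0 : Q p0 -> exists p, Q p /\ forall q, Q q -> (size p <= size q)%N.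
Proof.
move=> h0; have ex : exists n, `[< exists p, Q p /\ size p = n >] by exists (size p0); apply/asboolP; exists p0.
case: (ex_minnP ex) => n /asboolP[p [hp sp]] hmin; exists p; split=> // q hq.
by rewrite sp; apply: hmin; apply/asboolP; exists q.
Qed.

(** If all coefficients of kernel elements lie in [P], a general value of the variable works.
    Otherwise a kernel element [p] of least degree with leading coefficient off [P] reduces [a], by
    pseudo-division, to a constant [c0] off [P]; a point of [A] where [c0] and the leading
    coefficient of [p] are nonzero extends by a root of [p]. *)
Lemma nullst_extend : exists ev : {lrmorphism apoly A -> k^o},
  (forall x, f x = 0 -> ev x = 0) /\ ev a <> 0.
Proof.
have ev0P (e0 : {lrmorphism A -> k^o}) (x : k^o) (q : {poly A}) : (forall c, P c -> e0 c = 0) ->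
    (forall i, P q`_i) -> apoly_eval e0 x q = 0.
  move=> h hq; rewrite apoly_evalE; have -> : map_poly e0 q = 0; last by rewrite horner0.
  by apply/polyP => i; rewrite coef_map coef0; apply: h.
have [tr|/existsNP[p1 /not_implyP[fp1 /existsNP[i1 ni1]]]] :=
  pselect (forall q : {poly A}, f q = 0 -> forall i, P q`_i).
  have [i hi] : exists i, ~ P a`_i by apply/existsNP => h; apply: fa; exact: fcoef.
  have [e0 [h0 e0i]] := nA fK hi (f := [the {lrmorphism A -> K} of f \o apolyC A]).
  have a0 : map_poly e0 a != 0.
    by apply/eqP => /(congr1 (fun r : {poly k^o} => r`_i)); rewrite coef_map coef0.
  have [x [_ hx]] := @nonroot_ex k (map_poly e0 a) [::] a0.
  exists (apoly_eval e0 (x : k^o)); split; first by move=> q /tr; apply: ev0P.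
  by rewrite apoly_evalE; apply/eqP.
pose Q1 (p : {poly A}) := f p = 0 /\ ~ P (lead_coef p).
have [p2 h2] : exists p2, Q1 p2.
  have [p' [_ s2 s3]] := strip p1; exists p'; split; first by rewrite (strip_f s2).
  by case: s3 => // z; rewrite z subr0 in s2; case: ni1.
have {p1 fp1 i1 ni1 p2 h2} [p [[fp lp] pmin]] := min_size h2.
have Min (q : {poly A}) : f q = 0 -> (size q < size p)%N -> forall i, P q`_i.
  move=> fq sq; have [q' [s1 s2 [z|nl]]] := strip q; first by rewrite z subr0 in s2.
  have : (size p <= size q')%N by apply: pmin; split=> //; rewrite (strip_f s2).
  by rewrite leqNgt (leq_ltn_trans s1 sq).
have p0 := lead_n0 lp.
have sp : (1 < size p)%N.
  rewrite ltnNge; apply/negP => sp; apply: lp.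
  by rewrite [p in lead_coef p]size1_polyC // lead_coefC /P -f_C -size1_polyC.
(* [Sa] collects the multiples of [a] modulo the kernel that lie off the kernel; one of least degree
   turns out to be constant. *)
pose Sa (e : {poly A}) := f e <> 0 /\ exists u v : {poly A}, e = u * a + v /\ f v = 0.
have Sa_a : Sa a by split=> //; exists 1, 0; rewrite mul1r addr0; split=> //; exact: rmorph0.
have [e1 [[fe1 [u1 [v1 [e1E fv1]]]] e1min]] := min_size Sa_a.
have [e [s1 s2 s3]] := strip e1; have fe := strip_f s2.
have Sa_e : Sa e.
  split; first by rewrite fe.
  by exists u1, (v1 - (e1 - e)); rewrite f_B fv1 f_B fe subrr subr0; split=> //; rewrite e1E; ring.
have emin q : Sa q -> (size e <= size q)%N by move=> /e1min; apply: leq_trans.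
have le : ~ P (lead_coef e).
  by case: s3 => // z; case: Sa_e => + _; rewrite z => h _; apply: h; exact: rmorph0.
have e0 := lead_n0 le; have [_ [u [v [eE fv]]]] := Sa_e.
have sep : (size e < size p)%N.
  rewrite ltnNge; apply/negP => spe.
  have er := Pdiv.ComRing.rdivp_eq p e; set n := Pdiv.Ring.rscalp _ _ in er.
  set s := Pdiv.Ring.rdivp _ _ in er; set r := Pdiv.Ring.rmodp _ _ in er.
  have sr : (size r < size p)%N by rewrite Pdiv.Ring.ltn_rmodpN0.
  have fr : f r = f (apolyC A (lead_coef p ^+ n)) * f e.
    by rewrite -f_Z er f_D f_M fp mulr0 add0r.
  have : Sa r.
    split; first by rewrite fr => /(fmul0 fK)[/(PX lp) | /(proj1 Sa_e)].
    exists (lead_coef p ^+ n *: u), (lead_coef p ^+ n *: v - s * p); split.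
      have -> : r = lead_coef p ^+ n *: e - s * p by rewrite er addrC addKr.
      by rewrite eE scalerDr -scalerAl addrA.
    by rewrite f_B f_Z f_M fv fp !mulr0 subrr.
  by move=> /emin; rewrite leqNgt (leq_trans sr spe).
have se : size e = 1%N.
  apply/eqP; rewrite eqn_leq size_poly_gt0 e0 andbT leqNgt; apply/negP => se.
  have er := Pdiv.ComRing.rdivp_eq e p; set n := Pdiv.Ring.rscalp _ _ in er.
  set s := Pdiv.Ring.rdivp _ _ in er; set r := Pdiv.Ring.rmodp _ _ in er.
  have sr : (size r < size e)%N by rewrite Pdiv.Ring.ltn_rmodpN0.
  have fr : f r = - (f s * f e).
    by apply/eqP; rewrite -addr_eq0 addrC -f_M -f_D -er f_Z fp mulr0.
  have fr0 : f r = 0.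
    apply: contrapT => nr; have : Sa r; last by move=> /emin; rewrite leqNgt sr.
    split=> //; exists (- s * u), (lead_coef e ^+ n *: p - s * v); split.
      have -> : r = lead_coef e ^+ n *: p - s * e by rewrite er addrC addKr.
      by rewrite {2}eE; ring.
    by rewrite f_B f_Z f_M fv fp !mulr0 subrr.
  (* If [e] had positive degree, the quotient [s], stripped, would be a kernel element of smaller
     degree than [p] with leading coefficient off [P]. *)
  have fs : f s = 0.
    by move: fr; rewrite fr0 => /esym /eqP; rewrite oppr_eq0 => /eqP /(fmul0 fK)[] // /(proj1 Sa_e).
  have PM (q q' : {poly A}) i : (forall j, P q`_j) -> P (q * q')`_i.
    by move=> hq; rewrite coefM; apply: Psum => j; rewrite mulrC; exact: PMl.
  have [s' [t1 t2 t3]] := strip s.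
  have ls : ~ P (lead_coef s').
    case: t3 => // z; rewrite z subr0 in t2 => _; have := PM s e (size p).-1 t2.
    have -> : (s * e)`_(size p).-1 = lead_coef e ^+ n * lead_coef p.
      by rewrite /lead_coef -coefZ er coefD [r`__]nth_default ?addr0 // -ltnS prednK ?(ltnW sp) // (ltn_trans sr).
    by move=> /Pprime[/(PX le) | /lp].
  have s'0 := lead_n0 ls.
  have ss : (size s' < size p)%N.
    rewrite ltnNge; apply/negP => ss; pose i := (size s' + size e).-2%N.
    have := PM (s - s') e i t2.
    have -> : (s - s') * e = lead_coef e ^+ n *: p - r - s' * e by rewrite er; ring.
    rewrite !coefB coefZ [p`__]nth_default ?[r`__]nth_default; first last.
    - by rewrite /i; move: ss; move: (size s') (size e) (size p) se sp => *; lia.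
    - by rewrite /i; move: ss sr; move: (size s') (size e) (size p) (size r) se sp => *; lia.
    rewrite mulr0 subrr sub0r -mul_lead_coef => h.
    by move: h => /PN /Pprime[/ls | /le].
  by apply: ls; apply: (Min s' _ ss); rewrite (strip_f t2).
pose c0 := e`_0; have eC : e = c0%:P by apply: size1_polyC; rewrite se.
have c0P : ~ P (c0 * lead_coef p).
  by move=> /Pprime[|/lp //]; rewrite /P -f_C -eC; exact: (proj1 Sa_e).
have [ev0 [h0 e0i]] := nA fK c0P (f := [the {lrmorphism A -> K} of f \o apolyC A]).
rewrite rmorphM in e0i.
have [ec el] : ev0 c0 <> 0 /\ ev0 (lead_coef p) <> 0.
  by split=> z; apply: e0i; apply/eqP; rewrite mulf_eq0; apply/orP; [left | right]; apply/eqP.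
have sz : size (map_poly ev0 p) = size p by apply: size_map_poly_id0; apply/eqP.
have /(@closed_rootP k)[x /eqP hx] : size (map_poly ev0 p : {poly k}) != 1%N by rewrite sz gtn_eqF.
exists (apoly_eval ev0 (x : k^o)); have evp : apoly_eval ev0 (x : k^o) p = 0 by rewrite apoly_evalE.
have kill (q : {poly A}) : f q = 0 -> apoly_eval ev0 (x : k^o) q = 0.
  move=> fq; have er := Pdiv.ComRing.rdivp_eq p q; set n := Pdiv.Ring.rscalp _ _ in er.
  set s := Pdiv.Ring.rdivp _ _ in er; set r := Pdiv.Ring.rmodp _ _ in er.
  have sr : (size r < size p)%N by rewrite Pdiv.Ring.ltn_rmodpN0.
  have fr : f r = 0.
    have := congr1 f er; rewrite f_Z fq mulr0 f_D f_M fp mulr0 add0r; exact: esym.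
  have evr := ev0P ev0 x r h0 (Min r fr sr).
  have : apoly_eval ev0 (x : k^o) (lead_coef p ^+ n *: q : {poly A}) = 0.
    rewrite er; transitivity (apoly_eval ev0 (x : k^o) s * apoly_eval ev0 (x : k^o) p + apoly_eval ev0 (x : k^o) r).
      by rewrite -rmorphM -rmorphD.
    by rewrite evp evr mulr0 addr0.
  rewrite apoly_evalE map_polyZ hornerZ -apoly_evalE /= rmorphXn => /eqP.
  by rewrite mulf_eq0 expf_eq0 => /orP[/andP[_ /eqP] | /eqP].
split=> // ea; apply: ec; transitivity (apoly_eval ev0 (x : k^o) (u * a + v : {poly A})).
  by rewrite -eE eC apoly_evalE map_polyC hornerC.
transitivity (apoly_eval ev0 (x : k^o) u * apoly_eval ev0 (x : k^o) a + apoly_eval ev0 (x : k^o) v).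
  by rewrite -rmorphM -rmorphD.
by rewrite ea (kill v fv) mulr0 addr0.
Qed.
End Extend.

Lemma nice_ko : nice k^o. Proof. by split; [exact: domain_ko | exact: nullst_ko]. Qed.
Lemma nice_apoly A : nice A -> nice (apoly A).
Proof. by move=> [dA nA]; split; [exact: domain_apoly | move=> K f a fK fa; exact: nullst_extend]. Qed.
End Nullstellensatz.

(** * Sections determined by their values at k-points *)

Section Agree.
Variable k : closedFieldType.
Implicit Types A B C D L K : comAlgType k.

Definition lcompo A B C (g : {lrmorphism B -> C}) (f : {lrmorphism A -> B}) : {lrmorphism A -> C} :=
  [the {lrmorphism A -> C} of g \o f].

Lemma fmap_o (X : kfunctor k) A B C (g : {lrmorphism B -> C}) (f : {lrmorphism A -> B}) (x : X A) :
  fmap X (lcompo g f) x = fmap X g (fmap X f x).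
Proof. exact: (@fmap_comp k X A B C f g (lcompo g f) (fun=> erefl) x). Qed.

Lemma fmap_ext (X : kfunctor k) A B (f g : {lrmorphism A -> B}) (x : X A) : f =1 g -> fmap X f x = fmap X g x.
Proof.
move=> e; have eA : [the {lrmorphism A -> A} of idfun] =1 id by [].
have h : f =1 g \o [the {lrmorphism A -> A} of idfun] by exact: e.
by rewrite (fmap_comp h) /= (fmap_id eA).
Qed.

(** The properties of a localization delivered by [loc_ex], without fixing a model. *)
Definition is_loc A (t : A) L (io : {lrmorphism A -> L}) : Prop :=
  [/\ invertible (io t), forall a, io a = 0 -> exists n, t ^+ n * a = 0,
      forall l, exists a n, io t ^+ n * l = io a
    & forall B (phi : {lrmorphism A -> B}),
        invertible (phi t) -> exists psi : {lrmorphism L -> B}, phi =1 psi \o io].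

Lemma domain_pow A (t : A) n : domain A -> t <> 0 -> t ^+ n <> 0.
Proof.
move=> dA t0; elim: n => [|n IH]; first by rewrite expr0 => /eqP; rewrite oner_eq0.
by rewrite exprS => /dA[].
Qed.

Lemma is_loc_ex A (t : A) : domain A -> t <> 0 -> exists L (io : {lrmorphism A -> L}), is_loc t io.
Proof. by move=> dA t0; apply: loc_ex => n; apply: domain_pow. Qed.

Lemma loc_inj A (t : A) L (io : {lrmorphism A -> L}) : domain A -> t <> 0 -> is_loc t io ->
  forall a, io a = 0 -> a = 0.
Proof. by move=> dA t0 [_ h _ _] a /h[n] /dA[] // /(domain_pow dA t0). Qed.

Lemma unit_mulI A (u x y : A) : invertible u -> u * x = u * y -> x = y.
Proof.
by move=> [v uv] e; rewrite -[x]mul1r -[y]mul1r -uv [u * v]mulrC -!mulrA e.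
Qed.

Lemma invertible_map A B (f : {lrmorphism A -> B}) a : invertible a -> invertible (f a).
Proof. by move=> [b ab]; exists (f b); rewrite -rmorphM ab rmorph1. Qed.

Lemma invertible_pow A (a : A) n : invertible a -> invertible (a ^+ n).
Proof. by move=> [b ab]; exists (b ^+ n); rewrite -exprMn ab expr1n. Qed.

Lemma ko_unit (c : k^o) : c <> 0 -> invertible c.
Proof. by move=> /eqP c0; exists ((c : k)^-1); exact: divff. Qed.

(** A field-valued point of [L] restricts to [A]. Asking for a k-point off [a0 * t], where [a0] is
    the numerator of [a], lets it extend back to [L]. *)
Lemma nice_loc A (t : A) L (io : {lrmorphism A -> L}) : nice A -> t <> 0 -> is_loc t io -> nice L.
Proof.
move=> [dA nA] t0 hl; have inj := loc_inj dA t0 hl; have [ut _ hs hu] := hl.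
split.
  move=> x y xy; have [a [n ha]] := hs x; have [b [m hb]] := hs y.
  have /inj : io (a * b) = 0 by rewrite rmorphM /= -ha -hb mulrACA xy mulr0.
  by move=> /dA[z|z]; [left; apply: (unit_mulI (invertible_pow n ut)) | right; apply: (unit_mulI (invertible_pow m ut))];
    rewrite mulr0 ?ha ?hb z; exact: rmorph0.
move=> K f a fK fa; have [a0 [n ha]] := hs a.
have ft : f (io t) <> 0.
  by move=> z; have [b] := invertible_map f ut; rewrite z mul0r => /esym/eqP; rewrite oner_eq0.
have fn : f (io (a0 * t)) <> 0.
  have -> : f (io (a0 * t)) = f (io t) ^+ n * f a * f (io t).
    by rewrite rmorphM /= -ha !rmorphM rmorphXn.
  by move=> /(fmul0 fK)[/(fmul0 fK)[/(fexp0 fK)|]|].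
have [ev [kev eva]] := nA K (lcompo f io) _ fK fn.
have eM : ev (a0 * t) = ev a0 * ev t by exact: rmorphM.
have et : ev t <> 0 by move=> z; apply: eva; rewrite eM z mulr0.
have ea0 : ev a0 <> 0 by move=> z; apply: eva; rewrite eM z mul0r.
have [psi hpsi] := hu _ ev (ko_unit et).
have psi_io x l m : io t ^+ m * l = io x -> ev t ^+ m * psi l = ev x.
  move=> e; transitivity (psi (io t ^+ m * l)); last by rewrite e; exact/esym/hpsi.
  rewrite rmorphM rmorphXn; congr (_ ^+ _ * _); exact: hpsi.
have tp m : ev t ^+ m <> 0 by exact: (domain_pow (@domain_ko k)).
exists psi; split=> [x fx|pa].
  have [x0 [m hx]] := hs x; have h := psi_io _ _ _ hx.
  have e0 : ev x0 = 0.
    by apply: kev; transitivity (f (io t ^+ m * x)); [rewrite hx | rewrite rmorphM /= fx mulr0].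
  by rewrite e0 in h; case: (@domain_ko k _ _ h) => [/tp|].
by have := psi_io _ _ _ ha; rewrite pa mulr0 => /esym.
Qed.

(** The localization at [d] is nonzero, so it has a residue field, to which [nullst] applies. *)
Lemma nice_point D (d : D) : nice D -> d <> 0 -> exists ev : {lrmorphism D -> k^o}, ev d <> 0.
Proof.
move=> [dD nD] d0; have [L [io hl]] := is_loc_ex dD d0.
have nu : ~ unimodular (fun _ : L => False).
  move=> [n [c [a [h]]]]; rewrite big1 => [/esym/eqP|i]; first by rewrite oner_eq0.
  by case: (h i).
have [K [pi [fK _]]] := max_quot nu; have [ut _ _ _] := hl.
have fd : lcompo pi io d <> 0.
  move=> e; have [b hb] := invertible_map pi ut.
  by move: hb; rewrite [pi (io d)]e mul0r => /esym/eqP; rewrite oner_eq0.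
by have [ev [_ h]] := nD K (lcompo pi io) d fK fd; exists ev.
Qed.

Lemma unimodular_map_point A (ev : {lrmorphism A -> k^o}) (I : set A) :
  unimodular [set ev a | a in I]%classic -> exists2 a, I a & ev a <> 0.
Proof.
move=> [n [c [a [h e]]]]; apply: contrapT => nex.
have : \sum_i c i * a i = 0.
  rewrite big1 // => i _; have [b Ib <-] := h i.
  have -> : ev b = 0; last by rewrite mulr0.
  by apply: contrapT => eb; apply: nex; exists b.
by rewrite e => /eqP; rewrite oner_eq0.
Qed.

Lemma unimodular_unit A B (phi : {lrmorphism A -> B}) (I : set A) a : I a -> invertible (phi a) ->
  unimodular [set phi a | a in I]%classic.
Proof.
move=> Ia [b hb]; exists 1%N, (fun=> b), (fun=> phi a); split; first by move=> _; exists a.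
by rewrite big_ord1 mulrC.
Qed.

Lemma ko_field : is_field (k^o : comAlgType k).
Proof. by move=> a; exact: ko_unit. Qed.

Lemma invertible_l A (a b : A) : invertible (a * b) -> invertible a /\ invertible b.
Proof. by move=> [c h]; split; [exists (b * c); rewrite mulrA | exists (a * c); rewrite mulrCA mulrA]. Qed.

Lemma affine_agree (X : kfunctor k) (V : subfunctor X) L (x x' : X L) : is_affine V -> nice L ->
  V L x -> V L x' -> (forall ev : {lrmorphism L -> k^o}, fmap X ev x = fmap X ev x') -> x = x'.
Proof.
move=> [C [u [Vu hV]]] nL Vx Vx' e.
have [[f fu] _] := hV L x Vx; have [[g gu] _] := hV L x' Vx'.
rewrite -fu -gu; apply: fmap_ext => c; apply/subr0_eq; apply: contrapT => ne.
have [ev he] := nice_point nL ne; apply: he; rewrite rmorphB; apply/eqP; rewrite subr_eq0; apply/eqP.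
have Ve : V k^o (fmap X ev x) by exact: sub_stable.
have [_ h] := hV _ _ Ve.
by apply: (h (lcompo ev f) (lcompo ev g)); rewrite fmap_o ?fu ?gu.
Qed.

(** Equal values at a k-point [ev] put both sections in one affine chart near [ev], where they are
    compared function by function; this takes the place of separatedness. If the opens of agreement
    did not cover, [nullst] would give such an [ev] on the complement. *)
Theorem agree (M : kfunctor k) D (s s' : M D) : is_scheme M -> nice D ->
  (forall ev : {lrmorphism D -> k^o}, fmap M ev s = fmap M ev s') -> s = s'.
Proof.
move=> [sheaf loc] nD e; have [dD nsD] := nD.
pose T : set D := fun b => forall B (phi : {lrmorphism D -> B}), invertible (phi b) -> fmap M phi s = fmap M phi s'.
suff uT : unimodular T.
  have [|y [_ uy]] := sheaf D T uT (fun B phi _ => fmap M phi s).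
    by move=> B C phi psi chi _ _ ec; exact: fmap_comp.
  by rewrite -(uy s) // -(uy s') // => B phi [t Tt it]; rewrite (Tt B phi it).
apply: contrapT => nT; have [K [pi [fK hpi]]] := max_quot nT.
have [ev [kev _]] := nsD K pi 1 fK (fun z => negP (oner_neq0 K) (introT eqP (etrans (esym (rmorph1 pi)) z))).
have [V [oV aV Vs]] := loc _ ko_field (fmap M ev s).
have [I hI] := oV D s; have [a Ia ea] := unimodular_map_point (proj1 (hI _ ev) Vs).
rewrite e in Vs; have [I' hI'] := oV D s'; have [a' Ia' ea'] := unimodular_map_point (proj1 (hI' _ ev) Vs).
have eb : ev (a * a') <> 0 by rewrite rmorphM => /(@domain_ko k)[].
apply: eb; apply: kev; apply: hpi => B phi hB.
have b0 : a * a' <> 0 by move=> z; have [] := @domain_ko k (ev a) (ev a'); rewrite // -rmorphM z rmorph0.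
have [L [io hl]] := is_loc_ex dD b0; have [ub _ _ hu] := hl.
have [psi hpsi] := hu B phi hB.
rewrite !(fmap_comp hpsi) /=; congr (fmap M psi _).
rewrite rmorphM in ub; have [ua ua'] := invertible_l ub.
apply: (affine_agree aV (nice_loc nD b0 hl)).
- by apply/hI/(unimodular_unit Ia).
- by apply/hI'/(unimodular_unit Ia').
- by move=> ev1; rewrite -!fmap_o.
Qed.
End Agree.

(** * Curves with the same j-invariant *)

Section SameJ.
Variables (k : closedFieldType) (T : Type) (Q : ellcurve k -> T).
Hypothesis Qcc : forall E E' u r s t, u != 0 -> coord_change u r s t E E' -> Q E = Q E'.

Lemma delta_neq0 (E : ellcurve k) : delta E != 0.
Proof. by have [d hd] := ec_disc E; apply: contraTneq (oner_neq0 k) => z; rewrite -hd z mul0r eqxx. Qed.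

Definition weier (E : ellcurve k) a1 a2 a3 a4 a6 :=
  [/\ ec_a1 E = a1, ec_a2 E = a2, ec_a3 E = a3, ec_a4 E = a4 & ec_a6 E = a6].

Lemma weier_Q E E' a1 a2 a3 a4 a6 : weier E a1 a2 a3 a4 a6 -> weier E' a1 a2 a3 a4 a6 -> Q E = Q E'.
Proof. by move=> [e1 e2 e3 e4 e6] [f1 f2 f3 f4 f6]; congr Q; apply: ellcurve_eq; congruence. Qed.

Lemma change_exj (E' : ellcurve k) u r s t a1 a2 a3 a4 a6 : u != 0 ->
  u * a1 = ec_a1 E' + 2 * s ->
  u ^+ 2 * a2 = ec_a2 E' - s * ec_a1 E' + 3 * r - s ^+ 2 ->
  u ^+ 3 * a3 = ec_a3 E' + r * ec_a1 E' + 2 * t ->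
  u ^+ 4 * a4 = ec_a4 E' - s * ec_a3 E' + 2 * r * ec_a2 E' - (t + r * s) * ec_a1 E' + 3 * r ^+ 2 - 2 * s * t ->
  u ^+ 6 * a6 = ec_a6 E' + r * ec_a4 E' + r ^+ 2 * ec_a2 E' + r ^+ 3 - t * ec_a3 E' - t ^+ 2 - r * t * ec_a1 E' ->
  exists E, [/\ weier E a1 a2 a3 a4 a6, Q E' = Q E & jinv E' = jinv E].
Proof.
move=> u0 e1 e2 e3 e4 e6.
have hd : invertible (discriminant a1 a2 a3 a4 a6).
  have D0 : discriminant a1 a2 a3 a4 a6 != 0.
    have := delta_neq0 E'.
    rewrite -(coord_change_disc (ec_a1 E') (ec_a2 E') (ec_a3 E') (ec_a4 E') (ec_a6 E') r s t).
    by rewrite -e1 -e2 -e3 -e4 -e6 discriminant_scale mulf_eq0 negb_or => /andP[].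
  by exists (discriminant a1 a2 a3 a4 a6)^-1; rewrite divff.
have hc : coord_change u r s t (EllCurve hd) E' by split.
by exists (EllCurve hd); split=> //; [exact/esym/(Qcc u0 hc) | exact/esym/(coord_change_j hc)].
Qed.

Lemma change_ex (E' : ellcurve k) u r s t a1 a2 a3 a4 a6 : u != 0 ->
  u * a1 = ec_a1 E' + 2 * s ->
  u ^+ 2 * a2 = ec_a2 E' - s * ec_a1 E' + 3 * r - s ^+ 2 ->
  u ^+ 3 * a3 = ec_a3 E' + r * ec_a1 E' + 2 * t ->
  u ^+ 4 * a4 = ec_a4 E' - s * ec_a3 E' + 2 * r * ec_a2 E' - (t + r * s) * ec_a1 E' + 3 * r ^+ 2 - 2 * s * t ->
  u ^+ 6 * a6 = ec_a6 E' + r * ec_a4 E' + r ^+ 2 * ec_a2 E' + r ^+ 3 - t * ec_a3 E' - t ^+ 2 - r * t * ec_a1 E' ->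
  exists E, weier E a1 a2 a3 a4 a6 /\ Q E' = Q E.
Proof.
move=> u0 e1 e2 e3 e4 e6; have [E [h1 h2 _]] := change_exj u0 e1 e2 e3 e4 e6.
by exists E.
Qed.

Section OddChar.
Hypothesis two0 : 2 != 0 :> k.

Definition legendre (E : ellcurve k) l := weier E 0 (- (1 + l)) 0 l 0.

Lemma sqrt_ex (c : k) : exists u, u ^+ 2 = c.
Proof.
by have [u hu] := quadratic_root 0 (- c); exists u; apply/subr0_eq; rewrite -[RHS]hu; ring.
Qed.

Lemma cubic_roots (b2 b4 b6 : k) : exists x1 x2 x3,
  [/\ x1 + x2 + x3 = - b2, x1 * x2 + x1 * x3 + x2 * x3 = b4 & x1 * x2 * x3 = - b6].
Proof.
have [x hx] := @solve_monicpoly k 3 (nth 0 [:: - b6; - b4; - b2]) isT.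
rewrite !big_ord_recl big_ord0 /= /bump /= in hx.
have hx' : x ^+ 3 + b2 * x ^+ 2 + b4 * x + b6 = 0.
  transitivity (x ^+ 3 - (- b6 * x ^+ 0 + (- b4 * x ^+ 1 + (- b2 * x ^+ 2 + 0)))); first by ring.
  by rewrite hx; ring.
have [y hy] := quadratic_root (b2 + x) (b4 + b2 * x + x ^+ 2).
exists x, y, (- b2 - x - y); split; first by ring.
  by apply/subr0_eq; rewrite -[RHS]oppr0 -hy; ring.
apply/subr0_eq; transitivity ((x ^+ 3 + b2 * x ^+ 2 + b4 * x + b6) - x * (y ^+ 2 + (b2 + x) * y + (b4 + b2 * x + x ^+ 2))).
  by ring.
by rewrite hx' hy; ring.
Qed.

(** After completing the square, two roots of the cubic are moved to 0 and 1; they differ because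
    the discriminant is nonzero. *)
Lemma legendre_exj E' : exists l E, legendre E l /\ (Q E' = Q E /\ jinv E' = jinv E).
Proof.
set b1 := ec_a1 E'; set b3 := ec_a3 E'.
have [x1 [x2 [x3 [h2 h4 h6]]]] := cubic_roots (ec_a2 E' + b1 ^+ 2 / 4) (ec_a4 E' + b1 * b3 / 2) (ec_a6 E' + b3 ^+ 2 / 4).
have four0 : 4 != 0 :> k by rewrite (_ : 4 = 2 * 2) ?mulf_neq0 //; ring.
have b2E : ec_a2 E' = - (x1 + x2 + x3) - b1 ^+ 2 / 4 by rewrite h2; ring.
have b4E : ec_a4 E' = x1 * x2 + x1 * x3 + x2 * x3 - b1 * b3 / 2 by rewrite h4; ring.
have b6E : ec_a6 E' = - (x1 * x2 * x3) - b3 ^+ 2 / 4 by rewrite h6; ring.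
have n12 : x2 - x1 != 0.
  apply: contra_neq (delta_neq0 E') => e; have x2E : x2 = x1 by apply/subr0_eq.
  by rewrite b2E b4E b6E x2E -/b1 -/b3 /discriminant; field; rewrite ?two0 ?four0.
have [u hu] := sqrt_ex (x2 - x1).
have u0 : u != 0 by apply: contraNneq n12 => z; rewrite -hu z expr0n.
exists ((x3 - x1) / (x2 - x1)).
suff [E [g1 g2 g3]] : exists E, [/\ legendre E ((x3 - x1) / (x2 - x1)), Q E' = Q E & jinv E' = jinv E] by exists E.
apply: (@change_exj E' u x1 (- b1 / 2) (- (b3 + x1 * b1) / 2) 0 _ 0 _ 0 u0).
- by rewrite -/b1; field.
- by rewrite hu b2E -/b1; field; rewrite ?two0 ?four0.
- by rewrite -/b1 -/b3; field.
- by rewrite (exprM u 2 2) hu b2E b4E -/b1 -/b3; field; rewrite ?two0 ?four0.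
- by rewrite b2E b4E b6E -/b1 -/b3; field; rewrite ?two0 ?four0.
Qed.

Lemma legendre_neq E l : legendre E l -> l != 0 /\ 1 - l != 0.
Proof.
move=> [e1 e2 e3 e4 e6]; have := delta_neq0 E; rewrite e1 e2 e3 e4 e6.
rewrite (_ : discriminant _ _ _ _ _ = 16 * l ^+ 2 * (1 - l) ^+ 2); last by rewrite /discriminant; ring.
by move=> D; split; apply: contra_neq D => ->; rewrite expr0n /= ?mulr0 ?mul0r.
Qed.

Lemma legendre_sub E l : legendre E l -> exists E1, legendre E1 (1 - l) /\ Q E = Q E1.
Proof.
move=> [e1 e2 e3 e4 e6]; have [u hu] := sqrt_ex (-1).
have u0 : u != 0 by apply: contraTneq (oner_neq0 k) => z; rewrite -oppr_eq0 -hu z expr0n eqxx.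
apply: (@change_ex E u 1 0 0 _ _ _ _ _ u0); rewrite e1 ?e2 ?e3 ?e4 ?e6 ?(exprM u 2 2) ?hu; ring.
Qed.

Lemma legendre_inv E l : legendre E l -> exists E1, legendre E1 l^-1 /\ Q E = Q E1.
Proof.
move=> hE; have [l0 _] := legendre_neq hE; have [e1 e2 e3 e4 e6] := hE; have [u hu] := sqrt_ex l.
have u0 : u != 0 by apply: contraNneq l0 => z; rewrite -hu z expr0n.
by apply: (@change_ex E u 0 0 0 _ _ _ _ _ u0); rewrite e1 ?e2 ?e3 ?e4 ?e6 ?(exprM u 2 2) ?hu; field.
Qed.

(** Equality of j-invariants splits into six factors, one for each of [l], [1/l], [1-l], [1/(1-l)],
    [(l-1)/l] and [l/(l-1)], and each of these values is reached by coordinate changes. *)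
Lemma legendre_j E E' l m : legendre E l -> legendre E' m -> jinv E = jinv E' -> Q E = Q E'.
Proof.
move=> hE hE' ej; have [l0 l1] := legendre_neq hE; have [m0 m1] := legendre_neq hE'.
have := jinvE E; have := jinvE E'; rewrite -ej; set j := jinv E.
case: (hE) => -> -> -> -> ->; case: (hE') => -> -> -> -> ->.
rewrite (_ : discriminant _ _ _ _ _ = 16 * m ^+ 2 * (1 - m) ^+ 2); last by rewrite /discriminant; ring.
rewrite (_ : discriminant _ _ _ _ _ = 16 * l ^+ 2 * (1 - l) ^+ 2); last by rewrite /discriminant; ring.
rewrite /c4 => h1 h2.
have : 2 ^+ 16 * ((m - l) * (m * l - 1) * (m + l - 1) * (m * (1 - l) - 1) * (m * l - (l - 1)) * (m * (l - 1) - l)) = 0.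
  transitivity ((16 * l ^+ 2 * (1 - l) ^+ 2 * j) * (16 * m ^+ 2 * (1 - m) ^+ 2) - (16 * m ^+ 2 * (1 - m) ^+ 2 * j) * (16 * l ^+ 2 * (1 - l) ^+ 2)); last by ring.
  rewrite h1 h2; ring.
rewrite -[RHS](mulr0 (2 ^+ 16)) => /(mulfI (expf_neq0 16 two0)) /eqP; rewrite !mulf_eq0 !subr_eq0.
have [E1 [h_1 q1]] := legendre_sub hE; have [E2 [h_2 q2]] := legendre_inv hE.
have [E3 [h_3 q3]] := legendre_inv h_1; have [E4 [h_4 q4]] := legendre_sub h_2.
have [E5 [h_5 q5]] := legendre_inv h_4.
have fin E0 n : legendre E0 n -> m = n -> Q E0 = Q E' by move=> hn e; rewrite e in hE'; exact: weier_Q hn hE'.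
case/orP=> [/orP[/orP[/orP[/orP[/eqP e|/eqP e]|/eqP e]|/eqP e]|/eqP e]|/eqP e].
- exact: fin hE e.
- by rewrite q2; apply: fin h_2 _; apply: (mulIf l0); rewrite mulVf.
- by rewrite q1; apply: fin h_1 _; rewrite -e addrK.
- by rewrite q1 q3; apply: fin h_3 _; apply: (mulIf l1); rewrite mulVf.
- by rewrite q2 q4; apply: fin h_4 _; apply: (mulIf l0); rewrite e mulrBl mulVf // mul1r.
- rewrite q2 q4 q5; apply: fin h_5 _; have l1' : 1 - l^-1 != 0 by case: (legendre_neq h_4).
  apply: (mulIf l1'); rewrite mulVf //; apply: (mulIf l0).
  by rewrite mulrBr mulr1 mulrBl divfK // mul1r -[RHS]e; ring.
Qed.

Lemma same_j_odd E E' : jinv E = jinv E' -> Q E = Q E'.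
Proof.
have [l [E1 [h1 q1]]] := legendre_exj E; have [m [E2 [h2 q2]]] := legendre_exj E'.
move=> ej; rewrite q1.1 q2.1; apply: (legendre_j h1 h2); rewrite -q1.2 -q2.2; exact: ej.
Qed.
End OddChar.

Section EvenChar.
Hypothesis two0 : 2 = 0 :> k.

Lemma mod2 (x y z : k) : x = y + 2 * z -> x = y.
Proof. by rewrite two0 mul0r addr0. Qed.

(** In characteristic 2 the normal forms are [y^2 + xy = x^3 + a6], with j inverse to [a6], and
    [y^2 + y = x^3], with j zero. *)
Lemma even_normal E' : (ec_a1 E' != 0 /\ exists a6 E, [/\ weier E 1 0 0 0 a6, Q E' = Q E & jinv E' = jinv E]) \/
  (ec_a1 E' = 0 /\ exists E, [/\ weier E 0 0 1 0 0, Q E' = Q E & jinv E' = jinv E]).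
Proof.
set b1 := ec_a1 E'; set b2 := ec_a2 E'; set b3 := ec_a3 E'; set b4 := ec_a4 E'; set b6 := ec_a6 E'.
have [b10|b10] := eqVneq b1 0; [right; split=> // | left; split=> //].
  have b30 : b3 != 0.
    apply: contra_neq (delta_neq0 E') => b30; rewrite -/b1 -/b2 -/b3 -/b4 -/b6 b10 b30.
    by apply: (@mod2 _ _ (- 4 * (8 * b2 ^+ 2 * b2 * b6 - 2 * b2 ^+ 2 * b4 ^+ 2 + 8 * b4 ^+ 3 + 54 * b6 ^+ 2 - 36 * b2 * b4 * b6))); rewrite /discriminant; ring.
  have [u hu] := @solve_monicpoly k 3 (nth 0 [:: b3; 0; 0]) isT.
  rewrite !big_ord_recl big_ord0 /= /bump /= in hu.
  have {}hu : u ^+ 3 = b3 by rewrite hu; ring.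
  have u0 : u != 0 by apply: contraNneq b30 => z; rewrite -hu z expr0n.
  have [s hs] := @solve_monicpoly k 4 (nth 0 [:: - (b4 + b2 ^+ 2); b3; 0; 0]) isT.
  rewrite !big_ord_recl big_ord0 /= /bump /= in hs.
  have {}hs : s ^+ 4 = b3 * s - (b4 + b2 ^+ 2) by rewrite hs; ring.
  pose r := s ^+ 2 - b2.
  have [t ht] := quadratic_root b3 (- (b6 + r * b4 + r ^+ 2 * b2 + r ^+ 3)).
  apply: (@change_exj E' u r s t 0 0 1 0 0 u0); rewrite -/b1 -/b2 -/b3 -/b4 -/b6 ?b10.
  - by rewrite two0; ring.
  - by apply/esym/(@mod2 _ _ (s ^+ 2 - b2)); rewrite /r; ring.
  - by rewrite hu two0; ring.
  - apply/esym/(@mod2 _ _ (s ^+ 4 - 2 * b2 * s ^+ 2 + b2 ^+ 2 + r * b2 - s * t - b2 * s ^+ 2)).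
    transitivity ((s ^+ 4 - (b3 * s - (b4 + b2 ^+ 2))) + 2 * (s ^+ 4 - 2 * b2 * s ^+ 2 + b2 ^+ 2 + r * b2 - s * t - b2 * s ^+ 2)).
      by rewrite /r; ring.
    by rewrite hs; ring.
  - by apply/esym; transitivity (- (t ^+ 2 + b3 * t + (- (b6 + r * b4 + r ^+ 2 * b2 + r ^+ 3)))); [ring | rewrite ht; ring].
pose r := b3 / b1; have [s hs] := quadratic_root b1 (- (b2 + 3 * r)).
pose t := (b4 - s * b3 - r * s * b1 + 3 * r ^+ 2) / b1.
have rE : r * b1 = b3 by rewrite /r divfK.
have tE : t * b1 = b4 - s * b3 - r * s * b1 + 3 * r ^+ 2 by rewrite /t divfK.
exists ((b6 + r * b4 + r ^+ 2 * b2 + r ^+ 3 - t * b3 - t ^+ 2 - r * t * b1) / b1 ^+ 6).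
apply: (@change_exj E' b1 r s t 1 0 0 0 _ b10); rewrite -/b1 -/b2 -/b3 -/b4 -/b6.
- by rewrite two0; ring.
- by apply/esym; transitivity (- (s ^+ 2 + b1 * s + - (b2 + 3 * r))); [ring | rewrite hs; ring].
- by rewrite rE; apply/esym/(@mod2 _ _ (b3 + t)); ring.
- apply/esym/(@mod2 _ _ (r * b2 - s * t)); transitivity (b4 - s * b3 - r * s * b1 + 3 * r ^+ 2 - t * b1 + 2 * (r * b2 - s * t)).
    by ring.
  by rewrite tE; ring.
- by rewrite mulrC divfK // expf_neq0.
Qed.

Lemma same_j_even E E' : jinv E = jinv E' -> Q E = Q E'.
Proof.
have nrm E0 a6 : weier E0 1 0 0 0 a6 -> a6 * jinv E0 = -1.
  move=> [e1 e2 e3 e4 e6]; have := jinvE E0; rewrite e1 e2 e3 e4 e6 /c4 => h.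
  apply: (@mod2 _ _ (- 216 * a6 ^+ 2 * jinv E0)).
  transitivity (- (discriminant 1 0 0 0 a6 * jinv E0) + 2 * (- 216 * a6 ^+ 2 * jinv E0)).
    by rewrite /discriminant; ring.
  by rewrite h; ring.
have zr E0 : weier E0 0 0 1 0 0 -> jinv E0 = 0.
  by move=> [e1 e2 e3 e4 e6]; apply: jinv_uniq; rewrite e1 e2 e3 e4 /c4; ring.
have nz E0 a6 : weier E0 1 0 0 0 a6 -> jinv E0 <> 0.
  by move=> /nrm h z; move: h; rewrite z mulr0 => /esym/eqP; rewrite oppr_eq0 oner_eq0.
case: (even_normal E) => [[_ [a6 [E1 [h1 q1 j1]]]]|[_ [E1 [h1 q1 j1]]]];
  case: (even_normal E') => [[_ [a6' [E2 [h2 q2 j2]]]]|[_ [E2 [h2 q2 j2]]]]; rewrite q1 q2 j1 j2 => ej.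
- have j0 := nz _ _ h2; have e : a6 = a6'.
    by apply: (mulIf (introN eqP j0)); rewrite (nrm _ _ h2) -ej (nrm _ _ h1).
  by rewrite -e in h2; exact: weier_Q h1 h2.
- by case: (nz _ _ h1); rewrite ej; exact: zr h2.
- by case: (nz _ _ h2); rewrite -ej; exact: zr h1.
- exact: weier_Q h1 h2.
Qed.
End EvenChar.

Theorem same_j E E' : jinv E = jinv E' -> Q E = Q E'.
Proof. by have [h|h] := eqVneq (2 : k) 0; [apply: same_j_even | apply: same_j_odd]. Qed.
End SameJ.

(** * The coarse moduli scheme is the affine line *)

Section Sections.
Variables (k : closedFieldType) (M : scheme k) (eta : nattrans (ellcurve_functor k) M).
Hypothesis eta_iso : iso_invariant eta.
Implicit Types A B C D L : comAlgType k.
Let P : comAlgType k := apoly k^o.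
Let PX : P := ('X : {poly k^o}).
Let nP : nice P. Proof. exact: nice_apoly (nice_ko k). Qed.
Let dP : domain P. Proof. by case: nP. Qed.

Lemma eta_same_j (E E' : ellcurve k^o) : jinv E = jinv E' -> eta k^o E = eta k^o E'.
Proof.
apply: (@same_j k _ (eta k^o)) => F F' u r s t u0 hc; apply: eta_iso.
exact: (coord_change_iso (divff u0) hc).
Qed.

(** [s] is the section that a curve with j-invariant [x] would define. The condition bears on
    k-points, which is enough to determine [s] over a [nice] ring. *)
Definition good D (x : D) (s : M D) : Prop := forall (ev : {lrmorphism D -> k^o}) (E : ellcurve k^o),
  jinv E = ev x -> fmap M ev s = eta k^o E.

Lemma good_eta D (E : ellcurve D) : good (jinv E) (eta D E).
Proof.
move=> ev E' e; rewrite -(nt_nat eta ev E); apply: eta_same_j.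
by rewrite e; exact: jinv_map.
Qed.

Lemma good_map D B (f : {lrmorphism D -> B}) x s : good x s -> good (f x) (fmap M f s).
Proof. by move=> h ev E e; rewrite -fmap_o; apply: h. Qed.

Lemma family_one (K : comNzRingType) (t : K) : invertible (t ^+ 3 - 27) ->
  exists E : ellcurve K, (t ^+ 3 - 27) * jinv E = (t * (t ^+ 3 - 24)) ^+ 3.
Proof.
move=> ut; have h : invertible (discriminant t 0 1 0 0).
  by rewrite (_ : discriminant _ _ _ _ _ = t ^+ 3 - 27) // /discriminant; ring.
exists (EllCurve h); have := jinvE (EllCurve h); rewrite /= (_ : discriminant _ _ _ _ _ = t ^+ 3 - 27).
  by move=> ->; rewrite /c4; ring.
by rewrite /discriminant; ring.
Qed.

Lemma family_two (K : comNzRingType) (t : K) : invertible (16 * (t ^+ 2 - 4)) ->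
  exists E : ellcurve K, (16 * (t ^+ 2 - 4)) * jinv E = (16 * (t ^+ 2 - 3)) ^+ 3.
Proof.
move=> ut; have h : invertible (discriminant 0 t 0 1 0).
  by rewrite (_ : discriminant _ _ _ _ _ = 16 * (t ^+ 2 - 4)) // /discriminant; ring.
exists (EllCurve h); have := jinvE (EllCurve h); rewrite /= (_ : discriminant _ _ _ _ _ = 16 * (t ^+ 2 - 4)).
  by move=> ->; rewrite /c4; ring.
by rewrite /discriminant; ring.
Qed.

(** The curve [y^2 + xy = x^3 - 36 d x - d] with [d] inverse to [j - 1728], available away from the
    values 0 and 1728. *)
Lemma family_generic (K : comNzRingType) (j d : K) : (j - 1728) * d = 1 -> invertible j ->
  exists E : ellcurve K, jinv E = j.
Proof.
move=> jd [i ij]; have jd' : 1 + 1728 * d = j * d.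
  by apply/subr0_eq; transitivity (1 - (j - 1728) * d); [ring | rewrite jd subrr].
have D : discriminant 1 0 0 (-36 * d) (- d) = d * (j * d) ^+ 2.
  by rewrite -jd' /discriminant; ring.
have h : invertible (discriminant 1 0 0 (-36 * d) (- d)).
  exists ((j - 1728) ^+ 3 * i ^+ 2); rewrite D.
  by transitivity (((j - 1728) * d) ^+ 3 * (j * i) ^+ 2); [ring | rewrite jd ij !expr1n mulr1].
exists (EllCurve h); apply: jinv_uniq; rewrite /= D.
by transitivity ((j * d) ^+ 3); [ring | rewrite -jd' /c4; ring].
Qed.

(** The first family reaches every value unless the characteristic is 3, where the second is used.
    The parameter solves [y (y - 24)^3 = x (y - 27)] with [y = t^3], respectively
    [2^8 (y - 3)^3 = x (y - 4)] with [y = t^2]; a root cannot be 27, respectively 4, where the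
    discriminant vanishes. *)
Lemma family_ex : exists D (E : ellcurve D), nice D /\ forall x : k, exists ev : {lrmorphism D -> k^o}, ev (jinv E) = x.
Proof.
have locP (g : {poly k^o}) : g != 0 -> exists L (io : {lrmorphism P -> L}), [/\ nice L, invertible (io (g : P)) &
    forall x : k^o, g.[x] != 0 -> exists ev : {lrmorphism L -> k^o}, ev (io PX) = x].
  move=> /eqP g0; have [L [io hl]] := is_loc_ex dP (g0 : (g : P) <> 0).
  have [u _ _ hu] := hl; exists L, io; split=> //; first exact: nice_loc hl.
  move=> x gx; pose e := apoly_eval [the {lrmorphism k^o -> k^o} of idfun] x.
  have [|psi hpsi] := hu k^o e.
    by apply: ko_unit; rewrite apoly_evalE (map_poly_id (fun=> fun=> erefl)); apply/eqP.
  by exists psi; apply: etrans (esym (hpsi PX)) _; exact: apoly_evalX.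
have proot (p : {poly k^o}) (c : k^o) n : c != 0 -> p`_n.+1 = c -> exists x : k^o, p.[x] = 0.
  move=> c0 pc; have sp : (n.+1 < size p)%N.
    by rewrite ltnNge; apply: contra c0 => sp; rewrite -pc nth_default.
  have /(@closed_rootP k)[x /eqP hx] : size (p : {poly k}) != 1%N by rewrite gtn_eqF // (leq_trans _ sp).
  by exists x.
have ioE L (io : {lrmorphism P -> L}) (g : {poly k^o}) : io (g : P) = (map_poly (structure_map L) g).[io PX].
  by rewrite -apoly_evalE; apply: apoly_lrm_ext; rewrite apoly_evalX.
have nat1 L (n : nat) : structure_map L (n%:R : k^o) = n%:R by exact: rmorph_nat.
have [h3|h3] := eqVneq (3 : k) 0.
  have h2 : (2 : k) != 0.
    apply/eqP => h2; have : (1 : k) = 3 - 2 by ring.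
    by rewrite h2 h3 subrr => /eqP; rewrite oner_eq0.
  have n2 n : (2 : k) ^+ n != 0 by exact: expf_neq0.
  pose g : {poly k^o} := (16%:R : k^o) *: ('X^2 - (4%:R : k^o)%:P).
  have gE x : g.[x] = 16 * (x ^+ 2 - 4) by rewrite /g !(hornerZ, hornerD, hornerN, hornerXn, hornerC).
  have g0 : g != 0.
    apply/eqP => e; have := gE 0; rewrite e horner0 => h.
    have /eqP : (2 : k) ^+ 6 = 0 by transitivity (- (16 * (0 ^+ 2 - 4)) : k); [ring | rewrite -h oppr0].
    by rewrite (negPf (n2 6%N)).
  have [L [io [nL ug hev]]] := locP g g0.
  have gio : io (g : P) = 16 * (io PX ^+ 2 - 4).
    rewrite ioE /g map_polyZ rmorphB /= map_polyXn map_polyC hornerZ hornerD hornerN hornerXn hornerC.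
    by congr (_ * (_ - _)); exact: nat1.
  rewrite gio in ug; have [E hE] := family_two ug; exists L, E; split=> // x.
  pose p : {poly k^o} := (2 ^+ 8 : k^o) *: 'X^3 + (- 9 * 2 ^+ 8 : k^o) *: 'X^2 + (27 * 2 ^+ 8 - x : k^o) *: 'X + (- 27 * 2 ^+ 8 + 4 * x : k^o)%:P.
  have pE y : p.[y] = 2 ^+ 8 * (y - 3) ^+ 3 - x * (y - 4).
    by rewrite /p !(hornerZ, hornerD, hornerN, hornerXn, hornerC, hornerX); ring.
  have [|y hy] := @proot p (2 ^+ 8) 2 (n2 8%N).
    by rewrite /p !coefD !coefZ !coefXn coefX coefC /= !mulr0 mulr1 !addr0.
  have [t0 ht] := sqrt_ex (y : k); rewrite pE in hy.
  have y4 : y - 4 != 0.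
    apply/eqP => z; have yE : y = 4 by apply/subr0_eq.
    have /eqP : (2 : k) ^+ 8 = 0 by rewrite -[RHS]hy yE; ring.
    by rewrite (negPf (n2 8%N)).
  have g16 : 16 != 0 :> k by rewrite (_ : 16 = 2 ^+ 4) //; ring.
  have [|ev hX] := hev (t0 : k^o); first by rewrite gE ht mulf_neq0.
  exists ev; apply: (mulfI (mulf_neq0 g16 y4)).
  have := congr1 ev hE; rewrite rmorphM [X in _ = X]rmorphXn.
  have e4 : ev (16 * (io PX ^+ 2 - 4)) = 16 * (y - 4).
    by transitivity (16 * (ev (io PX) ^+ 2 - 4)); [ring | rewrite hX ht].
  have e3 : ev (16 * (io PX ^+ 2 - 3)) = 16 * (y - 3).
    by transitivity (16 * (ev (io PX) ^+ 2 - 3)); [ring | rewrite hX ht].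
  move=> h; transitivity ((16 * (y - 3)) ^+ 3); first by rewrite -e3 -e4; exact: h.
  transitivity (16 * (2 ^+ 8 * (y - 3) ^+ 3 - x * (y - 4)) + 16 * (y - 4) * x); first by ring.
  by rewrite hy mulr0 add0r.
have n3 n : (3 : k) ^+ n != 0 by exact: expf_neq0.
pose g : {poly k^o} := 'X^3 - (27%:R : k^o)%:P.
have gE x : g.[x] = x ^+ 3 - 27 by rewrite /g !(hornerD, hornerN, hornerXn, hornerC).
have g0 : g != 0.
  apply/eqP => e; have := gE 0; rewrite e horner0 => h.
  have /eqP : (3 : k) ^+ 3 = 0 by transitivity (- (0 ^+ 3 - 27) : k); [ring | rewrite -h oppr0].
  by rewrite (negPf (n3 3%N)).
have [L [io [nL ug hev]]] := locP g g0.
have gio : io (g : P) = io PX ^+ 3 - 27.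
  rewrite ioE /g rmorphB /= map_polyXn map_polyC hornerD hornerN hornerXn hornerC.
  by congr (_ - _); exact: nat1.
rewrite gio in ug; have [E hE] := family_one ug; exists L, E; split=> // x.
pose p : {poly k^o} := (1 : k^o) *: 'X^4 + (- 72 : k^o) *: 'X^3 + (1728 : k^o) *: 'X^2 + (- 13824 - x : k^o) *: 'X + (27 * x : k^o)%:P.
have pE y : p.[y] = y * (y - 24) ^+ 3 - x * (y - 27).
  by rewrite /p !(hornerZ, hornerD, hornerN, hornerXn, hornerC, hornerX); ring.
have [|y hy] := @proot p 1 3 (oner_neq0 k).
  by rewrite /p !coefD !coefZ !coefXn coefX coefC /= !mulr0 mulr1 !addr0.
have [t0 ht] := @solve_monicpoly k 3 (nth 0 [:: y; 0; 0]) isT.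
rewrite !big_ord_recl big_ord0 /= /bump /= in ht; rewrite pE in hy.
have {}ht : t0 ^+ 3 = y by rewrite ht; ring.
have y4 : y - 27 != 0.
  apply/eqP => z; have yE : y = 27 by apply/subr0_eq.
  have /eqP : (3 : k) ^+ 6 = 0 by rewrite -[RHS]hy yE; ring.
  by rewrite (negPf (n3 6%N)).
have [|ev hX] := hev (t0 : k^o); first by rewrite gE ht.
exists ev; apply: (mulfI y4).
have := congr1 ev hE; rewrite rmorphM [X in _ = X]rmorphXn.
have e4 : ev (io PX ^+ 3 - 27) = y - 27.
  by transitivity (ev (io PX) ^+ 3 - 27); [ring | rewrite hX ht].
have e3 : ev (io PX * (io PX ^+ 3 - 24)) = t0 * (y - 24).
  by transitivity (ev (io PX) * (ev (io PX) ^+ 3 - 24)); [ring | rewrite hX ht].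
move=> h; transitivity ((t0 * (y - 24)) ^+ 3); first by rewrite -e3 -e4; exact: h.
transitivity (t0 ^+ 3 * (y - 24) ^+ 3); first by ring.
rewrite ht; transitivity ((y * (y - 24) ^+ 3 - x * (y - 27)) + (y - 27) * x); first by ring.
by rewrite hy add0r.
Qed.

Lemma curve_with_j (x : k^o) : exists E : ellcurve k^o, jinv E = x.
Proof.
have [D [E [_ h]]] := family_ex; have [ev <-] := h x.
by exists (ellcurve_map ev E); exact: jinv_map.
Qed.

Lemma good_uniq D (x : D) (s s' : M D) : nice D -> good x s -> good x s' -> s = s'.
Proof.
move=> nD hs hs'; apply: (agree (sch_axiom M) nD) => ev.
by have [E hE] := curve_with_j (ev x); rewrite (hs ev E hE) (hs' ev E hE).
Qed.
End Sections.

Section LRMorphismRewriting.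
Variables (k : comNzRingType) (A B : comAlgType k) (f : {lrmorphism A -> B}).
Lemma lrM x y : f (x * y) = f x * f y. Proof. exact: rmorphM. Qed.
Lemma lrX x n : f (x ^+ n) = f x ^+ n. Proof. exact: rmorphXn. Qed.
Lemma lrB x y : f (x - y) = f x - f y. Proof. exact: rmorphB. Qed.
Lemma lr1 : f 1 = 1. Proof. exact: rmorph1. Qed.
Lemma lr0 : f 0 = 0. Proof. exact: rmorph0. Qed.
End LRMorphismRewriting.

Section Gluing.
Variables (k : closedFieldType) (M : scheme k) (eta : nattrans (ellcurve_functor k) M).
Hypothesis eta_iso : iso_invariant eta.
Implicit Types A B C D L : comAlgType k.
Let P : comAlgType k := apoly k^o.
Let PX : P := ('X : {poly k^o}).
Let nP : nice P. Proof. exact: nice_apoly (nice_ko k). Qed.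
Let dP : domain P. Proof. by case: nP. Qed.
Notation goodM := (good eta).

Definition evP B (b : B) : {lrmorphism P -> B} := apoly_eval (structure_map B) b.
Lemma evPX B (b : B) : evP b PX = b. Proof. exact: apoly_evalX. Qed.
Lemma evP_uniq B (f : {lrmorphism P -> B}) : f =1 evP (f PX).
Proof. by apply: apoly_lrm_ext; rewrite -[RHS]/(evP (f PX) PX) evPX. Qed.
Lemma evP_comp B C (f : {lrmorphism B -> C}) b p : f (evP b p) = evP (f b) p.
Proof. by rewrite [RHS](_ : _ = lcompo f (evP b) p) // (evP_uniq (lcompo f (evP b))) /= evPX. Qed.

Definition chart_at (q : P) := exists L (io : {lrmorphism P -> L}), is_loc q io /\ exists s : M L, goodM (io PX) s.

Lemma generic_chart : chart_at (PX * (PX - 1728)).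
Proof.
have cst : (1728 : P) = (1728%:R : k^o)%:P :> {poly k^o} by rewrite -[RHS]/(polyC (1728%:R)) rmorph_nat.
have X0 : PX <> 0 by move=> /(congr1 (fun p : {poly k^o} => p`_1)); rewrite coefX coef0 => /eqP; rewrite oner_eq0.
have X1 : PX - 1728 <> 0.
  move=> /(congr1 (fun p : {poly k^o} => p`_1)); rewrite cst coefB coefX coefC coef0 subr0 => /eqP.
  by rewrite oner_eq0.
have q0 : PX * (PX - 1728) <> 0 by move=> /dP[].
have [L [io hl]] := is_loc_ex dP q0; exists L, io; split=> //; have [u _ _ _] := hl.
have e : io (PX * (PX - 1728)) = io PX * (io PX - 1728) by ring.
rewrite e in u; have [ux [d hd]] := invertible_l u.
by have [E hE] := family_generic hd ux; exists (eta L E); rewrite -hE; exact: good_eta.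
Qed.

(** The absence of poles: [j - x0] vanishes at [ev0], so each such factor of the value of [p] at [j]
    forces a root [x0] of [p], and then cancels in the domain [D]. *)
Lemma factor_X (x0 : k^o) n (p : {poly k^o}) D (j f : D) (ev0 : {lrmorphism D -> k^o}) :
  domain D -> ev0 j = x0 -> j <> (x0 : k)%:A -> evP j (p : P) = (j - (x0 : k)%:A) ^+ n * f ->
  exists p', p = ('X - x0%:P) ^+ n * p' /\ evP j (p' : P) = f.
Proof.
move=> dD ej nj; have j0 : j - (x0 : k)%:A <> 0 by move=> /subr0_eq.
elim: n p f => [|n IH] p f e; first by exists p; rewrite mul1r expr0 mul1r in e *.
have rp : root p x0.
  apply/eqP; transitivity (ev0 (evP j (p : P))).
    by rewrite evP_comp ej /evP apoly_evalE (map_poly_id (fun c _ => mulr1 c)).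
  rewrite e rmorphM rmorphXn rmorphB /= ej lrmorph_alg (_ : (x0 : k)%:A = x0 :> k^o); last exact: mulr1.
  by rewrite subrr expr0n mul0r.
have [p1 p1E] := factor_theorem _ _ rp.
have evF : evP j ('X - x0%:P : {poly k^o}) = j - (x0 : k)%:A.
  transitivity (evP j PX - evP j (x0%:P : {poly k^o})); first exact: rmorphB.
  by rewrite evPX; congr (_ - _); rewrite /evP apoly_evalE map_polyC hornerC.
have [|p' [p'E fE]] := IH p1 f.
  apply/subr0_eq; case: (dD (j - (x0 : k)%:A) (evP j (p1 : P) - (j - (x0 : k)%:A) ^+ n * f)) => //.
  have e1 : evP j (p : P) = evP j (p1 : P) * (j - (x0 : k)%:A).
    by rewrite p1E -evF; exact: rmorphM.
  by rewrite mulrBr mulrA -exprS -e e1 mulrC subrr.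
by exists p'; rewrite p1E p'E exprS; split=> //; ring.
Qed.

(** Near [x0] the section descends from the family over [D]. In an affine neighbourhood [V] of its
    value above [x0], the generic chart gives its coordinates as rational functions of j. Pulled
    back to [D] they are regular above [x0], so [factor_X] removes the powers of [X - x0] from their
    denominators. *)
Lemma special_chart (x0 : k^o) : exists q : P, (q : {poly k^o}).[x0] != 0 /\ chart_at q.
Proof.
have [D [E [nD surj]]] := family_ex k; set j := jinv E in surj.
have [dD _] := nD; have [ev0 ev0j] := surj x0.
pose st := eta D E; have gst : goodM j st by exact: good_eta.
have [_ Mloc] := sch_axiom M.
have [V [oV aV V0]] := Mloc _ (@ko_field k) (fmap M ev0 st).
have [I hI] := oV D st; have [a Ia ea] := unimodular_map_point (proj1 (hI _ ev0) V0).
have a0 : a <> 0 by move=> z; apply: ea; rewrite z lr0.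
have jne (x : k^o) : j <> (x : k)%:A.
  move=> e; have [ev] := surj (x + 1); rewrite e lrmorph_alg => h.
  have /eqP : (1 : k) = 0 by apply: (addrI x); rewrite addr0 -[LHS]h; exact: mulr1.
  by rewrite oner_eq0.
have jne' (x : k^o) : j - (x : k)%:A <> 0 by move=> /subr0_eq; exact: jne.
have [Lu [iu [lu [su gu]]]] := generic_chart.
have [Iu hIu] := oV Lu su; set qu := PX * (PX - 1728) in lu.
have evj p : p <> 0 -> evP j p <> 0.
  move=> p0 z; have [x hx] : exists x : k, (p : {poly k^o}).[x] != 0.
    by have [x [_ hx]] := @nonroot_ex k (p : {poly k}) [::] (introN eqP p0); exists x.
  have [ev ex] := surj (x : k^o); move/eqP: hx; apply.
  transitivity (ev (evP j p)); last by rewrite z lr0.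
  by rewrite evP_comp ex /evP apoly_evalE (map_poly_id (fun c _ => mulr1 c)).
have qu0 : qu <> 0.
  by move=> z; have [[d hd] _ _ _] := lu; move: hd; rewrite z lr0 mul0r => /esym/eqP; rewrite oner_eq0.
have [ev1 h1] : exists ev1 : {lrmorphism D -> k^o}, ev1 (a * evP j qu) <> 0.
  by apply: nice_point nD _ => /dD[//|/(evj _ qu0)].
have [e10 e11] : ev1 a <> 0 /\ ev1 (evP j qu) <> 0.
  have M1 : ev1 (a * evP j qu) = ev1 a * ev1 (evP j qu) by exact: lrM.
  by split=> z; apply: h1; rewrite M1 z ?mul0r ?mulr0.
have [_ _ _ uu] := lu; have [|evu hevu] := uu k^o (evP (ev1 j)).
  by apply: ko_unit; rewrite -evP_comp.
have Vu : V k^o (fmap M evu su).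
  have -> : fmap M evu su = fmap M ev1 st.
    have [E1 hE1] := curve_with_j (ev1 j); rewrite (gst ev1 E1 hE1); apply: gu.
    by rewrite hE1; apply: etrans (esym (evPX _)) (hevu PX).
  by apply/hI/(unimodular_unit Ia)/ko_unit.
have [e Iue ee] := unimodular_map_point (proj1 (hIu _ evu) Vu).
have [_ _ su_surj _] := lu; have [e0' [n0 he0]] := su_surj e.
have e00 : e0' <> 0.
  move=> z; apply: ee; have [uq _ _ _] := lu.
  have [d hd] := invertible_pow n0 uq; have -> : e = d * (iu qu ^+ n0 * e) by rewrite mulrA [d * _]mulrC hd mul1r.
  by rewrite he0 z lr0 mulr0; exact: lr0.
(* Where [m] is invertible the generic section is defined and lies in [V]. *)
pose m : P := qu * e0'; have m0 : m <> 0 by move=> /dP[].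
have [L1 [i1 l1]] := is_loc_ex dP m0; have [um _ s1 u1] := l1.
have um' : invertible (i1 qu * i1 e0') by have <- : i1 m = i1 qu * i1 e0' by exact: lrM.
have [uq ue] := invertible_l um'; have [g1 hg1] := uu L1 i1 uq.
have V1 : V L1 (fmap M g1 su).
  apply/hIu/(unimodular_unit Iue); have : invertible (g1 (iu qu) ^+ n0 * g1 e).
    have -> : g1 (iu qu) ^+ n0 * g1 e = i1 e0'; last by case: (invertible_l um').
    have -> : i1 e0' = g1 (iu e0') by exact: hg1.
    by rewrite -he0 (lrM g1) (lrX g1).
  by case/invertible_l.
have [C [u [Vu0 aff]]] := aV.
have [[gc gcu] _] := aff L1 _ V1.
have [Da [ia la]] := is_loc_ex dD a0; have [ua _ _ uda] := la.
have nDa := nice_loc nD a0 la; have [dDa _] := nDa; have injDa := loc_inj dD a0 la.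
have [|evD hevD] := uda k^o ev0; first exact: ko_unit.
have Va : V Da (fmap M ia st) by apply/hI/(unimodular_unit Ia).
have [[fc fcu] _] := aff Da _ Va.
pose ja := ia j; have evja : evD ja = x0 by rewrite -ev0j; exact: esym (hevD j).
have jane : ja <> (x0 : k)%:A.
  by move=> z; apply: (jne x0); apply/subr0_eq/injDa; rewrite lrB /= lrmorph_alg; apply/eqP; rewrite subr_eq0; apply/eqP.
have mj0 : evP ja m <> 0 by rewrite -evP_comp => /injDa /(evj _ m0).
have [D2 [i2 l2]] := is_loc_ex dDa mj0; have [u2 _ _ _] := l2.
have nD2 := nice_loc nDa mj0 l2; have inj2 := loc_inj dDa mj0 l2.
have [|g2 hg2] := u1 D2 (evP (i2 ja)); first by rewrite -evP_comp.
(* Over [D2] both descriptions are available, and uniqueness of [good] sections identifies the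
   coordinates [fc] of the family with the coordinates [gc] of the generic section. *)
have agree_fg c : i2 (fc c) = g2 (gc c).
  have [_ h] := aff D2 (fmap M i2 (fmap M ia st)) (sub_stable i2 Va).
  apply: (h (lcompo i2 fc) (lcompo g2 gc)); first by rewrite fmap_o fcu.
  rewrite fmap_o gcu -(fmap_o g2 g1).
  apply: (good_uniq (eta := eta) (x := i2 ja) nD2).
    have -> : i2 ja = lcompo g2 g1 (iu PX).
      have h1' : i1 PX = g1 (iu PX) by exact: hg1.
      have h2' : evP (i2 ja) PX = g2 (i1 PX) by exact: hg2.
      by rewrite -[LHS]evPX h2' h1'.
    exact: (@good_map _ _ _ _ _ (lcompo g2 g1) _ _ gu).
  by rewrite -fmap_o; exact: (@good_map _ _ _ _ _ (lcompo i2 ia) _ _ gst).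
(* [m] is split into a power of [X - x0] and a factor [q] that is nonzero at [x0]; only [q] is to
   remain in denominators. *)
have [N [q rq mE]] := multiplicity_XsubC (m : {poly k}) (x0 : k).
have qx : q.[x0 : k] != 0.
  by apply: contraTN rq => /eqP h; rewrite (introN eqP m0 : (m : {poly k}) != 0) negbK; apply/eqP.
exists (q : {poly k^o}); split; first exact: qx.
have q0 : (q : P) <> 0 by move=> z; move/eqP: qx; apply; rewrite [q]z horner0.
have [L [io hl]] := is_loc_ex dP q0; exists L, io; split=> //.
have [uL _ sL uL'] := hl; have nL := nice_loc nP q0 hl.
have [|h hh] := uL' L1 i1.
  have : invertible (i1 (q : P) * i1 (('X - x0%:P) ^+ N : {poly k^o})).
    have <- : i1 m = i1 (q : P) * i1 (('X - x0%:P) ^+ N : {poly k^o}) by rewrite [m]mE; exact: rmorphM.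
    exact: um.
  by case/invertible_l.
have injL1 := loc_inj dP m0 l1.
have injh l : h l = 0 -> l = 0.
  move=> hl0; have [p [n hp]] := sL l; apply: (unit_mulI (invertible_pow n uL)); rewrite mulr0 hp.
  have -> : p = 0; last by exact: lr0.
  apply: injL1; have -> : i1 p = h (io p) by exact: hh.
  by rewrite -hp (lrM h) hl0 mulr0.
have gD x (p : P) (B : comAlgType k) (f : {lrmorphism B -> k^o}) (b : B) : f b = x -> f (evP b p) = evP (x : k^o) p.
  by move=> <-; exact: evP_comp.
have gi1 (p p' : {poly k^o}) : i1 (p * p' : {poly k^o}) = i1 (p : P) * i1 (p' : P) by exact: lrM.
have lift c : exists l, h l = gc c /\ forall ev : {lrmorphism L -> k^o}, ev (io PX) = x0 -> ev l = evD (fc c).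
  have [p [n hp]] := s1 (gc c).
  have e1 : evP ja p = evP ja m ^+ n * fc c.
    apply/subr0_eq/inj2; rewrite (lrB i2) (lrM i2) (lrX i2) agree_fg !evP_comp.
    have e2 (r : P) : evP (i2 ja) r = g2 (i1 r) by exact: hg2.
    by rewrite !e2 -hp (lrM g2) (lrX g2) subrr.
  have e3 : evP ja m = evP ja (q : P) * (ja - (x0 : k)%:A) ^+ N.
    have -> : evP ja m = evP ja (q : P) * evP ja (('X - x0%:P) ^+ N : {poly k^o}) by rewrite [m]mE; exact: lrM.
    congr (_ * _); transitivity (evP ja ('X - x0%:P : {poly k^o}) ^+ N); first exact: lrX.
    congr (_ ^+ _); transitivity (evP ja PX - evP ja (x0%:P : {poly k^o})); first exact: lrB.
    by rewrite evPX; congr (_ - _); rewrite /evP apoly_evalE map_polyC hornerC.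
  have e4 : evP ja p = (ja - (x0 : k)%:A) ^+ (N * n) * (evP ja (q : P) ^+ n * fc c).
    by rewrite e1 e3 exprMn -exprM; ring.
  have [p' [pE p'E]] := factor_X dDa evja jane e4.
  have [w hw] := invertible_pow n uL; exists (w * io (p' : P)); split.
    apply: (unit_mulI (invertible_pow n um)); rewrite hp (lrM h).
    have -> : i1 p = i1 (('X - x0%:P) ^+ (N * n) : {poly k^o}) * i1 (p' : P) by rewrite -gi1 -pE.
    have -> : i1 m = h (io (q : P)) * i1 (('X - x0%:P) ^+ N : {poly k^o}).
      by rewrite [m]mE gi1; congr (_ * _); exact: hh.
    have -> : i1 (('X - x0%:P) ^+ (N * n) : {poly k^o}) = i1 (('X - x0%:P) ^+ N : {poly k^o}) ^+ n.
      by rewrite exprM; exact: lrX.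
    have -> : h (io (p' : P)) = i1 (p' : P) by exact: esym (hh _).
    have hw' : h (io (q : P)) ^+ n * h w = 1 by rewrite -lrX -lrM hw lr1.
    move: (h w) (h (io _)) hw' => w' y hw'; rewrite exprMn.
    by rewrite -[RHS]mul1r -hw'; ring.
  move=> ev evx; have ioE (r : P) : io r = evP (io PX) r by exact: evP_uniq.
  have evE (r : P) : ev (io r) = evD (evP ja r) by rewrite ioE (gD x0) // (gD x0).
  have := invertible_pow n uL => /(invertible_map ev) ui; apply: (unit_mulI ui).
  rewrite -lrM mulrA hw mul1r evE p'E lrM lrX; congr (_ * _).
  by rewrite lrX evE.
pose sf c := projT1 (cid (lift c)); have sfE c : h (sf c) = gc c by rewrite /sf; case: cid => l [].
have injh' l l' : h l = h l' -> l = l' by move=> e5; apply/subr0_eq/injh; rewrite lrB e5; exact: subrr.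
have [s hs] : exists s : {lrmorphism C -> L}, s =1 sf.
  apply: mk_lrmorphism.
  - by move=> x y; apply: injh'; rewrite lrB !sfE; exact: lrB.
  - by apply: injh'; rewrite lr1 sfE; exact: lr1.
  - by move=> x y; apply: injh'; rewrite lrM !sfE; exact: lrM.
  - by move=> c; apply: injh'; rewrite sfE !lrmorph_alg.
(* At [x0] the value comes from the family; at any other point of [L] the element [m] is invertible
   and the value comes from the generic section. *)
exists (fmap M s u) => ev F hF; have [e6|e6] := pselect (ev (io PX) = x0).
  rewrite -fmap_o (fmap_ext u (g := lcompo evD fc)); last first.
    by move=> c; rewrite /= hs /sf; case: cid => l [_ hl2] /=; exact: hl2.
  rewrite fmap_o fcu -fmap_o; apply: gst; rewrite hF e6 -evja; exact: erefl.
have um1 : invertible (lcompo ev io m).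
  have -> : lcompo ev io m = lcompo ev io (q : P) * lcompo ev io (('X - x0%:P) ^+ N : {poly k^o}).
    by rewrite [m]mE; exact: lrM.
  apply: ko_unit => /(@domain_ko k)[|].
    by move=> z; have [d] := invertible_map ev uL; rewrite [ev (io _)]z mul0r => /esym/eqP; rewrite oner_eq0.
  have -> : lcompo ev io (('X - x0%:P) ^+ N : {poly k^o}) = lcompo ev io ('X - x0%:P : {poly k^o}) ^+ N by exact: lrX.
  move/eqP; rewrite expf_eq0 => /andP[_ /eqP]; have -> : lcompo ev io ('X - x0%:P : {poly k^o}) = ev (io PX) - x0.
    transitivity (lcompo ev io PX - lcompo ev io (x0%:P : {poly k^o})); first exact: lrB.
    congr (_ - _); have -> : (x0%:P : {poly k^o}) = apolyC k^o x0 :> P by rewrite apolyCE.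
    have -> : apolyC k^o x0 = (x0 : k)%:A by exact: ko_alg.
    by rewrite lrmorph_alg; exact: mulr1.
  by move/subr0_eq.
have [ev' hev'] := u1 k^o (lcompo ev io) um1.
have evh l : ev l = ev' (h l).
  have [p [n hp]] := sL l; have hE r : ev (io r) = ev' (h (io r)).
    by have /= -> := hev' r; congr (ev' _); exact: hh.
  apply: (unit_mulI (invertible_map ev (invertible_pow n uL))); rewrite -lrM hp hE -hp !lrM; congr (_ * _).
  by rewrite !lrX hE.
rewrite -fmap_o (fmap_ext u (g := lcompo ev' gc)); last by move=> c; rewrite /= hs evh sfE.
rewrite fmap_o gcu -fmap_o; apply: gu; rewrite hF /=; have /= -> := hev' PX; congr (ev' _); exact: hg1.
Qed.
End Gluing.

Lemma loc_ext (k : closedFieldType) (A L B : comAlgType k) (t : A) (io : {lrmorphism A -> L})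
  (f g : {lrmorphism L -> B}) : is_loc t io -> f \o io =1 g \o io -> f =1 g.
Proof.
move=> [ut _ st _] e l; have [a [n ha]] := st l.
have e' a' : f (io a') = g (io a') by exact: e.
apply: (unit_mulI (invertible_map f (invertible_pow n ut))); rewrite -lrM ha e' -ha lrM; congr (_ * _).
by rewrite !lrX e'.
Qed.

Section Moduli.
Variables (k : closedFieldType) (M : scheme k) (eta : nattrans (ellcurve_functor k) M).
Hypothesis eta_iso : iso_invariant eta.
Implicit Types A B C D L : comAlgType k.
Let P : comAlgType k := apoly k^o.
Let PX : P := ('X : {poly k^o}).
Let nP : nice P. Proof. exact: nice_apoly (nice_ko k). Qed.

Lemma evP_ko (x : k^o) (p : P) : evP x p = (p : {poly k^o}).[x].
Proof. by rewrite /evP apoly_evalE (map_poly_id (fun c _ => mulr1 c)). Qed.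

(** The charts cover the line by [special_chart], and any two agree on their overlap because [good]
    sections over a [nice] ring are unique. *)
Lemma global_section : exists sg : M P, good eta PX sg.
Proof.
have [dP nsP] := nP; have [sheaf _] := sch_axiom M.
pose T : set P := fun q => chart_at eta q.
have evE (ev : {lrmorphism P -> k^o}) q : ev q = (q : {poly k^o}).[ev PX] by rewrite -evP_ko; exact: evP_uniq.
have uT : unimodular T.
  apply: contrapT => nT; have [K [pi [fK hpi]]] := max_quot nT.
  have [ev [kev _]] := nsP K pi 1 fK (fun z => negP (oner_neq0 K) (introT eqP (etrans (esym (lr1 pi)) z))).
  have [q [hq Tq]] := special_chart eta_iso (ev PX); move/eqP: hq; apply.
  by rewrite -evE; apply: kev; apply: hpi.
pose Q B (phi : {lrmorphism P -> B}) (y : M B) := exists t L (io : {lrmorphism P -> L}) (psi : {lrmorphism L -> B}) (s : M L),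
  [/\ is_loc t io, good eta (io PX) s, phi =1 psi \o io & y = fmap M psi s].
have exQ B (phi : {lrmorphism P -> B}) : in_sieve T phi -> exists y, Q B phi y.
  move=> [t [L [io [hl [s gs]]]] it]; have [_ _ _ hu] := hl; have [psi hpsi] := hu B phi it.
  by exists (fmap M psi s), t, L, io, psi, s.
have unQ B (phi : {lrmorphism P -> B}) y y' : Q B phi y -> Q B phi y' -> y = y'.
  move=> [t [L [io [psi [s [hl gs e ->]]]]]] [t' [L' [io' [psi' [s' [hl' gs' e' ->]]]]]].
  have nz (t0 : P) L0 (i0 : {lrmorphism P -> L0}) : is_loc t0 i0 -> t0 <> 0.
    by move=> [[d hd] _ _ _] z; move: hd; rewrite z lr0 mul0r => /esym/eqP; rewrite oner_eq0.
  have tt0 : t * t' <> 0 by move=> /dP[]; [exact: (nz _ _ io)|exact: (nz _ _ io')].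
  have [L2 [i2 l2]] := is_loc_ex dP tt0; have [u2 _ _ uu2] := l2.
  rewrite lrM in u2; have [ut ut'] := invertible_l u2.
  have [ul _ _ hu] := hl; have [ul' _ _ hu'] := hl'.
  have [a ha] := hu L2 i2 ut; have [a' ha'] := hu' L2 i2 ut'.
  have [|p2 hp2] := uu2 B phi.
    rewrite lrM; have [d hd] := invertible_map psi ul; have [d' hd'] := invertible_map psi' ul'.
    have -> : phi t = psi (io t) by exact: e.
    have -> : phi t' = psi' (io' t') by exact: e'.
    by exists (d * d'); rewrite mulrACA hd hd' mulr1.
  have ee : fmap M a s = fmap M a' s'.
    apply: (good_uniq (eta := eta) (x := i2 PX) (nice_loc nP tt0 l2)).
      have -> : i2 PX = a (io PX) by exact: ha.
      exact: (@good_map _ _ _ _ _ a _ _ gs).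
    have -> : i2 PX = a' (io' PX) by exact: ha'.
    exact: (@good_map _ _ _ _ _ a' _ _ gs').
  have e1 : psi =1 lcompo p2 a.
    by apply: (loc_ext hl) => p; rewrite -[LHS](e p) (hp2 p) /= (ha p).
  have e2 : psi' =1 lcompo p2 a'.
    by apply: (loc_ext hl') => p; rewrite -[LHS](e' p) (hp2 p) /= (ha' p).
  by rewrite (fmap_ext s e1) (fmap_ext s' e2) !fmap_o ee.
pose x B (phi : {lrmorphism P -> B}) h := projT1 (cid (exQ B phi h)).
have xQ B (phi : {lrmorphism P -> B}) h : Q B phi (x B phi h) by exact: (projT2 (cid (exQ B phi h))).
have [|y [hy _]] := sheaf P T uT x.
  move=> B C phi psi chi hphi hchi e; apply: (unQ C chi); first exact: xQ.
  have [t [L [io [psi0 [s [hl gs e0 ->]]]]]] := xQ B phi hphi.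
  exists t, L, io, (lcompo psi psi0), s; split=> //; last by rewrite fmap_o.
  by move=> p; rewrite e /= e0.
exists y => ev E hE.
have Tev : in_sieve T ev.
  have [q [hq Tq]] := special_chart eta_iso (ev PX); exists q => //; apply: ko_unit.
  by rewrite evE => z; move/eqP: hq; apply.
rewrite (hy _ ev Tev); have [t [L [io [psi0 [s [hl gs e0 ->]]]]]] := xQ _ ev Tev.
by apply: gs; rewrite hE; exact: e0.
Qed.

(** A curve may live over an algebra that is not [nice]; identities between sections are proved on
    this one and pulled back. *)
Lemma universal_curve : exists (W : comAlgType k) (E : ellcurve W), nice W /\
  forall A (F : ellcurve A), exists phi : {lrmorphism W -> A}, ellcurve_map phi E = F.
Proof.
pose P2 := apoly P; pose P3 := apoly P2; pose P4 := apoly P3; pose P5 := apoly P4.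
have n5 : nice P5 by do 4 apply: nice_apoly.
pose b1 : P5 := apolyC P4 (apolyC P3 (apolyC P2 (apolyC P PX))).
pose b2 : P5 := apolyC P4 (apolyC P3 (apolyC P2 ('X : {poly P}))).
pose b3 : P5 := apolyC P4 (apolyC P3 ('X : {poly P2})).
pose b4 : P5 := apolyC P4 ('X : {poly P3}).
pose b6 : P5 := ('X : {poly P4}).
have hev A a1 a2 a3 a4 a6 : exists phi : {lrmorphism P5 -> A}, [/\ phi b1 = a1, phi b2 = a2, phi b3 = a3, phi b4 = a4 & phi b6 = a6].
  exists (apoly_eval (apoly_eval (apoly_eval (apoly_eval (evP a1) a2) a3) a4) a6).
  by rewrite /b1 /b2 /b3 /b4 /b6 !apoly_evalC !apoly_evalX ?evPX.
pose d := discriminant b1 b2 b3 b4 b6.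
have d0 : d <> 0.
  have [E _] := curve_with_j (0 : k^o).
  have [phi [e1 e2 e3 e4 e6]] := hev k^o (ec_a1 E) (ec_a2 E) (ec_a3 E) (ec_a4 E) (ec_a6 E).
  move=> z; have [c] := ec_disc E.
  have -> : discriminant (ec_a1 E) (ec_a2 E) (ec_a3 E) (ec_a4 E) (ec_a6 E) = phi d.
    by rewrite /d -discriminant_rmorph /= e1 e2 e3 e4 e6.
  by rewrite z lr0 mul0r => /esym/eqP; rewrite oner_eq0.
have [d5 _] := n5; have [W [io hl]] := is_loc_ex d5 d0; have [ud _ _ uu] := hl.
have dE : invertible (discriminant (io b1) (io b2) (io b3) (io b4) (io b6)) by rewrite discriminant_rmorph.
exists W, (EllCurve dE); split; first exact: nice_loc hl.
move=> A F; have [phi [e1 e2 e3 e4 e6]] := hev A (ec_a1 F) (ec_a2 F) (ec_a3 F) (ec_a4 F) (ec_a6 F).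
have [|psi hpsi] := uu A phi.
  by rewrite /d -discriminant_rmorph /= e1 e2 e3 e4 e6; exact: ec_disc.
have hp b : psi (io b) = phi b by rewrite hpsi.
by exists psi; apply: ellcurve_eq; rewrite /= hp.
Qed.
End Moduli.

Section Line.
Variables (k : closedFieldType) (M : scheme k) (eta : nattrans (ellcurve_functor k) M).
Hypothesis hM : is_coarse_moduli eta.
Implicit Types A B : comAlgType k.

(** One composite is the identity by uniqueness in the universal property, the other by comparison
    at k-points. *)
Theorem moduli_line : exists (h : nattrans M (affine_line k)) (s : nattrans (affine_line k) M),
  nat_inverse h s /\ forall A (E : ellcurve A), h A (eta A E) = jinv E.
Proof.
have [eta_iso _ univ] := hM; have [sg gsg] := global_section eta_iso.
pose P : comAlgType k := apoly k^o.
have jn A B (phi : {lrmorphism A -> B}) (E : ellcurve A) :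
  jinv (fmap (ellcurve_functor k) phi E) = phi (jinv E) by exact: jinv_map.
pose theta : nattrans (ellcurve_functor k) (affine_line_sch k) :=
  @NatTrans k (ellcurve_functor k) (affine_line_sch k) (fun A (E : ellcurve A) => jinv E) jn.
have [|h [hE _]] := univ (affine_line_sch k) theta; first by move=> A E E' /iso_jinv.
have sn A B (phi : {lrmorphism A -> B}) (b : A) : fmap M (evP (phi b)) sg = fmap M phi (fmap M (evP b) sg).
  by rewrite -fmap_o; apply: fmap_ext => p /=; rewrite evP_comp.
pose s : nattrans (affine_line k) M := @NatTrans k (affine_line k) M (fun A b => fmap M (evP b) sg) sn.
have sE A (E : ellcurve A) : s A (jinv E) = eta A E.
  have [W [EW [nW uW]]] := universal_curve k; have [phi <-] := uW A E.
  rewrite jinv_map -[LHS]/(fmap M (evP (phi (jinv EW))) sg) sn.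
  have -> : eta A (ellcurve_map phi EW) = fmap M phi (eta W EW) by exact: nt_nat.
  congr (fmap M phi _); apply: (good_uniq (eta := eta) (x := jinv EW) nW); last exact: good_eta.
  by rewrite -[X in good _ X](evPX (jinv EW)); exact: (@good_map _ _ _ _ _ (evP (jinv EW)) _ _ gsg).
exists h, s; split=> [A|//]; split=> m.
  have [h0 [_ un]] := univ M eta eta_iso.
  have snn (B C : comAlgType k) (phi : {lrmorphism B -> C}) (y : M B) : s C (h C (fmap M phi y)) = fmap M phi (s B (h B y)).
    by rewrite (nt_nat h phi y); exact: nt_nat.
  have -> : s A (h A m) = h0 A m.
    by apply: (un (@NatTrans k M M (fun (B : comAlgType k) y => s B (h B y)) snn)) => B E; rewrite /= hE; exact: sE.
  by apply: esym; apply: (un (@NatTrans k M M (fun (B : comAlgType k) y => y) (fun (B C : comAlgType k) phi y => erefl))).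
rewrite [s A m]/(fmap M (evP m) sg) (nt_nat h (evP m) sg).
suff -> : h P sg = ('X : {poly k^o}) by exact: evPX.
apply: (agree (affine_line_scheme k) (nice_apoly (nice_ko k))) => ev.
have [E hEv] := curve_with_j (ev ('X : {poly k^o})).
by rewrite -(nt_nat h ev sg) (gsg ev E hEv) hE.
Qed.

End Line.

(** * Chains near the cusp *)

Section Chains.
Variable k : closedFieldType.
Implicit Types (u v : nat -> k) (phi a b : (nat -> k) -> k).

(* the reciprocals [u i = 1 / v i] of a chain of 3-isogenies *)
Definition cnum (x : k) := x * (1 - x + x ^+ 2).
Definition cden (x : k) := 1 + 2 * x + 4 * x ^+ 2.
Definition uchain r u := forall i, (i < r)%N -> u i.+1 ^+ 3 * cden (u i) = cnum (u i).
Definition z0 : nat -> k := fun _ => 0.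

(* functions of [u 0, ..., u r] that are regular at the origin *)
Inductive reg (r : nat) : ((nat -> k) -> k) -> Prop :=
| reg_c c : reg r (fun _ => c)
| reg_v i : (i <= r)%N -> reg r (fun u => u i)
| reg_D a b : reg r a -> reg r b -> reg r (fun u => a u + b u)
| reg_M a b : reg r a -> reg r b -> reg r (fun u => a u * b u)
| reg_V a : reg r a -> a z0 != 0 -> reg r (fun u => (a u)^-1).

Lemma reg_N r a : reg r a -> reg r (fun u => - a u).
Proof.
move=> ha; have := reg_M (reg_c r (-1)) ha.
by have -> : (fun u => -1 * a u) = (fun u => - a u) by apply: funext => u; rewrite mulN1r.
Qed.
Lemma reg_X r a n : reg r a -> reg r (fun u => a u ^+ n).
Proof.
move=> ha; elim: n => [|n IH]; first exact: reg_c.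
have := reg_M ha IH.
by have -> : (fun u => a u * a u ^+ n) = (fun u => a u ^+ n.+1) by apply: funext => u; rewrite exprS.
Qed.
Lemma reg_sum r n (F : 'I_n -> (nat -> k) -> k) : (forall i, reg r (F i)) -> reg r (fun u => \sum_i F i u).
Proof.
elim: n F => [|n IH] F hF.
  have -> : (fun u => \sum_i F i u) = (fun _ => 0) by apply: funext => u; rewrite big_ord0.
  exact: reg_c.
have := reg_D (hF ord0) (IH (fun i => F (lift ord0 i)) (fun i => hF _)).
by have -> : (fun u => F ord0 u + \sum_i F (lift ord0 i) u) = (fun u => \sum_i F i u) by apply: funext => u; rewrite big_ord_recl.
Qed.
Lemma reg_ext r a u v : reg r a -> (forall i, (i <= r)%N -> u i = v i) -> a u = a v.
Proof. by move=> + e; elim=> {a} [c|i ir|a b _ -> _ ->|a b _ -> _ ->|a _ -> _] //; exact: e. Qed.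

Local Ltac regt := do ?[exact: reg_c | assumption | (apply: reg_v; by []) | apply: reg_X | apply: reg_N | apply: reg_D | apply: reg_M].
Lemma reg_cden r i : (i <= r)%N -> reg r (fun u => cden (u i)).
Proof. by move=> h; rewrite /cden; regt. Qed.
Lemma reg_cnum r i : (i <= r)%N -> reg r (fun u => cnum (u i)).
Proof. by move=> h; rewrite /cnum; regt. Qed.
Lemma cden0 : cden 0 = 1. Proof. by rewrite /cden; ring. Qed.

(** On a chain this is the cube of the next coordinate. *)
Definition rho r u := cnum (u r) * (cden (u r))^-1.
Lemma reg_rho r : reg r (rho r).
Proof.
by apply: reg_M; [exact: reg_cnum|apply: reg_V; [exact: reg_cden|rewrite /z0 cden0 oner_neq0]].
Qed.
Lemma rho0 r : rho r z0 = 0. Proof. by rewrite /rho /cnum /z0 !mul0r. Qed.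

(** The norm of [g0 + g1 x + g2 x ^+ 2] in the cubic extension [x ^+ 3 = rho]; [cnormE] exhibits the
    cofactor. *)
Definition cnorm r (g0 g1 g2 : (nat -> k) -> k) u :=
  g0 u ^+ 3 + g1 u ^+ 3 * rho r u + g2 u ^+ 3 * rho r u ^+ 2 - 3 * (g0 u * g1 u * g2 u * rho r u).

Lemma reg_cnorm r g0 g1 g2 : reg r g0 -> reg r g1 -> reg r g2 -> reg r (cnorm r g0 g1 g2).
Proof.
by move=> h0 h1 h2; have h3 := reg_rho r; rewrite /cnorm; regt.
Qed.

Lemma cnorm0 r g0 g1 g2 : cnorm r g0 g1 g2 z0 = g0 z0 ^+ 3.
Proof. by rewrite /cnorm rho0; ring. Qed.

Lemma cnormE r g0 g1 g2 u x : x ^+ 3 = rho r u -> cnorm r g0 g1 g2 u =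
  (g0 u + g1 u * x + g2 u * x ^+ 2) * ((g0 u ^+ 2 - rho r u * (g1 u * g2 u)) +
    (rho r u * g2 u ^+ 2 - g0 u * g1 u) * x + (g1 u ^+ 2 - g0 u * g2 u) * x ^+ 2).
Proof. by rewrite /cnorm => <-; ring. Qed.

Lemma uchain_rho r u : uchain r.+1 u -> cden (u r) != 0 -> u r.+1 ^+ 3 = rho r u.
Proof. by move=> hu d; rewrite /rho -hu ?mulfK. Qed.

(** Functions are reduced modulo [x ^+ 3 = rho] in the last variable, inverses being formed with the
    norm; the expression is valid where the denominator [d], nonzero at the origin, does not
    vanish. *)
Lemma reg_split r phi : reg r.+1 phi -> exists g0 g1 g2 d, [/\ reg r g0, reg r g1, reg r g2, reg r d &
  [/\ d z0 != 0, g0 z0 = phi z0 & forall u, uchain r.+1 u -> d u != 0 ->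
      phi u = g0 u + g1 u * u r.+1 + g2 u * u r.+1 ^+ 2]].
Proof.
have rc c : reg r (fun _ => c) by exact: reg_c.
have rr := reg_rho r; have rd : reg r (fun u => cden (u r)) by exact: reg_cden.
have n1 : (1 : k) != 0 by exact: oner_neq0.
elim=> {phi} [c|i ir|a b ra [g0 [g1 [g2 [d [r0 r1 r2 r3 [d0 e0 ea]]]]]] rb [h0 [h1 [h2 [d' [s0 s1 s2 s3 [d0' e0' eb]]]]]]
  |a b ra [g0 [g1 [g2 [d [r0 r1 r2 r3 [d0 e0 ea]]]]]] rb [h0 [h1 [h2 [d' [s0 s1 s2 s3 [d0' e0' eb]]]]]]
  |a ra [g0 [g1 [g2 [d [r0 r1 r2 r3 [d0 e0 ea]]]]]] a0].
- by exists (fun _ => c), (fun _ => 0), (fun _ => 0), (fun _ => 1); split=> //; split=> // u _ _; ring.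
- have [ir'|ir'] := leqP i r.
    exists (fun u => u i), (fun _ => 0), (fun _ => 0), (fun _ => 1); split=> //; first exact: reg_v.
    by split=> // u _ _; ring.
  have -> : i = r.+1 by lia.
  exists (fun _ => 0), (fun _ => 1), (fun _ => 0), (fun _ => 1); split=> //.
  by split=> // u _ _; ring.
- exists (fun u => g0 u + h0 u), (fun u => g1 u + h1 u), (fun u => g2 u + h2 u), (fun u => d u * d' u).
  split; try exact: reg_D; first exact: reg_M.
  split; [exact: mulf_neq0|by rewrite e0 e0'|move=> u hu].
  by rewrite mulf_eq0 negb_or => /andP[n n']; rewrite (ea u hu n) (eb u hu n'); ring.
- exists (fun u => g0 u * h0 u + rho r u * (g1 u * h2 u + g2 u * h1 u)),
    (fun u => g0 u * h1 u + g1 u * h0 u + rho r u * (g2 u * h2 u)),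
    (fun u => g0 u * h2 u + g1 u * h1 u + g2 u * h0 u), (fun u => d u * d' u * cden (u r)).
  split; regt.
  split; first by rewrite !mulf_neq0 // /z0 cden0.
    by rewrite rho0 e0 e0'; ring.
  move=> u hu; rewrite !mulf_eq0 !negb_or => /andP[/andP[n n'] n3].
  by rewrite (ea u hu n) (eb u hu n') -(uchain_rho hu n3); ring.
- exists (fun u => (g0 u ^+ 2 - rho r u * (g1 u * g2 u)) * (cnorm r g0 g1 g2 u)^-1),
    (fun u => (rho r u * g2 u ^+ 2 - g0 u * g1 u) * (cnorm r g0 g1 g2 u)^-1),
    (fun u => (g1 u ^+ 2 - g0 u * g2 u) * (cnorm r g0 g1 g2 u)^-1),
    (fun u => d u * cden (u r) * cnorm r g0 g1 g2 u).
  have g00 : g0 z0 != 0 by rewrite e0.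
  have nn : reg r (cnorm r g0 g1 g2) by exact: reg_cnorm.
  have nV : reg r (fun u => (cnorm r g0 g1 g2 u)^-1) by apply: reg_V => //; rewrite cnorm0 expf_neq0.
  split; regt.
  split; first by rewrite cnorm0 !mulf_neq0 ?expf_neq0 // /z0 cden0.
    by rewrite cnorm0 rho0 -e0 mul0r subr0; field.
  move=> u hu; rewrite !mulf_eq0 !negb_or => /andP[/andP[n n'] n3].
  rewrite (ea u hu n); have e3 := cnormE g0 g1 g2 (uchain_rho hu n').
  move: n3; rewrite e3 mulf_eq0 negb_or => /andP[n4 n5].
  rewrite invfM; set x := g0 u + _ + _ in n4 *; set y := (X in X != 0) in n5.
  transitivity (y * (x^-1 * y^-1)); last by rewrite /y; ring.
  by rewrite mulrCA mulfV ?mulr1.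
Qed.

Lemma reg0_poly phi : reg 0 phi -> exists a b : {poly k}, [/\ b.[0] != 0, a.[0] = phi z0 * b.[0] &
  forall u, b.[u 0%N] != 0 -> phi u * b.[u 0%N] = a.[u 0%N]].
Proof.
elim=> {phi} [c|i|p q _ [a [b [b0 a0 e]]] _ [a' [b' [b0' a0' e']]]|p q _ [a [b [b0 a0 e]]] _ [a' [b' [b0' a0' e']]]
  |p _ [a [b [b0 a0 e]]] p0].
- exists c%:P, 1; rewrite !hornerE; split=> // [|u _]; rewrite ?oner_neq0 ?hornerE //.
- rewrite leqn0 => /eqP ->; exists 'X, 1; rewrite !hornerE; split=> // [|u _]; rewrite ?oner_neq0 ?hornerE //.
- exists (a * b' + a' * b), (b * b'); split=> [||u]; rewrite !(hornerD, hornerM).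
  - exact: mulf_neq0.
  - by rewrite a0 a0'; ring.
  by rewrite mulf_eq0 negb_or => /andP[n n']; rewrite -(e u n) -(e' u n'); ring.
- exists (a * a'), (b * b'); split=> [||u]; rewrite !(hornerD, hornerM).
  - exact: mulf_neq0.
  - by rewrite a0 a0'; ring.
  by rewrite mulf_eq0 negb_or => /andP[n n']; rewrite -(e u n) -(e' u n'); ring.
- exists (b * b), (a * b); split=> [||u]; rewrite !hornerM.
  - by rewrite a0 !mulf_neq0.
  - by rewrite a0; field.
  rewrite mulf_eq0 negb_or => /andP[n n']; move: n; rewrite -(e u n') mulf_eq0 negb_or => /andP[n _].
  by field.
Qed.

(** Induction is applied to the norm: where the norm of [phi] is nonzero, so is [phi] at every
    extension of the chain by a cube root. *)
Lemma reg_chain r phi : reg r phi -> phi z0 != 0 -> exists u, [/\ uchain r u, u 0%N != 0 & phi u != 0].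
Proof.
elim: r phi => [|r IH] phi hphi p0.
  have [a [b [b0 a0 e]]] := reg0_poly hphi.
  have q0 : 'X * (a * b) != 0.
    rewrite !mulf_neq0 ?polyX_eq0 //; apply/eqP => z; [move: a0|move: b0]; rewrite z horner0 ?eqxx //.
    by move/esym/eqP; rewrite mulf_eq0 (negbTE p0) (negbTE b0).
  have [x [_]] := nonroot_ex [::] q0; rewrite !hornerM hornerX !mulf_eq0 !negb_or => /andP[x0 /andP[ax bx]].
  exists (fun _ => x); split=> //; apply: contraNneq ax => z.
  by rewrite -(e (fun _ => x) bx) z mul0r.
have [g0 [g1 [g2 [d [r0 r1 r2 r3 [d0 e0 e]]]]]] := reg_split hphi.
have [||u [hu u0]] := IH (fun u => cnorm r g0 g1 g2 u * (d u * cden (u r))).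
- by apply: reg_M; [exact: reg_cnorm|apply: reg_M => //; exact: reg_cden].
- by rewrite cnorm0 e0 !mulf_neq0 ?expf_neq0 // /z0 cden0 oner_neq0.
rewrite !mulf_eq0 !negb_or => /andP[n1 /andP[n2 n3]].
have [x] := @solve_monicpoly k 3 (fun i => if i == 0%N then rho r u else 0) isT.
rewrite !big_ord_recl big_ord0 /= expr0 mulr1 !mul0r !addr0 => hx.
pose w i := if (i <= r)%N then u i else x.
have ew i : (i <= r)%N -> w i = u i by rewrite /w => ->.
have wx : w r.+1 = x by rewrite /w ltnn.
have hw : uchain r.+1 w.
  move=> i; rewrite ltnS leq_eqVlt => /orP[/eqP ->|ir]; last by rewrite !ew ?(ltnW ir) //; exact: hu.
  by rewrite wx ew // hx /rho mulfVK.
have rw g : reg r g -> g w = g u by move=> hg; apply: (reg_ext hg).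
exists w; split; [exact: hw|by rewrite ew|].
rewrite (e w hw) ?(rw d) // wx !rw //; apply: contraNneq n1 => z.
by rewrite (cnormE g0 g1 g2 hx) z mul0r.
Qed.
End Chains.

(** * Leading exponents and the argument at the cusp *)

Section Lead.
Variable k : closedFieldType.
Implicit Types (F G : {poly {poly k}}) (u : nat -> k).
Definition v2 F (x y : k) : k := F.[x%:P].[y].

Lemma v2E F (x y : k) B : (forall a, (size (F`_a)%R <= B.+1)%N) ->
  v2 F x y = \sum_(a < size F) \sum_(b < B.+1) F`_a`_b * (x ^+ a * y ^+ b).
Proof.
move=> hB; rewrite /v2 (horner_coef F) horner_sum; apply: eq_bigr => a _.
rewrite -polyC_exp hornerM hornerC (horner_coef_wide y (hB a)) mulr_suml; apply: eq_bigr => b _.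
by rewrite mulrAC mulrA.
Qed.

(** With poles of orders [m] and [n] and [m > n B], the monomial with lexicographically largest
    exponent, [x] first, has the strictly largest pole; so the rescaled value is nonzero at the
    origin. *)
Lemma v2_lead F r (xi ups : (nat -> k) -> k) m n B : F != 0 -> (forall a, (size (F`_a)%R <= B.+1)%N) ->
  reg r xi -> reg r ups -> xi (z0 k) = 1 -> ups (z0 k) = 1 -> (0 < n)%N -> (n * B < m)%N ->
  exists al, [/\ reg r al, al (z0 k) != 0 & forall u x y, x * u r ^+ m = xi u -> y * u r ^+ n = ups u ->
    v2 F x y * u r ^+ (m * (size F).-1 + n * (size (lead_coef F)).-1) = al u].
Proof.
move=> F0 hB rx ru x1 u1 n0 hm; set a0 := (size F).-1; set b0 := (size (lead_coef F)).-1.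
have sF : (0 < size F)%N by rewrite size_poly_gt0.
have sL : (0 < size (lead_coef F))%N by rewrite size_poly_gt0 lead_coef_eq0.
have hb0 : (b0 < B.+1)%N by have := hB a0; rewrite -/(lead_coef F) /b0; lia.
have ha0 : (a0 < size F)%N by rewrite /a0; lia.
(* [e a b] is the distance to the leading pole order, positive for every other monomial that
   occurs. *)
pose e a b := (m * a0 + n * b0 - (m * a + n * b))%N.
exists (fun u => \sum_(a < size F) \sum_(b < B.+1) F`_a`_b * (xi u ^+ a * ups u ^+ b * u r ^+ (e a b))).
have hab a b : F`_a`_b != 0 -> (a < size F)%N -> (a = a0 /\ (b <= b0)%N) \/ ((a < a0)%N /\ (b <= B)%N).
  move=> c0 ha; have hb : (b < size (F`_a)%R)%N by rewrite ltnNge; apply: contraNN c0 => /(nth_default 0) ->.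
  have [aa|aa] := eqVneq a a0; [left|right]; last by have := hB a; rewrite /a0 in aa *; lia.
  by split=> //; move: hb; rewrite aa -/(lead_coef F) /b0; lia.
split.
- apply: reg_sum => a; apply: reg_sum => b; apply: reg_M; first exact: reg_c.
  apply: reg_M; first by apply: reg_M; apply: reg_X.
  by apply: reg_X; exact: reg_v.
- rewrite (bigD1 (Ordinal ha0)) //= (bigD1 (Ordinal hb0)) //= x1 u1 !expr1n /e subnn expr0 !mulr1.
  rewrite !big1 ?addr0; first by rewrite -/(lead_coef F) -/(lead_coef (lead_coef F)) !lead_coef_eq0.
    move=> a na; apply: big1 => b _; have [->|c0] := eqVneq (F`_a`_b) 0; first by rewrite mul0r.
    have [[aa _]|[aa bb]] := hab a b c0 (ltn_ord a); first by move: na; rewrite -val_eqE /= aa eqxx.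
    have [l ->] : exists l, (m * a0 + n * b0 - (m * a + n * b))%N = l.+1.
      exists ((m * a0 + n * b0 - (m * a + n * b)).-1)%N.
      have : (m * a.+1 <= m * a0)%N by rewrite leq_mul2l aa orbT.
      have : (n * b <= n * B)%N by rewrite leq_mul2l bb orbT.
      by rewrite mulnS; lia.
    by rewrite /z0 expr0n /= !mulr0.
  move=> b nb; have [->|c0] := eqVneq (F`_a0`_b) 0; first by rewrite mul0r.
  have [[_ bb]|[aa _]] := hab a0 b c0 ha0; last by rewrite ltnn in aa.
  have bb' : (b < b0)%N by rewrite ltn_neqAle bb andbT; move: nb; rewrite -val_eqE.
  have [l ->] : exists l, (m * a0 + n * b0 - (m * a0 + n * b))%N = l.+1.
    exists ((m * a0 + n * b0 - (m * a0 + n * b)).-1)%N.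
    have : (n * b.+1 <= n * b0)%N by rewrite leq_mul2l bb' orbT.
    by rewrite mulnS; lia.
  by rewrite /z0 expr0n /= !mulr0.
move=> u x y hx hy; rewrite (v2E x y hB) /= -hx -hy mulr_suml; apply: eq_bigr => a _; rewrite mulr_suml.
apply: eq_bigr => b _ /=; have [->|c0] := eqVneq (F`_a`_b) 0; first by rewrite !mul0r.
transitivity (F`_a`_b * ((x ^+ a * y ^+ b) * u r ^+ (m * a0 + n * b0))); first exact: esym (mulrA _ _ _).
congr (_ * _).
rewrite !exprMn -!exprM.
have le : (m * a + n * b <= m * a0 + n * b0)%N.
  have [[-> bb]|[aa bb]] := hab a b c0 (ltn_ord a); first by rewrite leq_add2l leq_mul2l bb orbT.
  have : (m * a.+1 <= m * a0)%N by rewrite leq_mul2l aa orbT.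
  have : (n * b <= n * B)%N by rewrite leq_mul2l bb orbT.
  by rewrite mulnS; lia.
have -> : (m * a0 + n * b0 = m * a + n * b + e a b)%N by rewrite /e; lia.
by rewrite !exprD; ring.
Qed.
End Lead.

Section Pair.
Variable k : closedFieldType.
Implicit Types (F G H : {poly {poly k}}) (u v : nat -> k).

(** [J1] and [J2] are the j-invariants of the curves [E] and [E'] of a chain, as functions of
    [c = v ^+ 3]. *)
Definition J1 (c : k) := ((c - 2) * ((c - 2) ^+ 3 - 24 * c)) ^+ 3 / (c ^+ 3 * (c + 1) ^+ 2 * (c - 8)).
Definition J2 (c : k) := ((c + 4) * ((c + 4) ^+ 3 - 24 * c ^+ 2)) ^+ 3 / (c ^+ 6 * (c + 1) * (c - 8) ^+ 2).

Definition inv2 F G := forall r v,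
  (forall i, (i < r)%N -> v i.+1 ^+ 3 * (v i ^+ 2 - v i + 1) = v i * (v i ^+ 2 + 2 * v i + 4)) ->
  (forall i, (i <= r)%N -> v i * (v i ^+ 3 - 8) * (v i ^+ 3 + 1) != 0) ->
  v2 G (J1 (v 0%N ^+ 3)) (J2 (v r ^+ 3)) != 0 -> v2 G (J2 (v 0%N ^+ 3)) (J1 (v r ^+ 3)) != 0 ->
  v2 F (J1 (v 0%N ^+ 3)) (J2 (v r ^+ 3)) * v2 G (J2 (v 0%N ^+ 3)) (J1 (v r ^+ 3)) =
  v2 F (J2 (v 0%N ^+ 3)) (J1 (v r ^+ 3)) * v2 G (J1 (v 0%N ^+ 3)) (J2 (v r ^+ 3)).

(** With [w = u ^+ 3] inverse to [c], [J1] is [N1 / D1] divided by [w ^+ 6] and [J2] is [N2 / D2]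
    divided by [w ^+ 3]; both quotients are 1 at the cusp. *)
Definition D1 (w : k) := (1 + w) ^+ 2 * (1 - 8 * w).
Definition D2 (w : k) := (1 + w) * (1 - 8 * w) ^+ 2.
Definition N1 (w : k) := ((1 - 2 * w) * ((1 - 2 * w) ^+ 3 - 24 * w ^+ 2)) ^+ 3.
Definition N2 (w : k) := ((1 + 4 * w) * ((1 + 4 * w) ^+ 3 - 24 * w)) ^+ 3.
Definition ok (x : k) := (1 + x ^+ 3) * (1 - 8 * x ^+ 3).

Lemma okP (x : k) : ok x != 0 -> 1 + x ^+ 3 != 0 /\ 1 - 8 * x ^+ 3 != 0.
Proof. by rewrite mulf_eq0 negb_or => /andP. Qed.

Lemma inv_sub (x : k) : x != 0 -> [/\ x^-1 ^+ 3 != 0, x^-1 ^+ 3 + 1 = (1 + x ^+ 3) / x ^+ 3,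
  x^-1 ^+ 3 - 8 = (1 - 8 * x ^+ 3) / x ^+ 3 & x ^+ 3 != 0].
Proof. by move=> x0; rewrite !expf_neq0 ?invr_neq0 //; split=> //; field. Qed.

Lemma J1E (x : k) : x != 0 -> ok x != 0 -> J1 (x^-1 ^+ 3) * x ^+ 18 = N1 (x ^+ 3) * (D1 (x ^+ 3))^-1.
Proof.
move=> x0 /okP[h1 h2]; have [n0 e1 e2 n1] := inv_sub x0; rewrite /J1 e1 e2 /N1 /D1.
have -> : x^-1 ^+ 3 = (x ^+ 3)^-1 by rewrite exprVn.
have -> : x ^+ 18 = (x ^+ 3) ^+ 6 by rewrite -exprM.
by move: (x ^+ 3) h1 h2 n1 => w h1 h2 n1; field; rewrite h1 h2 n1.
Qed.

Lemma J2E (x : k) : x != 0 -> ok x != 0 -> J2 (x^-1 ^+ 3) * x ^+ 9 = N2 (x ^+ 3) * (D2 (x ^+ 3))^-1.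
Proof.
move=> x0 /okP[h1 h2]; have [n0 e1 e2 n1] := inv_sub x0; rewrite /J2 e1 e2 /N2 /D2.
have -> : x^-1 ^+ 3 = (x ^+ 3)^-1 by rewrite exprVn.
have -> : x ^+ 9 = (x ^+ 3) ^+ 3 by rewrite -exprM.
by move: (x ^+ 3) h1 h2 n1 => w h1 h2 n1; field; rewrite h1 h2 n1.
Qed.

Local Ltac regt := do ?[exact: reg_c | assumption | (apply: reg_v; by []) | apply: reg_X | apply: reg_N | apply: reg_D | apply: reg_M].

Lemma reg_J1 r i : (i <= r)%N -> reg r (fun u => N1 (u i ^+ 3) * (D1 (u i ^+ 3))^-1).
Proof.
move=> h; apply: reg_M; first by rewrite /N1; regt.
apply: reg_V; first by rewrite /D1; regt.
by rewrite /D1 /z0 expr0n /= mulr0 addr0 subr0 mulr1 expr1n oner_neq0.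
Qed.
Lemma reg_J2 r i : (i <= r)%N -> reg r (fun u => N2 (u i ^+ 3) * (D2 (u i ^+ 3))^-1).
Proof.
move=> h; apply: reg_M; first by rewrite /N2; regt.
apply: reg_V; first by rewrite /D2; regt.
by rewrite /D2 /z0 expr0n /= mulr0 addr0 subr0 mul1r expr1n oner_neq0.
Qed.
Lemma J0 : N1 (0 ^+ 3) * (D1 (0 ^+ 3))^-1 = 1 /\ N2 (0 ^+ 3) * (D2 (0 ^+ 3))^-1 = 1.
Proof.
have [e1 e2 e3 e4] : [/\ N1 (0 ^+ 3) = 1, N2 (0 ^+ 3) = 1, D1 (0 ^+ 3) = 1 & D2 (0 ^+ 3) = 1].
  by rewrite /N1 /D1 /N2 /D2; split; ring.
by rewrite e1 e2 e3 e4 invr1 mulr1.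
Qed.

Lemma reg_ok r i : (i <= r)%N -> exists ka, [/\ reg r ka, ka (z0 k) = 1 &
  forall u, ka u != 0 -> forall j, (j <= i)%N -> ok (u j) != 0].
Proof.
elim: i => [|i IH] hi.
  exists (fun u => ok (u 0%N)); split; first by rewrite /ok; regt.
    by rewrite /ok /z0 expr0n /= mulr0; ring.
  by move=> u h j; rewrite leqn0 => /eqP ->.
have [ka [rk k0 hk]] := IH (ltnW hi).
exists (fun u => ka u * ok (u i.+1)); split; first by rewrite /ok; regt.
  by rewrite k0 /ok /z0 expr0n /= mulr0; ring.
move=> u; rewrite mulf_eq0 negb_or => /andP[h1 h2] j; rewrite leq_eqVlt => /orP[/eqP -> //|]; exact: hk.
Qed.

Lemma ok_fac (x : k) : ok x != 0 -> 1 - x + x ^+ 2 != 0.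
Proof.
move=> /okP[h _]; apply: contraNneq h => z.
have -> : 1 + x ^+ 3 = (1 + x) * (1 - x + x ^+ 2) by ring.
by rewrite z mulr0.
Qed.

(** Each step replaces a coordinate by the cube of the next one times a factor equal to 1 at the
    origin. *)
Lemma chain_om r i : (i <= r)%N -> exists om, [/\ reg r om, om (z0 k) = 1 &
  forall u, uchain r u -> (forall j, (j <= r)%N -> ok (u j) != 0) -> u 0%N = u i ^+ (3 ^ i) * om u].
Proof.
elim: i => [|i IH] hi.
  by exists (fun _ => 1); split=> [||u _ _]; [exact: reg_c| |rewrite expr1 mulr1].
have [om [ro o1 h]] := IH (ltnW hi); have hi' := ltnW hi.
have rV : reg r (fun u => (1 - u i + u i ^+ 2)^-1).
  by apply: reg_V; [regt|rewrite /z0 expr0n /= subr0 addr0 oner_neq0].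
exists (fun u => (cden (u i) * (1 - u i + u i ^+ 2)^-1) ^+ (3 ^ i) * om u); split.
- by rewrite /cden; regt.
- by rewrite o1 /z0 cden0 (_ : 1 - 0 + 0 ^+ 2 = 1) ?invr1 ?mulr1 ?expr1n //; ring.
- move=> u hu hk; rewrite (h u hu hk) mulrA expnS exprM -exprMn; congr (_ ^+ _ * _).
  by rewrite mulrA (hu i hi) /cnum mulfK // ok_fac ?hk.
Qed.

Lemma chain_v r u : uchain r u -> u 0%N != 0 -> (forall j, (j <= r)%N -> ok (u j) != 0) ->
  [/\ forall i, (i <= r)%N -> u i != 0,
    forall i, (i < r)%N -> (u i.+1)^-1 ^+ 3 * ((u i)^-1 ^+ 2 - (u i)^-1 + 1) = (u i)^-1 * ((u i)^-1 ^+ 2 + 2 * (u i)^-1 + 4)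
  & forall i, (i <= r)%N -> (u i)^-1 * ((u i)^-1 ^+ 3 - 8) * ((u i)^-1 ^+ 3 + 1) != 0].
Proof.
move=> hu u0 hk; have nz i : (i <= r)%N -> u i != 0.
  elim: i => [//|i IH] hi; apply: contraTneq (oner_neq0 k) => z.
  have := hu i hi; rewrite z expr0n /= mul0r => /esym/eqP; rewrite mulf_eq0 (negbTE (IH (ltnW hi))) /=.
  by rewrite (negbTE (ok_fac (hk i (ltnW hi)))).
split=> [//|i hi|i hi].
  have h := hu i hi; have x0 := nz i (ltnW hi); have y0 := nz i.+1 hi.
  move: (u i) (u i.+1) x0 y0 h => x y x0 y0; rewrite /cnum /cden => h.
  apply: (mulIf (expf_neq0 3 y0)); apply: (mulIf (expf_neq0 3 x0)).
  transitivity (x * (1 - x + x ^+ 2)); first by field; rewrite x0 y0.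
  by rewrite -h; field; rewrite x0.
have x0 := nz i hi; have [h1 h2] := okP (hk i hi); have [n0 e1 e2 n1] := inv_sub x0.
by rewrite e1 e2 !mulf_neq0 ?invr_neq0.
Qed.

(** Both sides of the relation are powers of [u r] times functions nonzero at the cusp, so the
    exponents agree: [q a0 + b0' = q a0' + b0] with [q = 3 ^ r]. As [b0] and [b0'] are below [q],
    both pairs are equal. *)
Lemma inv2_lead F G : F != 0 -> G != 0 -> inv2 F G ->
  (size F).-1 = (size G).-1 /\ (size (lead_coef F)).-1 = (size (lead_coef G)).-1.
Proof.
move=> F0 G0 hinv.
have szB H B : (\max_(i < size H) size (H`_i)%R <= B)%N -> forall a, (size (H`_a)%R <= B.+1)%N.
  move=> hB a; have [ha|ha] := ltnP a (size H); last by rewrite nth_default // size_poly0.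
  apply: leqW; apply: leq_trans hB; exact: (leq_bigmax (Ordinal ha)).
pose B := maxn (\max_(i < size F) size (F`_i)%R) (\max_(i < size G) size (G`_i)%R).
have BF : forall a, (size (F`_a)%R <= B.+1)%N by apply: szB; exact: leq_maxl.
have BG : forall a, (size (G`_a)%R <= B.+1)%N by apply: szB; exact: leq_maxr.
(* This [r] gives [q > 2 B], so that both pairs of pole orders, [18 q] with 9 and [9 q] with 18,
   rank monomials lexicographically. *)
pose r := (2 * B).+1; pose q := (3 ^ r)%N.
have rq : (r < q)%N by exact: ltn_expl.
have qB : (2 * B < q)%N by rewrite /r in rq; lia.
have [om [ro o1 hom]] := chain_om (leqnn r); have [ka [rk k1 hka]] := reg_ok (leqnn r).
have rV : reg r (fun u => (om u)^-1) by apply: reg_V; rewrite ?o1 ?oner_neq0.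
pose a1 u := N1 (u 0%N ^+ 3) * (D1 (u 0%N ^+ 3))^-1; pose a2 u := N2 (u 0%N ^+ 3) * (D2 (u 0%N ^+ 3))^-1.
pose b1 u := N1 (u r ^+ 3) * (D1 (u r ^+ 3))^-1; pose b2 u := N2 (u r ^+ 3) * (D2 (u r ^+ 3))^-1.
have ra1 : reg r a1 by exact: reg_J1. have ra2 : reg r a2 by exact: reg_J2.
have rb1 : reg r b1 by exact: reg_J1. have rb2 : reg r b2 by exact: reg_J2.
have [J01 J02] := J0.
have rx1 : reg r (fun u => a1 u * (om u)^-1 ^+ 18) by regt.
have rx2 : reg r (fun u => a2 u * (om u)^-1 ^+ 9) by regt.
have x1 : a1 (z0 k) * (om (z0 k))^-1 ^+ 18 = 1 by rewrite o1 invr1 expr1n mulr1; exact: J01.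
have x2 : a2 (z0 k) * (om (z0 k))^-1 ^+ 9 = 1 by rewrite o1 invr1 expr1n mulr1; exact: J02.
have m1 : (9 * B < 18 * q)%N by lia.
have m2 : (18 * B < 9 * q)%N by lia.
have [al1 [ral1 l1 e1]] := v2_lead F0 BF rx1 rb2 x1 J02 (isT : (0 < 9)%N) m1.
have [al2 [ral2 l2 e2]] := v2_lead F0 BF rx2 rb1 x2 J01 (isT : (0 < 18)%N) m2.
have [be1 [rbe1 l3 e3]] := v2_lead G0 BG rx1 rb2 x1 J02 (isT : (0 < 9)%N) m1.
have [be2 [rbe2 l4 e4]] := v2_lead G0 BG rx2 rb1 x2 J01 (isT : (0 < 18)%N) m2.
set a0 := (size F).-1 in e1 e2 *; set b0 := (size (lead_coef F)).-1 in e1 e2 *.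
set a0' := (size G).-1 in e3 e4 *; set b0' := (size (lead_coef G)).-1 in e3 e4 *.
have hb0 : (b0 <= B)%N.
  by have := BF (size F).-1; rewrite -/(lead_coef F) /b0; case: (size (lead_coef F)).
have hb0' : (b0' <= B)%N.
  by have := BG (size G).-1; rewrite -/(lead_coef G) /b0'; case: (size (lead_coef G)).
pose E1 := (18 * q * a0 + 9 * b0 + (9 * q * a0' + 18 * b0'))%N.
pose E2 := (9 * q * a0 + 18 * b0 + (18 * q * a0' + 9 * b0'))%N.
pose ps u := ka u * be1 u * be2 u.
have rps : reg r ps by rewrite /ps; regt.
have ps0 : ps (z0 k) != 0 by rewrite /ps k1 mul1r mulf_neq0.
have key u : uchain r u -> u 0%N != 0 -> ps u != 0 ->
    u r != 0 /\ al1 u * be2 u * u r ^+ E2 = al2 u * be1 u * u r ^+ E1.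
  move=> hu u0; rewrite !mulf_eq0 !negb_or => /andP[/andP[n1 n2] n3].
  have hk := hka u n1; have [nz hv nv] := chain_v hu u0 hk.
  have t0 := nz r (leqnn r); split=> //; have := hom u hu hk; rewrite -/q => homu.
  have om0 : om u != 0 by apply: contraNneq u0 => z; rewrite homu z mulr0.
  have hw n : u 0%N ^+ n * (om u)^-1 ^+ n = u r ^+ (n * q).
    by rewrite -exprMn (_ : u 0%N * (om u)^-1 = u r ^+ q) -?exprM 1?mulnC // [u 0%N]homu mulfK.
  pose v i := (u i)^-1; have := hinv r v hv nv.
  have j1 : J1 (v 0%N ^+ 3) * u r ^+ (18 * q) = a1 u * (om u)^-1 ^+ 18.
    transitivity (J1 (v 0%N ^+ 3) * (u 0%N ^+ 18 * (om u)^-1 ^+ 18)); first by rewrite hw.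
    by rewrite /a1 -(J1E u0 (hk 0%N isT)); exact: mulrA.
  have j2 : J2 (v r ^+ 3) * u r ^+ 9 = b2 u by exact: (J2E t0 (hk r (leqnn r))).
  have j3 : J2 (v 0%N ^+ 3) * u r ^+ (9 * q) = a2 u * (om u)^-1 ^+ 9.
    transitivity (J2 (v 0%N ^+ 3) * (u 0%N ^+ 9 * (om u)^-1 ^+ 9)); first by rewrite hw.
    by rewrite /a2 -(J2E u0 (hk 0%N isT)); exact: mulrA.
  have j4 : J1 (v r ^+ 3) * u r ^+ 18 = b1 u by exact: (J1E t0 (hk r (leqnn r))).
  have f1 := e1 u _ _ j1 j2; have f2 := e2 u _ _ j3 j4; have f3 := e3 u _ _ j1 j2; have f4 := e4 u _ _ j3 j4.
  move: f1 f2 f3 f4; move: (v2 F _ _) (v2 F _ _) (v2 G _ _) (v2 G _ _) => F2 F1 G2 G1 f1 f2 f3 f4.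
  have g1 : G1 != 0 by apply: contraNneq n2 => z; rewrite -f3 z mul0r.
  have g2 : G2 != 0 by apply: contraNneq n3 => z; rewrite -f4 z mul0r.
  move=> /(_ g1 g2) hF; rewrite -f1 -f2 -f3 -f4 /E1 /E2.
  move: (18 * q * a0)%N (9 * b0)%N (9 * q * a0')%N (18 * b0')%N (9 * q * a0)%N (18 * b0)%N (18 * q * a0')%N (9 * b0')%N
    => n8 n7 n6 n5 n4 n3' n2' n1'.
  rewrite !exprD; move: (u r ^+ n8) (u r ^+ n7) (u r ^+ n6) (u r ^+ n5) (u r ^+ n4) (u r ^+ n3') (u r ^+ n2') (u r ^+ n1') =>
    y8 y7 y6 y5 y4 y3 y2 y1.
  transitivity (F1 * G2 * (y1 * y2 * y3 * y4 * y5 * y6 * y7 * y8)); first by ring.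
  by rewrite hF; ring.
(* Unequal exponents would make [s1] a multiple of a positive power of [u r] on all admissible
   chains, against [reg_chain]. *)
have no (s1 s2 : (nat -> k) -> k) e f : reg r s1 -> reg r s2 -> s1 (z0 k) != 0 -> (e < f)%N ->
    (forall u, uchain r u -> u 0%N != 0 -> ps u != 0 -> s1 u * u r ^+ e = s2 u * u r ^+ f) -> False.
  move=> r1 r2 s10 ef h; have [||u [hu u0]] := @reg_chain k r (fun u => (s1 u - s2 u * u r ^+ (f - e)) * ps u).
  - by regt.
  - have [l ->] : exists l, (f - e)%N = l.+1 by exists (f - e).-1; lia.
    by rewrite /z0 expr0n /= mulr0 subr0 mulf_neq0.
  rewrite mulf_eq0 negb_or => /andP[n1 n2]; have [t0 _] := key u hu u0 n2.
  move/eqP: n1; apply; apply/eqP; rewrite subr_eq0; apply/eqP; apply: (mulIf (expf_neq0 e t0)).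
  by rewrite (h u hu u0 n2) -mulrA -exprD; congr (_ * _ ^+ _); lia.
have EE : E1 = E2.
  have [lt|lt|//] := ltngtP E1 E2; exfalso.
    apply: (no (fun u => al2 u * be1 u) (fun u => al1 u * be2 u) _ _ _ _ _ lt); try by regt.
      by rewrite mulf_neq0.
    by move=> u hu u0 n; have [_ ->] := key u hu u0 n.
  apply: (no (fun u => al1 u * be2 u) (fun u => al2 u * be1 u) _ _ _ _ _ lt); try by regt.
    by rewrite mulf_neq0.
  by move=> u hu u0 n; have [_ ->] := key u hu u0 n.
have h9 : (q * a0 + b0' = q * a0' + b0)%N by move: EE; rewrite /E1 /E2; nia.
have qB' : (B < q)%N by lia.
move: h9 qB' hb0 hb0'; move: (q) => Q h9 qB' hb0 hb0'.
have aa : a0 = a0'.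
  have [lt|lt|//] := ltngtP a0 a0'; exfalso.
    have h : (Q * a0.+1 <= Q * a0')%N by rewrite leq_mul2l lt orbT.
    by rewrite mulnS in h; lia.
  have h : (Q * a0'.+1 <= Q * a0)%N by rewrite leq_mul2l lt orbT.
  by rewrite mulnS in h; lia.
by split=> //; move: h9; rewrite aa; lia.
Qed.

Theorem inv2_const F G : G != 0 -> inv2 F G -> exists l : k, forall x y, v2 F x y = l * v2 G x y.
Proof.
move=> G0 hinv; have [->|F0] := eqVneq F 0; first by exists 0 => x y; rewrite /v2 !horner0 mul0r.
have [eF1 eF2] := inv2_lead F0 G0 hinv.
pose l := lead_coef (lead_coef F) / lead_coef (lead_coef G); exists l.
pose H := F - l%:P *: G.
have v2H x y : v2 H x y = v2 F x y - l * v2 G x y by rewrite /v2 /H !(hornerD, hornerN, hornerZ, hornerM, hornerC).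
suff H0 : H = 0 by move=> x y; apply/eqP; rewrite -subr_eq0 -v2H H0 /v2 !horner0.
apply/eqP; apply: contraT => H0; have [|eH1 eH2] := inv2_lead H0 G0.
  by move=> r v hv nv g1 g2; rewrite !v2H !mulrBl (hinv r v hv nv g1 g2); ring.
have : lead_coef (lead_coef H) != 0 by rewrite !lead_coef_eq0.
rewrite {1}/lead_coef eH2 {1}/lead_coef eH1 /H coefB coefZ coefB coefCM.
rewrite -/(lead_coef G) -/(lead_coef (lead_coef G)) -eF2 -eF1 -/(lead_coef F) -/(lead_coef (lead_coef F)).
by rewrite /l mulfVK ?subrr ?eqxx // !lead_coef_eq0.
Qed.
End Pair.

(** * Functions invariant under isomorphism of products *)

Section JC.
Variable k : closedFieldType.

Lemma isC_jinv (E : ellcurve k) a b : isC E a b ->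
  b ^+ 3 * (a ^+ 3 - 27 * b) != 0 /\ b ^+ 3 * (a ^+ 3 - 27 * b) * jinv E = (a * (a ^+ 3 - 24 * b)) ^+ 3.
Proof.
move=> [e1 e2 e3 e4 e6]; have dE : delta E = b ^+ 3 * (a ^+ 3 - 27 * b).
  by rewrite e1 e2 e3 e4 e6 /discriminant; ring.
split; last by rewrite -dE jinvE e1 e2 e3 e4 /c4; ring.
by rewrite -dE; have [d hd] := ec_disc E; apply: contra_eq_neq hd => ->; rewrite mul0r eq_sym oner_neq0.
Qed.

Lemma mul_div_cancel (a d n : k) : d != 0 -> a * d * (n / d) = a * n.
Proof. by move=> d0; field. Qed.

Lemma isC_J1 (E : ellcurve k) c s : isC E ((c - 2) * s) (c * s ^+ 3) -> jinv E = J1 c.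
Proof.
move=> /isC_jinv[d0 e]; have eD : (c * s ^+ 3) ^+ 3 * (((c - 2) * s) ^+ 3 - 27 * (c * s ^+ 3)) =
  s ^+ 12 * (c ^+ 3 * (c + 1) ^+ 2 * (c - 8)) by ring.
rewrite eD in d0 e; move: (d0); rewrite mulf_eq0 negb_or => /andP[s0 h0].
by apply: (mulfI d0); rewrite e /J1 mul_div_cancel //; ring.
Qed.

Lemma isC_J2 (E : ellcurve k) c s : isC E ((c + 4) * s) (c ^+ 2 * s ^+ 3) -> jinv E = J2 c.
Proof.
move=> /isC_jinv[d0 e]; have eD : (c ^+ 2 * s ^+ 3) ^+ 3 * (((c + 4) * s) ^+ 3 - 27 * (c ^+ 2 * s ^+ 3)) =
  s ^+ 12 * (c ^+ 6 * (c + 1) * (c - 8) ^+ 2) by ring.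
rewrite eD in d0 e; move: (d0); rewrite mulf_eq0 negb_or => /andP[s0 h0].
by apply: (mulfI d0); rewrite e /J2 mul_div_cancel //; ring.
Qed.
End JC.

Section PolyAlg.
Variable k : closedFieldType.
Implicit Types A B P : comAlgType k.

Lemma poly_alg_nat n : exists P (X : nat -> P), [/\ nice P,
  forall A (a : nat -> A), exists phi : {lrmorphism P -> A}, forall i, (i < n)%N -> phi (X i) = a i
  & forall A (f g : {lrmorphism P -> A}), (forall i, (i < n)%N -> f (X i) = g (X i)) -> f =1 g].
Proof.
elim: n => [|n [P [X [nP ex un]]]].
  exists k^o, (fun _ => 0); split=> [|A a|A f g _ c]; first exact: nice_ko.
    by exists (structure_map A).
  by rewrite (ko_alg f) (ko_alg g).
exists (apoly P), (fun i => if (i < n)%N then apolyC P (X i) else 'X); split.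
- exact: nice_apoly.
- move=> A a; have [phi hphi] := ex A a; exists (apoly_eval phi (a n)) => i; rewrite ltnS leq_eqVlt.
  case: ltnP => [h _|h]; first by rewrite apoly_evalC hphi.
  by rewrite orbF => /eqP ->; rewrite apoly_evalX.
- move=> A f g e r; rewrite (apoly_lrmE f r) (apoly_lrmE g r).
  have -> : f 'X = g 'X by have := e n (ltnSn n); rewrite ltnn.
  congr (_.[_]); apply: eq_map_poly => c; apply: (un A (lcompo f (apolyC P)) (lcompo g (apolyC P))) => i hi.
  by have := e i (ltnW hi); rewrite hi.
Qed.

Lemma poly_alg n : exists P (X : 'I_n -> P), [/\ nice P,
  forall A (a : 'I_n -> A), exists phi : {lrmorphism P -> A}, forall i, phi (X i) = a i
  & forall A (f g : {lrmorphism P -> A}), (forall i, f (X i) = g (X i)) -> f =1 g].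
Proof.
have [P [X [nP ex un]]] := poly_alg_nat n; exists P, (fun i => X i); split=> // [A a|A f g e].
  have [phi h] := ex A (fun j => if insub j is Some i then a i else 0).
  by exists phi => i; rewrite h // valK.
by apply: un => i hi; exact: (e (Ordinal hi)).
Qed.

Lemma v2_eval (F : {poly {poly k^o}}) (x y : k^o) :
  apoly_eval (evP y) x (F : apoly (apoly k^o)) = v2 F x y.
Proof.
rewrite apoly_evalE /v2 -(evP_ko y (F.[x%:P])) -[in LHS](_ : evP y (x%:P : {poly k^o}) = x).
  exact: horner_map.
by rewrite evP_ko hornerC.
Qed.
End PolyAlg.

Section Constancy.
Variables (k : closedFieldType) (g : nat) (hg : (2 <= g)%N) (P : comAlgType k) (X : 'I_g -> P).
Hypotheses (nP : nice P)
  (ex : forall (A : comAlgType k) (a : 'I_g -> A), exists phi : {lrmorphism P -> A}, forall i, phi (X i) = a i)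
  (un : forall (A : comAlgType k) (f h : {lrmorphism P -> A}), (forall i, f (X i) = h (X i)) -> f =1 h).

Definition sim (ev ev' : {lrmorphism P -> k^o}) := exists E E' : 'I_g -> ellcurve k,
  prod_iso E E' /\ forall i, ev (X i) = jinv (E i) /\ ev' (X i) = jinv (E' i).

Variables (F G : P).
Hypothesis hinv : forall ev ev' : {lrmorphism P -> k^o}, sim ev ev' -> ev G <> 0 -> ev' G <> 0 ->
  ev F * ev' G = ev' F * ev G.

(** All coordinates but two are frozen, with fixed curves of the prescribed j-invariants in the
    other places; on the slice the chains give [inv2], hence proportionality of [F] and [G]. *)
Lemma slice_rel (i0 i1 : 'I_g) (ev ev' : {lrmorphism P -> k^o}) : i0 != i1 ->
  (forall i, i != i0 -> i != i1 -> ev (X i) = ev' (X i)) -> ev F * ev' G = ev' F * ev G.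
Proof.
move=> ne hev.
pose Q : comAlgType k := apoly (apoly k^o).
have [S hS] := ex (fun i => if i == i0 then ('X : Q) else if i == i1 then apolyC (apoly k^o) ('X : {poly k^o}) else (ev (X i) : k)%:A).
have SE (x y : k^o) (e : {lrmorphism P -> k^o}) p : e (X i0) = x -> e (X i1) = y ->
    (forall i, i != i0 -> i != i1 -> e (X i) = ev (X i)) -> v2 (S p : {poly {poly k^o}}) x y = e p.
  move=> ex0 ey0 eo; rewrite -v2_eval -[LHS]/(lcompo (apoly_eval (evP y) x) S p); apply: un => i.
  have [->|n0] := eqVneq i i0; first by rewrite /= hS eqxx apoly_evalX ex0.
  have [->|n1] := eqVneq i i1; first by rewrite /= hS eq_sym (negbTE ne) eqxx apoly_evalC evPX ey0.
  by rewrite /= hS (negbTE n0) (negbTE n1) eo // lrmorph_alg; exact: mulr1.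
have ptE (x y : k^o) : exists e : {lrmorphism P -> k^o}, [/\ e (X i0) = x, e (X i1) = y &
    forall i, i != i0 -> i != i1 -> e (X i) = ev (X i)].
  have [e he] := ex (fun i => if i == i0 then x else if i == i1 then y else ev (X i)); exists e; split.
  - by rewrite he eqxx.
  - by rewrite he eq_sym (negbTE ne) eqxx.
  - by move=> i /negbTE n0 /negbTE n1; rewrite he n0 n1.
have e1 p : v2 (S p : {poly {poly k}}) (ev (X i0)) (ev (X i1)) = ev p by exact: SE.
have e2 p : v2 (S p : {poly {poly k}}) (ev' (X i0)) (ev' (X i1)) = ev' p.
  by apply: SE => // i n0 n1; rewrite hev.
have i2 : inv2 (S F : {poly {poly k}}) (S G : {poly {poly k}}).
  move=> r v hv nv.
  pose C i := projT1 (cid (curve_with_j (ev (X i)))).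
  have CE i : jinv (C i) = ev (X i) by rewrite /C; case: cid.
  have [E [E' [s [iso [s0 [c1 c2 c3 c4' co]]]]]] := chain_iso hv nv C ne.
  have j1 : jinv (E i0) = J1 (v 0%N ^+ 3) by apply: (isC_J1 (s := 1)); rewrite mulr1 expr1n mulr1.
  have j2 : jinv (E' i0) = J2 (v 0%N ^+ 3).
    by apply: (isC_J2 (s := 1)); rewrite mulr1 expr1n mulr1 -exprM.
  have j3 : jinv (E i1) = J2 (v r ^+ 3) by apply: (isC_J2 (s := s)); rewrite -exprM.
  have j4 : jinv (E' i1) = J1 (v r ^+ 3) by apply: (isC_J1 (s := s)).
  have [f [f0 f1 fo]] := ptE (J1 (v 0%N ^+ 3)) (J2 (v r ^+ 3)).
  have [f' [f0' f1' fo']] := ptE (J2 (v 0%N ^+ 3)) (J1 (v r ^+ 3)).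
  have q1 p : v2 (S p : {poly {poly k}}) (J1 (v 0%N ^+ 3)) (J2 (v r ^+ 3)) = f p by exact: SE.
  have q2 p : v2 (S p : {poly {poly k}}) (J2 (v 0%N ^+ 3)) (J1 (v r ^+ 3)) = f' p by exact: SE.
  rewrite (q1 F) (q1 G) (q2 F) (q2 G) => /eqP g1 /eqP g2.
  apply: hinv => //; exists E, E'; split=> // i.
  have [->|n0] := eqVneq i i0; first by rewrite f0 f0' j1 j2.
  have [->|n1] := eqVneq i i1; first by rewrite f1 f1' j3 j4.
  by have [-> ->] := co i n0 n1; rewrite CE fo // fo'.
rewrite -(e1 F) -(e1 G) -(e2 F) -(e2 G).
have [z|z] := eqVneq (S G : {poly {poly k}}) 0.
  by rewrite z /v2 !horner0 !mulr0.
by have [l hl] := inv2_const z i2; rewrite !hl; ring.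
Qed.

(** Coordinates are released one at a time: [rho m] keeps the first [m] variables and gives the
    others their values at [ev0]. One step changes a single coordinate, which is a slice together
    with any second index; such an index exists because [g] is at least 2. *)
Lemma constancy (ev0 : {lrmorphism P -> k^o}) : ev0 G <> 0 ->
  exists l : k^o, forall ev : {lrmorphism P -> k^o}, ev F = l * ev G.
Proof.
move=> g0; pose l : k^o := ev0 F / ev0 G; exists l.
pose H : P := F - (l : k)%:A * G.
have evH (ev : {lrmorphism P -> k^o}) : ev H = ev F - l * ev G.
  rewrite (lrB ev) (lrM ev) lrmorph_alg; congr (_ - _ * _); exact: mulr1.
suff H0 : H = 0 by move=> ev; apply/subr0_eq; rewrite -evH H0; exact: lr0.
have [dP _] := nP.
pose rho m := projT1 (cid (ex (fun i : 'I_g => if (i < m)%N then X i else (ev0 (X i) : k)%:A))).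
have rhoE m i : rho m (X i) = if (i < m)%N then X i else (ev0 (X i) : k)%:A by rewrite /rho; case: cid.
have one (c : k^o) : (c : k)%:A = c :> k^o by exact: mulr1.
have claim m : rho m H = 0.
  elim: m => [|m IH].
    have -> : rho 0%N H = lcompo (structure_map P) ev0 H by apply: un => i; rewrite rhoE.
    have -> : lcompo (structure_map P) ev0 H = structure_map P (ev0 H) by [].
    by rewrite evH /l divfK ?subrr; [exact: lr0|apply/eqP].
  have [hm|hm] := leqP g m.
    have -> : rho m.+1 H = rho m H; last by [].
    by apply: un => i; rewrite !rhoE !(leq_trans (ltn_ord i)) // ltnW.
  have rG : rho m G <> 0.
    move=> z; apply: g0; transitivity (ev0 (rho m G)); last by rewrite z; exact: lr0.
    apply: (un (h := lcompo ev0 (rho m))) => i /=; rewrite rhoE; case: ifP => // _.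
    by rewrite lrmorph_alg one.
  apply: contrapT => nz; have [|e he] := @nice_point k P (rho m.+1 H * rho m G) nP; first by move=> /dP[].
  apply: he; rewrite (lrM e).
  have [i1 ni1] : exists i1 : 'I_g, Ordinal hm != i1.
    have h0 : (0 < g)%N by lia. have h1 : (1 < g)%N by lia.
    have [z|z] := eqVneq m 0%N; [exists (Ordinal h1)|exists (Ordinal h0)]; rewrite -val_eqE /=; lia.
  have rel : lcompo e (rho m.+1) F * lcompo e (rho m) G = lcompo e (rho m) F * lcompo e (rho m.+1) G.
    apply: (slice_rel ni1) => i n0 n1 /=; rewrite !rhoE ltnS leq_eqVlt.
    by have -> : (val i == m) = false by apply/negbTE; move: n0; rewrite -val_eqE.
  have z' : lcompo e (rho m) F = l * lcompo e (rho m) G.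
    by apply/subr0_eq; rewrite -evH /= IH; exact: lr0.
  have -> : e (rho m.+1 H) = lcompo e (rho m.+1) F - l * lcompo e (rho m.+1) G by rewrite -evH.
  have -> : e (rho m G) = lcompo e (rho m) G by [].
  by rewrite mulrBl rel z'; ring.
have -> : H = rho g H; last exact: claim.
by apply: (un (f := [the {lrmorphism P -> P} of idfun])) => i /=; rewrite rhoE ltn_ord.
Qed.
End Constancy.

Lemma rfunE (k : comNzRingType) (Y X : kfunctor k) (f : ratmap Y X) (A B : comAlgType k) (phi : {lrmorphism A -> B})
    (x : Y A) (y : Y B) (hx : rdom f A x) (hy : rdom f B y) : fmap Y phi x = y ->
  fmap X phi (rfun f A (exist _ x hx)) = rfun f B (exist _ y hy).
Proof.
by move=> e; rewrite -(nt_nat (rfun f) phi (exist _ x hx)); congr (rfun f B _); apply: eq_exist.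
Qed.

Lemma rat_eq_refl (k : comNzRingType) (Y X : kfunctor k) (f : ratmap Y X) : Defs.rat_eq f f.
Proof.
exists (rdom f); split; [exact: rdom_open|exact: rdom_dense|].
by move=> A x hx; exists hx, hx.
Qed.

(** * Values of the rational map *)

Section Values.
Variables (g : nat) (hg : (2 <= g)%N) (k : closedFieldType)
  (M : scheme k) (eta : nattrans (ellcurve_functor k) M)
  (h : nattrans M (affine_line k)) (s : nattrans (affine_line k) M).
Hypotheses (hs : nat_inverse h s) (hE : forall (A : comAlgType k) (E : ellcurve A), h A (eta A E) = jinv E).
Variables (P : comAlgType k) (x : 'I_g -> P).
Hypotheses (nP : nice P)
  (ex : forall (A : comAlgType k) (a : 'I_g -> A), exists phi : {lrmorphism P -> A}, forall i, phi (x i) = a i)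
  (un : forall (A : comAlgType k) (e e' : {lrmorphism P -> A}), (forall i, e (x i) = e' (x i)) -> e =1 e').
Notation Y := (power_functor M g).
Let xg : Y P := fun i => s P (x i).
Implicit Types A B L : comAlgType k.

Lemma from_generic A (y : Y A) : exists phi : {lrmorphism P -> A}, fmap Y phi xg = y.
Proof.
have [phi hphi] := ex (fun i => h A (y i)); exists phi; apply: functional_extensionality_dep => i.
rewrite [LHS](_ : _ = fmap M phi (s P (x i))) // -(nt_nat s phi (x i)).
have -> : fmap (affine_line k) phi (x i) = h A (y i) by exact: hphi.
by have [-> _] := hs A.
Qed.

Variables (X : scheme k) (f : ratmap Y X).

Lemma domain_ideal : exists I : set P, forall B (phi : {lrmorphism P -> B}),
  rdom f B (fmap Y phi xg) <-> unimodular [set phi a | a in I]%classic.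
Proof. exact: (rdom_open f). Qed.

(** Density, tested against the whole space, gives a point of [W]; so the ideal of [W] has a nonzero
    element, and this is nonzero at some k-point. *)
Lemma dense_point (W : subfunctor Y) : is_open W -> is_dense W ->
  exists ev : {lrmorphism P -> k^o}, W k^o (fmap Y ev xg).
Proof.
move=> oW dW.
pose T : subfunctor Y := @SubFunctor k Y (fun A => setT) (fun A B phi y _ => I).
have [||A [y [Wy _]]] := dW T.
- move=> A y; exists setT => B phi; split=> // _; exists 1%N, (fun _ => 1), (fun _ => 1); split.
    by move=> _; exists 1 => //; exact: lr1.
  by rewrite big_ord1 mulr1.
- by exists P, xg.
have [phi hphi] := from_generic y; have [J hJ] := oW P xg.
have uJ : unimodular [set phi a | a in J]%classic by apply/hJ; rewrite hphi.
have [p Jp p0] : exists2 p, J p & p <> 0.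
  apply: contrapT => np; have [n [c [a [ha]]]] := uJ; rewrite big1 => [/esym/eqP|i _]; first by rewrite oner_eq0.
  have [b Jb <-] := ha i; have -> : b = 0 by apply: contrapT => b0; apply: np; exists b.
  by rewrite lr0 mulr0.
have [ev hev] := nice_point nP p0; exists ev; apply/hJ; apply: (unimodular_unit Jp); exact: ko_unit.
Qed.

Hypothesis fhyp : forall (E1 E2 : 'I_g -> ellcurve k) (y1 y2 : X k^o),
  (exists h : rdom f k^o (fun i => eta k^o (E1 i)), rfun f k^o (exist _ _ h) = y1) ->
  (exists h : rdom f k^o (fun i => eta k^o (E2 i)), rfun f k^o (exist _ _ h) = y2) ->
  prod_iso E1 E2 -> y1 = y2.

Lemma eta_generic (ev : {lrmorphism P -> k^o}) (E : 'I_g -> ellcurve k) :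
  (forall i, ev (x i) = jinv (E i)) -> fmap Y ev xg = (fun i => eta k^o (E i)).
Proof.
move=> e; apply: functional_extensionality_dep => i.
rewrite [LHS](_ : _ = fmap M ev (s P (x i))) // -(nt_nat s ev (x i)).
have -> : fmap (affine_line k) ev (x i) = h k^o (eta k^o (E i)) by rewrite hE -e.
by have [-> _] := hs k^o.
Qed.

Lemma value_sim (ev ev' : {lrmorphism P -> k^o}) : sim x ev ev' ->
  forall (u : rdom f k^o (fmap Y ev xg)) (u' : rdom f k^o (fmap Y ev' xg)),
  rfun f k^o (exist _ _ u) = rfun f k^o (exist _ _ u').
Proof.
move=> [E [E' [iso hj]]] u u'.
have e1 : fmap Y ev xg = (fun i => eta k^o (E i)) by apply: eta_generic => i; have [] := hj i.
have e2 : fmap Y ev' xg = (fun i => eta k^o (E' i)) by apply: eta_generic => i; have [] := hj i.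
by apply: (fhyp _ _ iso); [move: u; rewrite e1|move: u'; rewrite e2] => w; exists w.
Qed.

(** An affine neighbourhood [V] of the value contains the image of a basic open set. Functions on
    [V] become fractions to which [constancy] applies, so all k-points of that open set have the
    same value. *)
Lemma value_near (ev1 : {lrmorphism P -> k^o}) (u1 : rdom f k^o (fmap Y ev1 xg)) :
  exists q : P, ev1 q <> 0 /\ forall ev : {lrmorphism P -> k^o}, ev q <> 0 ->
    exists u : rdom f k^o (fmap Y ev xg), rfun f k^o (exist _ _ u) = rfun f k^o (exist _ _ u1).
Proof.
have [I hI] := domain_ideal; have [p Ip p1] := unimodular_map_point (proj1 (hI _ ev1) u1).
have [dP _] := nP; have nz q (e : {lrmorphism P -> k^o}) : e q <> 0 -> q <> 0 by move=> e0 z; apply: e0; rewrite z; exact: lr0.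
have [L [io hl]] := is_loc_ex dP (nz _ _ p1); have [up _ sL uL] := hl.
have UL : rdom f L (fmap Y io xg) by apply/hI/(unimodular_unit Ip).
pose sg : X L := rfun f L (exist _ _ UL).
have [w1 hw1] := uL k^o ev1 (ko_unit p1).
have [_ locX] := sch_axiom X.
have [V [oV [C [c [Vc aff]]] V1]] := locX _ (@ko_field k) (fmap X w1 sg).
have [J hJ] := oV L sg; have [a Ja a1] := unimodular_map_point (proj1 (hJ _ w1) V1).
have [a' [e he]] := sL a.
have a'1 : ev1 a' <> 0.
  have -> : ev1 a' = w1 (io a') by exact: hw1.
  rewrite -he (lrM w1) (lrX w1) => /(@domain_ko k)[|//]; move/eqP; rewrite expf_eq0 => /andP[_ /eqP z].
  by apply: p1; rewrite -z; exact: hw1.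
pose q := p * a'; have q1 : ev1 q <> 0 by rewrite (lrM ev1) => /(@domain_ko k)[].
have [L3 [i3 l3]] := is_loc_ex dP (nz _ _ q1); have [uq inj3 s3 u3] := l3.
have uq' : invertible (i3 p * i3 a') by rewrite -(lrM i3).
have [up3 ua3] := invertible_l uq'; have [t ht] := uL L3 i3 up3.
have Vt : V L3 (fmap X t sg).
  apply/hJ/(unimodular_unit Ja); have : invertible (t (io p) ^+ e * t a); last by case/invertible_l.
  by rewrite -(lrX t) -(lrM t) he; have <- : i3 a' = t (io a') by exact: ht.
have [[chi hchi] _] := aff L3 _ Vt.
have val (w : {lrmorphism L3 -> k^o}) (ev : {lrmorphism P -> k^o}) (hev : ev =1 w \o i3)
    (u : rdom f k^o (fmap Y ev xg)) : fmap X w (fmap X t sg) = rfun f k^o (exist _ _ u).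
  rewrite -fmap_o; apply: rfunE; rewrite -fmap_o; apply: fmap_ext => r; rewrite [RHS]hev /=.
  by congr (w _); exact: esym (ht r).
have dom (ev : {lrmorphism P -> k^o}) : ev q <> 0 -> rdom f k^o (fmap Y ev xg).
  move=> hq; apply/hI/(unimodular_unit Ip)/ko_unit => z; apply: hq.
  by rewrite (lrM ev) z mul0r.
have cst (b : C) : exists l : k^o, forall w : {lrmorphism L3 -> k^o}, w (chi b) = l.
  have [F0 [n hF]] := s3 (chi b).
  (* The extra factor [q] makes a nonzero value of [G] certify a point of the open set even when
     [n = 0]. *)
  pose F := q * F0; pose G := q ^+ n.+1.
  have FG (w : {lrmorphism L3 -> k^o}) : w (i3 F) = w (i3 G) * w (chi b).
    by rewrite -(lrM w) /F /G (lrM i3) -hF (lrX i3) exprS mulrA.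
  have Gq (ev : {lrmorphism P -> k^o}) : ev G <> 0 -> ev q <> 0.
    by move=> g0 z; apply: g0; rewrite /G (lrX ev) z expr0n.
  have hinv (ev ev' : {lrmorphism P -> k^o}) : sim x ev ev' -> ev G <> 0 -> ev' G <> 0 -> ev F * ev' G = ev' F * ev G.
    move=> hsim /Gq g0 /Gq g0'; have [w hw] := u3 k^o ev (ko_unit g0); have [w' hw'] := u3 k^o ev' (ko_unit g0').
    have E1 r : ev r = w (i3 r) by exact: hw.
    have E2 r : ev' r = w' (i3 r) by exact: hw'.
    rewrite !E1 !E2 !FG; have -> : w (chi b) = w' (chi b); last by ring.
    have ew : fmap X (lcompo w chi) c = fmap X (lcompo w' chi) c.
      rewrite !fmap_o hchi (val w ev hw (dom ev g0)) (val w' ev' hw' (dom ev' g0')); exact: value_sim.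
    have Vw : V k^o (fmap X (lcompo w' chi) c) by exact: sub_stable.
    have [_ h2] := aff k^o _ Vw; exact: (h2 (lcompo w chi) (lcompo w' chi) ew erefl b).
  have g1 : ev1 G <> 0 by rewrite /G (lrX ev1) => /eqP; rewrite expf_eq0 => /andP[_ /eqP].
  have [l hlc] := constancy hg nP ex un hinv g1; exists l => w.
  have := hlc (lcompo w i3); rewrite /= FG mulrC => e3.
  have : invertible (w (i3 G)) by rewrite /G (lrX i3) (lrX w); apply: invertible_pow; exact: invertible_map.
  by move=> uG; apply: (unit_mulI uG); rewrite mulrC e3 mulrC.
exists q; split=> // ev hq; exists (dom ev hq).
have [w hw] := u3 k^o ev (ko_unit hq); have [w' hw'] := u3 k^o ev1 (ko_unit q1).
rewrite -(val w ev hw) -(val w' ev1 hw') -hchi -!fmap_o; apply: fmap_ext => b /=.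
by have [l hlc] := cst b; rewrite !hlc.
Qed.

(** Two nonempty basic open sets meet, because [P] is a domain. *)
Lemma value_const (ev ev' : {lrmorphism P -> k^o}) (u : rdom f k^o (fmap Y ev xg)) (u' : rdom f k^o (fmap Y ev' xg)) :
  rfun f k^o (exist _ _ u) = rfun f k^o (exist _ _ u').
Proof.
have [q [hq vq]] := value_near u; have [q' [hq' vq']] := value_near u'.
have qq : q * q' <> 0.
  by have [dP _] := nP => /dP[] z; [apply: hq|apply: hq']; rewrite z; exact: lr0.
have [e] := nice_point nP qq; rewrite (lrM e) => he.
have e1 : e q <> 0 by move=> z; apply: he; rewrite z mul0r.
have e2 : e q' <> 0 by move=> z; apply: he; rewrite z mulr0.
by have [v <-] := vq e e1; have [v' <-] := vq' e e2; congr (rfun f _ _); apply: eq_exist.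
Qed.

(** Every [A]-point is a pullback of [xg]. On a basic open set of the domain the value is a section
    over a [nice] ring, constant since it is so at k-points; the sheaf property of [X] patches these
    pieces. *)
Lemma value_global (y : X k^o) : (forall (ev : {lrmorphism P -> k^o}) (u : rdom f k^o (fmap Y ev xg)), rfun f k^o (exist _ _ u) = y) ->
  forall A (z : functor_of_sub (rdom f) A), rfun f A z = fmap X (structure_map A) y.
Proof.
move=> hy A [z0 uz]; have [phi hphi] := from_generic z0; have [I hI] := domain_ideal.
have [dP _] := nP; have [sheafX _] := sch_axiom X.
have uni : unimodular [set phi a | a in I]%classic by apply/hI; rewrite hphi.
have strE (B C : comAlgType k) (w : {lrmorphism B -> C}) : fmap X w (fmap X (structure_map B) y) = fmap X (structure_map C) y.
  by rewrite -fmap_o; apply: fmap_ext => r; rewrite !ko_alg.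
have loc (B : comAlgType k) (psi : {lrmorphism A -> B}) : in_sieve [set phi a | a in I]%classic psi ->
    fmap X psi (rfun f A (exist _ z0 uz)) = fmap X (structure_map B) y.
  move=> [_ [p Ip <-] inv].
  have p0 : p <> 0.
    by move=> z; have [d] := inv; rewrite z (lr0 phi) (lr0 psi) mul0r => /esym/eqP; rewrite oner_eq0.
  have [L [io hl]] := is_loc_ex dP p0; have [up _ _ uL] := hl.
  have UL : rdom f L (fmap Y io xg) by apply/hI/(unimodular_unit Ip).
  have sgE : rfun f L (exist _ _ UL) = fmap X (structure_map L) y.
    apply: (agree (sch_axiom X) (nice_loc nP p0 hl)) => ev; rewrite strE.
    have ud : rdom f k^o (fmap Y (lcompo ev io) xg) by rewrite fmap_o; exact: sub_stable.
    rewrite (rfunE (y := fmap Y (lcompo ev io) xg) UL ud) ?fmap_o // hy.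
    by apply: esym; apply: fmap_id => r; exact: mulr1.
  have [w hw] := uL B (lcompo psi phi) inv.
  rewrite -(strE L B w) -sgE.
  have ub : rdom f B (fmap Y psi z0) by exact: sub_stable.
  rewrite (rfunE uz ub erefl); apply: esym; apply: rfunE; rewrite -hphi -!fmap_o.
  by apply: fmap_ext => r; exact: esym (hw r).
have [|v [_ uv]] := sheafX A _ uni (fun B psi _ => fmap X psi (rfun f A (exist _ z0 uz))).
  by move=> B C b c d _ _ e; exact: fmap_comp.
by rewrite -(uv (rfun f A (exist _ z0 uz))) // -(uv (fmap X (structure_map A) y)) // => B psi hpsi; rewrite strE loc.
Qed.
End Values.

Theorem theorem1p3 (g : nat) (hg : (2 <= g)%N) (k : closedFieldType)
    (A1 : scheme k) (eta : nattrans (ellcurve_functor k) A1)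
    (hA1 : is_coarse_moduli eta)
    (X : scheme k) (f : ratmap (power_functor A1 g) X) :
  (forall (E1 E2 : 'I_g -> ellcurve k) (y1 y2 : X k^o),
     rat_value f (fun i => eta k^o (E1 i)) y1 ->
     rat_value f (fun i => eta k^o (E2 i)) y2 ->
     prod_iso E1 E2 -> y1 = y2) ->
  rat_constant f.
Proof.
move=> fhyp; have [h [s [hs hE]]] := moduli_line hA1; have [P [x [nP ex un]]] := poly_alg k g.
have hyp (f' : ratmap (power_functor A1 g) X) : Defs.rat_eq f f' -> forall (E1 E2 : 'I_g -> ellcurve k) (y1 y2 : X k^o),
    (exists h : rdom f' k^o (fun i => eta k^o (E1 i)), rfun f' k^o (exist _ _ h) = y1) ->
    (exists h : rdom f' k^o (fun i => eta k^o (E2 i)), rfun f' k^o (exist _ _ h) = y2) ->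
    prod_iso E1 E2 -> y1 = y2.
  by move=> e E1 E2 y1 y2 h1 h2; apply: fhyp; exists f'.
have cst (f' : ratmap (power_functor A1 g) X) (e : Defs.rat_eq f f') := value_const hg hs hE nP ex un (hyp f' e).
have [ev0 u0] := dense_point hs nP ex (rdom_open f) (@rdom_dense _ _ _ f).
exists (rfun f k^o (exist _ _ u0)) => f' e; apply: (value_global hs nP ex) => ev u.
(* [f] and [f'] are each constant at k-points; a point of [W] shows that the two constants agree. *)
have [W [oW dW hW]] := e; have [ev2 u2] := dense_point hs nP ex oW dW.
have [v [v' vv]] := hW _ _ u2.
by rewrite (cst f' e _ _ u v') -vv; exact: (cst f (rat_eq_refl f)).
Qed.
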